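(* Let $z=(z_0,\dots,z_m)\in X\cap(\mathbb{C}^* )^{m+1}$. Then there is a constant $C_{\Omega,z,\mu,m}$, depending only on $\Omega$, $z$, $\mu$ and $m$, such that for all $u=(u_0,\dots,u_m)$ and $v=(v_0,\dots,v_m)$ in $\mathbb{C}^{m+1}$, $$\lim_{N\to\infty}\frac{1}{N^{m+1}}S_N\Big(z+\frac{u}{N},\,z+\frac{v}{N}\Big)=C_{\Omega,z,\mu,m}\,F_m\big(\beta(u)+\overline{\beta(v)}\big),$$ where $F_m(t)=\int_0^1 e^{ty}y^m\,dy$ and $\beta(w)=\dfrac{d'\rho(z)\cdot w}{d'\rho(z)\cdot z}$ for $w\in\mathbb{C}^{m+1}$.
   Context: Let $m\ge 0$ be an integer and let $\Omega=\{\rho<0\}\subset\mathbb{C}^{m+1}$ be a bounded strictly pseudoconvex complete Reinhardt domain with smooth boundary $X=\partial\Omega=\{\rho=0\}$, where $\rho$ is a real-valued $C^\infty$ defining function with $d\rho\ne0$ on $X$. Complete Reinhardt means: $(z_0,\dots,z_m)\in\Omega$ implies $(\lambda_0z_0,\dots,\lambda_mz_m)\in\Omega$ for all $\lambda_j\in\mathbb{C}$ with $|\lambda_j|\le1$. Strictly pseudoconvex means: at each $z\in X$ the Levi form $v\mapsto\sum_{j,k}\frac{\partial^2\rho}{\partial z_j\partial\bar z_k}(z)v_j\bar v_k$ is positive definite on $\{v:\sum_j\frac{\partial\rho}{\partial z_j}(z)v_j=0\}$. Let $\mu$ be a smooth positive volume measure on $X$ invariant under the torus action $(e^{i\theta_0},\dots,e^{i\theta_m})\cdot(z_0,\dots,z_m)=(e^{i\theta_0}z_0,\dots,e^{i\theta_m}z_m)$.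 Let $\mathcal{P}_N$ be the space of holomorphic polynomials on $\mathbb{C}^{m+1}$ of degree $\le N$ with inner product $(f,g)=\int_X f\bar g\,d\mu$, let $\{p_k\}_{k=1}^{d(N)}$ be an orthonormal basis of $\mathcal{P}_N$, $d(N)=\dim\mathcal{P}_N$, and let $S_N(z,w)=\sum_{k=1}^{d(N)}p_k(z)\overline{p_k(w)}$ (the partial Szegő kernel), $z,w\in\mathbb{C}^{m+1}$. Notation: $d'\rho(z)=\big(\frac{\partial\rho}{\partial z_0}(z),\dots,\frac{\partial\rho}{\partial z_m}(z)\big)$ and $a\cdot b=\sum_{j=0}^m a_jb_j$ (bilinear, no conjugation). One has $d'\rho(z)\cdot z\ne0$ for $z\in X$, and $\beta$ does not depend on the choice of $\rho$. $\mathbb{C}^*=\mathbb{C}\setminus\{0\}$. *)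

(* Defs.v *)
From HB Require Import structures.
From mathcomp Require Import all_boot all_order all_algebra.
From mathcomp Require Import all_classical all_reals all_analysis.
From mathcomp Require Import complex.
(* mpoly's notations clash with those of mathcomp-analysis. *)
From mathcomp Require Import -(notations) mpoly.

Set Implicit Arguments.
Unset Strict Implicit.
Unset Printing Implicit Defensive.
Import Order.TTheory GRing.Theory Num.Theory.
Import numFieldNormedType.Exports.
Local Open Scope classical_set_scope.
Local Open Scope ring_scope.

(* Packing R[i] as a numClosedFieldType gives it, and the row vectors over it,
   the norm topology of numFieldNormedType. *)
Definition Cplx (R : realType) : numClosedFieldType := R[i].

Definition mkC (R : realType) (x y : R) : Cplx R := (x +i* y)%C.
Definition ReC (R : realType) (z : Cplx R) : R := complex.Re z.
Definition ImC (R : realType) (z : Cplx R) : R := complex.Im z.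

Definition cexp (R : realType) (t : Cplx R) : Cplx R :=
  mkC (expR (ReC t) * cos (ImC t)) (expR (ReC t) * sin (ImC t)).

Definition cintegral d (T : measurableType d) (R : realType)
    (mu : {measure set T -> \bar R}) (D : set T) (f : T -> Cplx R) : Cplx R :=
  mkC (\int[mu]_(x in D) ReC (f x))%R (\int[mu]_(x in D) ImC (f x))%R.

(* C^n as the real vector space R^(2n): real parts, then imaginary parts. *)
Definition to_real (R : realType) (n : nat) (z : 'rV[Cplx R]_n) :
    'rV[R]_(n + n) :=
  row_mx (\row_j ReC (z 0 j)) (\row_j ImC (z 0 j)).

Definition of_real (R : realType) (n : nat) (w : 'rV[R]_(n + n)) :
    'rV[Cplx R]_n :=
  \row_j mkC (w 0 (lshift n j)) (w 0 (rshift n j)).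

(* f is C^oo on the open set U: the iterated directional derivatives of every
   order exist and are continuous on U. *)
Definition iter_derive (R : realType) (V W : normedModType R) (f : V -> W)
    (vs : seq V) : V -> W :=
  foldr (fun (v : V) (g : V -> W) => 'D_v g) f vs.

Definition smooth_on (R : realType) (V W : normedModType R) (U : set V)
    (f : V -> W) : Prop :=
  forall (vs : seq V) (x : V), U x ->
    {for x, continuous (iter_derive f vs)} /\
    (forall v : V, derivable (iter_derive f vs) x v).

(* Derivative of a complex-valued function on C^n in a real direction. *)
Definition rderive (R : realType) (n : nat) (v : 'rV[R]_(n + n))
    (f : 'rV[Cplx R]_n -> Cplx R) (z : 'rV[Cplx R]_n) : Cplx R :=
  mkC ('D_v (fun w => ReC (f (of_real w))) (to_real z))
      ('D_v (fun w => ImC (f (of_real w))) (to_real z)).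

Definition d_x (R : realType) (n : nat) (j : 'I_n) :=
  @rderive R n (row_mx (delta_mx 0 j) 0).
Definition d_y (R : realType) (n : nat) (j : 'I_n) :=
  @rderive R n (row_mx 0 (delta_mx 0 j)).

Definition d_z (R : realType) (n : nat) (j : 'I_n)
    (f : 'rV[Cplx R]_n -> Cplx R) (z : 'rV[Cplx R]_n) : Cplx R :=
  (d_x j f z - mkC 0 1 * d_y j f z) / 2.
Definition d_zbar (R : realType) (n : nat) (j : 'I_n)
    (f : 'rV[Cplx R]_n -> Cplx R) (z : 'rV[Cplx R]_n) : Cplx R :=
  (d_x j f z + mkC 0 1 * d_y j f z) / 2.

Definition realC (R : realType) (T : Type) (f : T -> R) (x : T) : Cplx R :=
  mkC (f x) 0.

(* d'rho(z) . w *)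
Definition dprime (R : realType) (n : nat) (rho : 'rV[Cplx R]_n -> R)
    (z w : 'rV[Cplx R]_n) : Cplx R :=
  \sum_j d_z j (realC rho) z * w 0 j.

Definition levi (R : realType) (n : nat) (rho : 'rV[Cplx R]_n -> R)
    (z v : 'rV[Cplx R]_n) : Cplx R :=
  \sum_j \sum_k d_z j (d_zbar k (realC rho)) z * v 0 j * (v 0 k)^*.

Definition boundary (T : topologicalType) (A : set T) : set T :=
  closure A `\` A°.

Definition defining_function (R : realType) (n : nat)
    (Omega : set 'rV[Cplx R]_n) (rho : 'rV[Cplx R]_n -> R) : Prop :=
  [/\ smooth_on setT (rho \o @of_real R n),
      Omega = [set z | rho z < 0],
      boundary Omega = [set z | rho z = 0] &
      forall z, boundary Omega z ->
        exists v, 'D_v (rho \o @of_real R n) (to_real z) != 0].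

Definition strictly_pseudoconvex (R : realType) (n : nat)
    (Omega : set 'rV[Cplx R]_n) : Prop :=
  exists2 rho, defining_function Omega rho &
    forall z, boundary Omega z ->
      forall v, v != 0 -> dprime rho z v = 0 -> 0 < levi rho z v.

Definition domain (T : topologicalType) (A : set T) : Prop :=
  [/\ open A, connected A & A !=set0].

Definition complete_Reinhardt (R : realType) (n : nat)
    (Omega : set 'rV[Cplx R]_n) : Prop :=
  forall z (lambda : 'I_n -> Cplx R), Omega z ->
    (forall j, `|lambda j| <= 1) -> Omega (\row_j (lambda j * z 0 j)).

Definition borel (T : topologicalType) := g_sigma_algebraType (@open T).

(* Integral of a nonnegative Borel function over R^k with respect to Lebesgue
   measure, as an iterated integral (Tonelli). *)
Fixpoint lebesgue_integral_rV (R : realType) (k : nat) :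
    ('rV[R]_k -> \bar R) -> \bar R :=
  match k with
  | 0 => fun f => f 0
  | k'.+1 => fun f =>
      (\int[lebesgue_measure]_(x in [set: R])
         lebesgue_integral_rV (fun v : 'rV[R]_k' =>
           f (row_mx (x%:M : 'rV[R]_1) v)))%E
  end.

(* X is a real hypersurface of C^(m+1), hence of real dimension 2m+1.  Since the
   dimensions agree, such a phi is a diffeomorphism onto an open subset of X. *)
Definition parametrization (R : realType) (m : nat)
    (X : set 'rV[Cplx R]_m.+1) (U : set 'rV[R]_(m.*2.+1))
    (phi : 'rV[R]_(m.*2.+1) -> 'rV[Cplx R]_m.+1) : Prop :=
  [/\ open U, smooth_on U (@to_real R m.+1 \o phi),
      (forall x, U x -> X (phi x)),
      set_inj U phi &
      forall x v, U x -> 'D_v (@to_real R m.+1 \o phi) x = 0 -> v = 0].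

(* A volume measure on X is represented by a Borel measure on C^(m+1) carried
   by X; smooth and positive means that in every local parametrization it has a
   smooth positive density with respect to Lebesgue measure. *)
Definition smooth_positive_measure (R : realType) (m : nat)
    (X : set 'rV[Cplx R]_m.+1)
    (mu : {measure set (borel 'rV[Cplx R]_m.+1) -> \bar R}) : Prop :=
  mu (~` X) = 0%E /\
  forall U phi, parametrization X U phi ->
    exists a : 'rV[R]_(m.*2.+1) -> R,
      [/\ smooth_on U (a : _ -> R^o),
          (forall x, U x -> 0 < a x) &
          forall B : set (borel 'rV[Cplx R]_m.+1),
            measurable B -> B `<=` phi @` U ->
            mu B = lebesgue_integral_rV (fun x =>
              if `[< U x /\ B (phi x) >] then (a x)%:E else 0%E)].

Definition torus_act (R : realType) (n : nat) (theta : 'I_n -> R)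
    (z : 'rV[Cplx R]_n) : 'rV[Cplx R]_n :=
  \row_j (cexp (mkC 0 (theta j)) * z 0 j).

Definition torus_invariant (R : realType) (n : nat)
    (mu : {measure set (borel 'rV[Cplx R]_n) -> \bar R}) : Prop :=
  forall (theta : 'I_n -> R) (B : set (borel 'rV[Cplx R]_n)), measurable B ->
    mu (torus_act theta @^-1` B) = mu B.

Definition evalp (R : realType) (n : nat) (p : mpoly.mpoly n (Cplx R))
    (z : 'rV[Cplx R]_n) : Cplx R :=
  mpoly.meval (z 0) p.

(* msize is the total degree plus one (and 0 for the zero polynomial). *)
Definition degree_le (R : realType) (n N : nat)
    (p : mpoly.mpoly n (Cplx R)) : Prop :=
  (mpoly.msize p <= N.+1)%N.

Definition inner (R : realType) (n : nat) (X : set 'rV[Cplx R]_n)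
    (mu : {measure set (borel 'rV[Cplx R]_n) -> \bar R})
    (f g : 'rV[Cplx R]_n -> Cplx R) : Cplx R :=
  cintegral mu X (fun z => f z * (g z)^*).

Definition orthonormal_basis (R : realType) (n : nat) (X : set 'rV[Cplx R]_n)
    (mu : {measure set (borel 'rV[Cplx R]_n) -> \bar R}) (N d : nat)
    (p : 'I_d -> mpoly.mpoly n (Cplx R)) : Prop :=
  [/\ (forall k, degree_le N (p k)),
      (forall k l, inner X mu (evalp (p k)) (evalp (p l)) = (k == l)%:R) &
      forall q, degree_le N q ->
        exists c : 'I_d -> Cplx R, q = \sum_k c k *: p k].

Definition szego (R : realType) (n d : nat)
    (p : 'I_d -> mpoly.mpoly n (Cplx R)) (z w : 'rV[Cplx R]_n) : Cplx R :=
  \sum_k evalp (p k) z * (evalp (p k) w)^*.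

Definition F_ (R : realType) (m : nat) (t : Cplx R) : Cplx R :=
  cintegral lebesgue_measure `[(0 : R), 1]
    (fun y : R => cexp (t * mkC y 0) * mkC y 0 ^+ m).

Definition beta (R : realType) (n : nat) (rho : 'rV[Cplx R]_n -> R)
    (z w : 'rV[Cplx R]_n) : Cplx R :=
  dprime rho z w / dprime rho z z.

(* Main.v *)
Require Import Defs.
From HB Require Import structures.
From mathcomp Require Import all_boot all_order all_algebra.
From mathcomp Require Import all_classical all_reals all_analysis.
From mathcomp Require Import measurable_realfun.
From mathcomp Require Import complex.
From mathcomp Require Import -(notations) mpoly.
From mathcomp Require Import ring lra.

(** The torus invariance of mu makes distinct monomials orthogonal, so the
   monomials normalised in L^2 form an orthonormal basis and
     S_N(z + u/N, z + v/N) = sum over |b| <= N of E_N(b) / t(b),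
   where t(b) is the integral over X of |w^b / z^b|^2 and E_N(b) is the product
   of the powers (1 + u_j / (N z_j))^(b_j) with the conjugates of the analogous
   powers for v ([szego_monomials], [szego_shift]).  Two asymptotics are needed:
   that of t(b), which depends on the geometry only, and that of E_N(b).

   Geometry.  In the coordinates x_j = log |w_j / z_j| a complete Reinhardt
   domain becomes a set stable under decreasing coordinates, and strict
   pseudoconvexity becomes strict convexity of its boundary ([levi_log],
   [Flog_convex]).  The boundary is thus a graph x_0 = k(x_1, ..., x_m) with k
   smooth and strictly concave near 0 ([smooth_k], [k_concave]), and its normal
   at 0 is the vector (1, h_1, ..., h_m) with h_i = - d_i k(0) > 0.

   Laplace method.  The function |w^b / z^b|^2 is exp (2 b . x).  Its peak on
   the boundary is at x = 0 when b is proportional to the normal; for b_0 = l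
   and b_i = h_i l + O(sqrt l) the integral concentrates at scale l^(-1/2), and
   l^(m/2) t(b) converges to a Gaussian integral in the limit of the deviations
   (b_i - h_i l) / sqrt l ([near_limit], [laplace_limit]).  Conversely t(b) is
   bounded below by c l^(-m/2) exp (c |deviation|) for all b ([wgt_lower]), so
   the multi-indices far from the normal ray contribute little.

   Summation.  Writing the sum over b as an integral over unit cells, one
   integrates over the position y on the normal ray and over the deviation at
   scale sqrt N.  The exponential bound allows dominated convergence: the
   deviation integrates to a constant, and y keeps the weight y^m, from the
   m-th power of the width ([summation]).  The constant involves neither u nor
   v, and this is the constant of the theorem.

   The exponential.  Along b_j / N --> y h_j / H, with h_0 = 1 and H the sum of
   the h_j, the factor E_N(b) converges to exp (y (beta u + conj (beta v))),
   since (1 + c/N)^a tends to exp (c tau) when a/N tends to tau ([pow_cvg]) and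
   beta w is the mean of the w_j / z_j with weights h_j ([beta_slope]): the
   logarithmic gradient of any defining function is a multiple of the normal.
   The remaining integral of y^m exp (y t) is F_m(t). *)

Set Implicit Arguments.
Unset Strict Implicit.
Unset Printing Implicit Defensive.
Import Order.TTheory GRing.Theory Num.Theory.
Import numFieldNormedType.Exports.
Local Open Scope classical_set_scope.
Local Open Scope ring_scope.

(** * Lebesgue measure on R^k as a Borel measure *)

Section consr.
Context {R : realType}.

Definition consr k (x : R) (v : 'rV[R]_k) : 'rV[R]_k.+1 :=
  row_mx (x%:M : 'rV[R]_1) v.

Lemma consr0 k (x : R) (v : 'rV[R]_k) : consr x v 0 ord0 = x.
Proof.
have -> : ord0 = lshift k (ord0 : 'I_1) by apply/val_inj.
by rewrite /consr (row_mxEl (x%:M : 'rV[R]_1) v) mxE eqxx mulr1n.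
Qed.

Lemma consrS k (x : R) (v : 'rV[R]_k) i : consr x v 0 (lift ord0 i) = v 0 i.
Proof.
have -> : lift ord0 i = rshift 1 i by apply/val_inj.
by rewrite /consr (row_mxEr (x%:M : 'rV[R]_1) v).
Qed.

Lemma consr_eta k (w : 'rV[R]_k.+1) :
  w = consr (w 0 ord0) (\row_i w 0 (lift ord0 i)).
Proof.
apply/rowP => j; case: (unliftP ord0 j) => [i ->|->].
  by rewrite consrS mxE.
by rewrite consr0.
Qed.

Lemma consr_ball k (x x' e : R) (v v' : 'rV[R]_k) :
  ball x e x' -> ball v e v' -> ball (consr x v) e (consr x' v').
Proof.
move=> bx [e0 bv]; split => // i j; rewrite ord1.
by case: (unliftP ord0 j) => [l ->|->]; rewrite ?consrS ?consr0.
Qed.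

End consr.

Section borel_measurability.

Lemma open_borel (T : ptopologicalType) (A : set T) :
  open A -> measurable (A : set (borel T)).
Proof. by move=> oA; exact: sub_sigma_algebra. Qed.

Lemma measurable_borel_fun d (T : measurableType d) (U : ptopologicalType)
    (D : set T) (f : T -> borel U) :
  (forall A : set U, open A -> measurable (D `&` f @^-1` A)) ->
  measurable_fun D f.
Proof.
move=> h; apply: (@measurability _ _ _ _ D f (@open U)) => //.
by move=> _ [A oA <-]; exact: h.
Qed.

Lemma continuous_borel_on (T : ptopologicalType) (R : realType) (D : set T)
    (f : T -> R) : open D -> {in D, continuous f} ->
  measurable_fun (D : set (borel T)) (f : borel T -> R).
Proof.
move=> oD cf; apply: (measurability _ (RGenOInfty.measurableE R)).
move=> _ [_ [x ->] <-]; apply: open_borel.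
by apply: ((continuous_inP _ oD).1 cf); exact: interval_open.
Qed.

Lemma continuous_borel (T : ptopologicalType) (R : realType) (f : T -> R) :
  continuous f -> measurable_fun setT (f : borel T -> R).
Proof. by move=> cf; apply: continuous_borel_on; [exact: openT|move=> x _; exact: cf]. Qed.

End borel_measurability.

Section consr_measurable.
Context {R : realType}.

Definition consrP k (p : measurableTypeR R * borel 'rV[R]_k) :
  borel 'rV[R]_k.+1 := consr p.1 p.2.

(** An open set of R^(k+1) is a countable union of rectangles I x W, with I a
    rational interval and W open in R^k: this is what makes the Borel sets of
    R^(k+1) product-measurable. *)
Lemma measurable_consrP k : measurable_fun setT (@consrP k).
Proof.
apply: measurable_borel_fun => A oA; rewrite setTI.
pose W (a : rat * rat) := [set v : 'rV[R]_k |
  forall x, `|x - ratr a.1| < ratr a.2 -> A (consr x v)]°.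
have -> : consrP (k := k) @^-1` A = \bigcup_(a : rat * rat)
    ([set x : measurableTypeR R | `|x - ratr a.1| < ratr a.2] `*` W a).
  apply/seteqP; split=> [[x v] Axv|[x v] [a _ [/= ax Wv]]]; last first.
    exact: (interior_subset Wv).
  have /nbhs_ballP[e /= e0 eA] : nbhs (consr x v) A.
    by apply: open_nbhs_nbhs; split.
  have e2 : 0 < e / 2 by rewrite divr_gt0.
  have e4 : 0 < e / 4 by rewrite divr_gt0.
  have [q /itvP qx] : exists q, ratr q \in `](x - e / 4), (x + e / 4)[.
    by apply: rat_in_itvoo; lra.
  have [r /itvP re] : exists r, ratr r \in `](e / 4), (e / 2)[.
    by apply: rat_in_itvoo; lra.
  have q1 : ratr q < x + e / 4 by rewrite qx.
  have q2 : x - e / 4 < ratr q by rewrite qx.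
  have r1 : e / 4 < ratr r by rewrite re.
  have r2 : ratr r < e / 2 by rewrite re.
  exists (q, r) => //; split => /=.
    by rewrite ltr_norml; apply/andP; split; lra.
  apply/nbhs_ballP; exists e => //= v' bv x'; rewrite ltr_norml => /andP[h1 h2].
  apply: eA; apply: consr_ball => //; rewrite /ball/= ltr_norml.
  by apply/andP; split; lra.
apply: countable_bigcupT_measurable => [|a].
  exact: countableP.
apply: measurableX; last exact: open_borel (open_interior _).
have -> : [set x : measurableTypeR R | `|x - ratr a.1| < ratr a.2] =
    `](ratr a.1 - ratr a.2), (ratr a.1 + ratr a.2)[%classic.
  by apply/seteqP; split=> x /=; rewrite in_itv/= ltr_norml => /andP[? ?];
    apply/andP; split; lra.
exact: measurable_itv.
Qed.

End consr_measurable.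

Section lam.
Context {R : realType}.

(** Boxes of finite volume exhausting R^k, for sigma-finiteness. *)
Definition bigbox k (n : nat) : set (borel 'rV[R]_k) :=
  [set v | forall i, `|v 0 i| <= n%:R].

Lemma measurable_bigbox k n : measurable (@bigbox k n).
Proof.
have -> : @bigbox k n = \bigcap_(i : 'I_k) [set v : borel 'rV[R]_k | `|v 0 i| <= n%:R].
  by apply/seteqP; split=> v h i; [move=> _|]; exact: h.
apply: fin_bigcap_measurable => // i _.
rewrite -[X in measurable X]setTI.
have : measurable_fun setT (fun v : borel 'rV[R]_k => `|v 0 i|).
  apply: continuous_borel => v; apply: continuous_comp; last exact: norm_continuous.
  exact: coord_continuous.
move=> /(_ measurableT `]-oo, n%:R]%classic (measurable_itv _)).
by congr (measurable (_ `&` _)); apply/seteqP; split=> x /=; rewrite in_itv.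
Qed.

Section lam_step.
Variables (k : nat) (m : {sigma_finite_measure set (borel 'rV[R]_k) -> \bar R}).
Hypothesis mfin : forall n, (m (@bigbox k n) < +oo)%E.

Definition lamS := pushforward ((@lebesgue_measure R) \x m)%E (@consrP R k).

Let mpf : {measure set (borel 'rV[R]_k.+1) -> \bar R} :=
  measure_function_pushforward__canonical__measure_function_Measure
    (lebesgue_measure \x m)%E (measurable_consrP (k:=k)).
Let lamS0 : lamS set0 = 0%E. Proof. exact: (measure0 mpf). Qed.
Let lamS_ge0 A : (0 <= lamS A)%E. Proof. exact: (measure_ge0 mpf). Qed.
Let lamS_sigma_additive : semi_sigma_additive lamS.
Proof. exact: (@measure_semi_sigma_additive _ _ _ mpf). Qed.

HB.instance Definition _ := measure_function.isMeasure.Build _ _ _ lamS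
  lamS0 lamS_ge0 lamS_sigma_additive.

Lemma lamS_bigbox n : (lamS (@bigbox k.+1 n) < +oo)%E.
Proof.
rewrite /lamS /pushforward (_ : _ @^-1` _ =
    `[(- n%:R : R), n%:R]%classic `*` @bigbox k n); last first.
  apply/seteqP; split=> [[x v] h|[x v] [/= h1 h2] i].
    split; last by move=> i; have := h (lift ord0 i); rewrite consrS.
    by have := h ord0; rewrite consr0/= in_itv/= ler_norml.
  case: (unliftP ord0 i) => [j ->|->]; first by rewrite consrS; exact: h2.
  by rewrite consr0 ler_norml; move: h1; rewrite in_itv.
rewrite product_measure1E; [|exact: measurable_itv|exact: measurable_bigbox].
apply: lte_mul_pinfty; [exact: measure_ge0| |exact: mfin].
by rewrite /= lebesgue_measure_itv/=; case: ifP.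
Qed.

Let lamS_sigma_finite : sigma_finite setT lamS.
Proof.
exists (@bigbox k.+1) => [|n]; last first.
  by split; [exact: measurable_bigbox|exact: lamS_bigbox].
apply/seteqP; split=> // v _.
exists (Num.truncn (\sum_i `|v 0 i|)).+1 => // i.
rewrite (le_trans _ (ltW (truncnS_gt _)))//.
by rewrite (bigD1 i)//= lerDl sumr_ge0.
Qed.

HB.instance Definition _ := Measure_isSigmaFinite.Build _ _ _ lamS
  lamS_sigma_finite.

Definition lamS_sf : {sigma_finite_measure set (borel 'rV[R]_k.+1) -> \bar R} :=
  lamS.

End lam_step.

Lemma lam0_bigbox n :
  ((@dirac _ (borel 'rV[R]_0) 0%R R) (@bigbox 0 n) < +oo)%E.
Proof. by rewrite diracE ltry. Qed.

Fixpoint lam_pkg k : {m : {sigma_finite_measure set (borel 'rV[R]_k) -> \bar R} |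
   forall n, (m (@bigbox k n) < +oo)%E} :=
  match k with
  | 0 => exist _ (@dirac _ (borel 'rV[R]_0) 0%R R : {sigma_finite_measure set _ -> \bar R})
           lam0_bigbox
  | k'.+1 => exist _ (lamS_sf (svalP (lam_pkg k')))
           (lamS_bigbox (svalP (lam_pkg k')))
  end.

Definition lam k := sval (lam_pkg k).

End lam.

(** * Iterated integrals and affine substitutions on R^k *)

Lemma cvg_rV (K : numFieldType) (U : pseudoMetricType K) (T : Type)
    (F : set_system T) {FF : Filter F} n (f : T -> 'rV[U]_n) (a : 'rV[U]_n) :
  (forall i, (fun t => f t 0 i) @ F --> a 0 i) -> f @ F --> a.
Proof.
move=> h; apply/cvg_ballP => e e0.
have : \forall t \near F, forall i, ball (a 0 i) e (f t 0 i).
  by apply: filter_forall => i; move/cvg_ballP: (h i); exact.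
by apply: filterS => t ht; split => // i j; rewrite ord1.
Qed.

Lemma continuous_rV (K : numFieldType) (U : pseudoMetricType K)
    (T : topologicalType) n (f : T -> 'rV[U]_n) x :
  (forall i, {for x, continuous (fun t => f t 0 i)}) -> {for x, continuous f}.
Proof. by move=> h; apply: cvg_rV. Qed.

Lemma cvg_sum (K : numFieldType) (V : normedModType K) (T I : Type)
    (F : set_system T) {FF : Filter F} (s : seq I) (f : I -> T -> V) (a : I -> V) :
  (forall i, f i @ F --> a i) ->
  (fun t => \sum_(i <- s) f i t) @ F --> \sum_(i <- s) a i.
Proof.
move=> h; elim: s => [|i s IH].
  by rewrite big_nil; under eq_fun do rewrite big_nil; exact: cvg_cst.
by rewrite big_cons; under eq_fun do rewrite big_cons; exact: cvgD.
Qed.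

Section lam_theory.
Context {R : realType}.
Local Open Scope ereal_scope.
Implicit Types k : nat.

Lemma measurable_consr k (f : borel 'rV[R]_k.+1 -> \bar R) :
  measurable_fun setT f ->
  measurable_fun setT (fun p : measurableTypeR R * borel 'rV[R]_k => f (consr p.1 p.2)).
Proof.
move=> mf; exact: (measurableT_comp mf (measurable_consrP (k:=k))).
Qed.

Lemma measurable_consr1 k (x : R) (f : borel 'rV[R]_k.+1 -> \bar R) :
  measurable_fun setT f ->
  measurable_fun setT (fun v : borel 'rV[R]_k => f (consr x v)).
Proof.
move=> /measurable_consr mf; exact: (measurableT_comp mf (pair1_measurable x)).
Qed.

Lemma measurable_integral_consr k (f : borel 'rV[R]_k.+1 -> \bar R) :
  measurable_fun setT f -> (forall v, 0 <= f v) ->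
  measurable_fun setT
    (fun x : measurableTypeR R => \int[lam k]_v f (consr x v)).
Proof.
move=> mf f0.
exact: (measurable_fun_fubini_tonelli_F (m2 := lam k) _ (measurable_consr mf)).
Qed.

Lemma integral_lam0 (f : borel 'rV[R]_0 -> \bar R) :
  measurable_fun setT f -> \int[lam 0]_v f v = f 0%R.
Proof. by move=> mf; rewrite integral_dirac// diracT mul1e. Qed.

Lemma integral_lamS k (f : borel 'rV[R]_k.+1 -> \bar R) :
  measurable_fun setT f -> (forall v, 0 <= f v) ->
  \int[lam k.+1]_v f v =
  \int[lebesgue_measure]_x \int[lam k]_v f (consr x v).
Proof.
move=> mf f0.
have := @ge0_integral_pushforward _ _ _ _ R _ (measurable_consrP (k:=k))
  (lebesgue_measure \x lam k) setT f measurableT mf (fun v _ => f0 v).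
rewrite preimage_setT => ->.
by rewrite (fubini_tonelli1 (m2 := lam k) _ (measurable_consr mf)).
Qed.

Lemma lebesgue_integral_rVE k (f : borel 'rV[R]_k -> \bar R) :
  measurable_fun setT f -> (forall v, 0 <= f v) ->
  lebesgue_integral_rV f = \int[lam k]_v f v.
Proof.
elim: k f => [|k IH] f mf f0; first by rewrite integral_lam0.
rewrite integral_lamS//=; apply: eq_integral => x _.
by apply: IH => //; exact: measurable_consr1.
Qed.

Lemma lebesgue_affine (c b : R) (A : set R) : (0 < c)%R -> measurable A ->
  lebesgue_measure A =
  c%:E * pushforward (lebesgue_measure : set (measurableTypeR R) -> _)
    (fun x : R => c * x + b)%R A.
Proof.
move=> c0.
have mf : measurable_fun [set: measurableTypeR R]
    ((fun x : R => c * x + b)%R : _ -> measurableTypeR R).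
  by apply: measurable_funD => //; exact: measurable_funM.
pose m1 : {measure set (measurableTypeR R) -> \bar R} :=
  measure_function_pushforward__canonical__measure_function_Measure
    (@lebesgue_measure R) mf.
pose c' : {nonneg R} := NngNum (ltW c0).
move: A; apply: (@lebesgue_measure_unique R (mscale c' m1)) => _ [[x y] _ <-].
rewrite /mscale/= /pushforward.
rewrite -[RHS]/(c%:E * lebesgue_measure ((fun x : R => c * x + b)%R @^-1` `]x, y])).
rewrite (_ : _ @^-1` _ = `]((x - b) / c)%R, ((y - b) / c)%R]%classic); last first.
  apply/seteqP; split=> t /=; rewrite !in_itv/= ltr_pdivrMr// ler_pdivlMr//.
    by rewrite ltrBlDr lerBrDr mulrC.
  by rewrite ltrBlDr lerBrDr mulrC.
rewrite !lebesgue_measure_itv/= !lte_fin ltr_pM2r ?invr_gt0// ltrD2r.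
case: ifP => // _; last by rewrite mule0.
by rewrite -!EFinD -EFinM; congr _%:E; field; rewrite gt_eqF.
Qed.

Lemma integral_affine1 (c b : R) (f : measurableTypeR R -> \bar R) : (0 < c)%R ->
  measurable_fun setT f -> (forall x, 0 <= f x) ->
  \int[lebesgue_measure]_x f x =
  c%:E * \int[lebesgue_measure]_x f (c * x + b)%R.
Proof.
move=> c0 mfu f0.
have mf : measurable_fun [set: measurableTypeR R]
    ((fun x : R => c * x + b)%R : _ -> measurableTypeR R).
  by apply: measurable_funD => //; exact: measurable_funM.
pose m1 : {measure set (measurableTypeR R) -> \bar R} :=
  measure_function_pushforward__canonical__measure_function_Measure
    (@lebesgue_measure R) mf.
pose c' : {nonneg R} := NngNum (ltW c0).
rewrite (@eq_measure_integral _ _ _ _ (mscale c' m1)); last first.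
  by move=> A mA _; exact: (lebesgue_affine b c0 mA).
rewrite ge0_integral_mscale//; congr (_ * _).
by rewrite (@ge0_integral_pushforward _ _ _ _ R _ mf lebesgue_measure setT f).
Qed.

Definition aff k (c b : 'I_k -> R) (v : 'rV[R]_k) : 'rV[R]_k :=
  \row_i (c i * v 0 i + b i)%R.

Lemma aff_consr k (c b : 'I_k.+1 -> R) x v :
  aff c b (consr x v) = consr (c ord0 * x + b ord0)%R
    (aff (c \o lift ord0) (b \o lift ord0) v).
Proof.
apply/rowP => i; rewrite mxE.
by case: (unliftP ord0 i) => [j ->|->]; rewrite ?consrS ?consr0 // mxE.
Qed.

Lemma measurable_aff k (c b : 'I_k -> R) :
  measurable_fun setT (aff c b : borel 'rV[R]_k -> borel 'rV[R]_k).
Proof.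
apply: measurable_borel_fun => A oA; rewrite setTI; apply: open_borel.
apply: open_comp => // v _. apply: continuous_rV => i.
rewrite (_ : (fun t => _) = (fun t : 'rV[R]_k => c i * t 0 i + b i)%R); last first.
  by apply/funext => t; rewrite mxE.
apply: (@continuousD _ R^o); last exact: cst_continuous.
by apply: continuousM; [exact: cst_continuous|exact: coord_continuous].
Qed.

Lemma integral_aff k (c b : 'I_k -> R) (f : borel 'rV[R]_k -> \bar R) :
  (forall i, 0 < c i)%R ->
  measurable_fun setT f -> (forall v, 0 <= f v) ->
  \int[lam k]_v f v = (\prod_i c i)%:E * \int[lam k]_v f (aff c b v).
Proof.
elim: k c b f => [|k IH] c b f c0 mf f0.
  rewrite big_ord0 mul1e; apply: eq_integral => v _; congr f.
  by apply/rowP => -[].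
have mfa : measurable_fun setT (f \o aff c b : borel 'rV[R]_k.+1 -> _).
  exact: (measurableT_comp mf (measurable_aff c b)).
rewrite !integral_lamS//.
rewrite (integral_affine1 (b ord0) (c0 ord0)); last 2 first.
- exact: measurable_integral_consr.
- by move=> x; apply: integral_ge0.
rewrite big_ord_recl EFinM -muleA; congr (_ * _).
have p0 : 0 <= (\prod_i (c \o lift ord0) i)%:E.
  by rewrite lee_fin prodr_ge0// => i _; exact: (ltW (c0 _)).
have F0 (x : measurableTypeR R) : [set: measurableTypeR R] x ->
    0 <= \int[lam k]_v f (aff c b (consr x v)).
  by move=> _; apply: integral_ge0 => v _; exact: f0.
rewrite -(ge0_integralZl lebesgue_measure measurableT (measurable_integral_consr mfa (fun _ => f0 _)) F0 p0).
apply: eq_integral => x _.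
rewrite (IH (c \o lift ord0) (b \o lift ord0))//=; last exact: measurable_consr1.
by under [in RHS]eq_integral do rewrite aff_consr.
Qed.

Lemma measurable_coord k (g : measurableTypeR R -> \bar R) (i : 'I_k) :
  measurable_fun setT g ->
  measurable_fun setT (fun v : borel 'rV[R]_k => g (v 0%R i)).
Proof.
move=> mg; apply: (measurableT_comp mg).
by apply: continuous_borel => v; exact: coord_continuous.
Qed.

Lemma integral_prod k (g : 'I_k -> measurableTypeR R -> \bar R) :
  (forall i, measurable_fun setT (g i)) -> (forall i x, 0 <= g i x) ->
  measurable_fun setT (fun v : borel 'rV[R]_k => \prod_i g i (v 0%R i)) /\
  \int[lam k]_v \prod_i g i (v 0%R i) =
  \prod_i \int[lebesgue_measure]_x g i x.
Proof.
move=> mg g0.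
have mp : forall k (g : 'I_k -> measurableTypeR R -> \bar R),
    (forall i, measurable_fun setT (g i)) ->
    measurable_fun setT (fun v : borel 'rV[R]_k => \prod_i g i (v 0%R i)).
  move=> {k g mg g0} k g mg; elim: (index_enum _) => [|i s IH].
    by under eq_fun do rewrite big_nil; exact: measurable_cst.
  under eq_fun do rewrite big_cons; apply: emeasurable_funM => //.
  exact: (measurable_coord i (mg i)).
split; first exact: mp.
elim: k g mg g0 => [|k IH] g mg g0.
  by rewrite integral_lam0 ?big_ord0//; exact: mp.
rewrite integral_lamS; [|exact: mp|by move=> v /=; apply: prode_ge0 => i _].
rewrite big_ord_recl -ge0_integralZr//; last first.
  by apply: prode_ge0 => i _; apply: integral_ge0.
apply: eq_integral => x _.
under eq_integral do rewrite big_ord_recl consr0.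
rewrite ge0_integralZl//.
- by congr (_ * _); rewrite -IH//; apply: eq_integral => v _;
    apply: eq_bigr => i _; rewrite consrS.
- rewrite [X in measurable_fun _ X](_ : _ = (fun v : borel 'rV[R]_k =>
    \prod_i g (lift ord0 i) (v 0%R i))); first exact: (mp k (fun i => g (lift ord0 i))).
  by apply/funext => v; apply: eq_bigr => i _; rewrite consrS.
- by move=> v _ /=; apply: prode_ge0 => i _.
Qed.

End lam_theory.

(** * First-order expansions and the chain rule *)

Section line_derivatives.
Context {R : realType}.

Lemma derivable_line (V W : normedModType R) (f : V -> W) p v t :
  derivable f (p + t *: v) v -> is_derive t (1:R) (fun s : R => f (p + s *: v)) ('D_v f (p + t *: v)).
Proof.
have E : (fun h : R => h^-1 *: (((fun s : R => f (p + s *: v)) \o shift t) (h *: (1:R))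
     - f (p + t *: v))) =
   (fun h : R => h^-1 *: ((f \o shift (p + t *: v)) (h *: v) - f (p + t *: v))).
  apply/funext => h /=; congr (_ *: (f _ - _)).
  by rewrite scalerDl -[h *: (1:R)]/(h * 1) mulr1 addrCA.
by move=> d; apply: DeriveDef; [rewrite /derivable E|rewrite /derive E].
Qed.

Lemma is_derive_cont (f : R -> R) (t df : R) :
  is_derive t (1:R) f df -> {for t, continuous f}.
Proof. by move=> [d _]; exact/differentiable_continuous/derivable1_diffP. Qed.

Lemma MVT_sym (f df : R -> R) (a b : R) :
  (forall t, `|t - a| <= `|b - a| -> is_derive t (1:R) f (df t)) ->
  exists2 x, `|x - a| <= `|b - a| & f b - f a = df x * (b - a).
Proof.
move=> h; have [ab|ba] := leP a b.
  have h' t : t \in `[a, b] -> is_derive t (1:R) f (df t).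
    rewrite in_itv/= => /andP[at_ tb]; apply: h.
    by rewrite !ger0_norm ?subr_ge0// lerB.
  have cf : {within `[a, b], continuous f}.
    by apply: derivable_within_continuous => y yab; have [] := h' y yab.
  have h'' t : t \in `]a, b[ -> is_derive t (1:R) f (df t).
    by move=> tab; apply: h'; exact: subset_itv_oo_cc.
  have [x xab ->] := MVT_segment ab h'' cf.
  exists x => //; move: xab; rewrite in_itv/= => /andP[ax xb].
  by rewrite !ger0_norm ?subr_ge0// lerB.
have h' t : t \in `[b, a] -> is_derive t (1:R) f (df t).
  rewrite in_itv/= => /andP[bt ta]; apply: h.
  by rewrite (distrC t) (distrC b) !ger0_norm ?subr_ge0// ?(ltW ba)// lerB.
have cf : {within `[b, a], continuous f}.
  by apply: derivable_within_continuous => y yab; have [] := h' y yab.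
have h'' t : t \in `]b, a[ -> is_derive t (1:R) f (df t).
  by move=> tab; apply: h'; exact: subset_itv_oo_cc.
have [x xab e] := MVT_segment (ltW ba) h'' cf.
exists x; last by rewrite -opprB e -mulrN opprB.
move: xab; rewrite in_itv/= => /andP[bx xa].
by rewrite (distrC x) (distrC b) !ger0_norm ?subr_ge0// ?(ltW ba)// lerB.
Qed.

Definition Ei k (i : 'I_k) : 'rV[R]_k := delta_mx 0 i.

Definition C1near k (F : 'rV[R]_k -> R) p :=
  (\forall q \near p, forall i, derivable F q (Ei i)) /\
  (forall i, {for p, continuous (fun q => 'D_(Ei i) F q)}).

Lemma consr_Ei0 k (x h : R) (v : 'rV[R]_k) :
  consr (x + h) v = consr x v + h *: Ei ord0.
Proof.
apply/rowP => j; case: (unliftP ord0 j) => [i ->|->]; rewrite [RHS]mxE.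
  by rewrite !consrS !mxE/= mulr0 addr0.
by rewrite !consr0 !mxE/= mulr1.
Qed.

Lemma consr_EiS k (x h : R) (v : 'rV[R]_k) i :
  consr x (v + h *: Ei i) = consr x v + h *: Ei (lift ord0 i).
Proof.
apply/rowP => j; case: (unliftP ord0 j) => [l ->|->]; rewrite [RHS]mxE.
  by rewrite !consrS !mxE (inj_eq (@lift_inj _ ord0)).
by rewrite !consr0 !mxE/= mulr0 addr0.
Qed.

Lemma growth_consrS k (F : 'rV[R]_k.+1 -> R) x v i :
  (fun h : R => h^-1 *: (((fun w => F (consr x w)) \o shift v) (h *: Ei i) - F (consr x v))) =
  (fun h : R => h^-1 *: ((F \o shift (consr x v)) (h *: Ei (lift ord0 i)) - F (consr x v))).
Proof.
apply/funext => h /=; congr (_ *: (F _ - _)).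
by rewrite addrC consr_EiS addrC.
Qed.

Lemma derive_consrS k (F : 'rV[R]_k.+1 -> R) x v i :
  'D_(Ei i) (fun w => F (consr x w)) v = 'D_(Ei (lift ord0 i)) F (consr x v).
Proof. by rewrite /derive growth_consrS. Qed.

Lemma consr_continuous1 k (x : R) : continuous (fun v : 'rV[R]_k => consr x v).
Proof.
move=> v A /nbhs_ballP[e /= e0 eA]; apply/nbhs_ballP; exists e => //.
by move=> v' bv; apply: eA; apply: consr_ball => //; exact: ballxx.
Qed.

Lemma C1near_consrS k (F : 'rV[R]_k.+1 -> R) x v :
  C1near F (consr x v) -> C1near (fun w => F (consr x w)) v.
Proof.
move=> [d c]; split.
  have H : \forall w \near v, forall i, derivable F (consr x w) (Ei i).
    exact: (@consr_continuous1 k x v _ d).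
  apply: filterS H => w h i.
  by rewrite /derivable growth_consrS; exact: h.
move=> i A nA.
have {}nA : nbhs ('D_(Ei (lift ord0 i)) F (consr x v)) A by rewrite -derive_consrS.
have H : \forall w \near v, A ('D_(Ei (lift ord0 i)) F (consr x w)).
  exact: (@consr_continuous1 k x v _ (c (lift ord0 i) _ nA)).
suff : \forall w \near v, A ('D_(Ei i) (fun w => F (consr x w)) w) by [].
by apply: filterS H => w; rewrite derive_consrS.
Qed.

Lemma is_derive_consr0 k (F : 'rV[R]_k.+1 -> R) t v :
  derivable F (consr t v) (Ei ord0) ->
  is_derive t (1:R) (fun s => F (consr s v)) ('D_(Ei ord0) F (consr t v)).
Proof.
have E : (fun h : R => h^-1 *: (((fun s : R => F (consr s v)) \o shift t) (h *: (1:R))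
     - F (consr t v))) =
   (fun h : R => h^-1 *: ((F \o shift (consr t v)) (h *: Ei ord0) - F (consr t v))).
  apply/funext => h /=; congr (_ *: (F _ - _)).
  by rewrite -[h *: (1:R)]/(h * 1) mulr1 addrC consr_Ei0 addrC.
by move=> d; apply: DeriveDef; [rewrite /derivable E|rewrite /derive E].
Qed.

(** Continuity of the partial derivatives gives a first-order expansion:
    the coordinates are changed one after the other, and each change is
    controlled by the mean value theorem. *)
Lemma C1_expansion k (F : 'rV[R]_k -> R) p : C1near F p ->
  forall e, 0 < e -> \forall q \near p,
    `|F q - F p - \sum_i 'D_(Ei i) F p * (q 0 i - p 0 i)| <=
    e * \sum_i `|q 0 i - p 0 i|.
Proof.
elim: k F p => [|k IH] F p.
  move=> _ e e0; near=> q; rewrite !big_ord0 mulr0 subr0.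
  rewrite (_ : q = p) ?subrr ?normr0//.
  by apply/rowP => -[].
rewrite (consr_eta p); set x0 := p 0 ord0; set v0 := \row_i _ => cF e e0.
have {IH}IH := IH _ _ (C1near_consrS cF) e e0.
have [dF cD] := cF.
have /nbhs_ballP[d /= d0 dP] : \forall q \near consr x0 v0,
    derivable F q (Ei ord0) /\ `|'D_(Ei ord0) F q - 'D_(Ei ord0) F (consr x0 v0)| <= e.
  near=> q; split.
    by move: ord0; near: q.
  by rewrite distrC; near: q; move/cvgrPdist_le : (cD ord0) => /(_ e e0).
have /nbhs_ballP[d' /= d'0 dP'] := IH.
have mn0 : 0 < Num.min d d' by rewrite lt_min d0.
near=> q.
have bq : ball (consr x0 v0) (Num.min d d') q.
  by near: q; exact: nbhsx_ballx.
pose x := q 0 ord0; pose v := \row_i q 0 (lift ord0 i).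
have qE : q = consr x v by exact: consr_eta.
have [_ bq'] := bq.
have xx0 : `|x - x0| < d.
  have := bq' 0 ord0; rewrite consr0 /ball/= distrC => /lt_le_trans; apply.
  by rewrite ge_min lexx.
have bvi e' : 0 < e' -> Num.min d d' <= e' -> ball v0 e' v.
  move=> e'0 le; split => // i j; rewrite ord1.
  have := bq' 0 (lift ord0 j); rewrite consrS [v 0 j]mxE => h.
  exact: le_ball le _ h.
have {dP'}IHq : `|F (consr x0 v) - F (consr x0 v0) - \sum_i 'D_(Ei (lift ord0 i)) F (consr x0 v0) *
    (v 0 i - v0 0 i)| <= e * \sum_i `|v 0 i - v0 0 i|.
  have := dP' v (bvi d' d'0 _); rewrite ge_min lexx orbT => /(_ isT) /=.
  by under eq_bigr do rewrite derive_consrS.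
have [|y yx Ey] := @MVT_sym (fun t => F (consr t v))
    (fun t => 'D_(Ei ord0) F (consr t v)) x0 x.
  move=> t tx; apply: is_derive_consr0; apply: (dP _ _).1.
  apply: consr_ball; last by apply: bvi => //; rewrite ge_min lexx.
  by rewrite /ball/= distrC (le_lt_trans tx).
have {}dP : `|'D_(Ei ord0) F (consr y v) - 'D_(Ei ord0) F (consr x0 v0)| <= e.
  apply: (dP _ _).2.
  apply: consr_ball; last by apply: bvi => //; rewrite ge_min lexx.
  by rewrite /ball/= distrC (le_lt_trans yx).
rewrite !big_ord_recl/= qE !consr0.
under eq_bigr do rewrite !consrS.
under [X in _ <= _ * (_ + X)]eq_bigr do rewrite !consrS.
have step : `|F (consr x v) - F (consr x0 v) -
    'D_(Ei ord0) F (consr x0 v0) * (x - x0)| <= e * `|x - x0|.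
  by rewrite Ey -mulrBl normrM ler_wpM2r.
rewrite [leRHS]mulrDr; apply: le_trans (lerD step IHq).
apply: le_trans (ler_normD _ _); rewrite le_eqVlt; apply/orP; left.
by apply/eqP; congr `|_|; ring.
Unshelve. all: by end_near. Qed.

(** The chain rule for a function with continuous partial derivatives along a
    differentiable curve. *)
Lemma is_derive_curve k (F : 'rV[R]_k -> R) (c : R -> 'rV[R]_k) (t0 : R)
    (c' : 'I_k -> R) :
  C1near F (c t0) ->
  (forall i, is_derive t0 (1:R) (fun t => c t 0 i) (c' i)) ->
  is_derive t0 (1:R) (fun t => F (c t)) (\sum_i 'D_(Ei i) F (c t0) * c' i).
Proof.
move=> cF dc.
pose q (h : R) i := h^-1 *: (c (h + t0) 0 i - c t0 0 i).
have dq i : q ^~ i @ 0^' --> c' i.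
  have [/cvg_ex[/= l dl] <-] := dc i.
  rewrite /derive; rewrite (cvg_lim _ dl)//; move: dl.
  rewrite /q; under eq_fun do rewrite -[_ *: (1:R)]/(_ * 1) mulr1 /=.
  exact.
have cc : {for t0, continuous c}.
  by apply: continuous_rV => i; exact: is_derive_cont (dc i).
suff H : (fun h : R => h^-1 *: (F (c (h + t0)) - F (c t0))) @ 0^' -->
    \sum_i 'D_(Ei i) F (c t0) * c' i.
  have E : (fun h : R => h^-1 *: (((fun t => F (c t)) \o shift t0) (h *: (1:R)) - F (c t0))) =
     (fun h : R => h^-1 *: (F (c (h + t0)) - F (c t0))).
    by apply/funext => h /=; rewrite -[h *: (1:R)]/(h * 1) mulr1.
  apply: DeriveDef; first by rewrite /derivable E; apply/cvg_ex; eexists; exact: H.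
  by rewrite /derive E; exact: cvg_lim.
have H1 : (fun h => \sum_i 'D_(Ei i) F (c t0) * q h i) @ 0^' -->
    \sum_i 'D_(Ei i) F (c t0) * c' i.
  apply: cvg_sum => i; apply: cvgM; [exact: cvg_cst|exact: dq].
rewrite -[X in _ --> X]addr0.
rewrite (_ : (fun h => _) = (fun h => \sum_i 'D_(Ei i) F (c t0) * q h i +
   h^-1 * (F (c (h + t0)) - F (c t0) -
      \sum_i 'D_(Ei i) F (c t0) * (c (h + t0) 0 i - c t0 0 i)))); last first.
  apply/funext => h; rewrite -[_ *: _]/(_ * _) [in RHS]mulrBr addrCA.
  rewrite mulr_sumr [X in _ + (X - _)](_ : _ = \sum_i h^-1 * ('D_(Ei i) F (c t0) * (c (h + t0) 0 i - c t0 0 i))).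
    by rewrite subrr addr0.
  by apply: eq_bigr => i _; rewrite mulrCA.
apply: cvgD; first exact: H1.
apply/cvgrPdist_le => e e0.
pose M := 1 + \sum_i `|c' i|.
have M0 : 0 < M by rewrite ltr_pwDl// sumr_ge0.
have HM : \forall h \near 0^', \sum_i `|q h i| <= M.
  have : (fun h => \sum_i `|q h i|) @ 0^' --> \sum_i `|c' i|.
    by apply: cvg_sum => i; apply: cvg_norm; exact: dq.
  by move/cvgr_le; apply; rewrite ltrDr.
have cs : (fun h : R => h + t0) @ 0^' --> t0.
  apply: cvg_trans (_ : (fun h : R => h + t0) @ 0 --> t0).
    by apply: cvg_app; exact: nbhs_dnbhs.
  rewrite -[X in _ --> X]add0r; apply: cvgD; [exact: cvg_id|exact: cvg_cst].
have EX := C1_expansion cF (divr_gt0 e0 M0).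
have {}EX : \forall h \near 0^', 
    `|F (c (h + t0)) - F (c t0) - \sum_i 'D_(Ei i) F (c t0) * (c (h + t0) 0 i - c t0 0 i)| <=
    e / M * \sum_i `|c (h + t0) 0 i - c t0 0 i|.
  exact: (cvg_comp _ _ cs cc) _ EX.
near=> h.
have h0 : h != 0 by near: h; exact: nbhs_dnbhs_neq.
rewrite sub0r normrN normrM.
apply: (@le_trans _ _ (`|h^-1| * (e / M * \sum_i `|c (h + t0) 0 i - c t0 0 i|))).
  by rewrite ler_wpM2l//; near: h.
rewrite mulrCA mulr_sumr -ler_pdivlMl ?divr_gt0// invf_div divfK ?gt_eqF//.
under eq_bigr do rewrite -normrM.
by near: h.
Unshelve. all: by end_near. Qed.

Lemma derive_sumEi k (F : 'rV[R]_k -> R) p v : C1near F p ->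
  is_derive p v F (\sum_i 'D_(Ei i) F p * v 0 i).
Proof.
move=> cF.
have H : is_derive (0:R) (1:R) (fun t : R => F (t *: v + p)) (\sum_i 'D_(Ei i) F p * v 0 i).
  have := @is_derive_curve k F (fun t : R => t *: v + p) 0 (fun i => v 0 i).
  rewrite scale0r add0r; apply => // i.
  rewrite (_ : (fun t : R => _) = (fun t : R => t * v 0 i + p 0 i)); last first.
    by apply/funext => t; rewrite !mxE.
  by apply: is_derive_eq; rewrite scaler0 add0r addr0 -[_ *: _]/(_ * _) mulr1.
have [h1 h2] := H.
apply: DeriveDef; first by apply/(derivable1P F p v).
rewrite -h2 /derive.
have -> // : (fun h : R => h^-1 *: ((F \o shift p) (h *: v) - F p)) =
  (fun h : R => h^-1 *: (((fun t : R => F (t *: v + p)) \o shift 0) (h *: (1:R)) - F (0 *: v + p))).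
by apply/funext => h /=; rewrite scale0r add0r addr0 -[h *: (1:R)]/(h * 1) mulr1.
Qed.

End line_derivatives.

(** * Smooth functions of several real variables *)

Section smooth.
Context {R : realType}.

Lemma is_derive_line0 (V W : normedModType R) (f : V -> W) (x v : V) d :
  is_derive (0:R) (1:R) (fun t : R => f (t *: v + x)) d <-> is_derive x v f d.
Proof.
have E : (fun h : R => h^-1 *: ((f \o shift x) (h *: v) - f x)) =
  (fun h : R => h^-1 *: (((fun t : R => f (t *: v + x)) \o shift 0) (h *: (1:R)) - f (0 *: v + x))).
  by apply/funext => h /=; rewrite scale0r add0r addr0 -[h *: (1:R)]/(h * 1) mulr1.
split=> -[h1 h2]; apply: DeriveDef.
- by rewrite /derivable E.
- by rewrite /derive E.
- by rewrite /derivable -E.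
- by rewrite /derive -E.
Qed.

Section Cn.
Context {V : normedModType R}.
Implicit Types (U : set V) (f g : V -> R).

Fixpoint Cn n U f : Prop :=
  match n with
  | 0 => forall x, U x -> {for x, continuous f}
  | n'.+1 => (forall x, U x -> {for x, continuous f}) /\
      forall v, (forall x, U x -> derivable f x v) /\ Cn n' U ('D_v f)
  end.

Definition smooth U f := forall n, Cn n U f.

Lemma CnW n U f : Cn n.+1 U f -> Cn n U f.
Proof.
elim: n f => [|n IH] f; first by case.
move=> [h hf]; split => // v; have [h1 h2] := hf v; split => //; exact: IH.
Qed.

Lemma smooth_derive U f v : smooth U f -> smooth U ('D_v f).
Proof. by move=> h n; have [_ /(_ v)[]] := h n.+1. Qed.

Lemma smooth_derivable U f v x : smooth U f -> U x -> derivable f x v.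
Proof. by move=> h Ux; have [_ /(_ v)[+ _]] := h 1%N; exact. Qed.

Lemma smooth_cont U f x : smooth U f -> U x -> {for x, continuous f}.
Proof. by move=> h Ux; exact: (h 0%N). Qed.

(** Smoothness read order by order: this form passes to products and
   compositions by induction on the order. *)
Lemma smooth_onP U f : smooth_on U f <-> smooth U f.
Proof.
split=> h.
  have hd n : forall f, smooth_on U f -> Cn n U f.
    elim: n => [|n IH] {h}f h /=; first by move=> x Ux; have [] := h [::] x Ux.
    split; first by move=> x Ux; have [] := h [::] x Ux.
    move=> v; split; first by move=> x Ux; have [_] := h [::] x Ux; exact.
    apply: IH => vs x Ux; have := h (rcons vs v) x Ux.
    by rewrite /iter_derive foldr_rcons.
  by move=> n; exact: hd.
move=> vs; elim/last_ind: vs f h => [|vs v IH] f h x Ux.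
  by split; [exact: smooth_cont h Ux|move=> v; exact: smooth_derivable h Ux].
rewrite /iter_derive foldr_rcons; exact: (IH _ (smooth_derive v h)).
Qed.

Variable U : set V.
Hypothesis oU : open U.

Lemma near_open x (P : V -> Prop) : U x -> (forall y, U y -> P y) ->
  \forall y \near x, P y.
Proof. by move=> Ux h; apply: filterS h _; exact: open_nbhs_nbhs. Qed.

Lemma Cn_eq n f g : (forall x, U x -> f x = g x) -> Cn n U f -> Cn n U g.
Proof.
elim: n f g => [|n IH] f g fg /=.
  move=> h x Ux; apply: cvg_trans (_ : f @ x --> _).
    by apply: near_eq_cvg; exact: near_open.
  by rewrite -fg//; exact: h.
move=> [h hd]; split.
  move=> x Ux; apply: cvg_trans (_ : f @ x --> _).
    by apply: near_eq_cvg; exact: near_open.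
  by rewrite -fg//; exact: h.
move=> v; have [h1 h2] := hd v; split.
  by move=> x Ux; apply: near_eq_derivable (h1 x Ux); exact: near_open.
apply: IH h2 => x Ux; apply: near_eq_derive; exact: near_open.
Qed.

Lemma Cn_cst n (c : R) : Cn n U (cst c).
Proof.
elim: n c => [|n IH] c /=; first by move=> x _; exact: cst_continuous.
split; first by move=> x _; exact: cst_continuous.
move=> v; split; first by move=> x _; exact: derivable_cst.
by rewrite (_ : 'D_v (cst c) = cst 0)//; apply/funext => x; rewrite derive_cst.
Qed.

Lemma Cn_add n f g : Cn n U f -> Cn n U g -> Cn n U (fun x => f x + g x).
Proof.
elim: n f g => [|n IH] f g /=.
  by move=> hf hg x Ux; apply: continuousD; [exact: hf|exact: hg].
move=> [hf df] [hg dg]; split.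
  by move=> x Ux; apply: continuousD; [exact: hf|exact: hg].
move=> v; have [f1 f2] := df v; have [g1 g2] := dg v.
split; first by move=> x Ux; apply: derivableD; [exact: f1|exact: g1].
apply: Cn_eq (IH _ _ f2 g2) => x Ux.
by rewrite -deriveD; [|exact: f1|exact: g1].
Qed.

Lemma Cn_mul n f g : Cn n U f -> Cn n U g -> Cn n U (fun x => f x * g x).
Proof.
elim: n f g => [|n IH] f g /=.
  by move=> hf hg x Ux; apply: continuousM; [exact: hf|exact: hg].
move=> hf0 hg0; have [hf df] := hf0; have [hg dg] := hg0; split.
  by move=> x Ux; apply: continuousM; [exact: hf|exact: hg].
move=> v; have [f1 f2] := df v; have [g1 g2] := dg v.
split; first by move=> x Ux; apply: derivableM; [exact: f1|exact: g1].
apply: Cn_eq (Cn_add (IH _ _ (CnW hf0) g2) (IH _ _ (CnW hg0) f2)) => x Ux.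
rewrite (_ : (fun y => f y * g y) = f * g)// deriveM; [|exact: f1|exact: g1].
by [].
Qed.

Lemma Cn_sum n (I : Type) (s : seq I) (f : I -> V -> R) :
  (forall i, Cn n U (f i)) -> Cn n U (fun x => \sum_(i <- s) f i x).
Proof.
move=> h; elim: s => [|i s IH].
  by apply: Cn_eq (Cn_cst n 0) => x _; rewrite big_nil.
by apply: Cn_eq (Cn_add (h i) IH) => x _; rewrite big_cons.
Qed.

Lemma Cn_opp n f : Cn n U f -> Cn n U (fun x => - f x).
Proof.
by move=> h; apply: Cn_eq (Cn_mul (Cn_cst n (-1)) h) => x _; rewrite /cst mulN1r.
Qed.

Lemma Cn_inv n f : (forall x, U x -> f x != 0) -> Cn n U f ->
  Cn n U (fun x => (f x)^-1).
Proof.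
move=> f0; elim: n f f0 => [|n IH] f f0 /=.
  by move=> hf x Ux; apply: continuousV; [exact: f0|exact: hf].
move=> hf0; have [hf df] := hf0; split.
  by move=> x Ux; apply: continuousV; [exact: f0|exact: hf].
move=> v; have [f1 f2] := df v.
split; first by move=> x Ux; apply: derivableV; [exact: f0|exact: f1].
have hV := IH f f0 (CnW hf0).
apply: Cn_eq (Cn_opp (Cn_mul (Cn_mul hV hV) f2)) => x Ux.
rewrite deriveV; [|exact: f0|exact: f1].
by rewrite -[_ *: _]/(_ * _) mulNr expr2 invfM.
Qed.

Lemma is_derive_comp1 (phi : R -> R) f (x v : V) d :
  is_derive (f x) (1:R) phi d -> derivable f x v ->
  is_derive x v (fun y => phi (f y)) (d * 'D_v f x).
Proof.
move=> hphi /derivableP /is_derive_line0 hf; apply/is_derive_line0.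
have hphi' : is_derive ((fun t : R => f (t *: v + x)) 0) (1:R) phi d.
  by rewrite /= scale0r add0r.
exact: (is_derive1_comp hphi' hf).
Qed.

Lemma Cn_comp1 n (phi phi' : R -> R) f :
  (forall t : R, is_derive t (1:R) phi (phi' t)) ->
  Cn n.+1 U f -> Cn n U (fun x => phi' (f x)) -> Cn n.+1 U (fun x => phi (f x)).
Proof.
move=> dphi hf0 hphi; have [hf df] := hf0.
split.
  move=> x Ux; apply: (@continuous_comp _ _ _ f phi); first exact: hf.
  exact: is_derive_cont (dphi _).
move=> v; have [f1 f2] := df v.
have D x : U x -> is_derive x v (fun y => phi (f y)) (phi' (f x) * 'D_v f x).
  by move=> Ux; apply: is_derive_comp1; exact: f1.
split; first by move=> x /D [].
by apply: Cn_eq (Cn_mul hphi f2) => x /D [_ ->].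
Qed.

Lemma Cn_comp0 (phi : R -> R) f : continuous phi ->
  Cn 0 U f -> Cn 0 U (fun x => phi (f x)).
Proof.
move=> cphi hf x Ux; apply: (@continuous_comp _ _ _ f phi); first exact: hf.
exact: cphi.
Qed.

Lemma Cn_expR n f : Cn n U f -> Cn n U (fun x => expR (f x)).
Proof.
elim: n => [|n IH] hf; first exact: Cn_comp0 (@continuous_expR R) hf.
by apply: (@Cn_comp1 n _ expR) => //; apply: IH; exact: CnW.
Qed.

Lemma Cn_cos_sin n f : Cn n U f ->
  Cn n U (fun x => cos (f x)) /\ Cn n U (fun x => sin (f x)).
Proof.
elim: n => [|n IH] hf.
  by split; apply: Cn_comp0 hf; [exact: continuous_cos|exact: continuous_sin].
have [hc hs] := IH (CnW hf).
split; last by apply: (@Cn_comp1 n _ cos).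
apply: (@Cn_comp1 n _ (fun t => - sin t)) => //.
exact: Cn_opp.
Qed.

End Cn.

Section Cn_rV.
Context {k : nat}.
Variable U : set 'rV[R]_k.
Hypothesis oU : open U.

Lemma Cn_coord n i : Cn n U (fun v => v 0 i).
Proof.
have D v x : is_derive x v (fun v : 'rV[R]_k => v 0 i) (v 0 i).
  apply/is_derive_line0.
  rewrite (_ : (fun t : R => _) = (fun t : R => t * v 0 i + x 0 i)).
    by apply: is_derive_eq; rewrite scaler0 add0r addr0 -[_ *: _]/(_ * _) mulr1.
  by apply/funext => t; rewrite !mxE.
case: n => [|n] /=; first by move=> x _; exact: coord_continuous.
split; first by move=> x _; exact: coord_continuous.
move=> v; split; first by move=> x _; have [] := D v x.
apply: (Cn_eq oU _ (Cn_cst U n (v 0 i))) => x _.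
by have [_ ->] := D v x.
Qed.

Lemma Cn1_C1near f p : U p -> Cn 1 U f -> C1near f p.
Proof.
move=> Up [_ h]; split.
  by apply: (near_open oU Up) => q Uq i; have [+ _] := h (Ei i); exact.
by move=> i; have [_] := h (Ei i); exact.
Qed.

End Cn_rV.

Lemma Cn_comp_on (V : normedModType R) (U : set V) l n (D : set 'rV[R]_l)
    (F : 'rV[R]_l -> R) (G : V -> 'rV[R]_l) : open U -> open D ->
  (forall x, U x -> D (G x)) -> smooth D F ->
  (forall i, Cn n U (fun x => G x 0 i)) -> Cn n U (fun x => F (G x)).
Proof.
move=> oU oD UD; have cF x F' : U x -> smooth D F' -> (forall i, {for x, continuous (fun x => G x 0 i)}) ->
    {for x, continuous (fun x => F' (G x))}.
  move=> Ux sF hG; apply: (@continuous_comp _ _ _ G F').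
    exact: continuous_rV.
  exact: smooth_cont sF (UD x Ux).
elim: n F => [|n IH] F sF hG.
  by move=> x Ux; apply: cF => // i; exact: hG.
split; first by move=> x Ux; apply: cF => // i; have [h _] := hG i; exact: h.
move=> v.
have dFG x : U x -> is_derive x v (fun x => F (G x))
    (\sum_i 'D_(Ei i) F (G x) * 'D_v (fun x => G x 0 i) x).
  move=> Ux; apply/is_derive_line0.
  have := @is_derive_curve R l F (fun t : R => G (t *: v + x)) 0
    (fun i => 'D_v (fun x => G x 0 i) x).
  rewrite scale0r add0r; apply.
    by apply: (Cn1_C1near oD); [exact: UD|exact: sF].
  move=> i; have [_ /(_ v) [dGi _]] := hG i.
  by have /is_derive_line0 := derivableP (dGi x Ux).
split; first by move=> x /dFG [].
apply: (@Cn_eq _ U oU _ (fun x => \sum_i 'D_(Ei i) F (G x) * 'D_v (fun x => G x 0 i) x)).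
  by move=> x /dFG [_ ->].
apply: Cn_sum => // i; apply: Cn_mul => //.
  by apply: (IH ('D_(Ei i) F)); [exact: smooth_derive|move=> j; exact: (CnW (hG j))].
by have [_ /(_ v) []] := hG i.
Qed.

Lemma Cn_comp (V : normedModType R) (U : set V) l n (F : 'rV[R]_l -> R)
    (G : V -> 'rV[R]_l) : open U ->
  smooth setT F -> (forall i, Cn n U (fun x => G x 0 i)) ->
  Cn n U (fun x => F (G x)).
Proof. by move=> oU; apply: Cn_comp_on => //; exact: openT. Qed.

End smooth.

(** * Complex coordinates and Wirtinger derivatives *)

Section complex_kit.
Context {R : realType}.
Implicit Types (a b : Cplx R) (x y : R).

Lemma mkC_eta a : a = mkC (ReC a) (ImC a). Proof. by case: a. Qed.

Lemma Cext a b : ReC a = ReC b -> ImC a = ImC b -> a = b.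
Proof. by rewrite [a]mkC_eta [b]mkC_eta => /= -> ->. Qed.

Lemma ReC_mk x y : ReC (mkC x y) = x. Proof. by []. Qed.
Lemma ImC_mk x y : ImC (mkC x y) = y. Proof. by []. Qed.
Lemma ReCD a b : ReC (a + b) = ReC a + ReC b. Proof. by case: a b => [? ?] []. Qed.
Lemma ImCD a b : ImC (a + b) = ImC a + ImC b. Proof. by case: a b => [? ?] []. Qed.
Lemma ReCN a : ReC (- a) = - ReC a. Proof. by case: a. Qed.
Lemma ImCN a : ImC (- a) = - ImC a. Proof. by case: a. Qed.
Lemma ReCM a b : ReC (a * b) = ReC a * ReC b - ImC a * ImC b.
Proof. by case: a b => [? ?] []. Qed.
Lemma ImCM a b : ImC (a * b) = ReC a * ImC b + ImC a * ReC b.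
Proof. by case: a b => [? ?] []. Qed.
Lemma ReC_conj a : ReC (a^*) = ReC a. Proof. by case: a. Qed.
Lemma ImC_conj a : ImC (a^*) = - ImC a. Proof. by case: a. Qed.
Lemma ReC_sum (I : Type) (s : seq I) (P : pred I) (f : I -> Cplx R) :
  ReC (\sum_(i <- s | P i) f i) = \sum_(i <- s | P i) ReC (f i).
Proof. by apply: (big_morph _ ReCD). Qed.
Lemma ImC_sum (I : Type) (s : seq I) (P : pred I) (f : I -> Cplx R) :
  ImC (\sum_(i <- s | P i) f i) = \sum_(i <- s | P i) ImC (f i).
Proof. by apply: (big_morph _ ImCD). Qed.

Lemma mkC_nat n : (n%:R : Cplx R) = mkC n%:R 0.
Proof.
elim: n => [//|n IH]; rewrite -addn1 natrD IH natrD.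
by apply: Cext; rewrite ?ReCD ?ImCD //= addr0.
Qed.

Lemma mkC_half : (2 : Cplx R)^-1 = mkC 2^-1 0.
Proof.
apply: (mulfI (_ : 2 != 0)) => //; rewrite mulfV// (mkC_nat 2).
by apply: Cext; rewrite ?ReCM ?ImCM/= ?mul0r ?mulr0 ?subr0 ?addr0// mulfV.
Qed.

Lemma ReC_half a : ReC (a / 2) = ReC a / 2.
Proof. by rewrite mkC_half ReCM/= mulr0 subr0. Qed.
Lemma ImC_half a : ImC (a / 2) = ImC a / 2.
Proof. by rewrite mkC_half ImCM/= mulr0 add0r. Qed.

Lemma Cpos_Re a : 0 < a -> 0 < ReC a.
Proof. by case: a => x y; rewrite ltcE /= => /andP[]. Qed.

Lemma cexp_neq0 a : cexp a != 0.
Proof.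
apply/eqP => h; have h1 : ReC (cexp a) = 0 by rewrite h.
have h2 : ImC (cexp a) = 0 by rewrite h.
have := cos2Dsin2 (ImC a).
move: h1 h2; rewrite /cexp /= => /eqP; rewrite mulf_eq0 gt_eqF ?expR_gt0//= => /eqP ->.
move=> /eqP; rewrite mulf_eq0 gt_eqF ?expR_gt0//= => /eqP ->.
by rewrite expr2 mul0r addr0 => /eqP; rewrite eq_sym oner_eq0.
Qed.

Lemma cexpD a b : cexp (a + b) = cexp a * cexp b.
Proof.
apply: Cext; rewrite ?ReCM ?ImCM /cexp/= ReCD ImCD expRD ?cosD ?sinD; ring.
Qed.

Lemma cexp0 : cexp (0 : Cplx R) = 1.
Proof. by apply: Cext; rewrite /cexp/= expR0 ?cos0 ?sin0 ?mulr1 ?mulr0. Qed.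

End complex_kit.

Lemma wirtinger_half (R : realType) (a b c d : R) :
  (mkC a b - mkC 0 1 * mkC c d) / 2 = mkC ((a + d) / 2) ((b - c) / 2) /\
  (mkC a b + mkC 0 1 * mkC c d) / 2 = mkC ((a - d) / 2) ((b + c) / 2).
Proof.
by split; apply: Cext; rewrite ?ReC_half ?ImC_half ?ReCD ?ImCD ?ReCN ?ImCN
  ?ReCM ?ImCM/=; congr (_ / _); ring.
Qed.

Lemma derive_half (R : realType) (V : normedModType R) (f : V -> R) x v :
  derivable f x v -> 'D_v (fun y => f y / 2) x = 'D_v f x / 2.
Proof.
move=> df; have [_ h] : is_derive x v (2^-1 \*: f) (2^-1 *: 'D_v f x).
  exact: is_deriveZ.
rewrite (_ : (fun y => _) = 2^-1 \*: f); first by rewrite h mulrC.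
by apply/funext => y; rewrite mulrC.
Qed.

Section log_coordinates.
Context {R : realType} {n : nat}.
Implicit Types (w z : 'rV[Cplx R]_n) (x th v : 'rV[R]_n).

(** Polar coordinates based at w: the point with coordinates
    exp (x_j + i th_j) w_j. *)
Definition polar w x th : 'rV[Cplx R]_n :=
  \row_j (cexp (mkC (x 0 j) (th 0 j)) * w 0 j).

Lemma to_realK : cancel (@to_real R n) (@of_real R n).
Proof.
move=> w; apply/rowP => j; rewrite mxE /to_real row_mxEl row_mxEr !mxE.
by rewrite -mkC_eta.
Qed.

Lemma of_realK : cancel (@of_real R n) (@to_real R n).
Proof.
move=> w; apply/rowP => j; rewrite /to_real.
by case: (split_ordP j) => i ->; rewrite ?row_mxEl ?row_mxEr !mxE.
Qed.

Lemma dxE j : row_mx (delta_mx 0 j) 0 = Ei (lshift n j) :> 'rV[R]_(n + n).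
Proof.
apply/rowP => i; case: (split_ordP i) => l ->; rewrite ?row_mxEl ?row_mxEr !mxE.
  by rewrite eq_lshift.
by rewrite eq_rlshift andbF.
Qed.

Lemma dyE j : row_mx 0 (delta_mx 0 j) = Ei (rshift n j) :> 'rV[R]_(n + n).
Proof.
apply/rowP => i; case: (split_ordP i) => l ->; rewrite ?row_mxEl ?row_mxEr !mxE.
  by rewrite eq_lrshift andbF.
by rewrite eq_rshift.
Qed.

Variable rho : 'rV[Cplx R]_n -> R.
Let rr := rho \o @of_real R n.
Hypothesis srr : smooth setT rr.

Let D1 i p : R := 'D_(Ei i) rr p.
Let D2 i l p : R := 'D_(Ei i) ('D_(Ei l) rr) p.

Lemma d_zE j z : d_z j (realC rho) z =
  mkC (D1 (lshift n j) (to_real z) / 2) (- D1 (rshift n j) (to_real z) / 2).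
Proof.
rewrite /d_z /d_x /d_y /rderive dxE dyE.
have e1 (v : 'rV[R]_(n + n)) : 'D_v (fun w : 'rV[R]_(n + n) => ReC (realC rho (of_real w))) (to_real z) = 'D_v rr (to_real z) by [].
have e2 (v : 'rV[R]_(n + n)) : 'D_v (fun w : 'rV[R]_(n + n) => ImC (realC rho (of_real w))) (to_real z) = 0.
  exact: derive_cst.
by rewrite !e1 !e2 (wirtinger_half _ _ _ _).1 addr0 sub0r.
Qed.

Lemma d_zbarE j z : d_zbar j (realC rho) z =
  mkC (D1 (lshift n j) (to_real z) / 2) (D1 (rshift n j) (to_real z) / 2).
Proof.
rewrite /d_zbar /d_x /d_y /rderive dxE dyE.
have e1 (v : 'rV[R]_(n + n)) : 'D_v (fun w : 'rV[R]_(n + n) => ReC (realC rho (of_real w))) (to_real z) = 'D_v rr (to_real z) by [].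
have e2 (v : 'rV[R]_(n + n)) : 'D_v (fun w : 'rV[R]_(n + n) => ImC (realC rho (of_real w))) (to_real z) = 0.
  exact: derive_cst.
by rewrite !e1 !e2 (wirtinger_half _ _ _ _).2 subr0 add0r.
Qed.

Lemma d_z_zbarE j k z (p := to_real z) : d_z j (d_zbar k (realC rho)) z =
  mkC ((D2 (lshift n j) (lshift n k) p + D2 (rshift n j) (rshift n k) p) / 4)
      ((D2 (lshift n j) (rshift n k) p - D2 (rshift n j) (lshift n k) p) / 4).
Proof.
rewrite /d_z /d_x /d_y /rderive dxE dyE.
have E l : 'D_l (fun w : 'rV[R]_(n + n) => ReC (d_zbar k (realC rho) (of_real w))) p =
    'D_l ('D_(Ei (lshift n k)) rr) p / 2.
  rewrite (_ : (fun w : 'rV[R]_(n + n) => _) =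
    (fun w : 'rV[R]_(n + n) => 'D_(Ei (lshift n k)) rr w / 2)); last first.
    by apply/funext => w; rewrite d_zbarE of_realK ReC_mk.
  apply: derive_half; exact: (smooth_derivable (smooth_derive _ srr)).
have E' l : 'D_l (fun w : 'rV[R]_(n + n) => ImC (d_zbar k (realC rho) (of_real w))) p =
    'D_l ('D_(Ei (rshift n k)) rr) p / 2.
  rewrite (_ : (fun w : 'rV[R]_(n + n) => _) =
    (fun w : 'rV[R]_(n + n) => 'D_(Ei (rshift n k)) rr w / 2)); last first.
    by apply/funext => w; rewrite d_zbarE of_realK ImC_mk.
  apply: derive_half; exact: (smooth_derivable (smooth_derive _ srr)).
have q1 (a b : R) : (a / 2 + b / 2) / 2 = (a + b) / 4 by field.
have q2 (a b : R) : (a / 2 - b / 2) / 2 = (a - b) / 4 by field.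
rewrite !E !E'.
rewrite (wirtinger_half _ _ _ _).1.
by rewrite q1 q2.
Qed.

End log_coordinates.

(** * The Levi form in logarithmic coordinates *)

Section second_order.
Context {R : realType}.

Lemma is_derive_sumR m (h : 'I_m -> R -> R) (t : R) (d : 'I_m -> R) :
  (forall i, is_derive t (1:R) (h i) (d i)) ->
  is_derive t (1:R) (fun t => \sum_i h i t) (\sum_i d i).
Proof.
move=> H; rewrite (_ : (fun t => _) = \sum_i h i); first exact: is_derive_sum.
by apply/funext => x; rewrite fct_sumE.
Qed.

Lemma is_derive_mulR (f g : R -> R) (t df dg : R) :
  is_derive t (1:R) f df -> is_derive t (1:R) g dg ->
  is_derive t (1:R) (fun t => f t * g t) (df * g t + f t * dg).
Proof.
move=> hf hg; apply: (is_derive_eq (is_deriveM hf hg)).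
by rewrite -[f t *: _]/(_ * _) -[g t *: _]/(_ * _) addrC mulrC.
Qed.

Lemma second_derive_curve k (F : 'rV[R]_k -> R) (c : R -> 'rV[R]_k)
    (c1 c2 : R -> 'I_k -> R) :
  smooth setT F ->
  (forall t i, is_derive t (1:R) (fun t => c t 0 i) (c1 t i)) ->
  (forall t i, is_derive t (1:R) (fun t => c1 t i) (c2 t i)) ->
  (forall t, is_derive t (1:R) (fun t => F (c t)) (\sum_i 'D_(Ei i) F (c t) * c1 t i)) /\
  (forall t, is_derive t (1:R) (fun t => \sum_i 'D_(Ei i) F (c t) * c1 t i)
    (\sum_i ((\sum_l 'D_(Ei l) ('D_(Ei i) F) (c t) * c1 t l) * c1 t i +
             'D_(Ei i) F (c t) * c2 t i))).
Proof.
move=> sF h1 h2.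
have C1 F' p : smooth setT F' -> C1near F' p.
  by move=> sF'; apply: (Cn1_C1near (@openT _)) => //; exact: sF'.
split=> t; first by apply: (@is_derive_curve R k F c t); exact: C1.
apply: is_derive_sumR => i; apply: is_derive_mulR.
by apply: (@is_derive_curve R k ('D_(Ei i) F) c t); apply: C1; exact: smooth_derive.
Qed.

Lemma is_derive_expK (a b t : R) :
  is_derive t (1:R) (fun t => expR (t * a) * b) (a * (expR (t * a) * b)).
Proof.
have H : is_derive t (1:R) (fun t => expR (t * a)) (expR (t * a) * a).
  apply: (@is_derive1_comp R expR (fun t => t * a)).
  by apply: is_derive_eq; rewrite scaler0 add0r -[_ *: _]/(_ * _) mulr1.
by apply: (is_derive_eq (is_derive_mulR H (is_derive_cst b t (1:R)))); rewrite /cst/=; ring.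
Qed.

Lemma is_derive_cosK (a b c t : R) :
  is_derive t (1:R) (fun t => cos (t * a) * b + sin (t * a) * c)
    (a * (cos (t * a) * c - sin (t * a) * b)).
Proof.
have Hl : is_derive t (1:R) (fun t => t * a) a.
  by apply: is_derive_eq; rewrite scaler0 add0r -[_ *: _]/(_ * _) mulr1.
have H1 : is_derive t (1:R) (fun t => cos (t * a)) (- sin (t * a) * a).
  exact: (@is_derive1_comp R cos (fun t => t * a)).
have H2 : is_derive t (1:R) (fun t => sin (t * a)) (cos (t * a) * a).
  exact: (@is_derive1_comp R sin (fun t => t * a)).
apply: (is_derive_eq (is_deriveD (is_derive_mulR H1 (is_derive_cst b t (1:R)))
  (is_derive_mulR H2 (is_derive_cst c t (1:R))))).
rewrite /cst/=; ring.
Qed.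

End second_order.

Lemma ReC_hermitian (R : realType) (P Q s t : R) (x y : Cplx R) :
  ReC (mkC P Q * (mkC s 0 * x) * (mkC t 0 * y)^*) =
  P * (s * t * (ReC x * ReC y + ImC x * ImC y)) -
  Q * (s * t * (ImC x * ReC y - ReC x * ImC y)).
Proof.
case: x y => [a b] [c d].
rewrite ReCM ReC_conj ImC_conj ReCM ImCM !(ReCM (mkC _ _)) !(ImCM (mkC _ _)) /=; ring.
Qed.

Section levi_log.
Context {R : realType} {n : nat}.
Variable rho : 'rV[Cplx R]_n -> R.
Let rr := rho \o @of_real R n.
Hypothesis srr : smooth setT rr.
Variables (w : 'rV[Cplx R]_n).
Let p := to_real w.
Let q : 'rV[R]_(n + n) := row_mx (\row_j - ImC (w 0 j)) (\row_j ReC (w 0 j)).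
Let K (v : 'rV[R]_n) : 'rV[R]_(n + n) := row_mx v v.

Lemma to_real_polarx v t i :
  to_real (polar w (t *: v) 0) 0 i = expR (t * K v 0 i) * p 0 i.
Proof.
rewrite /to_real /p /K; case: (split_ordP i) => j ->;
  rewrite ?row_mxEl ?row_mxEr !mxE ?ReCM ?ImCM /cexp/= cos0 sin0; ring.
Qed.

Lemma to_real_polart v t i :
  to_real (polar w 0 (t *: v)) 0 i =
  cos (t * K v 0 i) * p 0 i + sin (t * K v 0 i) * q 0 i.
Proof.
rewrite /to_real /p /K /q; case: (split_ordP i) => j ->;
  rewrite ?row_mxEl ?row_mxEr !mxE ?ReCM ?ImCM /cexp/= expR0; ring.
Qed.

Definition grad_log (j : 'I_n) : R :=
  'D_(Ei (lshift n j)) rr p * ReC (w 0 j) + 'D_(Ei (rshift n j)) rr p * ImC (w 0 j).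

Hypothesis torus0 : forall th, rho (polar w 0 th) = 0.

Lemma sum_splitK (f : 'I_(n + n) -> R) :
  \sum_i f i = \sum_j (f (lshift n j) + f (rshift n j)).
Proof. by rewrite big_split_ord big_split. Qed.

Let rr_polar x th : rr (to_real (polar w x th)) = rho (polar w x th).
Proof. by rewrite /rr /= to_realK. Qed.

Lemma polar00 : polar w 0 0 = w.
Proof.
apply/rowP => j; rewrite !mxE (_ : mkC 0 0 = 0)// cexp0 mul1r//.
Qed.

Lemma d_z_log j : d_z j (realC rho) w * w 0 j = mkC (grad_log j / 2) 0.
Proof.
pose e : 'rV[R]_n := delta_mx 0 j.
have cg1 (t : R) i := is_derive_cosK (K e 0 i) (p 0 i) (q 0 i) t.
have H : is_derive (0:R) (1:R) (fun t : R => rr (to_real (polar w 0 (t *: e))))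
    (\sum_i 'D_(Ei i) rr (to_real (polar w 0 ((0:R) *: e))) *
      (K e 0 i * (cos (0 * K e 0 i) * q 0 i - sin (0 * K e 0 i) * p 0 i))).
  apply: is_derive_curve; first by apply: (Cn1_C1near (@openT _)) => //; exact: srr.
  move=> i; rewrite (_ : (fun t : R => _) = (fun t => cos (t * K e 0 i) * p 0 i + sin (t * K e 0 i) * q 0 i)).
    exact: cg1.
  by apply/funext => t; rewrite to_real_polart.
have H0 : is_derive (0:R) (1:R) (fun t : R => rr (to_real (polar w 0 (t *: e)))) 0.
  rewrite (_ : (fun t => _) = cst 0); first exact: is_derive_cst.
  by apply/funext => t; rewrite rr_polar torus0.
have [_ E] := H; have [_ E0] := H0.
have {H H0}E : \sum_i 'D_(Ei i) rr p * (K e 0 i * q 0 i) = 0.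
  rewrite -[RHS]E0 E; apply: eq_bigr => i _.
  by rewrite scale0r polar00 mul0r cos0 sin0 mul1r mul0r subr0.
have {}E : 'D_(Ei (rshift n j)) rr p * ReC (w 0 j) - 'D_(Ei (lshift n j)) rr p * ImC (w 0 j) = 0.
  rewrite -[RHS]E sum_splitK (bigD1 j)//= big1 ?addr0 => [|i ij].
    by rewrite /K /q !row_mxEl !row_mxEr !mxE !eqxx/=; ring.
  by rewrite /K !row_mxEl !row_mxEr !mxE (negbTE ij) andbF !mul0r !mulr0 addr0.
rewrite d_zE//; apply: Cext; rewrite ?ReCM ?ImCM/= -/rr -/p.
  by rewrite /grad_log; lra.
by lra.
Qed.

Lemma dprime_log (u : 'rV[Cplx R]_n) : (forall j, w 0 j != 0) ->
  dprime rho w u = \sum_j mkC (grad_log j / 2) 0 * (u 0 j / w 0 j).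
Proof.
move=> w0; rewrite /dprime; apply: eq_bigr => j _.
by rewrite -d_z_log -mulrA (mulrCA (w 0 j)) mulfV// mulr1.
Qed.

(** Strict pseudoconvexity in logarithmic coordinates.  Along the real
    direction v and the rotation direction iv the second derivatives of rho add
    up to four times the Levi form, the accelerations of the two curves being
    opposite; the rotation curve stays in the boundary and contributes zero. *)
Lemma levi_log v : (forall j, w 0 j != 0) ->
  (forall u, u != 0 -> dprime rho w u = 0 -> 0 < levi rho w u) -> v != 0 ->
  exists f1 f2 : R -> R,
  [/\ (forall t, is_derive t (1:R) (fun t => rho (polar w (t *: v) 0)) (f1 t)),
      (forall t, is_derive t (1:R) f1 (f2 t)),
      f1 0 = \sum_j grad_log j * v 0 j &
      f1 0 = 0 -> 0 < f2 0].
Proof.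
move=> w0 psc v0.
pose k i := K v 0 i.
have hf1 (t : R) i : is_derive t (1:R) (fun t : R => to_real (polar w (t *: v) 0) 0 i)
    (k i * (expR (t * k i) * p 0 i)).
  rewrite (_ : (fun t : R => _) = (fun t => expR (t * k i) * p 0 i)).
    exact: is_derive_expK.
  by apply/funext => s; rewrite to_real_polarx.
have hf2 (t : R) i : is_derive t (1:R) (fun t : R => k i * (expR (t * k i) * p 0 i))
    (k i * (k i * (expR (t * k i) * p 0 i))).
  have := is_derive_mulR (is_derive_cst (k i) t (1:R)) (is_derive_expK (k i) (p 0 i) t).
  by rewrite /cst mul0r add0r.
have hg1 (t : R) i : is_derive t (1:R) (fun t : R => to_real (polar w 0 (t *: v)) 0 i)
    (k i * (cos (t * k i) * q 0 i - sin (t * k i) * p 0 i)).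
  rewrite (_ : (fun t : R => _) = (fun t => cos (t * k i) * p 0 i + sin (t * k i) * q 0 i)).
    exact: is_derive_cosK.
  by apply/funext => s; rewrite to_real_polart.
have hg2 (t : R) i : is_derive t (1:R)
    (fun t : R => k i * (cos (t * k i) * q 0 i - sin (t * k i) * p 0 i))
    (- (k i * (k i * (cos (t * k i) * p 0 i + sin (t * k i) * q 0 i)))).
  have H := is_derive_cosK (k i) (q 0 i) (- p 0 i) t.
  have {}H := is_derive_mulR (is_derive_cst (k i) t (1:R)) H.
  rewrite (_ : (fun t : R => _) = (fun t => cst (k i) t * (cos (t * k i) * q 0 i + sin (t * k i) * (- p 0 i)))).
    by apply: (is_derive_eq H); rewrite /cst; ring.
  by apply/funext => s; rewrite /cst mulrN.
have [df ddf] := second_derive_curve srr hf1 hf2.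
have [dg ddg] := second_derive_curve srr hg1 hg2.
pose f1 t := \sum_i 'D_(Ei i) rr (to_real (polar w (t *: v) 0)) * (k i * (expR (t * k i) * p 0 i)).
pose f2 (t : R) := \sum_i ((\sum_l 'D_(Ei l) ('D_(Ei i) rr) (to_real (polar w (t *: v) 0)) *
   (k l * (expR (t * k l) * p 0 l))) * (k i * (expR (t * k i) * p 0 i)) +
    'D_(Ei i) rr (to_real (polar w (t *: v) 0)) * (k i * (k i * (expR (t * k i) * p 0 i)))).
have g10 t : \sum_i 'D_(Ei i) rr (to_real (polar w 0 (t *: v))) *
    (k i * (cos (t * k i) * q 0 i - sin (t * k i) * p 0 i)) = 0.
  have [_ <-] := dg t.
  rewrite (_ : (fun t => _) = cst 0) ?derive_cst//.
  by apply/funext => s; rewrite rr_polar torus0.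
pose H i l : R := 'D_(Ei l) ('D_(Ei i) rr) p.
have p00 : to_real (polar w ((0:R) *: v) 0) = p by rewrite scale0r polar00.
have p00' : to_real (polar w 0 ((0:R) *: v)) = p by rewrite scale0r polar00.
have g20 : \sum_i ((\sum_l H i l * (k l * q 0 l)) * (k i * q 0 i) -
    'D_(Ei i) rr p * (k i * (k i * p 0 i))) = 0.
  have [_] := ddg 0.
  rewrite (_ : (fun t => _) = cst 0) ?derive_cst; last by apply/funext => t; rewrite g10.
  move=> E; rewrite [RHS]E; apply: eq_bigr => i _.
  rewrite p00' mul0r cos0 sin0 !mul1r !mul0r subr0 addr0 mulrN; congr (_ * _ - _).
  by apply: eq_bigr => l _; rewrite mul0r cos0 sin0 mul1r mul0r subr0.
have f20 : f2 0 = \sum_i ((\sum_l H i l * (k l * p 0 l)) * (k i * p 0 i) +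
    'D_(Ei i) rr p * (k i * (k i * p 0 i))).
  apply: eq_bigr => i _; rewrite p00 mul0r expR0 mul1r; congr (_ * _ + _).
  by apply: eq_bigr => l _; rewrite mul0r expR0 mul1r.
have f10 : f1 0 = \sum_j grad_log j * v 0 j.
  rewrite /f1 p00 sum_splitK; apply: eq_bigr => j _.
  rewrite /grad_log /k !mul0r expR0 !mul1r /K /p /to_real !row_mxEl !row_mxEr !mxE.
  ring.
exists f1, f2; split; [|exact: ddf|exact: f10|move=> f10'].
  move=> t; rewrite (_ : (fun t : R => _) = (fun t => rr (to_real (polar w (t *: v) 0)))).
    exact: df.
  by apply/funext => s; rewrite rr_polar.
pose u : 'rV[Cplx R]_n := \row_j (mkC (v 0 j) 0 * w 0 j).
have u0 : u != 0.
  have [j vj] : exists j, v 0 j != 0.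
    apply: contrapT => /forallNP h; move/eqP: v0; apply; apply/rowP => j.
    by rewrite mxE; apply/eqP; apply: contrapT => /negP; exact: h.
  apply/eqP => /rowP /(_ j); rewrite !mxE => /eqP; rewrite mulf_eq0 (negbTE (w0 j)) orbF.
  by move=> /eqP e; move/eqP: vj; apply; have := congr1 (@ReC R) e.
have du : dprime rho w u = 0.
  rewrite dprime_log//.
  under eq_bigr => j _.
    rewrite mxE -mulrA mulfV// mulr1.
    over.
  apply: Cext; rewrite ?ReC_sum ?ImC_sum.
    under eq_bigr do rewrite ReCM/= mulr0 subr0 mulrAC.
    by rewrite -mulr_suml -f10 f10' mul0r.
  by apply: big1 => j _; rewrite ImCM/= mulr0 mul0r addr0.
have := Cpos_Re (psc u u0 du).
suff -> : ReC (levi rho w u) = f2 0 / 4 by rewrite pmulr_lgt0// invr_gt0.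
pose T i l := H i l * (k l * k i * (p 0 l * p 0 i + q 0 l * q 0 i)).
have -> : f2 0 = \sum_i \sum_l T i l.
  rewrite f20 -[LHS]addr0 -[X in _ + X]g20 -big_split/=; apply: eq_bigr => i _.
  rewrite addrACA subrr addr0 !mulr_suml -big_split/=; apply: eq_bigr => l _.
  rewrite /T; ring.
rewrite exchange_big/= sum_splitK mulr_suml /levi ReC_sum; apply: eq_bigr => j _.
rewrite ReC_sum !sum_splitK -big_split mulr_suml; apply: eq_bigr => l _.
have E : d_z j (d_zbar l (realC rho)) w =
    mkC ((H (lshift n l) (lshift n j) + H (rshift n l) (rshift n j)) / 4)
        ((H (rshift n l) (lshift n j) - H (lshift n l) (rshift n j)) / 4).
  exact: d_z_zbarE.
rewrite E /T; move: (H (lshift n l) (lshift n j)) (H (rshift n l) (rshift n j))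
  (H (rshift n l) (lshift n j)) (H (lshift n l) (rshift n j)) => a b c d.
rewrite /k /K /p /q /to_real !row_mxEl !row_mxEr !mxE.
by rewrite ReC_hermitian /=; field.
Qed.

End levi_log.

(** * Convexity of the logarithmic image of the domain *)

Section reinhardt.
Context {R : realType} {n : nat}.
Variables (Omega : set 'rV[Cplx R]_n) (rho : 'rV[Cplx R]_n -> R).
Hypothesis Reinhardt : complete_Reinhardt Omega.
Hypothesis srr : smooth setT (rho \o @of_real R n).
Hypothesis OmegaE : Omega = [set z | rho z < 0].
Hypothesis bdE : boundary Omega = [set z | rho z = 0].
Hypothesis psc : forall w, boundary Omega w ->
  forall u, u != 0 -> dprime rho w u = 0 -> 0 < levi rho w u.
Variable z : 'rV[Cplx R]_n.
Hypothesis z0 : forall j, z 0 j != 0.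

Implicit Types (x th v : 'rV[R]_n).

Definition ones : 'rV[R]_n := const_mx 1.

Lemma cexp_norm (a b : R) : `|cexp (mkC a b)| = mkC (expR a) 0.
Proof.
rewrite /cexp /mkC normc_def /= !exprMn -mulrDr cos2Dsin2 mulr1 sqrtr_sqr.
by rewrite ger0_norm ?expR_ge0.
Qed.

Lemma lec_real (a b : R) : (mkC a 0 <= mkC b 0) = (a <= b).
Proof. by rewrite lecE /= eqxx. Qed.
Lemma ltc_real (a b : R) : (mkC a 0 < mkC b 0) = (a < b).
Proof. by rewrite ltcE /= eqxx. Qed.

Lemma polar_polar (w : 'rV[Cplx R]_n) x th x' th' :
  polar (polar w x th) x' th' = polar w (x' + x) (th' + th).
Proof. by apply/rowP => j; rewrite !mxE mulrA -cexpD. Qed.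

Lemma polar_neq0 (w : 'rV[Cplx R]_n) x th j : w 0 j != 0 -> polar w x th 0 j != 0.
Proof. by move=> w0; rewrite mxE mulf_neq0// cexp_neq0. Qed.

Lemma Omega_le x th x' th' : (forall j, x' 0 j <= x 0 j) ->
  Omega (polar z x th) -> Omega (polar z x' th').
Proof.
move=> le Ox.
have := Reinhardt (lambda := fun j => cexp (mkC (x' 0 j - x 0 j) (th' 0 j - th 0 j))) Ox.
rewrite (_ : \row__ _ = polar z x' th').
  by apply=> j; rewrite cexp_norm lec_real -expR0 ler_expR subr_le0.
apply/rowP => j; rewrite !mxE mulrA -cexpD; congr (cexp _ * _).
by apply: Cext => /=; ring.
Qed.

Lemma bd_closure (w : 'rV[Cplx R]_n) (s : R) th : boundary Omega w -> (forall j, w 0 j != 0) -> 0 < s ->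
  Omega (polar w (- s *: ones) th).
Proof.
move=> [cw _] w0 s0.
pose c : Cplx R := mkC (expR (- s)) 0.
have c1 : c < 1 by rewrite (ltc_real _ 1) -expR0 ltr_expR oppr_lt0.
have near_w : nbhs w (fun w' : 'rV[Cplx R]_n => forall j, c * `|w 0 j| < `|w' 0 j|).
  apply: (@filter_forall _ _ (fun j (w' : 'rV[Cplx R]_n) => c * `|w 0 j| < `|w' 0 j|) (nbhs w) (nbhs_filter w)) => j.
  have e0 : 0 < (1 - c) * `|w 0 j| by rewrite mulr_gt0 ?subr_gt0// normr_gt0.
  have C := @coord_continuous _ _ _ 0 j w.
  near=> w'.
  have h : `|w 0 j - w' 0 j| < (1 - c) * `|w 0 j|.
    by near: w'; move/cvgrPdist_lt : C; apply.
  have h1 : `|w 0 j| <= `|w 0 j - w' 0 j| + `|w' 0 j|.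
    by rewrite -{1}(subrK (w' 0 j) (w 0 j)) ler_normD.
  have := le_lt_trans h1 (ltr_leD h (lexx `|w' 0 j|)).
  by rewrite mulrBl mul1r -ltrBlDl opprB addrC subrK.
have [w' [Ow' /= w'w]] := cw _ near_w.
have w'0 j : w' 0 j != 0.
  rewrite -normr_gt0; apply: le_lt_trans (w'w j).
  by rewrite mulr_ge0// (lec_real 0) expR_ge0.
have := Reinhardt (lambda := fun j => cexp (mkC (- s) (th 0 j)) * w 0 j / w' 0 j) Ow'.
rewrite (_ : \row__ _ = polar w (- s *: ones) th).
  apply=> j; rewrite normrM normfV ler_pdivrMr ?normr_gt0// mul1r normrM cexp_norm.
  exact: ltW.
by apply/rowP => j; rewrite !mxE divfK// mulr1.
Unshelve. all: by end_near. Qed.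

Lemma smooth_rho_polar (b : 'rV[Cplx R]_n) : smooth setT (fun x => rho (polar b x 0)).
Proof.
move=> N.
have E : (fun x => rho (polar b x 0)) =
    (fun x => (rho \o @of_real R n) (to_real (polar b x 0))).
  by apply/funext => x; rewrite /= to_realK.
rewrite E; apply: Cn_comp; [exact: openT|exact: srr|].
move=> i; case: (split_ordP i) => j ->.
  apply: (@Cn_eq _ _ _ openT _ (fun x => expR (x 0 j) * ReC (b 0 j))).
    move=> x _; rewrite /to_real row_mxEl !mxE ReCM /cexp/= cos0 sin0; ring.
  apply: Cn_mul; [exact: openT| |exact: Cn_cst].
  apply: Cn_expR; [exact: openT|]; apply: Cn_coord; exact: openT.
apply: (@Cn_eq _ _ _ openT _ (fun x => expR (x 0 j) * ImC (b 0 j))).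
  move=> x _; rewrite /to_real row_mxEr !mxE ImCM /cexp/= cos0 sin0; ring.
apply: Cn_mul; [exact: openT| |exact: Cn_cst].
apply: Cn_expR; [exact: openT|]; apply: Cn_coord; exact: openT.
Qed.

(** The defining function in logarithmic moduli; its negativity set is the
   logarithmic image of the domain. *)
Definition Flog x := rho (polar z x 0).

Lemma smooth_Flog : smooth setT Flog.
Proof. exact: smooth_rho_polar. Qed.

Lemma Flog_cont x : {for x, continuous Flog}.
Proof. exact: smooth_cont smooth_Flog _. Qed.

Lemma FlogC1 x : C1near Flog x.
Proof. apply: (Cn1_C1near (@openT _)) => //; exact: smooth_Flog. Qed.

Lemma Omega_Flog x th : Omega (polar z x th) <-> Flog x < 0.
Proof.
have -> : (Flog x < 0) = (Omega (polar z x 0)) :> Prop by rewrite OmegaE.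
by split; apply: Omega_le.
Qed.

Lemma Flog_lower x x' : (forall j, x' 0 j <= x 0 j) -> Flog x < 0 -> Flog x' < 0.
Proof. by move=> h /(Omega_Flog x 0) /(Omega_le 0 h) /Omega_Flog. Qed.

Lemma lim_below (F : 'rV[R]_n -> R) x : {for x, continuous F} ->
  (forall s : R, 0 < s -> F (- s *: ones + x) < 0) -> F x <= 0.
Proof.
move=> cF h; rewrite leNgt; apply/negP => Fx.
have H : \forall y \near x, 0 < F y by move/cvgr_gt : cF; apply.
have C : (fun s : R => - s *: ones + x) @ 0^'+ --> x.
  apply: cvg_rV => i; rewrite (_ : (fun t : R => _) = (fun t : R => - t + x 0 i)); last first.
    by apply/funext => t; rewrite !mxE mulr1.
  apply: cvg_at_right_filter.
  have : (fun t : R => - t + x 0 i) @ (0:R) --> - 0 + x 0 i.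
    by apply: cvgD; [apply: cvgN; exact: cvg_id|exact: cvg_cst].
  by rewrite oppr0 add0r.
have {}H : \forall s \near 0^'+, 0 < F (- s *: ones + x) by exact: C _ H.
near (0:R)^'+ => s.
have s0 : 0 < s by near: s; exact: nbhs_right_gt.
have : 0 < F (- s *: ones + x) by near: s.
by rewrite ltNge ltW// h.
Unshelve. all: by end_near. Qed.

Lemma rho_polar_rot x th th' : rho (polar z x th) = 0 -> rho (polar z x th') = 0.
Proof.
move=> r0.
have bw : boundary Omega (polar z x th) by rewrite bdE.
have h s : 0 < s -> Omega (polar z (- s *: ones + x) th').
  move=> s0; have := bd_closure (th' - th) bw (fun j => polar_neq0 x th (z0 j)) s0.
  by rewrite polar_polar subrK.
have E y : rho (polar z y th') = rho (polar (polar z 0 th') y 0).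
  by rewrite polar_polar addr0 add0r.
apply/eqP; rewrite eq_le; apply/andP; split.
  rewrite E; apply: (@lim_below (fun y => rho (polar (polar z 0 th') y 0))).
    by apply: smooth_cont (smooth_rho_polar _) _.
  by move=> s /h; rewrite -E OmegaE.
rewrite leNgt; apply/negP => lt0.
have : Omega (polar z x th) by apply: (@Omega_le x th' x th) => //; rewrite OmegaE.
by rewrite OmegaE /= r0 ltxx.
Qed.

Lemma bd_polar x th : boundary Omega (polar z x th) <-> Flog x = 0.
Proof. by rewrite bdE; split; exact: rho_polar_rot. Qed.

Lemma Flog_bd_lt x s : Flog x = 0 -> 0 < s -> Flog (- s *: ones + x) < 0.
Proof.
move=> /(bd_polar x 0) bx s0; apply/(Omega_Flog _ 0).
have := bd_closure 0 bx (fun j => polar_neq0 x 0 (z0 j)) s0.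
by rewrite polar_polar addr0.
Qed.

Lemma Flog_bd_le x x' : Flog x = 0 -> (forall j, x' 0 j <= x 0 j) -> Flog x' <= 0.
Proof.
move=> x0 le; apply: lim_below; first exact: Flog_cont.
move=> s s0; apply: Flog_lower (Flog_bd_lt x0 s0) => j.
by rewrite !mxE lerD2l.
Qed.

Lemma Flog_line x v (t : R) :
  is_derive t (1:R) (fun t => Flog (x + t *: v)) ('D_v Flog (x + t *: v)) /\
  is_derive t (1:R) (fun t => 'D_v Flog (x + t *: v)) ('D_v ('D_v Flog) (x + t *: v)).
Proof.
by split; apply: derivable_line; [apply: smooth_derivable smooth_Flog _|
  apply: smooth_derivable (smooth_derive _ smooth_Flog) _].
Qed.

Lemma Flog_tangent x v : Flog x = 0 -> v != 0 -> 'D_v Flog x = 0 ->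
  0 < 'D_v ('D_v Flog) x.
Proof.
move=> x0 v0 d0.
have wj j : polar z x 0 0 j != 0 by exact: polar_neq0.
have H := levi_log srr _ wj (psc _) v0.
have [|f1 [f2 [df ddf f10 f2pos]]] := H _ ((bd_polar x 0).2 x0).
  by move=> th; rewrite polar_polar add0r addr0; exact: rho_polar_rot x0.
have E : (fun t : R => rho (polar (polar z x 0) (t *: v) 0)) = (fun t => Flog (x + t *: v)).
  by apply/funext => t; rewrite polar_polar addr0 addrC.
rewrite E in df.
have f1E t : f1 t = 'D_v Flog (x + t *: v).
  by have [_ <-] := df t; have [[_ <-] _] := Flog_line x v t.
have f2E : f2 0 = 'D_v ('D_v Flog) (x + (0:R) *: v).
  have f1E' : f1 = (fun t => 'D_v Flog (x + t *: v)) by apply/funext => t; exact: f1E.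
  by have [_ <-] := ddf 0; rewrite f1E'; have [_ [_ ->]] := Flog_line x v 0.
rewrite scale0r addr0 in f2E; rewrite -f2E; apply: f2pos.
by rewrite f1E scale0r addr0.
Qed.

Lemma pos_first_order (f : R -> R) d : is_derive (0:R) (1:R) f d -> 0 < d ->
  \forall t \near 0^'+, f 0 < f t.
Proof.
move=> [h hd] d0.
have C : (fun t : R => t^-1 *: (f (t *: (1:R) + 0) - f 0)) @ 0^'+ --> d.
  rewrite -hd; apply: cvg_dnbhs_at_right; exact: h.
near=> t.
have t0 : 0 < t by near: t; exact: nbhs_right_gt.
have : 0 < t^-1 *: (f (t *: (1:R) + 0) - f 0).
  by near: t; move/cvgr_gt : C; apply.
rewrite addr0 -[t *: (1:R)]/(t * 1) mulr1 -[_ *: _]/(_ * _) pmulr_rgt0 ?invr_gt0//.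
by rewrite subr_gt0.
Unshelve. all: by end_near. Qed.

Lemma pos_second_order (f f1 : R -> R) d : (forall t, is_derive t (1:R) f (f1 t)) ->
  f1 0 = 0 -> is_derive (0:R) (1:R) f1 d -> 0 < d ->
  \forall t \near 0^'+, f 0 < f t.
Proof.
move=> df f10 df1 d0; have := pos_first_order df1 d0; rewrite f10.
move=> [e /= e0 he]; exists e => //= t te t0.
have [|x] := @MVT R f f1 0 t t0.
  by apply: derivable_within_continuous => x _; have [] := df x.
rewrite in_itv/= subr0 => /andP[x0 xt] E.
rewrite -subr_gt0 E mulr_gt0//; apply: he => //=.
by move: te; rewrite /ball_/= !sub0r !normrN !gtr0_norm//; exact: (lt_trans xt).
Qed.

(** Strict convexity of the logarithmic image: leaving a boundary point in a
    direction that is not strictly inward, one leaves the domain. *)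
Lemma Flog_exit x v : Flog x = 0 -> v != 0 -> 0 <= 'D_v Flog x ->
  \forall t \near 0^'+, 0 < Flog (x + t *: v).
Proof.
move=> x0 v0; rewrite le_eqVlt => /orP[/eqP d0|d0].
  have h t := (Flog_line x v t).1.
  have E0 : 'D_v Flog (x + (0:R) *: v) = 0 by rewrite scale0r addr0.
  have h2 := (Flog_line x v 0).2.
  have h3 : 0 < 'D_v ('D_v Flog) (x + (0:R) *: v).
    by rewrite scale0r addr0; exact: (Flog_tangent x0 v0 (esym d0)).
  have := pos_second_order h E0 h2 h3.
  by rewrite scale0r addr0 x0.
have h := (Flog_line x v 0).1.
have := pos_first_order h; rewrite scale0r addr0 x0; exact.
Qed.

Lemma Flog_deriveN x v : 'D_(- v) Flog x = - 'D_v Flog x.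
Proof.
have [_ ->] := derive_sumEi (- v) (FlogC1 x); have [_ ->] := derive_sumEi v (FlogC1 x).
by rewrite -sumrN; apply: eq_bigr => i _; rewrite mxE mulrN.
Qed.

(** If a partial derivative were not positive, strict convexity would make the
   decrease of that coordinate leave the domain, against completeness. *)
Lemma Flog_partial_gt0 x j : Flog x = 0 -> 0 < 'D_(Ei j) Flog x.
Proof.
move=> x0; rewrite ltNge; apply/negP => le0.
have e0 : - Ei j != 0 :> 'rV[R]_n.
  apply/eqP => /rowP /(_ j); rewrite !mxE !eqxx /= => /eqP.
  by rewrite oppr_eq0 oner_eq0.
have H : \forall t \near 0^'+, 0 < Flog (x + t *: - Ei j).
  by apply: Flog_exit => //; rewrite Flog_deriveN oppr_ge0.
near (0:R)^'+ => t.
have t0 : 0 < t by near: t; exact: nbhs_right_gt.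
have : 0 < Flog (x + t *: - Ei j) by near: t.
rewrite ltNge (Flog_bd_le x0)// => i; rewrite !mxE gerDl mulrN oppr_le0.
by rewrite mulr_ge0 ?ler0n// ltW.
Unshelve. all: by end_near. Qed.

(** The logarithmic image is convex.  A segment pushed far down lies in it;
    raised until it first touches the boundary, it would touch at an interior
    point of the segment, against strict convexity there. *)
Lemma Flog_convex a b (t : R) : Flog a < 0 -> Flog b < 0 -> 0 <= t <= 1 ->
  Flog (a + t *: (b - a)) < 0.
Proof.
move=> La Lb t01; rewrite ltNge; apply/negP => Lt.
pose t1 := \sum_j `|b 0 j - a 0 j|.
have t1_ge0 : 0 <= t1 by exact: sumr_ge0.
pose G (p : R * R) : 'rV[R]_n := a + p.1 *: (b - a) - p.2 *: ones.
have cG : continuous G.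
  move=> p; apply: continuous_rV => i.
  rewrite (_ : (fun q : R * R => _) = (fun q => a 0 i + q.1 * (b 0 i - a 0 i) - q.2)); last first.
    by apply/funext => q; rewrite !mxE mulr1.
  apply: cvgB; last exact: cvg_snd.
  apply: cvgD; first exact: cvg_cst.
  by apply: cvgM; [exact: cvg_fst|exact: cvg_cst].
have cFG : continuous (Flog \o G).
  by move=> p; apply: continuous_comp; [exact: cG|exact: Flog_cont].
pose K := (`[(0:R), 1] `*` `[(0:R), t1]) `&` (Flog \o G) @^-1` [set y | 0 <= y].
have cK : compact K.
  apply: compact_closedI; first by apply: compact_setX; exact: segment_compact.
  by apply: closed_comp => [p _|]; [exact: cFG|exact: closed_ge].
have K0 : K !=set0.
  exists (t, 0); split; last by rewrite /= /G/= scale0r subr0.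
  by split; rewrite /= in_itv//= lexx.
have [|[s d] Ksd sdmax] := @compact_EVT_max _ R snd K K0 cK.
  by apply: continuous_subspaceT => p; exact: cvg_snd.
move: Ksd; rewrite inE => -[[/=]]; rewrite !in_itv/= => /andP[s0 s1] /andP[d0 dt1] FGsd.
have dlt : d < t1.
  rewrite lt_neqAle dt1 andbT; apply/eqP => dE; move: FGsd; rewrite leNgt => /negP; apply.
  apply: Flog_lower La => j; rewrite !mxE mulr1 dE -addrA gerDl subr_le0.
  apply: le_trans (ler_norm _) _; rewrite normrM ger0_norm//.
  apply: (@le_trans _ _ `|b 0 j - a 0 j|); first by rewrite ler_piMl.
  by rewrite /t1 (bigD1 j)//= lerDl sumr_ge0.
have above r e : 0 <= r <= 1 -> 0 < e -> Flog (- e *: ones + G (r, d)) < 0.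
  move=> r01 e0; rewrite ltNge; apply/negP => ge0.
  pose e' := Num.min e (t1 - d).
  have e'0 : 0 < e' by rewrite lt_min e0 subr_gt0.
  have Kr : (r, d + e') \in K.
    rewrite inE; split => /=.
      split => //=; rewrite in_itv/= addr_ge0 ?(ltW e'0)//=.
      by rewrite addrC -lerBrDr ge_min lexx orbT.
    rewrite leNgt; apply/negP => /(@Flog_lower _ (- e *: ones + G (r, d))) h.
    have {}h := h _; move: ge0; rewrite leNgt h// => j.
    rewrite !mxE !mulr1 addrC -!addrA lerD2l lerD2l opprD lerD2l lerN2.
    by rewrite ge_min lexx.
  have := sdmax _ Kr; rewrite /= gerDl leNgt e'0 //.
have Gle r : 0 <= r <= 1 -> Flog (G (r, d)) <= 0.
  by move=> r01; apply: lim_below; [exact: Flog_cont|move=> e e0; exact: above].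
have G0 : Flog (G (s, d)) = 0.
  by apply/eqP; rewrite eq_le FGsd andbT Gle// s0.
have lowa : Flog (a - d *: ones) < 0.
  by apply: Flog_lower La => j; rewrite !mxE mulr1 gerDl oppr_le0.
have lowb : Flog (b - d *: ones) < 0.
  by apply: Flog_lower Lb => j; rewrite !mxE mulr1 gerDl oppr_le0.
have sn0 : s != 0.
  by apply/eqP => e; move: lowa; rewrite -G0 /G e/= scale0r addr0 ltxx.
have sn1 : s != 1.
  by apply/eqP => e; move: lowb; rewrite -G0 /G e/= scale1r (addrC a) subrK ltxx.
have v0 : b - a != 0.
  by apply/eqP => e; move: lowa; rewrite -G0 /G e/= scaler0 addr0 ltxx.
have Gline r : G (s, d) + r *: (b - a) = G (s + r, d).
  by rewrite /G/= scalerDl addrAC addrA.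
have [D|/ltW D] := leP 0 ('D_(b - a) Flog (G (s, d))).
  have H := Flog_exit G0 v0 D.
  near (0:R)^'+ => r.
  have r0 : 0 < r by near: r; exact: nbhs_right_gt.
  have : 0 < Flog (G (s, d) + r *: (b - a)) by near: r.
  rewrite Gline ltNge Gle// addr_ge0 ?(ltW r0)//= addrC -lerBrDr.
  by near: r; apply: nbhs_right_le; rewrite subr_gt0 lt_neqAle sn1.
have nv0 : - (b - a) != 0 by rewrite oppr_eq0.
have H : \forall r \near 0^'+, 0 < Flog (G (s, d) + r *: - (b - a)).
  by apply: Flog_exit => //; rewrite Flog_deriveN oppr_ge0.
near (0:R)^'+ => r.
have r0 : 0 < r by near: r; exact: nbhs_right_gt.
have : 0 < Flog (G (s, d) + r *: - (b - a)) by near: r.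
rewrite scalerN -scaleNr Gline ltNge Gle// subr_ge0; apply/andP; split.
  by near: r; apply: nbhs_right_le; rewrite lt_neqAle eq_sym sn0.
by rewrite lerBlDr (le_trans s1)// lerDl ltW.
Unshelve. all: by end_near. Qed.

End reinhardt.

(** * The logarithmic boundary as a strictly concave graph *)

Lemma cvg_line (R : realType) (V : normedModType R) (v y : V) :
  (fun h : R => h *: v + y) @ (0:R) --> y.
Proof.
have C : (fun h : R => h *: v + y) @ (0:R) --> (0:R) *: v + y.
  by apply: cvgD; [exact: scalel_continuous|exact: cvg_cst].
by rewrite scale0r add0r in C.
Qed.

Section graph.
Context {R : realType} {m : nat}.
Variable F : 'rV[R]_m.+1 -> R.
Hypothesis sF : smooth setT F.
Hypothesis F_lower : forall x x' : 'rV[R]_m.+1, (forall j, x' 0 j <= x 0 j) -> F x < 0 -> F x' < 0.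
Hypothesis F_partial : forall x j, F x = 0 -> 0 < 'D_(Ei j) F x.
Hypothesis F_tangent : forall x v, F x = 0 -> v != 0 -> 'D_v F x = 0 ->
  0 < 'D_v ('D_v F) x.

Implicit Types (y v : 'rV[R]_m) (s t : R).

Let FC1 (G : 'rV[R]_m.+1 -> R) p : smooth setT G -> C1near G p.
Proof. by move=> sG; apply: (Cn1_C1near (@openT _)) => //; exact: sG. Qed.

Let F_cont (x : 'rV[R]_m.+1) : {for x, continuous F}.
Proof. exact: smooth_cont sF _. Qed.

Let consr_le s s' y : s' <= s -> forall j, consr s' y 0 j <= consr s y 0 j.
Proof.
by move=> le j; case: (unliftP ord0 j) => [i ->|->]; rewrite ?consrS ?consr0.
Qed.

Lemma F_below s s' y : F (consr s y) = 0 -> s' < s -> F (consr s' y) < 0.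
Proof.
move=> Fs ss'.
have H : is_derive (0:R) (1:R) (fun t => - F (consr (s - t) y)) ('D_(Ei ord0) F (consr s y)).
  have h : is_derive ((fun t => s - t) (0:R)) (1:R) (fun t => F (consr t y)) ('D_(Ei ord0) F (consr s y)).
    rewrite /= subr0; apply: is_derive_consr0; exact: smooth_derivable sF _.
  have h1 : is_derive (0:R) (1:R) (fun t => s - t) (- 1).
    have := is_deriveB (is_derive_cst s (0:R) (1:R)) (is_derive_id (0:R) (1:R)).
    by rewrite sub0r.
  have := is_deriveN (@is_derive1_comp R (fun t => F (consr t y)) (fun t => s - t) 0 _ _ h h1).
  by rewrite mulrN1 opprK.
have := pos_first_order H (F_partial _ Fs); rewrite subr0 Fs oppr0.
move=> N; near (0:R)^'+ => t.
have t0 : 0 < t by near: t; exact: nbhs_right_gt.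
have : 0 < - F (consr (s - t) y) by near: t.
rewrite oppr_gt0; apply: F_lower; apply: consr_le.
by rewrite lerBrDr -lerBrDl; near: t; apply: nbhs_right_le; rewrite subr_gt0.
Unshelve. all: by end_near. Qed.

Lemma F_root_unique s s' y : F (consr s y) = 0 -> F (consr s' y) = 0 -> s = s'.
Proof.
move=> h h'; have [lt|lt|//] := ltgtP s s'.
  by have := F_below h' lt; rewrite h ltxx.
by have := F_below h lt; rewrite h' ltxx.
Qed.

Lemma F_above s s' y : F (consr s y) = 0 -> s < s' -> 0 < F (consr s' y).
Proof.
move=> h ss'; rewrite lt_neqAle; apply/andP; split.
  by apply/eqP => /esym h'; have := F_root_unique h h' => e; move: ss'; rewrite e ltxx.
rewrite leNgt; apply/negP => /(F_lower (consr_le y (ltW ss'))).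
by rewrite h ltxx.
Qed.

(** The boundary is the graph x_0 = k y over the open set gdom. *)
Definition gdom : set 'rV[R]_m := [set y | exists s, F (consr s y) = 0].
Definition k y : R := xget 0 [set s | F (consr s y) = 0].

Lemma kP y : gdom y -> F (consr (k y) y) = 0.
Proof.
move=> [s hs]; rewrite /k; case: xgetP => [_ _ //|h].
by case: (h s).
Qed.

Lemma k_eq y s : F (consr s y) = 0 -> k y = s.
Proof. by move=> h; apply: (F_root_unique (kP _) h); exists s. Qed.

Lemma F_lt0_k y s : gdom y -> (F (consr s y) < 0) = (s < k y).
Proof.
move=> /kP h; have [lt|lt|->] := ltgtP s (k y).
- exact: F_below h lt.
- by apply/negbTE; rewrite -leNgt ltW// (F_above h).
- by rewrite h ltxx.
Qed.

Let consr_near y s (P : 'rV[R]_m.+1 -> Prop) : (\forall q \near consr s y, P q) ->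
  \forall y' \near y, P (consr s y').
Proof. exact: (@consr_continuous1 R m s y P). Qed.

Lemma k_near y e : gdom y -> 0 < e ->
  \forall y' \near y, gdom y' /\ `|k y' - k y| <= e.
Proof.
move=> gy e0; have h := kP gy.
have h1 : F (consr (k y - e) y) < 0 by apply: F_below h _; rewrite ltrBlDr ltrDl.
have h2 : 0 < F (consr (k y + e) y) by apply: F_above h _; rewrite ltrDl.
have n1 : \forall q \near consr (k y - e) y, F q < 0.
  by move/cvgr_lt : (@F_cont (consr (k y - e) y)); apply.
have n2 : \forall q \near consr (k y + e) y, 0 < F q.
  by move/cvgr_gt : (@F_cont (consr (k y + e) y)); apply.
have {}n1 := consr_near n1; have {}n2 := consr_near n2.
near=> y'.
have lo : F (consr (k y - e) y') < 0 by near: y'.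
have hi : 0 < F (consr (k y + e) y') by near: y'.
have le : k y - e <= k y + e by rewrite lerD2l; lra.
have cf : {within `[k y - e, k y + e], continuous (fun s => F (consr s y'))}.
  apply: derivable_within_continuous => s _.
  have [] // := @is_derive_consr0 _ _ F s y' _.
  exact: smooth_derivable sF _.
have [|s] := @IVT R (fun s => F (consr s y')) _ _ 0 le cf.
  by rewrite ge_min (ltW lo)/= le_max (ltW hi) orbT.
rewrite in_itv/= => /andP[s1 s2] Fs; split; first by exists s.
by rewrite (k_eq Fs) ler_norml; apply/andP; split; lra.
Unshelve. all: by end_near. Qed.

Lemma open_gdom : open gdom.
Proof.
rewrite openE => y gy.
by apply: (@filterS _ _ (nbhs_filter y)) (k_near gy ltr01) => y' [].
Qed.

Lemma k_cont y : gdom y -> {for y, continuous k}.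
Proof.
move=> gy; apply/(@cvgrPdist_le _ _ _ (nbhs y) (nbhs_filter y) k (k y)) => e e0.
by apply: (@filterS _ _ (nbhs_filter y)) (k_near gy e0) => y' [_]; rewrite distrC.
Qed.

Lemma is_derive_k y v : gdom y ->
  is_derive y v k (- 'D_(consr 0 v) F (consr (k y) y) / 'D_(Ei ord0) F (consr (k y) y)).
Proof.
move=> gy; have Fp := kP gy.
set p := consr (k y) y; set A := 'D_(Ei ord0) F p; set B := 'D_(consr 0 v) F p.
have A0 : 0 < A by exact: F_partial.
pose S := \sum_i `|v 0 i|.
have S0 : 0 <= S by exact: sumr_ge0.
have BE : B = \sum_i 'D_(Ei (lift ord0 i)) F p * v 0 i.
  rewrite /B; have [_ ->] := derive_sumEi (consr 0 v) (FC1 p sF).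
  rewrite big_ord_recl consr0 mulr0 add0r.
  by apply: eq_bigr => i _; rewrite consrS.
pose C := 2 * `|B| / A + 2 * S.
have C0 : 0 <= C.
  by apply: addr_ge0; [apply: divr_ge0; [exact: mulr_ge0|exact: ltW]|exact: mulr_ge0].
suff H : (fun h : R => h^-1 *: ((k \o shift y) (h *: v) - k y)) @ 0^' --> - B / A.
  apply: DeriveDef; first by apply/cvg_ex; eexists; exact: H.
  exact: cvg_lim H.
apply/cvgrPdist_le => e e0.
pose d := Num.min (A / 2) (e * A / (C + 1)).
have C1 : 0 < C + 1 by rewrite ltr_wpDl.
have d0 : 0 < d by rewrite lt_min !divr_gt0 ?mulr_gt0.
have dA : d <= A / 2 by rewrite ge_min lexx.
have dC : d <= e * A / (C + 1) by rewrite ge_min lexx orbT.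
have L : (fun h : R => h *: v + y) @ 0^' --> y.
  apply: cvg_trans (_ : (fun h : R => h *: v + y) @ 0 --> y).
    by apply: cvg_app; exact: nbhs_dnbhs.
  exact: cvg_line.
have Lk : (fun h : R => k (h *: v + y)) @ 0^' --> k y.
  exact: (cvg_comp _ _ L (k_cont gy)).
have Lp : (fun h : R => consr (k (h *: v + y)) (h *: v + y)) @ 0^' --> p.
  apply: cvg_rV => j; case: (unliftP ord0 j) => [i ->|->].
    under eq_fun do rewrite consrS; rewrite /p consrS.
    exact: (cvg_comp _ _ L (@coord_continuous _ _ _ 0 i y)).
  by under eq_fun do rewrite consr0; rewrite /p consr0.
have N1 : \forall h \near 0^', gdom (h *: v + y).
  exact: (L _ (open_nbhs_nbhs (conj open_gdom gy))).
have N2 := Lp _ (C1_expansion (FC1 p sF) d0).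
near=> h.
have h0 : h != 0 by near: h; exact: nbhs_dnbhs_neq.
have gh : gdom (h *: v + y) by near: h.
have : `|F (consr (k (h *: v + y)) (h *: v + y)) - F p -
   \sum_i 'D_(Ei i) F p * (consr (k (h *: v + y)) (h *: v + y) 0 i - p 0 i)| <=
   d * \sum_i `|consr (k (h *: v + y)) (h *: v + y) 0 i - p 0 i|.
  by near: h.
rewrite (kP gh) Fp subrr sub0r normrN !big_ord_recl !consr0.
rewrite [X in `|_ + X|](_ : _ = h * B); last first.
  rewrite BE mulr_sumr; apply: eq_bigr => i _; rewrite !consrS !mxE; ring.
rewrite [X in d * (_ + X)](_ : _ = `|h| * S); last first.
  rewrite mulr_sumr; apply: eq_bigr => i _; rewrite !consrS !mxE -normrM; congr `|_|; ring.
rewrite /= -/A; set D := k _ - k y => E.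
have hpos : 0 < `|h| by rewrite normr_gt0.
have ADle : A * `|D| <= `|A * D + h * B| + `|h| * `|B|.
  have -> : A * `|D| = `|A * D| by rewrite normrM (gtr0_norm A0).
  rewrite -[X in `|X|](addrK (h * B)); apply: le_trans (ler_normB _ _) _.
  by rewrite (normrM h).
have D0 : 0 <= `|D| by [].
have B0 : 0 <= `|B| by [].
have Dle : `|D| + `|h| * S <= `|h| * C.
  rewrite -(ler_pM2l A0).
  have e1 : d * (`|D| + `|h| * S) <= A / 2 * (`|D| + `|h| * S).
    by apply: ler_wpM2r => //; rewrite addr_ge0// mulr_ge0// ltW.
  have -> : A * (`|h| * C) = 2 * (`|h| * `|B|) + 2 * (A * (`|h| * S)).
    by rewrite /C; field; rewrite gt_eqF.
  lra.
have -> : - B / A - h^-1 *: D = - ((A * D + h * B) / (A * h)).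
  by rewrite -[_ *: _]/(_ * _); field; rewrite h0 gt_eqF.
rewrite normrN normrM normfV (normrM A) (gtr0_norm A0) ler_pdivrMr ?mulr_gt0//.
apply: le_trans E _; apply: le_trans (ler_wpM2l (ltW d0) Dle) _.
have dCe : d * C <= e * A.
  move: dC; rewrite ler_pdivlMr// => dC; apply: le_trans dC.
  by rewrite ler_wpM2l ?ltW// ltrDl.
rewrite [leLHS](_ : _ = `|h| * (d * C)); last ring.
by rewrite [leRHS](_ : _ = `|h| * (e * A)) ?ler_wpM2l//; ring.
Unshelve. all: by end_near. Qed.

(** The derivative of the implicit function is a quotient of derivatives of F
   along the graph, so each order of smoothness gives the next one. *)
Lemma smooth_k : smooth gdom k.
Proof.
move=> n; elim: n => [|n IH]; first by move=> y gy; exact: k_cont.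
split; first by move=> y gy; exact: k_cont.
move=> v; split; first by move=> y gy; have [] := is_derive_k v gy.
apply: (@Cn_eq _ _ gdom open_gdom _ (fun y => (- 'D_(consr 0 v) F (consr (k y) y)) * ('D_(Ei ord0) F (consr (k y) y))^-1)).
  by move=> y gy; have [_ ->] := is_derive_k v gy.
have hc i : Cn n gdom (fun y => consr (k y) y 0 i).
  case: (unliftP ord0 i) => [j ->|->].
    apply: (@Cn_eq _ _ gdom open_gdom _ (fun y => y 0 j)) => [y _|].
      by rewrite consrS.
    exact: (Cn_coord open_gdom).
  by apply: (@Cn_eq _ _ gdom open_gdom _ k) => // y _; rewrite consr0.
apply: Cn_mul; first exact: open_gdom.
  apply: Cn_opp; first exact: open_gdom.
  apply: (@Cn_comp _ _ gdom _ n ('D_(consr 0 v) F) (fun y => consr (k y) y)) => //.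
    exact: open_gdom.
  exact: smooth_derive.
apply: Cn_inv; first exact: open_gdom.
  by move=> y gy; rewrite gt_eqF// F_partial//; exact: kP.
apply: (@Cn_comp _ _ gdom _ n ('D_(Ei ord0) F) (fun y => consr (k y) y)) => //.
  exact: open_gdom.
exact: smooth_derive.
Qed.

(** The graph is strictly concave: differentiating the equation of the graph
    twice along v expresses the second derivative of k through that of F along
    the tangent lift of v. *)
Lemma k_concave y v : gdom y -> v != 0 -> 'D_v ('D_v k) y < 0.
Proof.
move=> gy v0; set p := consr (k y) y.
pose A := 'D_(Ei ord0) F; pose B := 'D_(consr 0 v) F.
have sA : smooth setT A by exact: smooth_derive.
have sB : smooth setT B by exact: smooth_derive.
have A0 : 0 < A p by apply: F_partial; exact: kP.
pose a := 'D_v k y; pose V := consr a v.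
have aE : a * A p + B p = 0.
  by rewrite /a; have [_ ->] := is_derive_k v gy; rewrite divfK ?gt_eqF// addNr.
have DVE q : 'D_V F q = a * A q + B q.
  rewrite /A /B; have [_ ->] := derive_sumEi V (FC1 q sF).
  have [_ ->] := derive_sumEi (consr 0 v) (FC1 q sF).
  rewrite !big_ord_recl !consr0 mulr0 add0r mulrC; congr (_ + _).
  by apply: eq_bigr => i _; rewrite !consrS.
have V0 : V != 0.
  apply: contra v0 => /eqP/rowP h; apply/eqP/rowP => i.
  by have := h (lift ord0 i); rewrite consrS !mxE.
have pos : 0 < 'D_V ('D_V F) p.
  by apply: F_tangent => //; [exact: kP|rewrite DVE].
have lin t : gdom (t *: v + y) -> is_derive t (1:R) (fun t => k (t *: v + y)) ('D_v k (t *: v + y)).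
  move=> gt; have dk : derivable k (y + t *: v) v.
    by rewrite addrC; exact: smooth_derivable smooth_k gt.
  have := derivable_line dk; rewrite addrC.
  by under eq_fun do rewrite addrC.
have gy0 : gdom ((0:R) *: v + y) by rewrite scale0r add0r.
pose c t := consr (k (t *: v + y)) (t *: v + y).
have c0 : c 0 = p by rewrite /c scale0r add0r.
have dc i : is_derive (0:R) (1:R) (fun t => c t 0 i) (V 0 i).
  rewrite /c /V; case: (unliftP ord0 i) => [j ->|->].
    rewrite (_ : (fun t => _) = (fun t => t * v 0 j + y 0 j)).
      rewrite consrS.
      by apply: is_derive_eq; rewrite scaler0 add0r addr0 -[_ *: _]/(_ * _) mulr1.
    by apply/funext => t; rewrite consrS !mxE.
  rewrite consr0 (_ : (fun t => _) = (fun t => k (t *: v + y))).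
    by have := lin 0 gy0; rewrite scale0r add0r.
  by apply/funext => t; rewrite consr0.
have along G : smooth setT G -> is_derive (0:R) (1:R) (fun t => G (c t)) ('D_V G p).
  move=> sG; have [_ ->] := derive_sumEi V (FC1 p sG).
  have := @is_derive_curve R m.+1 G c 0 (fun i => V 0 i); rewrite c0.
  by apply => //; exact: FC1.
have dk2 : is_derive (0:R) (1:R) (fun t => 'D_v k (t *: v + y)) ('D_v ('D_v k) y).
  apply/(is_derive_line0 ('D_v k) y v); apply: derivableP.
  exact: (smooth_derivable (smooth_derive v smooth_k) gy).
have dsum := is_deriveD (is_derive_mulR dk2 (along _ sA)) (along _ sB).
have near0 : \forall t \near (0:R), 0 = ('D_v k (t *: v + y)) * A (c t) + B (c t).
  have N : \forall t \near (0:R), gdom (t *: v + y).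
    exact: (@cvg_line _ _ v y _ (open_nbhs_nbhs (conj open_gdom gy))).
  apply: filterS N => t gt; have [_ ->] := is_derive_k v gt.
  by rewrite divfK ?addNr// gt_eqF// F_partial//; exact: kP.
have dzero := near_eq_is_derive near0 (is_derive_cst 0 (0:R) (1:R)).
have E : 'D_v ('D_v k) y * A p + a * 'D_V A p + 'D_V B p = 0.
  have [_ <-] := dzero; have [_] := dsum.
  by rewrite c0 scale0r add0r => ->.
have DDE : 'D_V ('D_V F) p = a * 'D_V A p + 'D_V B p.
  rewrite (_ : 'D_V F = (fun q => a * A q + B q)); last by apply/funext => q; exact: DVE.
  have dA := derivableP (smooth_derivable (v := V) (x := p) sA I).
  have dB := derivableP (smooth_derivable (v := V) (x := p) sB I).
  by have [_ ->] := is_deriveD (is_deriveZ a dA) dB.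
rewrite DDE in pos; rewrite -(pmulr_llt0 _ A0) -subr_gt0 sub0r.
by move/eqP: E; rewrite -addrA addr_eq0 -eqr_oppLR => /eqP ->.
Qed.

End graph.

(** * Quadratic bounds and the linear gap *)

Section taylor.
Context {R : realType}.

Lemma taylor2_le (f f1 f2 : R -> R) (M : R) :
  (forall t : R, 0 <= t <= 1 -> is_derive t (1:R) f (f1 t)) ->
  (forall t : R, 0 <= t <= 1 -> is_derive t (1:R) f1 (f2 t)) ->
  (forall t : R, 0 <= t <= 1 -> f2 t <= M) -> f 1 - f 0 - f1 0 <= M / 2.
Proof.
move=> d1 d2 fM.
pose h t := f t - f1 0 * t - M / 2 * t ^+ 2.
pose h1 t := f1 t - f1 0 - M * t.
have dh (t : R) : 0 <= t <= 1 -> is_derive t (1:R) h (h1 t).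
  move=> /d1 D; rewrite /h.
  have D1 := is_derive_mulR (is_derive_cst (f1 0) t (1:R)) (is_derive_id t (1:R)).
  have D2 := is_derive_mulR (is_derive_cst (M / 2) t (1:R))
    (is_derive_mulR (is_derive_id t (1:R)) (is_derive_id t (1:R))).
  apply: (is_derive_eq (is_deriveB (is_deriveB D D1) D2)).
  by rewrite /h1 /cst /=; field.
have dh1 (t : R) : 0 <= t <= 1 -> is_derive t (1:R) h1 (f2 t - M).
  move=> /d2 D; rewrite /h1.
  have D1 := is_derive_mulR (is_derive_cst M t (1:R)) (is_derive_id t (1:R)).
  apply: (is_derive_eq (is_deriveB (is_deriveB D (is_derive_cst (f1 0) t (1:R))) D1)).
  by rewrite /cst /=; ring.
have [||x] := @MVT_segment R h h1 0 1 ler01.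
- by move=> t; rewrite in_itv/= => /andP[t0 t1]; apply: dh; rewrite !ltW.
- apply: derivable_within_continuous => t; rewrite in_itv/= => t01.
  by have [] := dh t t01.
rewrite in_itv/= => /andP[x0 x1] E.
have [||y] := @MVT_segment R h1 (fun t => f2 t - M) 0 x x0.
- move=> t; rewrite in_itv/= => /andP[t0 tx]; apply: dh1.
  by rewrite ltW//= (le_trans (ltW tx)).
- apply: derivable_within_continuous => t; rewrite in_itv/= => /andP[t0 tx].
  by have [] := dh1 t; rewrite ?t0/= ?(le_trans tx).
rewrite in_itv/= => /andP[y0 yx] E'.
have fy : f2 y <= M by apply: fM; rewrite y0 (le_trans yx).
have hx : h1 x <= 0.
  have -> : h1 x = (f2 y - M) * (x - 0) by rewrite -E' /h1; ring.
  by rewrite subr0 mulr_le0_ge0// subr_le0.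
have := E; rewrite /h subr0 mulr1 expr1n mulr1 mulr0 expr0n mulr0 !subr0 mulr1 => E2.
by move: hx; rewrite -E2; lra.
Qed.

Lemma taylor2_ge (f f1 f2 : R -> R) (M : R) :
  (forall t : R, 0 <= t <= 1 -> is_derive t (1:R) f (f1 t)) ->
  (forall t : R, 0 <= t <= 1 -> is_derive t (1:R) f1 (f2 t)) ->
  (forall t : R, 0 <= t <= 1 -> M <= f2 t) -> M / 2 <= f 1 - f 0 - f1 0.
Proof.
move=> d1 d2 fM.
have n1 (t : R) : 0 <= t <= 1 -> is_derive t (1:R) (fun t => - f t) (- f1 t).
  by move=> /d1 D; exact: is_deriveN.
have n2 (t : R) : 0 <= t <= 1 -> is_derive t (1:R) (fun t => - f1 t) (- f2 t).
  by move=> /d2 D; exact: is_deriveN.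
have n3 (t : R) : 0 <= t <= 1 -> - f2 t <= - M by move=> t01; rewrite lerN2 fM.
by have := taylor2_le n1 n2 n3; lra.
Qed.

Definition nsq m (v : 'rV[R]_m) : R := \sum_i v 0 i ^+ 2.

Lemma nsq_ge0 m (v : 'rV[R]_m) : 0 <= nsq v.
Proof. by apply: sumr_ge0 => i _; exact: sqr_ge0. Qed.

Lemma nsq_eq0 m (v : 'rV[R]_m) : nsq v = 0 -> v = 0.
Proof.
move=> /eqP; rewrite psumr_eq0 => [/allP h|i _]; last exact: sqr_ge0.
apply/rowP => i; rewrite mxE; apply/eqP.
by have := h i (mem_index_enum i); rewrite /= sqrf_eq0.
Qed.

Lemma nsqZ m (a : R) (v : 'rV[R]_m) : nsq (a *: v) = a ^+ 2 * nsq v.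
Proof. by rewrite /nsq mulr_sumr; apply: eq_bigr => i _; rewrite mxE exprMn. Qed.

Lemma le_nsq m (v : 'rV[R]_m) i : v 0 i ^+ 2 <= nsq v.
Proof. by rewrite /nsq (bigD1 i)//= lerDl sumr_ge0// => j _; exact: sqr_ge0. Qed.

Lemma nsq_cont m : continuous (@nsq m).
Proof.
move=> v; apply: (@cvg_sum R R _ _ (nbhs v) (nbhs_filter v) _
  (fun i (v : 'rV[R]_m) => v 0 i ^+ 2)) => i.
by apply: cvgM; exact: (@coord_continuous _ _ _ 0 i v).
Qed.

Definition hess m (k : 'rV[R]_m -> R) (y v : 'rV[R]_m) : R :=
  \sum_i (\sum_j 'D_(Ei j) ('D_(Ei i) k) y * v 0 j) * v 0 i.

Lemma hessE m (k : 'rV[R]_m -> R) (D : set 'rV[R]_m) y v : open D -> smooth D k -> D y ->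
  'D_v ('D_v k) y = hess k y v.
Proof.
move=> oD sk Dy.
have C1 (G : 'rV[R]_m -> R) p : smooth D G -> D p -> C1near G p.
  by move=> sG Dp; apply: (Cn1_C1near oD) => //; exact: sG.
have N : \forall p \near y, 'D_v k p = \sum_i 'D_(Ei i) k p * v 0 i.
  by apply: (near_open oD Dy) => p Dp; have [_ ->] := derive_sumEi v (C1 _ _ sk Dp).
rewrite (near_eq_derive _ N).
have E : (fun p => \sum_i 'D_(Ei i) k p * v 0 i) = \sum_i (fun p => 'D_(Ei i) k p * v 0 i).
  by apply/funext => p; rewrite fct_sumE.
rewrite E.
have H i : is_derive y v (fun p => 'D_(Ei i) k p * v 0 i) ((\sum_j 'D_(Ei j) ('D_(Ei i) k) y * v 0 j) * v 0 i).
  have dki := derive_sumEi v (C1 _ _ (smooth_derive (Ei i) sk) Dy).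
  have -> : (fun p => 'D_(Ei i) k p * v 0 i) = (v 0 i) \*: 'D_(Ei i) k.
    by apply: functional_extensionality_dep => p; rewrite mulrC.
  apply: (is_derive_eq (is_deriveZ (v 0 i) dki)).
  by rewrite -[v 0 i *: _]/(v 0 i * _) mulrC.
by have [_ ->] := is_derive_sum H.
Qed.

Lemma hessZ m (k : 'rV[R]_m -> R) y (a : R) v : hess k y (a *: v) = a ^+ 2 * hess k y v.
Proof.
rewrite /hess mulr_sumr; apply: eq_bigr => i _; rewrite mxE.
under eq_bigr do rewrite mxE mulrCA.
by rewrite -mulr_sumr; ring.
Qed.

(** By compactness a strictly concave function is, near a point, squeezed
    between two quadratic functions. *)
Lemma quad_bounds m (k : 'rV[R]_m -> R) (D : set 'rV[R]_m) :
  open D -> smooth D k -> D 0 -> k 0 = 0 ->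
  (forall y v, D y -> v != 0 -> 'D_v ('D_v k) y < 0) ->
  exists r c C : R, [/\ 0 < r, 0 < c, 0 < C,
    (forall y : 'rV[R]_m, (forall i, `|y 0 i| <= r) -> D y) &
    forall y : 'rV[R]_m, (forall i, `|y 0 i| <= r) ->
      - C * nsq y <= k y - 'D_y k 0 <= - c * nsq y].
Proof.
move=> oD sk D0 k0 conc.
have /nbhs_ballP[e /= e0 eD] : nbhs (0 : 'rV[R]_m) D by apply: open_nbhs_nbhs.
pose r := e / 2; have r0 : 0 < r by rewrite divr_gt0.
have rD (y : 'rV[R]_m) : (forall i, `|y 0 i| <= r) -> D y.
  move=> h; apply: eD; split => // i j; rewrite ord1 mxE /ball/= sub0r normrN.
  by rewrite (le_lt_trans (h j))// ltr_pdivrMr// ltr_pMr// ltr1n.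
case: m => [|m] in k D oD sk D0 k0 conc eD rD *.
  exists r, 1, 1; split => // y _.
  have -> : y = 0 by apply/rowP => -[].
  by rewrite derive0 k0 subr0 /nsq big_ord0 !mulr0 lexx.
pose B := [set y : 'rV[R]_m.+1 | forall i, `[-r, r]%classic (y 0 i)].
have BP y : B y <-> forall i, `|y 0 i| <= r.
  by split => h i; have := h i; rewrite /= in_itv/= ler_norml.
pose S := [set v : 'rV[R]_m.+1 | forall i, `[-1, 1]%classic (v 0 i)] `&` (@nsq m.+1) @^-1` [set 1].
have cB : compact B.
  exact: (@rV_compact R m.+1 (fun=> `[-r, r]%classic) (fun=> @segment_compact R _ _)).
have cS : compact S.
  apply: compact_closedI.
    exact: (@rV_compact R m.+1 (fun=> `[-1, 1]%classic) (fun=> @segment_compact R _ _)).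
  by apply: closed_comp => [v _|]; [exact: nsq_cont|exact: closed_eq].
have B0 : B 0 by apply/BP => i; rewrite mxE normr0 ltW.
have S0 : S (Ei ord0).
  split => [i|]/=.
    by rewrite in_itv/= !mxE lern1 leq_b1 andbT (le_trans _ (ler0n _ _))// lerN10.
  rewrite /nsq (bigD1 ord0)//= big1 ?addr0 => [|i i0]; first by rewrite mxE !eqxx expr1n.
  by rewrite mxE (negbTE i0) andbF expr0n.
pose K := B `*` S.
have cK : compact K by exact: compact_setX.
have K0 : K !=set0 by exists (0, Ei ord0).
pose Phi (p : 'rV[R]_m.+1 * 'rV[R]_m.+1) := hess k p.1 p.2.
have cPhi : {within K, continuous Phi}.
  apply: continuous_in_subspaceT => -[y v]; rewrite inE => -[/= /BP By _].
  have c2 i : {for (y, v), continuous (fun p : 'rV[R]_m.+1 * 'rV[R]_m.+1 => p.2 0 i)}.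
    apply: (@continuous_comp _ _ _ snd (fun v : 'rV[R]_m.+1 => v 0 i) (y, v)).
      exact: cvg_snd.
    exact: coord_continuous.
  pose N := nbhs (y, v); have FN : Filter N by exact: nbhs_filter.
  apply: (@cvg_sum R R _ _ N FN _ (fun i p =>
    (\sum_j 'D_(Ei j) ('D_(Ei i) k) p.1 * p.2 0 j) * p.2 0 i)) => i.
  apply: cvgM; last exact: c2.
  apply: (@cvg_sum R R _ _ N FN _ (fun j p => 'D_(Ei j) ('D_(Ei i) k) p.1 * p.2 0 j)) => j.
  apply: cvgM; last exact: c2.
  apply: (@continuous_comp _ _ _ fst ('D_(Ei j) ('D_(Ei i) k)) (y, v)).
    exact: cvg_fst.
  exact: (smooth_cont (smooth_derive _ (smooth_derive _ sk)) (rD _ By)).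
have [[y1 v1] K1 max1] := compact_EVT_max K0 cK cPhi.
have [[y2 v2] K2 min2] := compact_EVT_min K0 cK cPhi.
have neg y v : K (y, v) -> Phi (y, v) < 0.
  move=> [/BP /= By [_ /= Sv]]; rewrite /Phi/= -(hessE v oD sk (rD _ By)).
  apply: conc; first exact: rD.
  by apply/eqP => v0; move: Sv; rewrite v0 /nsq big1 => [/eqP|i _]; rewrite ?mxE ?expr0n// eq_sym oner_eq0.
pose c := - Phi (y1, v1) / 2; pose C := - Phi (y2, v2) / 2.
have c0 : 0 < c by rewrite divr_gt0// oppr_gt0 neg//; rewrite inE in K1.
have C0 : 0 < C by rewrite divr_gt0// oppr_gt0 neg//; rewrite inE in K2.
exists r, c, C; split => // y hy.
have [->|y0] := eqVneq y 0.
  rewrite derive0 k0 subr0 /nsq big1 ?mulr0 ?lexx// => i _.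
  by rewrite mxE expr0n.
have s0 : 0 < nsq y.
  rewrite lt_neqAle nsq_ge0 andbT eq_sym; apply: contra y0 => /eqP h.
  by rewrite (nsq_eq0 h).
pose s := Num.sqrt (nsq y).
have sp : 0 < s by rewrite sqrtr_gt0.
have s2 : s ^+ 2 = nsq y by rewrite sqr_sqrtr// ltW.
have yle i : `|y 0 i| <= s by rewrite -sqrtr_sqr; apply: ler_wsqrtr; exact: le_nsq.
have KP (t : R) : 0 <= t <= 1 -> K (t *: y, s^-1 *: y).
  move=> /andP[t0 t1]; split => /=.
    apply/BP => i; rewrite mxE normrM ger0_norm//.
    by apply: le_trans (hy i); rewrite ler_piMl.
  split; last by rewrite /= nsqZ -s2 exprVn mulVf// expf_neq0// gt_eqF.
  move=> i; rewrite /= in_itv/= -ler_norml mxE normrM normfV (gtr0_norm sp).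
  by rewrite mulrC ler_pdivrMr// mul1r.
have hE t : hess k (t *: y) y = nsq y * Phi (t *: y, s^-1 *: y).
  rewrite /Phi/= hessZ -s2 mulrA -exprMn mulfV ?gt_eqF// expr1n mul1r//.
have Dt (t : R) : 0 <= t <= 1 -> D (t *: y) by move=> /KP[/BP h _]; exact: rD.
have d1 (t : R) : 0 <= t <= 1 -> is_derive t (1:R) (fun t => k (t *: y)) ('D_y k (t *: y)).
  move=> t01; have := @derivable_line R _ _ k 0 y t; rewrite add0r.
  under eq_fun do rewrite add0r.
  by apply; exact: (smooth_derivable sk (Dt t t01)).
have d2 (t : R) : 0 <= t <= 1 -> is_derive t (1:R) (fun t => 'D_y k (t *: y)) (hess k (t *: y) y).
  move=> t01; rewrite -(hessE y oD sk (Dt t t01)).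
  have E : (fun s : R => 'D_y k (0 + s *: y)) = (fun s => 'D_y k (s *: y)).
    by apply/funext => x; rewrite add0r.
  have := @derivable_line R _ _ ('D_y k) 0 y t; rewrite E add0r.
  by apply; exact: (smooth_derivable (smooth_derive y sk) (Dt t t01)).
have U (t : R) : 0 <= t <= 1 -> hess k (t *: y) y <= - (2 * c * nsq y).
  move=> t01; rewrite hE mulrC -mulNr ler_wpM2r ?nsq_ge0//.
  have := max1 _ (mem_set (KP t t01)).
  by rewrite /c mulrCA divff// mulr1 opprK.
have L (t : R) : 0 <= t <= 1 -> - (2 * C * nsq y) <= hess k (t *: y) y.
  move=> t01; rewrite hE [leRHS]mulrC -mulNr ler_wpM2r ?nsq_ge0//.
  have := min2 _ (mem_set (KP t t01)).
  by rewrite /C mulrCA divff// mulr1 opprK.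
have := taylor2_le d1 d2 U; have := taylor2_ge d1 d2 L.
rewrite scale1r scale0r k0 subr0.
have half a : - (2 * a * nsq y) / 2 = - a * nsq y by rewrite !mulNr -mulrA mulrAC divff// mul1r.
by rewrite !half => -> ->.
Qed.

End taylor.

Section tail.
Context {R : realType} {m : nat}.
Variable F : 'rV[R]_m.+1 -> R.
Hypothesis sF : smooth setT F.
Hypothesis F_lower : forall x x' : 'rV[R]_m.+1, (forall j, x' 0 j <= x 0 j) -> F x < 0 -> F x' < 0.
Hypothesis F_partial : forall x j, F x = 0 -> 0 < 'D_(Ei j) F x.
Hypothesis F_bd : forall x (s : R), F x = 0 -> 0 < s -> F (- s *: ones + x) < 0.
Hypothesis F_convex : forall a b (t : R), F a < 0 -> F b < 0 -> 0 <= t <= 1 ->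
  F (a + t *: (b - a)) < 0.
Hypothesis F0 : F 0 = 0.

(** Concavity of the graph near 0 and convexity of the sublevel set force the
    whole set below the tangent hyperplane, with a linear gap far from 0. *)
Lemma linear_gap (r c : R) s (y : 'rV[R]_m) : 0 < r -> 0 < c ->
  (forall y : 'rV[R]_m, (forall i, `|y 0 i| <= r) -> gdom F y) ->
  (forall y : 'rV[R]_m, (forall i, `|y 0 i| <= r) -> k F y - 'D_y (k F) 0 <= - c * nsq y) ->
  F (consr s y) <= 0 -> r < Num.sqrt (nsq y) ->
  s <= 'D_y (k F) 0 - c * r * Num.sqrt (nsq y).
Proof.
move=> r0 c0 rD quad Fx; set e := Num.sqrt _ => re.
have e0 : 0 < e by exact: lt_trans re.
have e2 : e ^+ 2 = nsq y by rewrite sqr_sqrtr// nsq_ge0.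
pose t := r / e.
have t0 : 0 < t by rewrite divr_gt0.
have t1 : t < 1 by rewrite ltr_pdivrMr// mul1r.
have tx : F (t *: consr s y) <= 0.
  apply: lim_below; first exact: smooth_cont sF _.
  move=> sg sg0.
  have h1 : F (- sg *: ones + consr s y) < 0.
    move: Fx; rewrite le_eqVlt => /orP[/eqP/F_bd|]; first exact.
    by apply: F_lower => j; rewrite !mxE mulr1 gerDr oppr_le0 ltW.
  have h2 : F (- sg *: ones) < 0 by have := F_bd F0 sg0; rewrite addr0.
  have t01 : 0 <= t <= 1 by rewrite !ltW.
  have := F_convex h2 h1 t01.
  by rewrite [X in _ + t *: X]addrC addKr.
have ty i : `|(t *: y) 0 i| <= r.
  rewrite mxE normrM gtr0_norm// /t mulrAC ler_pdivrMr// ler_wpM2l ?(ltW r0)//.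
  by rewrite -sqrtr_sqr; apply: ler_wsqrtr; exact: le_nsq.
have tE : t *: consr s y = consr (t * s) (t *: y).
  apply/rowP => j; rewrite mxE; case: (unliftP ord0 j) => [i ->|->].
    by rewrite !consrS mxE.
  by rewrite !consr0.
have tsk : t * s <= k F (t *: y).
  rewrite leNgt; apply/negP => lt.
  have := F_above sF F_lower F_partial (kP (rD _ ty)) lt.
  by rewrite -tE ltNge tx.
have D0 : gdom F 0 by apply: rD => i; rewrite mxE normr0 ltW.
have C1 : C1near (k F) 0.
  apply: (Cn1_C1near (open_gdom sF F_lower F_partial)) => //.
  exact: (smooth_k sF F_lower F_partial).
have gE : 'D_(t *: y) (k F) 0 = t * 'D_y (k F) 0.
  have [_ ->] := derive_sumEi (t *: y) C1; have [_ ->] := derive_sumEi y C1.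
  by rewrite mulr_sumr; apply: eq_bigr => i _; rewrite mxE mulrCA.
have := quad _ ty; rewrite gE nsqZ -e2 lerBlDl => /(le_trans tsk).
have -> : - c * (t ^+ 2 * e ^+ 2) = - (t * (c * r * e)).
  have er : t * e = r by rewrite /t divfK ?gt_eqF.
  by rewrite -exprMn er -er; ring.
by rewrite -mulrBr ler_pM2l.
Qed.

End tail.

(** * Monomials and the Szego kernel *)

Section real_continuity.
Context {K : numFieldType} {T : topologicalType}.
Implicit Types f g : T -> K.
Lemma contD f g : continuous f -> continuous g -> continuous (fun x => f x + g x).
Proof. by move=> cf cg x; apply: (@continuousD _ K); [exact: cf|exact: cg]. Qed.
Lemma contM f g : continuous f -> continuous g -> continuous (fun x => f x * g x).
Proof. by move=> cf cg x; apply: continuousM; [exact: cf|exact: cg]. Qed.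
Lemma contN f : continuous f -> continuous (fun x => - f x).
Proof. by move=> cf x; apply: continuousN; exact: cf. Qed.
End real_continuity.

Section complex_topology.
Context {R : realType}.

Lemma norm_mkC (a : Cplx R) : `|a| = mkC (Num.sqrt (ReC a ^+ 2 + ImC a ^+ 2)) 0.
Proof. by case: a. Qed.

Lemma mkC_gt0 (e : R) : 0 < e -> (0 : Cplx R) < mkC e 0.
Proof. by move=> e0; rewrite (ltcE (0 : R[i])) /= eqxx. Qed.

Lemma ltc_mk (a b : R) : ((mkC a 0 : Cplx R) < mkC b 0) = (a < b).
Proof. by rewrite ltcE /= eqxx. Qed.

Lemma ReC_continuous : continuous (@ReC R).
Proof.
move=> a; apply/(@cvgrPdist_lt _ _ _ (nbhs a) (nbhs_filter a) (@ReC R) (ReC a)) => e e0.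
have := @nbhsx_ballx _ (Cplx R) a _ (mkC_gt0 e0).
apply: (@filterS _ _ (nbhs_filter a)) => b; rewrite /ball/= norm_mkC ltc_mk.
apply: le_lt_trans; rewrite -sqrtr_sqr; apply: ler_wsqrtr.
by rewrite ReCD ReCN lerDl sqr_ge0.
Qed.

Lemma ImC_continuous : continuous (@ImC R).
Proof.
move=> a; apply/(@cvgrPdist_lt _ _ _ (nbhs a) (nbhs_filter a) (@ImC R) (ImC a)) => e e0.
have := @nbhsx_ballx _ (Cplx R) a _ (mkC_gt0 e0).
apply: (@filterS _ _ (nbhs_filter a)) => b; rewrite /ball/= norm_mkC ltc_mk.
apply: le_lt_trans; rewrite -sqrtr_sqr; apply: ler_wsqrtr.
by rewrite ImCD ImCN lerDr sqr_ge0.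
Qed.

Lemma cvg_complex (T : Type) (F : set_system T) {FF : Filter F} (f : T -> Cplx R) (a : Cplx R) :
  (fun t => ReC (f t)) @ F --> ReC a -> (fun t => ImC (f t)) @ F --> ImC a -> f @ F --> a.
Proof.
move=> hr hi; apply/cvgrPdist_lt => e.
case: e => e1 e2; rewrite ltcE /= => /andP[/eqP -> e0].
have e20 : 0 < e1 / 2 by rewrite divr_gt0.
near=> t.
rewrite norm_mkC (ltc_mk _ e1) ReCD ImCD ReCN ImCN.
have h1 : `|ReC a - ReC (f t)| < e1 / 2 by near: t; move/cvgrPdist_lt : hr; apply.
have h2 : `|ImC a - ImC (f t)| < e1 / 2 by near: t; move/cvgrPdist_lt : hi; apply.
have -> : e1 = Num.sqrt (e1 ^+ 2) by rewrite sqrtr_sqr ger0_norm// ltW.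
rewrite ltr_sqrt ?exprn_gt0//.
have s1 x : `|x| < e1 / 2 -> x ^+ 2 < e1 ^+ 2 / 4.
  move=> h; have : `|x| ^+ 2 < (e1 / 2) ^+ 2 by rewrite ltrXn2r ?nnegrE// ltW.
  by rewrite real_normK ?num_real// expr_div_n -natrX.
have := s1 _ h1; have := s1 _ h2; have : 0 < e1 ^+ 2 by rewrite exprn_gt0.
lra.
Unshelve. all: by end_near. Qed.

Definition cabs2 (a : Cplx R) : R := ReC a ^+ 2 + ImC a ^+ 2.

Lemma cabs2M a b : cabs2 (a * b) = cabs2 a * cabs2 b.
Proof. by rewrite /cabs2 ReCM ImCM; ring. Qed.

Lemma cabs2_ge0 a : 0 <= cabs2 a.
Proof. by rewrite addr_ge0// sqr_ge0. Qed.

Lemma mul_conjE (a : Cplx R) : a * a^* = mkC (cabs2 a) 0.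
Proof. by apply: Cext; rewrite ?ReCM ?ImCM ReC_conj ImC_conj/= /cabs2; ring. Qed.

End complex_topology.

Section monomials.
Context {R : realType} {n : nat}.
Implicit Types (w : 'rV[Cplx R]_n) (f g : 'rV[Cplx R]_n -> Cplx R).

Definition mono (a : mpoly.multinom n) w : Cplx R :=
  \prod_(j < n) w 0 j ^+ fun_of_multinom a j.

Variables (X : set 'rV[Cplx R]_n)
  (mu : {measure set (borel 'rV[Cplx R]_n) -> \bar R}).
Hypothesis mX : measurable (X : set (borel 'rV[Cplx R]_n)).
Hypothesis muX : (mu X < +oo)%E.
Hypothesis bX : exists M : R, forall w, X w -> forall j, `|ReC (w 0 j)| <= M /\ `|ImC (w 0 j)| <= M.
Hypothesis rotX : forall th, X `<=` @torus_act R n th @^-1` X.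
Hypothesis mu_inv : torus_invariant mu.

(** Bounded continuous functions: the class in which all integrals below are
    finite and linear. *)
Definition bcont f := [/\ continuous (fun w => ReC (f w)),
  continuous (fun w => ImC (f w)) &
  exists M : R, forall w, X w -> `|ReC (f w)| <= M /\ `|ImC (f w)| <= M].

Lemma bcont_cst c : bcont (fun=> c).
Proof.
split; [exact: cst_continuous|exact: cst_continuous|].
exists (Num.max `|ReC c| `|ImC c|) => w _.
by rewrite !le_max !lexx orbT.
Qed.

Lemma bcontD f g : bcont f -> bcont g -> bcont (fun w => f w + g w).
Proof.
move=> [f1 f2 [M hM]] [g1 g2 [N hN]]; split.
- rewrite (_ : (fun w => _) = (fun w => ReC (f w) + ReC (g w))).
    exact: contD f1 g1.
  by apply/funext => w; exact: ReCD.
- rewrite (_ : (fun w => _) = (fun w => ImC (f w) + ImC (g w))).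
    exact: contD f2 g2.
  by apply/funext => w; exact: ImCD.
exists (M + N) => w Xw; have [a b] := hM w Xw; have [c d] := hN w Xw.
by rewrite ReCD ImCD; split; apply: le_trans (ler_normD _ _) _; apply: lerD.
Qed.

Lemma bcontM f g : bcont f -> bcont g -> bcont (fun w => f w * g w).
Proof.
move=> [f1 f2 [M hM]] [g1 g2 [N hN]]; split.
- rewrite (_ : (fun w => _) = (fun w => ReC (f w) * ReC (g w) - ImC (f w) * ImC (g w))).
    exact: contD (contM f1 g1) (contN (contM f2 g2)).
  by apply/funext => w; exact: ReCM.
- rewrite (_ : (fun w => _) = (fun w => ReC (f w) * ImC (g w) + ImC (f w) * ReC (g w))).
    exact: contD (contM f1 g2) (contM f2 g1).
  by apply/funext => w; exact: ImCM.
exists (M * N + M * N) => w Xw; have [a b] := hM w Xw; have [c d] := hN w Xw.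
rewrite ReCM ImCM; split.
  apply: le_trans (ler_normB _ _) _; rewrite !normrM.
  by apply: lerD; apply: ler_pM.
apply: le_trans (ler_normD _ _) _; rewrite !normrM.
by apply: lerD; apply: ler_pM.
Qed.

Lemma bcont_conj f : bcont f -> bcont (fun w => (f w)^*).
Proof.
move=> [f1 f2 [M hM]]; split.
- rewrite (_ : (fun w => _) = (fun w => ReC (f w)))//.
  by apply/funext => w; exact: ReC_conj.
- rewrite (_ : (fun w => _) = (fun w => - ImC (f w))).
    exact: contN f2.
  by apply/funext => w; exact: ImC_conj.
by exists M => w /hM; rewrite ReC_conj ImC_conj normrN.
Qed.

Lemma bcont_coord j : bcont (fun w => w 0 j).
Proof.
split.
- move=> w; apply: (@continuous_comp _ _ _ (fun w : 'rV[Cplx R]_n => w 0 j) (@ReC R)).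
    exact: coord_continuous.
  exact: ReC_continuous.
- move=> w; apply: (@continuous_comp _ _ _ (fun w : 'rV[Cplx R]_n => w 0 j) (@ImC R)).
    exact: coord_continuous.
  exact: ImC_continuous.
by have [M h] := bX; exists M => w Xw; exact: h.
Qed.

Lemma bcont_sum (I : Type) (s : seq I) (f : I -> 'rV[Cplx R]_n -> Cplx R) :
  (forall i, bcont (f i)) -> bcont (fun w => \sum_(i <- s) f i w).
Proof.
move=> h; elim: s => [|i s IH].
  by under eq_fun do rewrite big_nil; exact: bcont_cst.
by under eq_fun do rewrite big_cons; exact: bcontD.
Qed.

Lemma bcont_prod (I : Type) (s : seq I) (f : I -> 'rV[Cplx R]_n -> Cplx R) :
  (forall i, bcont (f i)) -> bcont (fun w => \prod_(i <- s) f i w).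
Proof.
move=> h; elim: s => [|i s IH].
  by under eq_fun do rewrite big_nil; exact: bcont_cst.
by under eq_fun do rewrite big_cons; exact: bcontM.
Qed.

Lemma bcontX f k : bcont f -> bcont (fun w => f w ^+ k).
Proof.
move=> h; elim: k => [|k IH]; first exact: bcont_cst.
by under eq_fun do rewrite exprS; exact: bcontM.
Qed.

Lemma bcont_mono a : bcont (mono a).
Proof. by apply: bcont_prod => j; apply: bcontX; exact: bcont_coord. Qed.

Lemma integrable_bounded (h : 'rV[Cplx R]_n -> R) : continuous h ->
  (exists M : R, forall w, X w -> `|h w| <= M) ->
  mu.-integrable X (EFin \o h).
Proof.
move=> ch [M hM]; apply: measurable_bounded_integrable => //.
  by apply: measurable_funS (continuous_borel ch).
exists M; split; first exact: num_real.
by move=> x Mx w Xw; exact: le_trans (hM w Xw) (ltW Mx).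
Qed.

Lemma bcont_integrable f : bcont f ->
  mu.-integrable X (EFin \o (fun w => ReC (f w))) /\
  mu.-integrable X (EFin \o (fun w => ImC (f w))).
Proof.
move=> [f1 f2 [M hM]].
by split; apply: integrable_bounded => //; exists M => w /hM [].
Qed.

Definition IC f := cintegral mu X f.

Lemma IC_D f g : bcont f -> bcont g -> IC (fun w => f w + g w) = IC f + IC g.
Proof.
move=> /bcont_integrable[f1 f2] /bcont_integrable[g1 g2].
apply: Cext; rewrite ?ReCD ?ImCD /IC /cintegral /=.
  rewrite -(RintegralD mX f1 g1); apply: eq_Rintegral => w _; exact: ReCD.
rewrite -(RintegralD mX f2 g2); apply: eq_Rintegral => w _; exact: ImCD.
Qed.

Lemma IC_Z c f : bcont f -> IC (fun w => c * f w) = c * IC f.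
Proof.
move=> /bcont_integrable[f1 f2].
apply: Cext; rewrite ?ReCM ?ImCM /IC /cintegral /=.
  rewrite -(RintegralZl _ mX f1) -(RintegralZl _ mX f2).
  rewrite -(RintegralB mX (integrableZl mX (ReC c) f1) (integrableZl mX (ImC c) f2)).
  by apply: eq_Rintegral => w _; exact: ReCM.
rewrite -(RintegralZl _ mX f1) -(RintegralZl _ mX f2).
rewrite -(RintegralD mX (integrableZl mX (ReC c) f2) (integrableZl mX (ImC c) f1)).
by apply: eq_Rintegral => w _; exact: ImCM.
Qed.

Lemma IC_sum (I : Type) (s : seq I) (c : I -> Cplx R) (f : I -> 'rV[Cplx R]_n -> Cplx R) :
  (forall i, bcont (f i)) ->
  IC (fun w => \sum_(i <- s) c i * f i w) = \sum_(i <- s) c i * IC (f i).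
Proof.
move=> h; elim: s => [|i s IH].
  rewrite big_nil (_ : IC _ = IC (fun w => 0 * (fun=> 1) w)).
    by rewrite IC_Z ?mul0r//; exact: bcont_cst.
  by congr IC; apply/funext => w; rewrite big_nil mul0r.
rewrite big_cons -IH -IC_Z// -IC_D.
- by congr IC; apply/funext => w; rewrite big_cons.
- by apply: bcontM => //; exact: bcont_cst.
- by apply: bcont_sum => j; apply: bcontM => //; exact: bcont_cst.
Qed.

Lemma torus_act_continuous th : continuous (@torus_act R n th).
Proof.
move=> w; apply: continuous_rV => j.
rewrite (_ : (fun t : 'rV[Cplx R]_n => _) = (fun t => cexp (mkC 0 (th j)) * t 0 j)); last first.
  by apply/funext => t; rewrite mxE.
have cc : continuous (fun t : 'rV[Cplx R]_n => t 0 j) by exact: coord_continuous.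
exact: (contM (@cst_continuous _ _ (cexp (mkC 0 (th j)))) cc).
Qed.

Lemma torus_act_measurable th :
  measurable_fun setT (@torus_act R n th : borel _ -> borel _).
Proof.
apply: measurable_borel_fun => A oA; rewrite setTI; apply: open_borel.
by apply: open_comp => // w _; exact: torus_act_continuous.
Qed.

Lemma torus_actK th : cancel (@torus_act R n th) (torus_act (fun j => - th j)).
Proof.
move=> w; apply/rowP => j; rewrite !mxE mulrA -cexpD.
rewrite (_ : mkC 0 (- th j) + _ = 0) ?cexp0 ?mul1r//.
by apply: Cext; rewrite ?ReCD ?ImCD/= ?addr0 ?addNr.
Qed.

Lemma torus_preimage th : @torus_act R n th @^-1` X = X.
Proof.
apply/seteqP; split; last exact: rotX.
by move=> w h; have := @rotX (fun j => - th j) _ h; rewrite /preimage/= torus_actK.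
Qed.

Lemma Rintegral_torus th (h : 'rV[Cplx R]_n -> R) : continuous h ->
  (exists M : R, forall w, X w -> `|h w| <= M) ->
  (\int[mu]_(w in X) h (torus_act th w) = \int[mu]_(w in X) h w)%R.
Proof.
move=> ch [M hM]; rewrite /Rintegral; congr fine.
pose pm : {measure set (borel 'rV[Cplx R]_n) -> \bar R} :=
  measure_function_pushforward__canonical__measure_function_Measure
    mu (torus_act_measurable th).
rewrite [RHS](@eq_measure_integral _ _ _ _ pm); last first.
  by move=> A mA _; rewrite -[LHS](mu_inv th mA).
have := @integral_pushforward _ _ _ _ R _ (torus_act_measurable th) mu X (EFin \o h).
rewrite torus_preimage => -> //.
  by apply/measurable_EFinP; exact: continuous_borel.
apply: integrable_bounded.
  move=> w; apply: (@continuous_comp _ _ _ (torus_act th) h w); first exact: torus_act_continuous.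
  exact: ch.
by exists M => w /(@rotX th); exact: hM.
Qed.

Lemma IC_torus th f : bcont f -> IC (fun w => f (torus_act th w)) = IC f.
Proof.
move=> [f1 f2 [M hM]]; apply: Cext; rewrite /IC /cintegral /=.
  by apply: (@Rintegral_torus th (fun w => ReC (f w))) => //; exists M => w /hM [].
by apply: (@Rintegral_torus th (fun w => ImC (f w))) => //; exists M => w /hM [].
Qed.

Lemma cexp_exp (t : R) k : cexp (mkC 0 t) ^+ k = cexp (mkC 0 (t * k%:R)).
Proof.
elim: k => [|k IH]; first by rewrite mulr0 (_ : mkC 0 0 = 0)// cexp0.
rewrite exprS IH -cexpD; congr cexp.
by apply: Cext; rewrite ?ReCD ?ImCD/= ?addr0// -natr1; ring.
Qed.

Lemma cexp_conj (t : R) : (cexp (mkC 0 t))^* = cexp (mkC 0 (- t)).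
Proof. by apply: Cext; rewrite ?ReC_conj ?ImC_conj /cexp/= ?cosN ?sinN ?mulrN. Qed.

(** Distinct monomials have distinct weights under the torus, and some rotation
    changes the sign of the product of one with the conjugate of the other. *)
Lemma mono_orth a b : a <> b -> IC (fun w => mono a w * (mono b w)^*) = 0.
Proof.
move=> ab.
have [j abj] : exists j, fun_of_multinom a j != fun_of_multinom b j.
  apply: contrapT => /forallNP h; apply: ab; apply/mpoly.mnmP => j.
  by apply/eqP; apply: contrapT => /negP; exact: h.
pose d : R := (fun_of_multinom a j)%:R - (fun_of_multinom b j)%:R.
have d0 : d != 0 by rewrite subr_eq0 eqr_nat.
pose t := pi / d.
pose th i : R := if i == j then t else 0.
have monoT c w : mono c (torus_act th w) = cexp (mkC 0 (t * (fun_of_multinom c j)%:R)) * mono c w.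
  rewrite /mono -cexp_exp.
  under eq_bigr do rewrite mxE exprMn.
  rewrite big_split/=; congr (_ * _).
  rewrite (bigD1 j)//= big1 ?mulr1 /th ?eqxx// => i /negbTE ->.
  by rewrite (_ : mkC 0 0 = 0)// cexp0 expr1n.
have bf : bcont (fun w => mono a w * (mono b w)^*).
  by apply: bcontM; [exact: bcont_mono|apply: bcont_conj; exact: bcont_mono].
have E : IC (fun w => mono a w * (mono b w)^*) = - IC (fun w => mono a w * (mono b w)^*).
  rewrite -{1}(IC_torus th bf) -mulN1r -IC_Z//; congr IC; apply/funext => w.
  rewrite !monoT rmorphM/= cexp_conj mulrACA -cexpD; congr (_ * _).
  have -> : mkC 0 (t * (fun_of_multinom a j)%:R) + mkC 0 (- (t * (fun_of_multinom b j)%:R)) = mkC 0 pi.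
    apply: Cext; rewrite ?ReCD ?ImCD/= ?addr0// -mulrBr -/d /t divfK//.
  by apply: Cext; rewrite /cexp/= expR0 ?cospi ?sinpi ?mulr0 ?mul1r ?oppr0.
by apply/eqP; move: E; move: (IC _) => I E; have := mulrn_eq0 I 2; rewrite mulr2n {1}E addNr eqxx => /esym.
Qed.

Definition J a : R := (\int[mu]_(w in X) cabs2 (mono a w))%R.

Lemma mono_norm a : IC (fun w => mono a w * (mono a w)^*) = mkC (J a) 0.
Proof.
rewrite /IC /cintegral; congr mkC; first by apply: eq_Rintegral => w _; rewrite mul_conjE.
under eq_Rintegral do rewrite mul_conjE /=.
by rewrite /Rintegral integral0.
Qed.

Lemma IC_mono a b : IC (fun w => mono a w * (mono b w)^*) = (a == b)%:R * mkC (J a) 0.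
Proof.
have [->|/eqP ab] := eqVneq a b; first by rewrite mono_norm mul1r.
by rewrite mono_orth// mul0r.
Qed.

Lemma evalp_mono N (p : mpoly.mpoly n (Cplx R)) w : degree_le N p ->
  evalp p w = \sum_(a : mpoly.bmultinom n N.+1) mpoly.mcoeff a p * mono a w.
Proof.
move=> /mpoly.mpolywE E; rewrite /evalp {1}E raddf_sum; apply: eq_bigr => a _.
by rewrite [LHS]mpoly.mevalZ mpoly.mevalX.
Qed.

Lemma szego_monomials N d (p : 'I_d -> mpoly.mpoly n (Cplx R)) :
  orthonormal_basis X mu N p ->
  (forall a : mpoly.bmultinom n N.+1, J a != 0) /\
  forall z w, szego p z w =
    \sum_(a : mpoly.bmultinom n N.+1) mono a z * (mono a w)^* / mkC (J a) 0.
Proof.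
move=> [deg orth span].
have bp k : bcont (evalp (p k)).
  rewrite (_ : evalp (p k) = (fun w => \sum_(a : mpoly.bmultinom n N.+1) mpoly.mcoeff a (p k) * mono a w)).
    by apply: bcont_sum => a; apply: bcontM; [exact: bcont_cst|exact: bcont_mono].
  by apply/funext => w; exact: evalp_mono.
pose e k (a : mpoly.bmultinom n N.+1) := mpoly.mcoeff a (p k).
have Xp k (a : mpoly.bmultinom n N.+1) :
    IC (fun w => mono a w * (evalp (p k) w)^*) = (e k a)^* * mkC (J a) 0.
  rewrite (_ : IC _ = IC (fun w => \sum_(b : mpoly.bmultinom n N.+1) (e k b)^* * (mono a w * (mono b w)^*))).
    rewrite IC_sum => [|b]; last first.
      by apply: bcontM; [exact: bcont_mono|apply: bcont_conj; exact: bcont_mono].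
    rewrite (bigD1 a)//= IC_mono eqxx mul1r big1 ?addr0// => b ba.
    by rewrite IC_mono (_ : _ == _ = false) ?mul0r ?mulr0//; apply/negbTE; rewrite eq_sym -val_eqE.
  congr IC; apply/funext => w; rewrite (evalp_mono w (deg k)) rmorph_sum mulr_sumr.
  by apply: eq_bigr => b _; rewrite rmorphM mulrCA.
have H (a : mpoly.bmultinom n N.+1) :
    mpoly.mpolyX (Cplx R) a = \sum_k ((e k a)^* * mkC (J a) 0) *: p k.
  have [|c cE] := span (mpoly.mpolyX (Cplx R) a).
    by rewrite /degree_le mpoly.msizeX ltnS -ltnS; case: (a) => /= [? ?].
  rewrite {1}cE; apply: eq_bigr => k _; congr (_ *: _); rewrite -Xp.
  rewrite (_ : IC _ = IC (fun w => \sum_l c l * (evalp (p l) w * (evalp (p k) w)^*))).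
    rewrite IC_sum => [|l]; last by apply: bcontM => //; exact: bcont_conj.
    rewrite (bigD1 k)//= big1 ?addr0 => [|l lk].
      by have := orth k k; rewrite /inner -/(IC _) eqxx => ->; rewrite mulr1.
    by have := orth l k; rewrite /inner -/(IC _) (negbTE lk) => ->; rewrite mulr0.
  congr IC; apply/funext => w; rewrite -[mono a w](mpoly.mevalX) cE raddf_sum mulr_suml.
  apply: eq_bigr => l _; rewrite mulrA; congr (_ * _).
  exact: (mpoly.mevalZ (w 0) (c l) (p l)).
have J0 (a : mpoly.bmultinom n N.+1) : J a != 0.
  apply/eqP => Ja; have := congr1 (mpoly.mcoeff a) (H a).
  rewrite mpoly.mcoeffX eqxx big1 => [|k _]; last by rewrite Ja (_ : mkC 0 0 = 0)// mulr0 scale0r.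
  by rewrite raddf0 => /eqP; rewrite oner_eq0.
split => // z w; rewrite /szego.
under eq_bigr do rewrite (evalp_mono w (deg _)) rmorph_sum mulr_sumr.
rewrite exchange_big/=; apply: eq_bigr => a _.
have -> : mono a z = \sum_k ((e k a)^* * mkC (J a) 0) * evalp (p k) z.
  rewrite -[mono a z](mpoly.mevalX) H raddf_sum; apply: eq_bigr => k _.
  exact: (mpoly.mevalZ (z 0) ((e k a)^* * mkC (J a) 0) (p k)).
have mJ : mkC (J a) 0 != 0 :> Cplx R.
  by apply: contra (J0 a) => /eqP/(congr1 (@ReC R)) /= ->.
rewrite !mulr_suml; apply: eq_bigr => k _.
rewrite rmorphM /= -/(e k a).
have scal (u v x y : Cplx R) : v != 0 -> x * (u * y) = u * v * x * y / v.
  by move=> v0; field.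
exact: scal.
Qed.

End monomials.

(** A member of the basis is a constant of norm 1, whereas the real value of the
   integral of a constant over a set of infinite mass is 0, never 1. *)
Lemma finite_mass (R : realType) n (X : set 'rV[Cplx R]_n)
    (mu : {measure set (borel 'rV[Cplx R]_n) -> \bar R}) d
    (p : 'I_d -> mpoly.mpoly n (Cplx R)) :
  measurable (X : set (borel 'rV[Cplx R]_n)) ->
  orthonormal_basis X mu 0 p -> (mu X < +oo)%E.
Proof.
move=> mX [deg orth span].
have [|c cE] := span (mpoly.mpolyX (Cplx R) mpoly.mnm0).
  by rewrite /degree_le mpoly.msizeX mpoly.mdeg0.
case: d => [|d] in p deg orth span c cE *.
  have := congr1 (mpoly.mcoeff mpoly.mnm0) cE.
  by rewrite big_ord0 mpoly.mcoeffX eqxx raddf0 => /eqP; rewrite oner_eq0.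
have pE w : evalp (p ord0) w = mpoly.mcoeff mpoly.mnm0 (p ord0).
  by rewrite /evalp {1}(mpoly.msize1_polyC (deg ord0)) mpoly.mevalC.
have := orth ord0 ord0; rewrite eqxx /inner /cintegral => /(congr1 (@ReC R)) /=.
under eq_Rintegral do rewrite pE mul_conjE /=.
set C := cabs2 _; rewrite /Rintegral integral_cst// => h.
rewrite ltey; apply/eqP => muoo; move: h; rewrite muoo.
have [->|C0] := eqVneq C 0; first by rewrite mul0e => /esym/eqP; rewrite oner_eq0.
rewrite gt0_muley ?lte_fin ?lt_neqAle ?(eq_sym 0) ?C0 ?cabs2_ge0//=.
by move=> /esym/eqP; rewrite oner_eq0.
Qed.

(** * A parametrization of the boundary near z *)

Section vector_valued.
Context {R : realType}.

Lemma is_derive_rV (V : normedModType R) n (f : V -> 'rV[R]_n) x v (d : 'I_n -> R) :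
  (forall i, is_derive x v (fun y => f y 0 i) (d i)) ->
  is_derive x v f (\row_i d i).
Proof.
move=> h.
have c : (fun t : R => t^-1 *: ((f \o shift x) (t *: v) - f x)) @ 0^' --> \row_i d i.
  apply: cvg_rV => i; rewrite mxE.
  have [hd <-] := h i.
  rewrite (_ : (fun t : R => _) =
    (fun t : R => t^-1 *: (((fun y => f y 0 i) \o shift x) (t *: v) - f x 0 i))).
    exact: hd.
  by apply/funext => t; rewrite !mxE.
by apply: DeriveDef; [exact: cvgP c|exact: cvg_lim c].
Qed.

Lemma smooth_on_rV (V : normedModType R) n (U : set V) (f : V -> 'rV[R]_n) :
  open U -> (forall i, smooth U (fun x => f x 0 i)) -> smooth_on U f.
Proof.
move=> oU sf.
pose G vs i := iter_derive (fun x => f x 0 i : R^o) vs.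
have sG vs i : smooth U (G vs i).
  by elim: vs => [|v vs IH]; [exact: sf|exact: smooth_derive].
pose H vs x : 'rV[R]_n := \row_i G vs i x.
have HE vs i : (fun y => H vs y 0 i) = G vs i by apply/funext => y; rewrite mxE.
have dH vs v x : U x -> is_derive x v (H vs) (\row_i 'D_v (G vs i) x).
  move=> Ux; apply: is_derive_rV => i; rewrite HE.
  by apply: DeriveDef => //; exact: smooth_derivable (sG vs i) Ux.
have E vs x : U x -> iter_derive f vs x = H vs x.
  elim: vs x => [|v vs IH] x Ux; first by apply/rowP => i; rewrite mxE.
  rewrite /=; apply: etrans (_ : 'D_v (H vs) x = _).
    by apply: near_eq_derive; exact: near_open oU _ _ Ux _.
  by have [_ ->] := dH vs v x Ux.
move=> vs x Ux; split.
  apply: cvg_trans (_ : H vs @ x --> _).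
    by apply: near_eq_cvg; apply: near_open oU _ _ Ux _ => y Uy; rewrite E.
  rewrite E//; apply: continuous_rV => i; rewrite HE.
  exact: smooth_cont (sG vs i) Ux.
move=> v; apply: near_eq_derivable (_ : derivable (H vs) x v).
  by apply: near_open oU _ _ Ux _ => y Uy; rewrite E.
by have [] := dH vs v x Ux.
Qed.

End vector_valued.

Section parametrization.
Context {R : realType} {m : nat}.

Lemma dim_split : (m + m.+1 = m.*2.+1)%N.
Proof. by rewrite addnS addnn. Qed.

Definition yix (i : 'I_m) : 'I_(m.*2.+1) := cast_ord dim_split (lshift m.+1 i).
Definition tix (j : 'I_m.+1) : 'I_(m.*2.+1) := cast_ord dim_split (rshift m j).
Definition ypart (v : 'rV[R]_(m.*2.+1)) : 'rV[R]_m := \row_i v 0 (yix i).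
Definition tpart (v : 'rV[R]_(m.*2.+1)) : 'rV[R]_m.+1 := \row_j v 0 (tix j).

Lemma yt_split (q : 'I_(m.*2.+1)) : (exists i, q = yix i) \/ (exists j, q = tix j).
Proof.
rewrite -(cast_ordKV dim_split q); set q' := cast_ord _ q.
by case: (split_ordP q') => [i ->|j ->]; [left; exists i|right; exists j].
Qed.

Lemma prod_split (T : comPzSemiRingType) (G : 'I_(m.*2.+1) -> T) :
  \prod_q G q = \prod_i G (yix i) * \prod_j G (tix j).
Proof.
rewrite (reindex (cast_ord dim_split)) ?big_split_ord//=.
by apply: onW_bij; exists (cast_ord (esym dim_split)); [exact: cast_ordK|exact: cast_ordKV].
Qed.

Variables (k : 'rV[R]_m -> R) (D : set 'rV[R]_m) (z : 'rV[Cplx R]_m.+1) (r : R).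
Hypothesis oD : open D.
Hypothesis sk : smooth D k.
Hypothesis z0 : forall j, z 0 j != 0.
Hypothesis rD : forall y : 'rV[R]_m, (forall i, `|y 0 i| <= r) -> D y.

Definition xlog (v : 'rV[R]_(m.*2.+1)) : 'rV[R]_m.+1 := consr (k (ypart v)) (ypart v).
Definition phi (v : 'rV[R]_(m.*2.+1)) : 'rV[Cplx R]_m.+1 := polar z (xlog v) (tpart v).
Definition pdom : set 'rV[R]_(m.*2.+1) :=
  [set v | (forall i, `|ypart v 0 i| < r) /\ (forall j, `|tpart v 0 j| < 2)].

Lemma open_forall (T : topologicalType) (I : finType) (P : I -> set T) :
  (forall i, open (P i)) -> open [set x | forall i, P i x].
Proof.
by move=> oP; rewrite openE => x Px; apply: filter_forall => i; have := oP i; rewrite openE; apply; exact: Px.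
Qed.

Lemma pdom_D v : pdom v -> D (ypart v).
Proof. by move=> [h _]; apply: rD => i; exact: ltW. Qed.

Lemma open_norm_coord n (q : 'I_n) (s : R) : open [set v : 'rV[R]_n | `|v 0 q| < s].
Proof.
apply: (@open_comp _ _ (fun v : 'rV[R]_n => `|v 0 q|) [set x | x < s]); last exact: open_lt.
move=> v _; apply: (@continuous_comp _ _ _ (fun v : 'rV[R]_n => v 0 q) Num.norm).
  exact: coord_continuous.
exact: norm_continuous.
Qed.

Lemma open_pdom : open pdom.
Proof.
apply: openI; apply: (@open_forall _ _ (fun i v => _)) => i.
  rewrite (_ : (fun v => _) = [set v : 'rV[R]_(m.*2.+1) | `|v 0 (yix i)| < r]).
    exact: open_norm_coord.
  by apply/funext => v; rewrite /= mxE.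
rewrite (_ : (fun v => _) = [set v : 'rV[R]_(m.*2.+1) | `|v 0 (tix i)| < 2]).
  exact: open_norm_coord.
by apply/funext => v; rewrite /= mxE.
Qed.

Lemma cexp_eq1 (a b : R) : cexp (mkC a b) = 1 -> `|b| < 4 -> a = 0 /\ b = 0.
Proof.
move=> h b4.
have ec : expR a * cos b = 1 by have := congr1 (@ReC R) h.
have es : expR a * sin b = 0 by have := congr1 (@ImC R) h.
have sb : sin b = 0 by move/eqP: es; rewrite mulf_eq0 gt_eqF ?expR_gt0//= => /eqP.
have cb : cos b = 1.
  have c2 : cos b ^+ 2 = 1 by rewrite cos2sin2 sb expr0n/= subr0.
  have c0 : 0 < cos b by rewrite -(pmulr_rgt0 _ (expR_gt0 a)) ec.
  by apply/eqP; rewrite -(eqrXn2 (n := 2))// ?c2 ?expr1n// ltW.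
have a0 : a = 0 by apply: expR_inj; rewrite expR0 -ec cb mulr1.
split => //.
have s2 : sin (b / 2) = 0.
  have E : b = (b / 2) *+ 2 by rewrite -mulr_natr divfK.
  have : sin (b / 2) ^+ 2 = 0.
    have := cos_mulr2n (b / 2); rewrite -E cb cos2sin2 mulr2n => h2.
    move: h2; set q := _ ^+ 2 => h2; lra.
  by move/eqP; rewrite sqrf_eq0 => /eqP.
have p2 := pi_ge2 R.
case: (ltgtP b 0) => // b0.
  have : 0 < sin (- (b / 2)) by apply: sin_gt0_pi; move: b4; rewrite ltr_norml; lra.
  by rewrite sinN s2 oppr0 ltxx.
have : 0 < sin (b / 2) by apply: sin_gt0_pi; move: b4; rewrite ltr_norml; lra.
by rewrite s2 ltxx.
Qed.

Lemma polar_inj (x x' th th' : 'rV[R]_m.+1) : (forall j, `|th 0 j - th' 0 j| < 4) ->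
  polar z x th = polar z x' th' -> x = x' /\ th = th'.
Proof.
move=> h4 E.
have H j : x 0 j = x' 0 j /\ th 0 j = th' 0 j.
  have /(mulIf (z0 j)) Ej : cexp (mkC (x 0 j) (th 0 j)) * z 0 j = cexp (mkC (x' 0 j) (th' 0 j)) * z 0 j.
    by have := congr1 (fun w : 'rV_m.+1 => w 0 j) E; rewrite !mxE.
  have h1 : cexp (mkC (x 0 j - x' 0 j) (th 0 j - th' 0 j)) = 1.
    rewrite (_ : mkC _ _ = mkC (x 0 j) (th 0 j) + mkC (- x' 0 j) (- th' 0 j)).
      rewrite cexpD Ej -cexpD -cexp0; congr cexp.
      by apply: Cext; rewrite ?ReCD ?ImCD/= subrr.
    by apply: Cext; rewrite ?ReCD ?ImCD.
  have [a b] := cexp_eq1 h1 (h4 j).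
  by split; apply/eqP; rewrite -subr_eq0 ?a ?b.
by split; apply/rowP => j; have [] := H j.
Qed.

Lemma phi_inj : set_inj pdom phi.
Proof.
move=> v v' /[!inE] Uv Uv' /polar_inj[j|xx tt].
  have := Uv.2 j; have := Uv'.2 j; rewrite !ltr_norml; lra.
have yy : ypart v = ypart v'.
  apply/rowP => i; have := congr1 (fun w : 'rV[R]_m.+1 => w 0 (lift ord0 i)) xx.
  by rewrite /xlog !consrS.
apply/rowP => q; have [[i ->]|[j ->]] := yt_split q.
  by have := congr1 (fun w : 'rV[R]_m => w 0 i) yy; rewrite !mxE.
by have := congr1 (fun w : 'rV[R]_m.+1 => w 0 j) tt; rewrite !mxE.
Qed.

Lemma smooth_ypart (U : set 'rV[R]_(m.*2.+1)) i : open U -> smooth U (fun v => ypart v 0 i).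
Proof.
move=> oU n; rewrite (_ : (fun v => _) = (fun v : 'rV[R]_(m.*2.+1) => v 0 (yix i))); first exact: Cn_coord.
by apply/funext => v; rewrite mxE.
Qed.

Lemma smooth_tpart (U : set 'rV[R]_(m.*2.+1)) j : open U -> smooth U (fun v => tpart v 0 j).
Proof.
move=> oU n; rewrite (_ : (fun v => _) = (fun v : 'rV[R]_(m.*2.+1) => v 0 (tix j))); first exact: Cn_coord.
by apply/funext => v; rewrite mxE.
Qed.
Lemma smooth_xlog j : smooth pdom (fun v => xlog v 0 j).
Proof.
move=> n; case: (unliftP ord0 j) => [i ->|->].
  rewrite (_ : (fun v => _) = (fun v => ypart v 0 i)); first exact: smooth_ypart open_pdom _.
  by apply/funext => v; rewrite /xlog consrS.
rewrite (_ : (fun v => _) = (fun v => k (ypart v))); last by apply/funext => v; rewrite /xlog consr0.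
apply: (Cn_comp_on open_pdom oD pdom_D sk) => i; exact: smooth_ypart open_pdom _.
Qed.

Lemma to_real_phi_l v j : to_real (phi v) 0 (lshift m.+1 j) =
  expR (xlog v 0 j) * (cos (tpart v 0 j) * ReC (z 0 j) + sin (tpart v 0 j) * - ImC (z 0 j)).
Proof. rewrite /to_real row_mxEl !mxE ReCM /cexp /=; ring. Qed.

Lemma to_real_phi_r v j : to_real (phi v) 0 (rshift m.+1 j) =
  expR (xlog v 0 j) * (cos (tpart v 0 j) * ImC (z 0 j) + sin (tpart v 0 j) * ReC (z 0 j)).
Proof. rewrite /to_real row_mxEr !mxE ImCM /cexp /=; ring. Qed.

Lemma smooth_phi q : smooth pdom (fun v => to_real (phi v) 0 q).
Proof.
have H (b c : R) j : smooth pdom (fun v => expR (xlog v 0 j) * (cos (tpart v 0 j) * b + sin (tpart v 0 j) * c)).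
  move=> n; apply: (Cn_mul open_pdom).
    apply: (Cn_expR open_pdom); exact: smooth_xlog.
  have [hc hs] := Cn_cos_sin open_pdom (@smooth_tpart _ j open_pdom n).
  by apply: (Cn_add open_pdom); apply: (Cn_mul open_pdom) => //; exact: Cn_cst.
move=> n; case: (split_ordP q) => j ->.
  apply: (Cn_eq open_pdom _ (H (ReC (z 0 j)) (- ImC (z 0 j)) j n)) => v _.
  by rewrite to_real_phi_l.
apply: (Cn_eq open_pdom _ (H (ImC (z 0 j)) (ReC (z 0 j)) j n)) => v _.
by rewrite to_real_phi_r.
Qed.

Lemma is_derive_expcos (x th : R -> R) (x' th' b c : R) :
  is_derive (0:R) (1:R) x x' -> is_derive (0:R) (1:R) th th' ->
  is_derive (0:R) (1:R) (fun t => expR (x t) * (cos (th t) * b + sin (th t) * c))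
   (expR (x 0) * (x' * (cos (th 0) * b + sin (th 0) * c) + th' * (cos (th 0) * c + sin (th 0) * - b))).
Proof.
move=> hx ht.
have he : is_derive (0:R) (1:R) (fun t => expR (x t)) (expR (x 0) * x').
  by apply: (is_derive_eq (@is_derive1_comp _ expR x 0 _ _ (is_derive_expR (x 0)) hx)).
have hc : is_derive (0:R) (1:R) (fun t => cos (th t)) (- sin (th 0) * th').
  by apply: (is_derive_eq (@is_derive1_comp _ cos th 0 _ _ (is_derive_cos (th 0)) ht)).
have hs : is_derive (0:R) (1:R) (fun t => sin (th t)) (cos (th 0) * th').
  by apply: (is_derive_eq (@is_derive1_comp _ sin th 0 _ _ (is_derive_sin (th 0)) ht)).
have hb : is_derive (0:R) (1:R) (fun=> b) 0 by exact: is_derive_cst.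
have hcc : is_derive (0:R) (1:R) (fun=> c) 0 by exact: is_derive_cst.
have h1 := is_derive_mulR hc hb; have h2 := is_derive_mulR hs hcc.
have h3 := is_derive_mulR he (is_deriveD h1 h2).
apply: (is_derive_eq h3); rewrite ![in LHS]fctE; ring.
Qed.

Lemma rot_solve (a t C S b c : R) : C ^+ 2 + S ^+ 2 = 1 -> b != 0 \/ c != 0 ->
  a * (C * b + S * - c) + t * (C * - c + S * - b) = 0 ->
  a * (C * c + S * b) + t * (C * b + S * - c) = 0 -> a = 0 /\ t = 0.
Proof.
move=> CS bc h1 h2.
have n0 : b ^+ 2 + c ^+ 2 != 0.
  by rewrite paddr_eq0 ?sqr_ge0// !sqrf_eq0; case: bc => /negbTE ->; rewrite ?andbF.
have ha : a * (b ^+ 2 + c ^+ 2) = 0.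
  transitivity ((C * b + S * - c) * (a * (C * b + S * - c) + t * (C * - c + S * - b)) +
    (C * c + S * b) * (a * (C * c + S * b) + t * (C * b + S * - c)) -
    a * (b ^+ 2 + c ^+ 2) * (C ^+ 2 + S ^+ 2 - 1)); first by ring.
  by rewrite h1 h2 CS subrr !mulr0 addr0 subr0.
have ht : t * (b ^+ 2 + c ^+ 2) = 0.
  transitivity ((C * b + S * - c) * (a * (C * c + S * b) + t * (C * b + S * - c)) -
    (C * c + S * b) * (a * (C * b + S * - c) + t * (C * - c + S * - b)) -
    t * (b ^+ 2 + c ^+ 2) * (C ^+ 2 + S ^+ 2 - 1)); first by ring.
  by rewrite h1 h2 CS subrr !mulr0 !subr0.
by split; apply/eqP; [move/eqP: ha|move/eqP: ht]; rewrite mulf_eq0 (negbTE n0) orbF.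
Qed.

Lemma phi_immersion x v : pdom x -> 'D_v (@to_real R m.+1 \o phi) x = 0 -> v = 0.
Proof.
move=> Ux E.
have E0 q : 'D_v (fun v => to_real (phi v) 0 q) x = 0.
  have [|_ h] := @is_derive_rV _ _ _ (@to_real R m.+1 \o phi) x v (fun q => 'D_v (fun v => to_real (phi v) 0 q) x).
    by move=> i; apply: DeriveDef => //; exact: smooth_derivable (smooth_phi i) Ux.
  by have := congr1 (fun w : 'rV[R]_(m.+1 + m.+1) => w 0 q) h; rewrite E !mxE => <-.
pose xi j := 'D_v (fun v => xlog v 0 j) x.
have xiE j : is_derive (0:R) (1:R) (fun t : R => xlog (t *: v + x) 0 j) (xi j).
  by apply/(is_derive_line0 (fun v => xlog v 0 j)); apply: DeriveDef => //; exact: smooth_derivable (smooth_xlog j) Ux.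
have tE j : is_derive (0:R) (1:R) (fun t : R => tpart (t *: v + x) 0 j) (v 0 (tix j)).
  rewrite (_ : (fun t => _) = (fun t => t * v 0 (tix j) + x 0 (tix j))); last by apply/funext => t; rewrite !mxE.
  have h := is_deriveD (is_derive_mulR (is_derive_id (0:R) (1:R)) (is_derive_cst (v 0 (tix j)) (0:R) 1)) (is_derive_cst (x 0 (tix j)) (0:R) 1).
  by apply: (is_derive_eq h); rewrite mulr0 mul1r !addr0.
have yE i : xi (lift ord0 i) = v 0 (yix i).
  have h : is_derive (0:R) (1:R) (fun t : R => xlog (t *: v + x) 0 (lift ord0 i)) (v 0 (yix i)).
    rewrite (_ : (fun t => _) = (fun t => t * v 0 (yix i) + x 0 (yix i))); last first.
      by apply/funext => t; rewrite /xlog consrS !mxE.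
    have h := is_deriveD (is_derive_mulR (is_derive_id (0:R) (1:R)) (is_derive_cst (v 0 (yix i)) (0:R) 1)) (is_derive_cst (x 0 (yix i)) (0:R) 1).
    by apply: (is_derive_eq h); rewrite mulr0 mul1r !addr0.
  by have [_ <-] := xiE (lift ord0 i); have [_ <-] := h.
have K j : xi j = 0 /\ v 0 (tix j) = 0.
  set b := ReC (z 0 j); set c := ImC (z 0 j).
  have d1 := is_derive_expcos b (- c) (xiE j) (tE j).
  have d2 := is_derive_expcos c b (xiE j) (tE j).
  have := E0 (lshift m.+1 j); have := E0 (rshift m.+1 j).
  have el : (fun t : R => to_real (phi (t *: v + x)) 0 (lshift m.+1 j)) =
      (fun t : R => expR (xlog (t *: v + x) 0 j) *
        (cos (tpart (t *: v + x) 0 j) * b + sin (tpart (t *: v + x) 0 j) * (- c))).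
    by apply/funext => t; exact: to_real_phi_l.
  have [_ ->] := (is_derive_line0 (fun v => to_real (phi v) 0 (lshift m.+1 j)) x v _).1
    (eq_ind_r (fun f => is_derive (0:R) (1:R) f _) d1 el).
  have er : (fun t : R => to_real (phi (t *: v + x)) 0 (rshift m.+1 j)) =
      (fun t : R => expR (xlog (t *: v + x) 0 j) *
        (cos (tpart (t *: v + x) 0 j) * c + sin (tpart (t *: v + x) 0 j) * b)).
    by apply/funext => t; exact: to_real_phi_r.
  have [_ ->] := (is_derive_line0 (fun v => to_real (phi v) 0 (rshift m.+1 j)) x v _).1
    (eq_ind_r (fun f => is_derive (0:R) (1:R) f _) d2 er).
  rewrite scale0r add0r.
  have ne : b != 0 \/ c != 0.
    have [b0|] := eqVneq b 0; last by left.
    right; apply: contra (z0 j) => /eqP c0; apply/eqP; exact: Cext.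
  have e0 : expR (xlog x 0 j) != 0 by rewrite gt_eqF ?expR_gt0.
  move=> /eqP; rewrite mulf_eq0 (negbTE e0)/= => /eqP h2.
  move=> /eqP; rewrite mulf_eq0 (negbTE e0)/= => /eqP h1.
  exact: (rot_solve (cos2Dsin2 (tpart x 0 j)) ne h1 h2).
apply/rowP => q; rewrite mxE; have [[i ->]|[j ->]] := yt_split q.
  by rewrite -yE; have [] := K (lift ord0 i).
by have [] := K j.
Qed.

(** The logarithms of the last moduli and all the angles are coordinates: the
   angles stay in a range on which the exponential is injective. *)
Lemma phi_parametrization (X : set 'rV[Cplx R]_m.+1) :
  (forall y th, D y -> X (polar z (consr (k y) y) th)) -> parametrization X pdom phi.
Proof.
move=> hX; split.
- exact: open_pdom.
- apply: (smooth_on_rV open_pdom) => i; exact: smooth_phi.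
- by move=> v /pdom_D Dv; exact: hX.
- exact: phi_inj.
- exact: phi_immersion.
Qed.
End parametrization.

(** * Integrals against a density *)

Section density.
Context {R : realType} d1 d2 {T1 : measurableType d1} {T2 : measurableType d2}.
Variables (mu1 : {measure set T1 -> \bar R}) (mu2 : {measure set T2 -> \bar R}).
Variables (D1 : set T1) (D2 : set T2) (g : T2 -> T1) (w : T2 -> R).
Hypotheses (mD1 : measurable D1) (mD2 : measurable D2) (mg : measurable_fun D2 g)
  (mw : measurable_fun D2 w) (w0 : forall x, 0 <= w x).
Hypothesis muE : forall B, measurable B ->
  (mu1 (B `&` D1) = \int[mu2]_(x in D2) ((\1_B (g x))%:E * (w x)%:E))%E.

Let m_indic B : measurable B -> measurable_fun D2 (fun x => (\1_B (g x) : R)).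
Proof.
move=> mB; apply: (@measurable_comp _ _ _ _ _ _ setT (\1_B : T1 -> R) D2 g) => //.
Qed.

Import HBNNSimple.

(** A density known on Borel sets passes to nonnegative functions by simple
   approximation. *)
Lemma integral_density (f : T1 -> \bar R) : measurable_fun setT f ->
  (forall x, 0 <= f x)%E ->
  (\int[mu1]_(x in D1) f x = \int[mu2]_(x in D2) (f (g x) * (w x)%:E))%E.
Proof.
move=> mf f0.
pose f_ := nnsfun_approx measurableT mf.
have cf x : (f_ n x)%:E @[n --> \oo] --> f x by apply: cvg_nnsfun_approx.
have mfn n : measurable_fun D2 (fun x => f_ n (g x)).
  by apply: (@measurable_comp _ _ _ _ _ _ setT (f_ n) D2 g).
transitivity (limn (fun n => \int[mu1]_(x in D1) (f_ n x)%:E))%E.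
  rewrite -monotone_convergence//.
  - by apply: eq_integral => y _; apply/esym/cvg_lim => //.
  - by move=> n; apply/measurable_EFinP/measurable_funTS.
  - by move=> n y _; rewrite lee_fin.
  - by move=> y _ m n mn; rewrite lee_fin; exact/lefP/nd_nnsfun_approx.
transitivity (limn (fun n => \int[mu2]_(x in D2) ((f_ n (g x))%:E * (w x)%:E)))%E; last first.
  rewrite -monotone_convergence//.
  - apply: eq_integral => y _; apply/cvg_lim => //.
    by apply: cvgeZr => //; exact: cf.
  - by move=> n; apply: emeasurable_funM; apply/measurable_EFinP.
  - by move=> n y _; rewrite mule_ge0// lee_fin.
  - by move=> y _ m n mn; rewrite lee_wpmul2r ?lee_fin//; exact/lefP/nd_nnsfun_approx.
congr (limn _); apply/funext => n.
have mk r : measurable (f_ n @^-1` [set r]) by [].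
transitivity (\sum_(k \in range (f_ n))
    \int[mu1]_(x in D1) (k * \1_(f_ n @^-1` [set k]) x)%:E)%E.
  under eq_integral do rewrite fimfunE -fsumEFin//.
  rewrite ge0_integral_fsum//.
  - by move=> r; apply/measurable_EFinP/measurable_funTS/measurable_funM => //; exact: measurable_indic.
  - by move=> r y _; rewrite EFinM nnfun_muleindic_ge0.
transitivity (\sum_(k \in range (f_ n))
    \int[mu2]_(x in D2) ((k * \1_(f_ n @^-1` [set k]) (g x))%:E * (w x)%:E))%E; last first.
  rewrite -ge0_integral_fsum//.
  - apply: eq_integral => x _; rewrite [in RHS]fimfunE -fsumEFin// ge0_mule_fsuml//.
    by move=> r; rewrite EFinM nnfun_muleindic_ge0.
  - move=> r; apply: emeasurable_funM; apply/measurable_EFinP => //.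
    by apply: measurable_funM => //; exact: m_indic.
  - by move=> r y _; rewrite mule_ge0 ?lee_fin// -lee_fin EFinM nnfun_muleindic_ge0.
apply: eq_fsbigr => r _.
have [r0|r0] := leP 0 r; last first.
  rewrite preimage_nnfun0// !integral0_eq// => x _; rewrite indic0 mulr0 ?mul0e//.
under eq_integral do rewrite EFinM.
rewrite ge0_integralZl//; last first.
  by apply/measurable_EFinP/measurable_funTS; exact: measurable_indic.
rewrite integral_indic// muE// -ge0_integralZl//.
- by apply: eq_integral => x _; rewrite muleA -EFinM.
- by apply: emeasurable_funM; apply/measurable_EFinP => //; exact: m_indic.
- by move=> x _; rewrite mule_ge0// lee_fin.
Qed.
End density.

(** * Complex logarithms on a half plane *)

Section half_plane.
Context {R : realType}.
Implicit Types q : Cplx R.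

Definition right_half q := 0 < ReC q \/ (ReC q = 0 /\ ImC q < 0).

Lemma right_half_opp q : q != 0 -> right_half (- q) <-> ~ right_half q.
Proof.
move=> q0; rewrite /right_half ReCN ImCN; split.
  by move=> + h; move: h; case: (ltgtP (ReC q) 0); lra.
move=> h; case: (ltgtP (ReC q) 0) => hr.
- by left; rewrite oppr_gt0.
- by exfalso; apply: h; left.
- right; rewrite hr oppr0; split => //; rewrite oppr_lt0.
  case: (ltgtP (ImC q) 0) => hi //.
    by exfalso; apply: h; right.
  by exfalso; move/eqP: q0; apply; exact: Cext.
Qed.

Lemma cabs2_gt0 q : q != 0 -> 0 < cabs2 q.
Proof.
move=> q0; rewrite lt_neqAle cabs2_ge0 andbT eq_sym; apply: contra q0.
rewrite /cabs2 paddr_eq0 ?sqr_ge0// !sqrf_eq0 => /andP[/eqP a /eqP b].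
by apply/eqP; exact: Cext.
Qed.

Lemma cabs2_cexp (x t : R) : cabs2 (cexp (mkC x t)) = expR x ^+ 2.
Proof.
rewrite /cabs2 /cexp/= !exprMn -mulrDr cos2Dsin2 mulr1 //.
Qed.

Lemma right_half_cexp (x t : R) : - (pi / 2) <= t < pi / 2 -> right_half (cexp (mkC x t)).
Proof.
move=> /andP[]; rewrite le_eqVlt => /predU1P[<- _|t1 t2].
  right; rewrite /cexp/= cosN cos_pihalf mulr0 sinN sin_pihalf mulrN mulr1.
  by rewrite oppr_lt0 expR_gt0.
by left; rewrite /cexp/= mulr_gt0 ?expR_gt0// cos_gt0_pihalf// t1.
Qed.

Lemma cexp_right_half q : right_half q ->
  exists x t : R, - (pi / 2) <= t < pi / 2 /\ q = cexp (mkC x t).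
Proof.
move=> hq.
have q0 : q != 0.
  apply/eqP => q0; move: hq; rewrite q0 /right_half /=; rewrite ltxx; by case=> // -[].
have re0 : 0 <= ReC q by case: hq => [/ltW//|[-> _]].
have c0 := cabs2_gt0 q0.
pose p := Num.sqrt (cabs2 q).
have p0 : 0 < p by rewrite sqrtr_gt0.
have p2 : p ^+ 2 = cabs2 q by rewrite sqr_sqrtr ?ltW.
pose s := ImC q / p.
have s2 : 1 - s ^+ 2 = (ReC q / p) ^+ 2.
  rewrite /s !expr_div_n p2; rewrite -{1}(divff (lt0r_neq0 c0)) -mulrBl; congr (_ / _).
  by rewrite /cabs2; ring.
have s1 : -1 <= s <= 1.
  rewrite -ler_norml -(ler_pXn2r (n := 2))// ?nnegrE// expr1n real_normK ?num_real//.
  by rewrite -subr_ge0 s2 sqr_ge0.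
have sE : sin (asin s) = s by rewrite asinK// in_itv.
have cE : cos (asin s) = ReC q / p.
  by rewrite (cos_asin s1) s2 sqrtr_sqr; apply: ger0_norm; apply: divr_ge0 => //; exact: ltW.
exists (ln p), (asin s); split.
  apply/andP; split; first exact: asin_geNpi2.
  have := asin_lepi2 s1; rewrite le_eqVlt => /orP[/eqP h|//]; exfalso.
  move: sE; rewrite h sin_pihalf => /esym s1'.
  have sp : ImC q = p by move/(congr1 (fun t => t * p)): s1'; rewrite /s divfK ?mul1r// gt_eqF.
  move: cE; rewrite h cos_pihalf => /esym/eqP.
  rewrite mulf_eq0 invr_eq0 (gt_eqF p0) orbF => /eqP r0.
  by case: hq => [|[_]]; rewrite ?r0 ?ltxx// sp ltNge ltW.
by apply: Cext; rewrite /cexp/= lnK ?posrE// ?sE ?cE /s mulrC divfK// gt_eqF.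
Qed.

Lemma cexp_surj q : q != 0 -> exists x t : R, q = cexp (mkC x t).
Proof.
move=> q0; have [/cexp_right_half[x [t [_ ->]]]|/(right_half_opp q0).2/cexp_right_half[x [t [_ h]]]] := pselect (right_half q).
  by exists x, t.
exists x, (t + pi); rewrite -[q]opprK h (_ : mkC x (t + pi) = mkC x t + mkC 0 pi).
  by rewrite cexpD; apply: Cext; rewrite ?ReCM ?ImCM ?ReCN ?ImCN /cexp/= expR0 cospi sinpi; ring.
by apply: Cext; rewrite ?ReCD ?ImCD/= ?addr0.
Qed.

Lemma measurable_right_half n (j : 'I_n) (c : Cplx R) :
  measurable ([set w | right_half (w 0 j / c)] : set (borel 'rV[Cplx R]_n)).
Proof.
have cc : continuous (fun w : 'rV[Cplx R]_n => w 0 j / c).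
  by apply: contM; [exact: coord_continuous|exact: cst_continuous].
have cr : continuous (fun w : 'rV[Cplx R]_n => ReC (w 0 j / c)).
  move=> w; apply: (@continuous_comp _ _ _ (fun w : 'rV[Cplx R]_n => w 0 j / c) (@ReC R)).
    exact: cc.
  exact: ReC_continuous.
have ci : continuous (fun w : 'rV[Cplx R]_n => ImC (w 0 j / c)).
  move=> w; apply: (@continuous_comp _ _ _ (fun w : 'rV[Cplx R]_n => w 0 j / c) (@ImC R)).
    exact: cc.
  exact: ImC_continuous.
have mr := continuous_borel cr; have mi := continuous_borel ci.
apply: measurableU.
  rewrite -[X in measurable X]setTI.
  by have := mr measurableT _ (measurable_itv `]0, +oo[); rewrite set_itvoy.
apply: measurableI.
  rewrite -[X in measurable X]setTI.
  exact: mr measurableT _ (measurable_set1 0).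
rewrite -[X in measurable X]setTI.
by have := mi measurableT _ (measurable_itv `]-oo, 0[); rewrite set_itvNyo.
Qed.

End half_plane.

(** * Torus-invariant integrals near the torus of z *)

Section near.
Context {R : realType} {m : nat}.
Variables (X : set 'rV[Cplx R]_m.+1)
  (mu : {measure set (borel 'rV[Cplx R]_m.+1) -> \bar R})
  (z : 'rV[Cplx R]_m.+1) (k : 'rV[R]_m -> R) (D : set 'rV[R]_m) (r : R).
Hypothesis mX : measurable (X : set (borel 'rV[Cplx R]_m.+1)).
Hypothesis rotX : forall th, X `<=` @torus_act R m.+1 th @^-1` X.
Hypothesis mu_inv : torus_invariant mu.
Hypothesis mu_smooth : smooth_positive_measure X mu.
Hypothesis z0 : forall j, z 0 j != 0.
Hypothesis oD : open D.
Hypothesis sk : smooth D k.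
Hypothesis rD : forall y : 'rV[R]_m, (forall i, `|y 0 i| <= r) -> D y.

Definition shell : set 'rV[Cplx R]_m.+1 := [set w | forall i : 'I_m,
  expR (- r) ^+ 2 < cabs2 (w 0 (lift ord0 i) / z 0 (lift ord0 i)) < expR r ^+ 2].
Definition near_part : set 'rV[Cplx R]_m.+1 := X `&` shell.

Hypothesis Xk : forall y th, D y -> X (polar z (consr (k y) y) th).
Hypothesis Xlog : forall x th, X (polar z x th) ->
  (forall i, `|x 0 (lift ord0 i)| < r) -> x 0 ord0 = k (\row_i x 0 (lift ord0 i)).
Hypothesis X0 : forall w, near_part w -> w 0 ord0 != 0.

Lemma cabs2_continuous n (j : 'I_n) (c : Cplx R) :
  continuous (fun w : 'rV[Cplx R]_n => cabs2 (w 0 j / c)).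
Proof.
have cc : continuous (fun w : 'rV[Cplx R]_n => w 0 j / c).
  by apply: contM; [exact: coord_continuous|exact: cst_continuous].
have cr : continuous (fun w : 'rV[Cplx R]_n => ReC (w 0 j / c)).
  move=> w; apply: (@continuous_comp _ _ _ (fun w : 'rV[Cplx R]_n => w 0 j / c) (@ReC R)).
    exact: cc.
  exact: ReC_continuous.
have ci : continuous (fun w : 'rV[Cplx R]_n => ImC (w 0 j / c)).
  move=> w; apply: (@continuous_comp _ _ _ (fun w : 'rV[Cplx R]_n => w 0 j / c) (@ImC R)).
    exact: cc.
  exact: ImC_continuous.
exact: contD (contM cr cr) (contM ci ci).
Qed.

Lemma measurable_near_part : measurable (near_part : set (borel 'rV[Cplx R]_m.+1)).
Proof.
apply: measurableI => //; apply: open_borel; apply: (@open_forall _ _ (fun i w => _)) => i.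
apply: (@open_comp _ _ (fun w : 'rV[Cplx R]_m.+1 => cabs2 (w 0 (lift ord0 i) / z 0 (lift ord0 i)))
  [set x | expR (- r) ^+ 2 < x < expR r ^+ 2]).
  by move=> w _; exact: cabs2_continuous.
rewrite (_ : [set x | _] = `](expR (- r) ^+ 2), (expR r ^+ 2)[%classic); first exact: interval_open.
by apply/seteqP; split => x /=; rewrite in_itv.
Qed.

Lemma near_neq0 w j : near_part w -> w 0 j != 0.
Proof.
move=> nw; case: (unliftP ord0 j) => [i ->|->]; last exact: X0.
have [_ /(_ i) /andP[h _]] := nw; apply/eqP => w0; move: h.
by rewrite w0 mul0r /cabs2/= expr0n addr0 ltNge sqr_ge0.
Qed.

Lemma near_rot th w : near_part (torus_act th w) <-> near_part w.
Proof.
have X_rot : X (torus_act th w) <-> X w.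
  by rewrite -[X in _ <-> X w](torus_preimage rotX th).
suff E : shell (torus_act th w) <-> shell w by split=> -[/X_rot a /E b].
have E j : cabs2 (torus_act th w 0 j / z 0 j) = cabs2 (w 0 j / z 0 j).
  by rewrite mxE -mulrA [LHS]cabs2M cabs2_cexp expR0 expr1n mul1r.
by split=> h i; have := h i; rewrite E.
Qed.

Definition sector q : set 'rV[Cplx R]_m.+1 :=
  [set w : 'rV[Cplx R]_m.+1 | forall j : 'I_m.+1, (j < q)%N -> right_half (w 0 j / z 0 j)].

Lemma measurable_sector q : measurable (sector q : set (borel 'rV[Cplx R]_m.+1)).
Proof.
rewrite (_ : sector q = \bigcap_(j in [set j : 'I_m.+1 | (j < q)%N]) [set w : 'rV[Cplx R]_m.+1 | right_half (w 0 j / z 0 j)]).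
  apply: fin_bigcap_measurable => [|j _]; first exact: finite_finset.
  exact: measurable_right_half.
by apply/seteqP; split => w h j; exact: h.
Qed.

Definition flip (q : 'I_m.+1) : 'I_m.+1 -> R := fun j => if j == q then pi else 0.

Lemma flip_coord q w j : torus_act (flip q) w 0 j = if j == q then - w 0 j else w 0 j.
Proof.
rewrite mxE /flip; case: ifP => _.
  by apply: Cext; rewrite ?ReCM ?ImCM ?ReCN ?ImCN /cexp/= expR0 cospi sinpi; ring.
by rewrite (_ : mkC 0 0 = 0)// cexp0 mul1r.
Qed.

Lemma integral_sectorS (q : 'I_m.+1) (f : 'rV[Cplx R]_m.+1 -> \bar R) :
  measurable_fun setT (f : borel _ -> \bar R) -> (forall w, 0 <= f w)%E ->
  (forall th w, f (torus_act th w) = f w) ->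
  (\int[mu]_(w in near_part `&` sector q) f w =
   2%:E * \int[mu]_(w in near_part `&` sector q.+1) f w)%E.
Proof.
move=> mf f0 fT.
pose H : set 'rV[Cplx R]_m.+1 := [set w : 'rV[Cplx R]_m.+1 | right_half (w 0 q / z 0 q)].
have mH : measurable (H : set (borel _)) by exact: measurable_right_half.
pose A := near_part `&` sector q.
have mA : measurable (A : set (borel _)).
  by apply: measurableI; [exact: measurable_near_part|exact: measurable_sector].
have AH : near_part `&` sector q.+1 = A `&` H.
  apply/seteqP; split => w.
    move=> [nw h]; split; last exact: h.
    by split => // j jq; apply: h; exact: ltnW.
  move=> [[nw h1] h2]; split => // j; rewrite ltnS leq_eqVlt => /orP[/eqP jq|]; last exact: h1.
  by rewrite (_ : j = q)//; exact: val_inj.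
have AC : near_part `&` sector q = (A `&` H) `|` (A `&` ~` H) by rewrite -setIUr setUCr setIT.
have mAH : measurable (A `&` H : set (borel _)) by exact: measurableI.
have mAC : measurable (A `&` ~` H : set (borel _)) by apply: measurableI => //; exact: measurableC.
rewrite AC AH ge0_integral_setU//; last 2 first.
- exact: measurable_funTS.
- by apply/disj_setPS => w [[_ h] [_ h']].
suff -> : (\int[mu]_(x in A `&` ~` H) f x = \int[mu]_(x in A `&` H) f x)%E.
  by rewrite -[(2%:E)%E]/((1 + 1)%:E)%E EFinD ge0_muleDl ?mul1e ?lee_fin//.
pose g : borel 'rV[Cplx R]_m.+1 -> borel 'rV[Cplx R]_m.+1 := torus_act (flip q).
have mg : measurable_fun setT g by exact: torus_act_measurable.
pose pm : {measure set (borel 'rV[Cplx R]_m.+1) -> \bar R} :=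
  measure_function_pushforward__canonical__measure_function_Measure mu mg.
rewrite [RHS](@eq_measure_integral _ _ _ _ pm); last first.
  by move=> B mB _; rewrite -[LHS](mu_inv (flip q) mB).
rewrite [RHS](@ge0_integral_pushforward _ _ _ _ _ _ mg)//; last exact: measurable_funTS.
have -> : g @^-1` (A `&` H) = A `&` ~` H.
  have hq w : right_half (g w 0 q / z 0 q) = right_half (- (w 0 q / z 0 q)).
    by rewrite /g flip_coord eqxx mulNr.
  have n0 w : near_part w -> w 0 q / z 0 q != 0.
    by move=> nw; apply: mulf_neq0; [exact: near_neq0|rewrite invr_eq0; exact: z0].
  have sq w : sector q (g w) <-> sector q w.
    have E (j : 'I_m.+1) : (j < q)%N -> g w 0 j = w 0 j.
      by move=> jq; rewrite /g flip_coord ifF//; apply/negbTE; rewrite neq_ltn jq.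
    by split=> h j jq; have := h j jq; rewrite E.
  apply/seteqP; split => w.
    move=> [[/near_rot nw /sq sw]]; rewrite /H/= hq => /right_half_opp h.
    by split => //; apply: h; exact: n0.
  move=> [[nw sw] hw]; split; last by rewrite /H/= hq; apply/right_half_opp => //; exact: n0.
  by split; [exact/near_rot|exact/sq].
by apply: eq_integral => w _; rewrite /= fT.
Qed.

(** A half turn in one coordinate exchanges a half plane with its complement, so
   each coordinate contributes a factor 2 to the integral of an invariant
   function; what remains is a sector inside one coordinate chart. *)
Lemma integral_sector (f : 'rV[Cplx R]_m.+1 -> \bar R) :
  measurable_fun setT (f : borel _ -> \bar R) -> (forall w, 0 <= f w)%E ->
  (forall th w, f (torus_act th w) = f w) ->
  (\int[mu]_(w in near_part) f w =
   (2 ^+ m.+1)%:E * \int[mu]_(w in near_part `&` sector m.+1) f w)%E.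
Proof.
move=> mf f0 fT.
have H q : (q <= m.+1)%N -> (\int[mu]_(w in near_part) f w =
   (2 ^+ q)%:E * \int[mu]_(w in near_part `&` sector q) f w)%E.
  elim: q => [_|q IH qm].
    by rewrite mul1e; congr (integral mu _ f); apply/seteqP; split => w; [move=> h|case].
  rewrite IH ?(ltnW qm)// (@integral_sectorS (Ordinal qm) f)//= muleA -EFinM exprSr //.
exact: H.
Qed.

(** Half-open in the angles, so that the chart covers a sector exactly once. *)
Definition window : set 'rV[R]_(m.*2.+1) := [set v |
  (forall i, `|ypart v 0 i| < r) /\ forall j, - (pi / 2) <= tpart v 0 j < pi / 2].

Lemma window_pdom v : window v -> pdom r v.
Proof.
move=> [h1 h2]; split => // j; have /andP[a b] := h2 j.
have := pihalf_02 R => /andP[_ p2]; rewrite ltr_norml; apply/andP; split.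
  by apply: lt_le_trans a; rewrite ltrN2.
exact: lt_trans p2.
Qed.

Definition joinv (y : 'rV[R]_m) (th : 'rV[R]_m.+1) : 'rV[R]_(m.*2.+1) :=
  \row_q row_mx y th 0 (cast_ord (esym (dim_split (m:=m))) q).

Lemma ypart_joinv y th : ypart (joinv y th) = y.
Proof. by apply/rowP => i; rewrite 2!mxE cast_ordK row_mxEl. Qed.

Lemma tpart_joinv y th : tpart (joinv y th) = th.
Proof. by apply/rowP => i; rewrite 2!mxE cast_ordK row_mxEr. Qed.

Lemma phi_ratio v j : phi k z v 0 j / z 0 j = cexp (mkC (xlog k v 0 j) (tpart v 0 j)).
Proof. by rewrite mxE mulfK. Qed.

Lemma expR_sqr_window x : expR (- r) ^+ 2 < expR x ^+ 2 < expR r ^+ 2 = (`|x| < r).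
Proof. by rewrite !ltr_pXn2r ?nnegrE ?expR_ge0// !ltr_expR ltr_norml. Qed.

Lemma window_phi v : window v -> (near_part `&` sector m.+1) (phi k z v).
Proof.
move=> wv; have Dv := pdom_D rD (window_pdom wv); case: wv => [h1 h2].
split; last by move=> j _; rewrite phi_ratio; exact: right_half_cexp.
split; first exact: Xk.
by move=> i; rewrite phi_ratio cabs2_cexp expR_sqr_window /xlog consrS.
Qed.

Lemma phi_window w : (near_part `&` sector m.+1) w -> exists2 v, window v & phi k z v = w.
Proof.
move=> [[Xw sw] hw].
have /choice[p hp] : forall j, exists p : R * R, - (pi / 2) <= p.2 < pi / 2 /\
    w 0 j / z 0 j = cexp (mkC p.1 p.2).
  by move=> j; have [x [t ?]] := cexp_right_half (hw j (ltn_ord j)); exists (x, t).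
pose x := \row_j (p j).1; pose th := \row_j (p j).2.
have wE : w = polar z x th.
  apply/rowP => j; have [_ E] := hp j.
  by rewrite !mxE -E divfK.
have xr i : `|x 0 (lift ord0 i)| < r.
  by have := sw i; have [_ ->] := hp (lift ord0 i); rewrite cabs2_cexp expR_sqr_window mxE.
pose y := \row_i x 0 (lift ord0 i).
have xE : x = consr (k y) y.
  by rewrite {1}[x]consr_eta (Xlog (th := th)) -?wE.
exists (joinv y th).
  split; first by move=> i; rewrite ypart_joinv mxE.
  by move=> j; rewrite tpart_joinv mxE; have [] := hp j.
by rewrite wE xE /phi /xlog ypart_joinv tpart_joinv.
Qed.

Lemma window_phiE v : pdom r v -> (near_part `&` sector m.+1) (phi k z v) <-> window v.
Proof.
move=> pv; split; last exact: window_phi.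
move=> /phi_window[v' wv' E].
suff <- : v' = v by [].
by apply: (@phi_inj R m k z r z0) E; rewrite inE//; exact: window_pdom.
Qed.

Lemma phi_cont v : pdom r v -> {for v, continuous (phi k z)}.
Proof.
move=> pv; apply: continuous_rV => j.
have hR : {for v, continuous (fun v => ReC (phi k z v 0 j))}.
  rewrite (_ : (fun v => _) = (fun v => to_real (phi k z v) 0 (lshift m.+1 j))).
    exact: (smooth_cont (smooth_phi z oD sk rD (lshift m.+1 j)) pv).
  by apply/funext => u; rewrite /to_real row_mxEl mxE.
have hI : {for v, continuous (fun v => ImC (phi k z v 0 j))}.
  rewrite (_ : (fun v => _) = (fun v => to_real (phi k z v) 0 (rshift m.+1 j))).
    exact: (smooth_cont (smooth_phi z oD sk rD (rshift m.+1 j)) pv).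
  by apply/funext => u; rewrite /to_real row_mxEr mxE.
exact: (@cvg_complex R _ (nbhs v) (nbhs_filter v) (fun v => phi k z v 0 j) (phi k z v 0 j) hR hI).
Qed.

Lemma measurable_phi : measurable_fun (pdom r : set (borel _))
  (phi k z : borel _ -> borel 'rV[Cplx R]_m.+1).
Proof.
apply: measurable_borel_fun => A oA; apply: open_borel; rewrite openE => v [pv Av].
apply: (@filterI _ (nbhs v) (nbhs_filter v)); first exact: open_nbhs_nbhs (conj (@open_pdom R m r) pv).
by apply: (phi_cont pv); exact: open_nbhs_nbhs (conj oA Av).
Qed.

Lemma measurable_forall d (T : measurableType d) (I : finType) (P : I -> set T) :
  (forall i, measurable (P i)) -> measurable [set x | forall i, P i x].
Proof.
move=> mP; rewrite (_ : [set x | _] = \bigcap_(i in [set: I]) P i).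
  by apply: fin_bigcap_measurable => // ; exact: finite_finset.
by apply/seteqP; split => w h i; [move=> _|]; exact: h.
Qed.

Lemma measurable_window : measurable (window : set (borel _)).
Proof.
apply: measurableI.
  apply: (@measurable_forall _ _ _ (fun i v => _)) => i; apply: open_borel.
  rewrite (_ : (fun v => _) = [set v : 'rV[R]_(m.*2.+1) | `|v 0 (yix i)| < r]).
    exact: open_norm_coord.
  by apply/funext => v; rewrite /= mxE.
apply: (@measurable_forall _ _ _ (fun i v => _)) => j.
have cj : continuous (fun v : 'rV[R]_(m.*2.+1) => v 0 (tix j)) by exact: coord_continuous.
have mc := continuous_borel cj.
have := mc measurableT _ (measurable_itv `[- (pi / 2), pi / 2[).
rewrite setTI; congr measurable; apply/seteqP; split => v; by rewrite /= in_itv mxE.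
Qed.

(** One parametrization covers a fundamental sector of the near part, so its
   density computes every torus-invariant integral there. *)
Lemma near_formula : exists a : 'rV[R]_(m.*2.+1) -> R,
  [/\ forall v, pdom r v -> {for v, continuous a},
      forall v, pdom r v -> 0 < a v,
      forall f : 'rV[Cplx R]_m.+1 -> \bar R,
        measurable_fun setT (f : borel _ -> \bar R) ->
        measurable_fun (pdom r : set (borel _)) (fun v : borel 'rV[R]_(m.*2.+1) =>
          (f (phi k z v) * (\1_window v * a v)%:E)%E) &
      forall f : 'rV[Cplx R]_m.+1 -> \bar R,
        measurable_fun setT (f : borel _ -> \bar R) -> (forall w, 0 <= f w)%E ->
        (forall th w, f (torus_act th w) = f w) ->
        (\int[mu]_(w in near_part) f w = (2 ^+ m.+1)%:E *
          \int[lam (m.*2.+1)]_(v in pdom r) (f (phi k z v) * (\1_window v * a v)%:E))%E].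
Proof.
have [_ /(_ _ _ (phi_parametrization oD sk z0 rD Xk))[a [sa a0 muE]]] := mu_smooth.
have ac v : pdom r v -> {for v, continuous a}.
  by move=> pv; have [] := sa [::] v pv.
have mpd : measurable (pdom r : set (borel 'rV[R]_(m.*2.+1))) by apply: open_borel; exact: open_pdom.
have mw : measurable_fun (pdom r : set (borel _)) (fun v : borel 'rV[R]_(m.*2.+1) => (\1_window v : R) * a v).
  apply: measurable_funM.
    by apply: measurable_funTS; exact: measurable_indic measurable_window.
  by apply: continuous_borel_on; [exact: open_pdom|move=> v /[!inE]; exact: ac].
have w0 v : 0 <= \1_window v * a v.
  rewrite indicE; case: (boolP (v \in window)) => [/[!inE]/window_pdom/a0/ltW h|_].
    by rewrite mul1r.
  by rewrite mul0r.
exists a; split => //.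
  move=> f mf; apply: emeasurable_funM; last exact/measurable_EFinP.
  by apply: (@measurable_comp _ _ _ (borel 'rV[R]_(m.*2.+1)) (borel 'rV[Cplx R]_m.+1) _ setT f (pdom r) (phi k z)) => //; exact: measurable_phi.
move=> f mf f0 fT.
rewrite integral_sector//; congr (_ * _)%E.
apply: (integral_density _ _ measurable_phi mw w0 _ mf f0) => //.
  by apply: measurableI; [exact: measurable_near_part|exact: measurable_sector].
move=> B mB.
have mBD : measurable (B `&` (near_part `&` sector m.+1)).
  apply: measurableI => //.
  by apply: measurableI; [exact: measurable_near_part|exact: measurable_sector].
rewrite (muE _ mBD); last first.
  by move=> w [_ /phi_window[v wv <-]]; exists v => //; exact: window_pdom.
have E : (fun v => if `[< pdom r v /\ (B `&` (near_part `&` sector m.+1)) (phi k z v) >] then (a v)%:E else 0%E) =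
    (fun v => ((\1_B (phi k z v))%:E * (\1_window v * a v)%:E)%E) \_ (pdom r).
  apply/funext => v; rewrite patchE; case: (boolP (v \in pdom r)) => [/[!inE] pv|/negP h]; last first.
    by rewrite asboolF// => -[pv _]; apply: h; rewrite inE.
  have [H|h] := pselect (pdom r v /\ (B `&` (near_part `&` sector m.+1)) (phi k z v)); [rewrite asboolT//|rewrite asboolF//].
    case: H => _ [Bv wv].
    have {}wv := (window_phiE pv).1 wv.
    by rewrite !indicE !mem_set// !mul1r mul1e.
  rewrite !indicE -EFinM; case: (boolP (phi k z v \in B)) => [/[!inE] Bv|]; last by rewrite !mul0r.
  case: (boolP (v \in window)) => [/[!inE] wv|]; last by rewrite mul0r mulr0.
  by exfalso; apply: h; split => //; split => //; exact: window_phi.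
rewrite E lebesgue_integral_rVE//.
- by rewrite [RHS]integral_mkcond.
- apply/(measurable_restrictT _ mpd); apply: emeasurable_funM; apply/measurable_EFinP => //.
  by apply: (@measurable_comp _ _ _ (borel 'rV[R]_(m.*2.+1)) (borel 'rV[Cplx R]_m.+1) R setT (\1_B) (pdom r) (phi k z)) => //; exact: measurable_phi.
- by move=> v; apply: erestrict_ge0 => u; rewrite mule_ge0// lee_fin.
Qed.
End near.

(** * Weights of the monomials and their lower bound *)

Section weights.
Context {R : realType} {m : nat}.
Variables (X : set 'rV[Cplx R]_m.+1) (z : 'rV[Cplx R]_m.+1).
Hypothesis bX : exists M : R, forall w, X w -> forall j, `|ReC (w 0 j)| <= M /\ `|ImC (w 0 j)| <= M.
Hypothesis z0 : forall j, z 0 j != 0.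
Implicit Types a : mpoly.multinom m.+1.

Definition wgt a w : R := cabs2 (mono a w) / cabs2 (mono a z).

Lemma mono_neq0 a : mono a z != 0.
Proof. by apply/prodf_neq0 => j _; rewrite expf_neq0. Qed.

Lemma wgt_ge0 a w : 0 <= wgt a w.
Proof. by rewrite divr_ge0 ?cabs2_ge0. Qed.

Lemma cabs2_prod (I : Type) (s : seq I) (f : I -> Cplx R) :
  cabs2 (\prod_(i <- s) f i) = \prod_(i <- s) cabs2 (f i).
Proof.
elim: s => [|i s IH]; last by rewrite !big_cons cabs2M IH.
by rewrite !big_nil /cabs2/= expr1n expr0n addr0.
Qed.

Lemma cabs2X (c : Cplx R) n : cabs2 (c ^+ n) = cabs2 c ^+ n.
Proof.
elim: n => [|n IH]; last by rewrite !exprS cabs2M IH.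
by rewrite /cabs2/= expr1n expr0n addr0.
Qed.

Lemma wgt_polar a x th : wgt a (polar z x th) =
  expR (2 * \sum_j (fun_of_multinom a j)%:R * x 0 j).
Proof.
rewrite /wgt; have -> : mono a (polar z x th) =
    \prod_j cexp (mkC (x 0 j) (th 0 j)) ^+ fun_of_multinom a j * mono a z.
  by rewrite /mono -big_split; apply: eq_bigr => j _; rewrite mxE exprMn.
rewrite cabs2M mulfK ?gt_eqF ?cabs2_gt0 ?mono_neq0//.
rewrite cabs2_prod mulr_sumr expR_sum; apply: eq_bigr => j _.
by rewrite cabs2X cabs2_cexp -!expRM_natl mulrCA.
Qed.

Lemma wgt_torus a th w : wgt a (torus_act th w) = wgt a w.
Proof.
rewrite /wgt; congr (_ / _); rewrite /mono !cabs2_prod; apply: eq_bigr => j _.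
by rewrite mxE !cabs2X cabs2M cabs2_cexp expR0 expr1n mul1r.
Qed.

Lemma wgt_zero a (w : 'rV[Cplx R]_m.+1) j : w 0 j = 0 -> (0 < fun_of_multinom a j)%N -> wgt a w = 0.
Proof.
move=> wj aj.
have mw : mono a w = 0.
  by apply/eqP/prodf_eq0; exists j => //; rewrite wj expr0n eqn0Ngt aj.
have c0 : cabs2 (0 : Cplx R) = 0 by rewrite /cabs2/= expr0n addr0.
by rewrite /wgt mw c0 mul0r.
Qed.

Lemma wgt_continuous a : continuous (wgt a).
Proof.
have [cr ci _] := bcont_mono bX a.
have c2 : continuous (fun w => cabs2 (mono a w)) := contD (contM cr cr) (contM ci ci).
exact: contM c2 (@cst_continuous _ _ _).
Qed.

Lemma measurable_wgt a : measurable_fun setT (fun w : borel 'rV[Cplx R]_m.+1 => (wgt a w)%:E).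
Proof. by apply/measurable_EFinP; apply: continuous_borel; exact: wgt_continuous. Qed.

Lemma wgt_phi a (k : 'rV[R]_m -> R) v : wgt a (phi k z v) =
  expR (2 * ((fun_of_multinom a ord0)%:R * k (ypart v) +
    \sum_i (fun_of_multinom a (lift ord0 i))%:R * ypart v 0 i)).
Proof.
rewrite wgt_polar big_ord_recl /xlog consr0; congr (expR (2 * (_ + _))).
by apply: eq_bigr => i _; rewrite consrS.
Qed.
End weights.

Section box_volume.
Context {R : realType} {m : nat}.

Lemma box_volume (b : 'I_(m.*2.+1) -> R) (d e : R) : 0 <= d -> 0 <= e ->
  let g (q : 'I_(m.*2.+1)) (x : measurableTypeR R) : \bar R :=
    (\1_(`[b q, b q + (if (q < m)%N then d else e)]%classic) x)%:E in
  measurable_fun setT (fun v : borel 'rV[R]_(m.*2.+1) => \prod_q g q (v 0%R q))%E /\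
  (\int[lam (m.*2.+1)]_v \prod_q g q (v 0%R q) = (d ^+ m * e ^+ m.+1)%:E)%E.
Proof.
move=> d0 e0 g.
have [||h1 ->] := @integral_prod R _ g.
- by move=> i; apply/measurable_EFinP; exact: measurable_indic.
- by move=> i x; rewrite lee_fin.
split => //.
rewrite (eq_bigr (fun q : 'I_(m.*2.+1) => (if (q < m)%N then d else e)%:E)); last first.
  move=> q _; rewrite integral_indic// setIT /= lebesgue_measure_itv/= lte_fin.
  case: ltP => [_|]; first by rewrite -EFinB addrC addKr.
  rewrite gerDl => h; congr EFin; move: h; case: ifP => _ h; apply/eqP; rewrite eq_le ?d0 ?e0 ?h//.
rewrite prodEFin prod_split; congr EFin; congr (_ * _).
  by rewrite (eq_bigr (fun=> d)) ?prodr_const ?card_ord// => i _; rewrite /yix/= ltn_ord.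
by rewrite (eq_bigr (fun=> e)) ?prodr_const ?card_ord// => i _; rewrite /tix/= ltnNge leq_addr.
Qed.
End box_volume.

Section lower_bound.
Context {R : realType} {m : nat}.
Variables (X : set 'rV[Cplx R]_m.+1)
  (mu : {measure set (borel 'rV[Cplx R]_m.+1) -> \bar R})
  (z : 'rV[Cplx R]_m.+1) (k : 'rV[R]_m -> R) (r C : R).
Hypothesis mX : measurable (X : set (borel 'rV[Cplx R]_m.+1)).
Hypothesis bX : exists M : R, forall w, X w -> forall j, `|ReC (w 0 j)| <= M /\ `|ImC (w 0 j)| <= M.
Hypothesis z0 : forall j, z 0 j != 0.
Hypothesis r0 : 0 < r.
Hypothesis k0 : k 0 = 0.
Variable h : 'I_m -> R.
Hypothesis C0 : 0 <= C.
Hypothesis k_lower : forall y : 'rV[R]_m, (forall i, `|y 0 i| <= r) ->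
  - (\sum_i h i * y 0 i) - C * nsq y <= k y.
Variable a : 'rV[R]_(m.*2.+1) -> R.
Hypothesis a_cont : forall v, pdom r v -> {for v, continuous a}.
Hypothesis a_gt0 : forall v, pdom r v -> 0 < a v.
Hypothesis near_int : forall f : 'rV[Cplx R]_m.+1 -> \bar R,
        measurable_fun setT (f : borel _ -> \bar R) -> (forall w, 0 <= f w)%E ->
        (forall th w, f (torus_act th w) = f w) ->
        (\int[mu]_(w in near_part X z r) f w = (2 ^+ m.+1)%:E *
          \int[lam (m.*2.+1)]_(v in pdom r) (f (phi k z v) * (\1_(window r) v * a v)%:E))%E.
Hypothesis near_meas : forall f : 'rV[Cplx R]_m.+1 -> \bar R,
        measurable_fun setT (f : borel _ -> \bar R) ->
        measurable_fun (pdom r : set (borel _))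
          (fun v : borel 'rV[R]_(m.*2.+1) => (f (phi k z v) * (\1_(window r) v * a v)%:E)%E).
Hypothesis mnear : measurable (near_part X z r : set (borel _)).

Implicit Types b : mpoly.multinom m.+1.

Definition sc (l : nat) : R := Num.sqrt l.+1%:R.
(** Offset of the exponents from the ray spanned by the normal at z, in units of
   the width of the Gaussian peak. *)
Definition dev b i : R := ((fun_of_multinom b (lift ord0 i))%:R - (fun_of_multinom b ord0)%:R * h i) / sc (fun_of_multinom b ord0).

Lemma sc_gt0 l : 0 < sc l. Proof. by rewrite sqrtr_gt0. Qed.
Lemma sc2 l : sc l ^+ 2 = l.+1%:R. Proof. by rewrite sqr_sqrtr. Qed.
Lemma sc_ge1 l : 1 <= sc l.
Proof. by rewrite -(ler_pXn2r (n:=2))// ?nnegrE ?sqrtr_ge0// sc2 expr1n ler1n. Qed.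
Lemma sc_le l : sc l <= l.+1%:R.
Proof. by rewrite -sc2 expr2 ler_peMr ?sc_ge1// ltW// sc_gt0. Qed.

(** The part of the integral over a box of size [d / sqrt l] in the quadrant
    where the monomial exceeds its value at [z] is already this large. *)
Lemma wgt_lower : exists2 c : R, 0 < c & forall b,
  ((c * (sc (fun_of_multinom b ord0) ^+ m)^-1 * expR (c * \sum_i `|dev b i|))%:E <=
   \int[mu]_(w in X) (wgt z b w)%:E)%E.
Proof.
have p0 : pdom r (0 : 'rV[R]_(m.*2.+1)).
  by split => i; rewrite !mxE normr0.
have a00 := a_gt0 p0.
have [e /= e0 he] : exists2 e : R, 0 < e & forall v : 'rV[R]_(m.*2.+1), (forall q, `|v 0 q| < e) -> a 0 / 2 <= a v.
  have : \forall v \near (0 : 'rV[R]_(m.*2.+1)), `|a 0 - a v| < a 0 / 2.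
    have /(@cvgrPdist_lt _ _ _ (nbhs (0 : 'rV[R]_(m.*2.+1))) (nbhs_filter _) a (a 0)) := a_cont p0.
    by apply; rewrite divr_gt0.
  move=> /nbhs_ballP[e /= e0 he]; exists e => // v hv.
  have : `|a 0 - a v| < a 0 / 2.
    by apply: he; split => // i q; rewrite (ord1 i) /ball/= mxE sub0r normrN.
  rewrite ltr_norml => /andP[_]; lra.
pose d := Num.min (Num.min (r / 2) (e / 2)) (1 / 2).
have d0 : 0 < d by rewrite !lt_min !divr_gt0.
have dr : d < r by rewrite /d !gt_min; apply/orP; left; apply/orP; left; rewrite ltr_pdivrMr// ltr_pMr// ltr1n.
have de : d < e by rewrite /d !gt_min; apply/orP; left; apply/orP; right; rewrite ltr_pdivrMr// ltr_pMr// ltr1n.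
have d1 : d <= 1 / 2 by rewrite /d ge_min lexx orbT.
pose K := expR (- (2 * C * m%:R * d ^+ 2)) * (a 0 / 2) * (2 ^+ m.+1) * (d / 2) ^+ m * d ^+ m.+1.
have K0 : 0 < K by rewrite !mulr_gt0 ?expR_gt0 ?exprn_gt0 ?divr_gt0.
exists (Num.min K d); first by rewrite lt_min K0.
move=> b; set l := fun_of_multinom b ord0; set s := sc l.
have s0 : 0 < s := sc_gt0 l.
have s1 : 1 <= s := sc_ge1 l.
pose lo (q : 'I_(m.*2.+1)) : R :=
  if insub (q : nat) is Some i then (if 0 <= dev b i then d / 2 / s else - (d / s)) else 0.
pose g (q : 'I_(m.*2.+1)) (x : measurableTypeR R) : \bar R :=
  (\1_(`[lo q, lo q + (if (q < m)%N then d / 2 / s else d)]%classic) x)%:E.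
have [mg vol] : measurable_fun setT (fun v : borel 'rV[R]_(m.*2.+1) => \prod_q g q (v 0%R q))%E /\
    (\int[lam (m.*2.+1)]_v \prod_q g q (v 0%R q) = ((d / 2 / s) ^+ m * d ^+ m.+1)%:E)%E
  := box_volume lo (ltW (divr_gt0 (divr_gt0 d0 (ltr0Sn _ 1)) s0)) (ltW d0).
have lo_y i : lo (yix i) = if 0 <= dev b i then d / 2 / s else - (d / s).
  by rewrite /lo insubT/= => [|p]; [exact: ltn_ord|congr (if 0 <= dev b _ then _ else _); exact: val_inj].
have lo_t j : lo (tix j) = 0.
  by rewrite /lo insubF//= ltnNge leq_addr.
pose Y := expR (2 * (d / 2 * \sum_i `|dev b i| - C * m%:R * d ^+ 2)) * (a 0 / 2).
have Y0 : 0 <= Y by rewrite mulr_ge0 ?expR_ge0// ltW// divr_gt0.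
have inbox (v : 'rV[R]_(m.*2.+1)) : (forall q, v 0 q \in `[lo q, lo q + (if (q < m)%N then d / 2 / s else d)]) ->
    [/\ pdom r v, window r v & Y <= wgt z b (phi k z v) * a v].
  move=> hv.
  have hy i : if 0 <= dev b i then d / 2 / s <= ypart v 0 i <= d / s else - (d / s) <= ypart v 0 i <= - (d / 2 / s).
    have := hv (yix i); rewrite in_itv/= mxE lo_y ltn_ord; case: ifP => _.
      by rewrite -mulrDl -splitr.
    have -> : - (d / s) + d / 2 / s = - (d / 2 / s) by rewrite {1}(splitr d) mulrDl; ring.
    by [].
  have ht j : 0 <= tpart v 0 j <= d.
    by have := hv (tix j); rewrite in_itv/= mxE lo_t add0r ltnNge leq_addr.
  have ds : d / s <= d by rewrite ler_pdivrMr// ler_peMr// ltW.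
  have d2s : 0 <= d / 2 / s by rewrite ltW// !divr_gt0.
  have ay i : `|ypart v 0 i| <= d / s.
    rewrite ler_norml; have := hy i.
    have : d / 2 / s <= d / s by rewrite ler_pM2r ?invr_gt0//; move: d0; lra.
    move: d2s; move: (d / 2 / s) (d / s) => t u t0 tu.
    by case: ifP => _ /andP[u1 u2]; apply/andP; split; lra.
  have wv : window r v.
    split=> [i|j]; first by apply: le_lt_trans (ay i) _; exact: le_lt_trans dr.
    have := ht j; have := pihalf_ge1 R; lra.
  split => //; first exact: window_pdom.
  have av : a 0 / 2 <= a v.
    apply: he => q; have [[i ->]|[j ->]] := yt_split q.
      by have := ay i; rewrite mxE => u; apply: le_lt_trans u _; exact: le_lt_trans de.
    by have := ht j; rewrite mxE => /andP[u1 u2]; rewrite ger0_norm//; exact: le_lt_trans u2 de.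
  have q0 : 0 <= a 0 / 2 by rewrite ltW// divr_gt0.
  apply: ler_pM => //.
  rewrite wgt_phi// ler_expR ler_pM2l//.
  have ky : - (\sum_i h i * ypart v 0 i) - C * nsq (ypart v) <= k (ypart v).
    by apply: k_lower => i; apply: le_trans (ay i) _; apply: le_trans ds _; exact: ltW.
  have n2 : l%:R * nsq (ypart v) <= m%:R * d ^+ 2.
    apply: le_trans (_ : s ^+ 2 * (m%:R * (d / s) ^+ 2) <= _); last first.
      by rewrite expr_div_n mulrCA [s ^+ 2 * _]mulrC divfK// expf_neq0// gt_eqF.
    apply: ler_pM; rewrite ?ler0n ?nsq_ge0//; first by rewrite sc2 ler_nat.
    rewrite /nsq -[X in X%:R * _](card_ord m) -sum1_card natr_sum mulr_suml.
    apply: ler_sum => i _; rewrite mul1r -real_normK ?num_real// lerXn2r ?nnegrE// ltW// divr_gt0//.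
  have dv : d / 2 * \sum_i `|dev b i| <= \sum_i ((fun_of_multinom b (lift ord0 i))%:R - l%:R * h i) * ypart v 0 i.
    rewrite mulr_sumr; apply: ler_sum => i _.
    have -> : (fun_of_multinom b (lift ord0 i))%:R - l%:R * h i = dev b i * s by rewrite /dev divfK// gt_eqF.
    have e2 : d / 2 = s * (d / 2 / s) by rewrite [RHS]mulrC divfK// gt_eqF.
    rewrite e2; have := hy i; set t := d / 2 / s; case: ifP => [d0' /andP[u1 _]|/negbT].
      rewrite ger0_norm// (_ : s * t * dev b i = dev b i * s * t); last by ring.
      by apply: ler_wpM2l => //; rewrite mulr_ge0// ltW.
    rewrite -ltNge => d0' /andP[_ u2].
    rewrite ltr0_norm// (_ : s * t * - dev b i = dev b i * s * - t); last by ring.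
    by apply: ler_wnM2l => //; rewrite mulr_le0_ge0// ltW.
  apply: le_trans (_ : \sum_i ((fun_of_multinom b (lift ord0 i))%:R - l%:R * h i) * ypart v 0 i - C * (l%:R * nsq (ypart v)) <= _).
    apply: lerB => //; rewrite -mulrA; exact: ler_wpM2l.
  apply: le_trans (_ : l%:R * (- (\sum_i h i * ypart v 0 i) - C * nsq (ypart v)) + \sum_i (fun_of_multinom b (lift ord0 i))%:R * ypart v 0 i <= _); last first.
    by rewrite lerD2r; apply: ler_wpM2l.
  under eq_bigr do rewrite mulrBl -mulrA.
  rewrite big_split/= sumrN -mulr_sumr; lra.
pose A : set 'rV[R]_(m.*2.+1) :=
  [set v | forall q, v 0 q \in `[lo q, lo q + (if (q < m)%N then d / 2 / s else d)]].
have gE (v : 'rV[R]_(m.*2.+1)) : (\prod_q g q (v 0%R q) = (\1_A v)%:E)%E.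
  rewrite prodEFin; congr EFin; rewrite [RHS]indicE.
  have [hv|hv] := pselect (A v).
    by rewrite [v \in A]mem_set//; apply: big1 => q _; rewrite indicE mem_set//; exact: hv.
  rewrite [v \in A]memNset//; move/existsNP: hv => [q hq].
  by rewrite (bigD1 q)//= indicE memNset ?mul0r.
have mwgt := measurable_wgt z bX b.
have w0 v : 0 <= wgt z b v := wgt_ge0 z b v.
apply: le_trans (_ : ((2 ^+ m.+1)%:E * (Y%:E * ((d / 2 / s) ^+ m * d ^+ m.+1)%:E) <= _)%E).
  rewrite -!EFinM lee_fin.
  have -> : 2 ^+ m.+1 * (Y * ((d / 2 / s) ^+ m * d ^+ m.+1)) = K * (s ^+ m)^-1 * expR (d * \sum_i `|dev b i|).
    rewrite /Y /K mulrBr expRD expr_div_n.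
    have -> : 2 * (d / 2 * \sum_i `|dev b i|) = d * \sum_i `|dev b i|.
      by rewrite mulrA mulrCA divff ?mulr1.
    have -> : - (2 * (C * m%:R * d ^+ 2)) = - (2 * C * m%:R * d ^+ 2) by rewrite !mulrA.
    set E1 := expR _; set E2 := expR _; set S := _^-1; ring.
  have S0 : 0 <= (s ^+ m)^-1 by rewrite invr_ge0 exprn_ge0// ltW.
  apply: ler_pM; rewrite ?expR_ge0//.
  - by rewrite mulr_ge0// le_min !ltW.
  - by apply: ler_wpM2r => //; rewrite ge_min lexx.
  - by rewrite ler_expR; apply: ler_wpM2r; [exact: sumr_ge0|rewrite ge_min lexx orbT].
rewrite -vol -ge0_integralZl//; last by move=> v _; rewrite gE lee_fin.
apply: le_trans (_ : (\int[mu]_(w in near_part X z r) (wgt z b w)%:E <= _)%E); last first.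
  by apply: ge0_subset_integral => //; [exact: measurable_funTS|move=> w _; rewrite lee_fin|move=> w []].
rewrite near_int//; last by move=> th w; rewrite wgt_torus.
apply: lee_wpmul2l; first by rewrite lee_fin exprn_ge0.
rewrite [leRHS]integral_mkcond; apply: ge0_le_integral => //.
- by move=> v _; rewrite gE -EFinM lee_fin mulr_ge0.
- by apply: measurable_funeM.
- have mpd : measurable (pdom r : set (borel 'rV[R]_(m.*2.+1))) by apply: open_borel; exact: open_pdom.
  by apply/(measurable_restrictT _ mpd); exact: (near_meas mwgt).
move=> v _; rewrite gE patchE indicE.
have [/inbox[pv wv Yv]|vA] := pselect (A v).
  by rewrite [v \in pdom r]mem_set// -!EFinM lee_fin; case: (v \in A); rewrite ?mulr1 ?mulr0 indicE [v \in window r]mem_set// mul1r// (le_trans Y0).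
rewrite [v \in A]memNset// mule0; case: ifP => [/[!inE] pv|//].
by rewrite -EFinM lee_fin mulr_ge0// mulr_ge0// ltW// a_gt0.
Qed.
End lower_bound.

(** * Analytic tools for the Laplace method *)

Section limits.
Context {R : realType}.

Lemma sandwich (a b e : R) : `|a - b| < e -> a - e <= b /\ b <= a + e.
Proof. by rewrite ltr_norml => /andP[h1 h2]; split; lra. Qed.

Lemma sandwich2 (T K L H e : R) :
  T * (H - e * 2) / 2 <= K - L -> K - L <= T * (H + e * 2) / 2 ->
  `|K - L - T * (H / 2)| <= T * e.
Proof. by move=> h1 h2; rewrite ler_norml; apply/andP; split; lra. Qed.

Lemma second_order m (k : 'rV[R]_m -> R) (D : set 'rV[R]_m) (y : 'rV[R]_m) :
  open D -> smooth D k -> D 0 -> k 0 = 0 ->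
  forall e, 0 < e -> \forall t \near (0 : R), 
    `|k (t *: y) - t * 'D_y k 0 - t ^+ 2 * (hess k 0 y / 2)| <= t ^+ 2 * e.
Proof.
move=> oD sk D0 k0 e e0.
have chess : {for (0 : 'rV[R]_m), continuous (fun p => hess k p y)}.
  pose N := nbhs (0 : 'rV[R]_m); have FN : Filter N by exact: nbhs_filter.
  apply: (@cvg_sum R R _ _ N FN _ (fun i p => (\sum_j 'D_(Ei j) ('D_(Ei i) k) p * y 0 j) * y 0 i)) => i.
  apply: cvgM; last exact: cvg_cst.
  apply: (@cvg_sum R R _ _ N FN _ (fun j p => 'D_(Ei j) ('D_(Ei i) k) p * y 0 j)) => j.
  apply: cvgM; last exact: cvg_cst.
  exact: (smooth_cont (smooth_derive _ (smooth_derive _ sk)) D0).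
have nD : \forall p \near (0 : 'rV[R]_m), D p /\ `|hess k 0 y - hess k p y| < e * 2.
  apply: (@filterI _ (nbhs (0 : 'rV[R]_m)) (nbhs_filter _)); first exact: open_nbhs_nbhs.
  move/(@cvgrPdist_lt _ _ _ (nbhs (0 : 'rV[R]_m)) (nbhs_filter _) (fun p => hess k p y)) : chess.
  by apply; rewrite mulr_gt0.
have cl : (fun t : R => t *: y) @ (0 : R) --> (0 : 'rV[R]_m).
  have := @cvg_line R _ y 0; under eq_fun do rewrite addr0; exact.
have nT : \forall t \near (0 : R), D (t *: y) /\ `|hess k 0 y - hess k (t *: y) y| < e * 2.
  exact: cl nD.
have /nbhs_ballP[d /= d0 hd] := nT.
apply/nbhs_ballP; exists d => //= t; rewrite /ball/= sub0r normrN => td.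
have inb (s : R) : 0 <= s <= 1 -> D (s *: (t *: y)) /\ `|hess k 0 y - hess k (s *: (t *: y)) y| < e * 2.
  move=> /andP[s0 s1]; rewrite scalerA; apply: hd; rewrite /ball/= sub0r normrN normrM ger0_norm//.
  by apply: le_lt_trans td; rewrite ler_piMl.
pose u := t *: y.
have d1 (s : R) : 0 <= s <= 1 -> is_derive s (1:R) (fun s => k (s *: u)) ('D_u k (s *: u)).
  move=> s01; have := @derivable_line R _ _ k 0 u s; rewrite add0r.
  under eq_fun do rewrite add0r.
  by apply; exact: (smooth_derivable sk (inb s s01).1).
have d2 (s : R) : 0 <= s <= 1 -> is_derive s (1:R) (fun s => 'D_u k (s *: u)) (hess k (s *: u) u).
  move=> s01; rewrite -(hessE u oD sk (inb s s01).1).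
  have E : (fun s : R => 'D_u k (0 + s *: u)) = (fun s => 'D_u k (s *: u)).
    by apply/funext => x; rewrite add0r.
  have := @derivable_line R _ _ ('D_u k) 0 u s; rewrite E add0r.
  by apply; exact: (smooth_derivable (smooth_derive u sk) (inb s s01).1).
have B (s : R) : 0 <= s <= 1 -> t ^+ 2 * (hess k 0 y - e * 2) <= hess k (s *: u) u <= t ^+ 2 * (hess k 0 y + e * 2).
  move=> /inb[_] /sandwich[a b]; rewrite /u [s *: _]lock hessZ -lock.
  by apply/andP; split; apply: ler_wpM2l; rewrite ?sqr_ge0.
have := taylor2_le d1 d2 (fun s hs => proj2 (andP (B s hs))).
have := taylor2_ge d1 d2 (fun s hs => proj1 (andP (B s hs))).
have dE : 'D_u k 0 = t * 'D_y k 0.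
  have C1 : C1near k 0 by apply: (Cn1_C1near oD) => //; exact: sk.
  have [_ ->] := derive_sumEi u C1; have [_ ->] := derive_sumEi y C1.
  by rewrite mulr_sumr; apply: eq_bigr => i _; rewrite mxE mulrCA.
rewrite scale1r scale0r k0 subr0 dE -/u => h1 h2.
exact: sandwich2.
Qed.

Lemma integral_exp_abs (c : R) : 0 < c ->
  (\int[lebesgue_measure]_x (expR (- (c * `|x|)))%:E < +oo)%E.
Proof.
move=> c0.
pose p := exponential_pdf c.
have mp : measurable_fun setT p := measurable_exponential_pdf c.
have p0 x : 0 <= p x by apply: exponential_pdf_ge0; exact: ltW.
have mpE : measurable_fun setT (fun x : measurableTypeR R => (p x)%:E) by exact/measurable_EFinP.
have mpN : measurable_fun setT (fun x : measurableTypeR R => (p (- x))%:E).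
  by apply/measurable_EFinP; apply: (measurableT_comp mp); exact: oppr_measurable.
have mo : measurable_fun setT (-%R : measurableTypeR R -> measurableTypeR R) by exact: oppr_measurable.
have intN : (\int[lebesgue_measure]_x (p (- x))%:E = 1)%E.
  rewrite -(integral_exponential_pdf c0).
  have := @ge0_integral_pushforward _ _ _ (measurableTypeR R) R (-%R : measurableTypeR R -> measurableTypeR R) mo lebesgue_measure setT (fun x => (p x)%:E).
  rewrite preimage_setT => <-//; last by move=> y _; rewrite lee_fin.
  by apply: eq_measure_integral => A mA _; rewrite -[RHS](lebesgue_measureN mA).
have intP : (\int[lebesgue_measure]_x (p x)%:E = 1)%E := integral_exponential_pdf c0.
suff le : (\int[lebesgue_measure]_x (expR (- (c * `|x|)))%:E <= (c^-1)%:E *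
    (\int[lebesgue_measure]_x (p x)%:E + \int[lebesgue_measure]_x (p (- x))%:E))%E.
  by apply: le_lt_trans le _; rewrite intP intN -EFinD -EFinM ltry.
rewrite -ge0_integralD//; last 2 first.
- by move=> x _; rewrite lee_fin.
- by move=> x _; rewrite lee_fin.
rewrite -ge0_integralZl//; last 2 first.
- by move=> x _; rewrite adde_ge0// lee_fin.
- by rewrite lee_fin invr_ge0 ltW.
apply: ge0_le_integral => //.
- apply/measurable_EFinP; apply: measurable_funTS; apply: continuous_measurable_fun => x.
  apply: continuous_comp; last exact: continuous_expR.
  by apply: cvgN; apply: cvgM; [exact: cvg_cst|exact: norm_continuous].
- by apply: measurable_funeM; exact: emeasurable_funD.
- move=> x _; rewrite -EFinD -EFinM lee_fin.
have pE t : 0 <= t -> p t = c * expR (- (c * t)).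
  by move=> t0; rewrite /p exponential_pdfE// mulNr.
have cp (A : R) : c^-1 * (c * A) = A by rewrite mulKf// gt_eqF.
have [x0|x0] := leP 0 x.
  by rewrite (ger0_norm x0) mulrDr pE// cp lerDl mulr_ge0// invr_ge0 ltW.
have nx : 0 <= - x by rewrite oppr_ge0 ltW.
by rewrite (ltr0_norm x0) mulrDr (pE _ nx) cp lerDr mulr_ge0// invr_ge0 ltW.
by apply: emeasurable_funD.
Qed.

Lemma dominated_ge0 d (T : measurableType d) (nu : {measure set T -> \bar R})
    (f_ : nat -> T -> \bar R) (f g : T -> \bar R) n0 :
  (forall n, measurable_fun setT (f_ n)) -> (forall n x, 0 <= f_ n x)%E ->
  measurable_fun setT g ->
  (forall n x, (n0 <= n)%N -> f_ n x <= g x)%E -> (\int[nu]_x g x < +oo)%E ->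
  {ae nu, forall x, f_ ^~ x @ \oo --> f x} -> measurable_fun setT f ->
  nu.-integrable setT f /\
  (fun n => \int[nu]_x f_ n x)%E @ \oo --> (\int[nu]_x f x)%E.
Proof.
move=> mf f0 mg fg ig fc mfl.
rewrite -(cvg_shiftn n0).
have g0 x : (0 <= g x)%E by apply: le_trans (f0 n0 x) _; exact: fg.
have ig' : nu.-integrable setT g.
  by apply/integrableP; split => //; under eq_integral do rewrite gee0_abs//.
have [] // := @dominated_convergence _ _ _ nu setT measurableT (fun n => f_ (n + n0)%N) f g _ mfl _ ig' _.
- case: fc => N [mN N0 hN]; exists N; split => // x /= hx; apply: hN => h; apply: hx => _.
  by rewrite (cvg_shiftn n0 (fun n => f_ n x)).
- by apply: aeW => x n _; rewrite gee0_abs//; apply: fg; exact: leq_addl.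
Qed.
End limits.

(** * The Laplace method near the torus of z *)

Section laplace_near.
Context {R : realType} {m : nat}.
Variables (X : set 'rV[Cplx R]_m.+1)
  (mu : {measure set (borel 'rV[Cplx R]_m.+1) -> \bar R})
  (z : 'rV[Cplx R]_m.+1) (k : 'rV[R]_m -> R) (D : set 'rV[R]_m) (r r2 c : R).
Hypothesis bX : exists M : R, forall w, X w -> forall j, `|ReC (w 0 j)| <= M /\ `|ImC (w 0 j)| <= M.
Hypothesis z0 : forall j, z 0 j != 0.
Hypothesis r20 : 0 < r2.
Hypothesis r2r : r2 < r.
Hypothesis oD : open D.
Hypothesis sk : smooth D k.
Hypothesis D0 : D 0.
Hypothesis k0 : k 0 = 0.
Hypothesis c0 : 0 < c.
Let h i := - 'D_(Ei i) k 0.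
Hypothesis k_upper : forall y : 'rV[R]_m, (forall i, `|y 0 i| <= r) ->
  k y <= - (\sum_i h i * y 0 i) - c * nsq y.
Variable a : 'rV[R]_(m.*2.+1) -> R.
Hypothesis a_cont : forall v, pdom r v -> {for v, continuous a}.
Hypothesis a_gt0 : forall v, pdom r v -> 0 < a v.
Hypothesis near_int : forall f : 'rV[Cplx R]_m.+1 -> \bar R,
        measurable_fun setT (f : borel _ -> \bar R) -> (forall w, 0 <= f w)%E ->
        (forall th w, f (torus_act th w) = f w) ->
        (\int[mu]_(w in near_part X z r) f w = (2 ^+ m.+1)%:E *
          \int[lam (m.*2.+1)]_(v in pdom r) (f (phi k z v) * (\1_(window r) v * a v)%:E))%E.
Hypothesis near_meas : forall f : 'rV[Cplx R]_m.+1 -> \bar R,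
        measurable_fun setT (f : borel _ -> \bar R) ->
        measurable_fun (pdom r : set (borel _))
          (fun v : borel 'rV[R]_(m.*2.+1) => (f (phi k z v) * (\1_(window r) v * a v)%:E)%E).

Lemma shell_phi s v : shell z s (phi k z v) <-> forall i, `|ypart v 0 i| < s.
Proof.
have E (i : 'I_m) : expR (- s) ^+ 2 < cabs2 (phi k z v 0 (lift ord0 i) / z 0 (lift ord0 i)) < expR s ^+ 2
    = (`|ypart v 0 i| < s).
  by rewrite (phi_ratio _ z0) cabs2_cexp expR_sqr_window /xlog consrS.
by split=> H i; have := H i; rewrite E.
Qed.

Lemma window_le (v : 'rV[R]_(m.*2.+1)) : window r2 v -> window r v.
Proof. by move=> [h1 h2]; split => // i; exact: lt_trans (h1 i) r2r. Qed.

Lemma measurable_shell s : measurable (shell z s : set (borel 'rV[Cplx R]_m.+1)).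
Proof. by have := @measurable_near_part R m setT z s measurableT; rewrite /near_part setTI. Qed.

Lemma near_half (f : 'rV[Cplx R]_m.+1 -> \bar R) :
  measurable_fun setT (f : borel _ -> \bar R) -> (forall w, 0 <= f w)%E ->
  (forall th w, f (torus_act th w) = f w) ->
  measurable_fun setT (fun v : borel 'rV[R]_(m.*2.+1) => (f (phi k z v) * (\1_(window r2) v * a v)%:E)%E) /\
  (\int[mu]_(w in near_part X z r2) f w = (2 ^+ m.+1)%:E *
    \int[lam (m.*2.+1)]_v (f (phi k z v) * (\1_(window r2) v * a v)%:E))%E.
Proof.
move=> mf f0 fT.
pose f' := f \_ (shell z r2).
have mf' : measurable_fun setT (f' : borel _ -> \bar R).
  by apply/(measurable_restrictT _ (measurable_shell r2)); exact: measurable_funTS.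
have mpd : measurable (pdom r : set (borel 'rV[R]_(m.*2.+1))) by apply: open_borel; exact: open_pdom.
have E : (fun v => (f (phi k z v) * (\1_(window r2) v * a v)%:E)%E) =
    (fun v => (f' (phi k z v) * (\1_(window r) v * a v)%:E)%E) \_ (pdom r).
  apply/funext => v; rewrite patchE; have [pv|pv] := pselect (pdom r v); last first.
    rewrite [v \in pdom r]memNset// indicE memNset ?mul0r ?mule0//.
    by move=> /window_le /window_pdom.
  rewrite [v \in pdom r]mem_set// !indicE /f' patchE.
  have [wv|wv] := pselect (window r2 v).
    rewrite [v \in window r2]mem_set// [v \in window r]mem_set; last exact: window_le.
    by rewrite [phi k z v \in _]mem_set//; apply/shell_phi; case: wv.
  rewrite [v \in window r2]memNset// mul0r mule0.
  have [wv'|wv'] := pselect (window r v); last by rewrite [v \in window r]memNset// mul0r mule0.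
  rewrite [phi k z v \in _]memNset ?mul0e// => /shell_phi sv; apply: wv; split => //.
  by case: wv'.
have near2 : near_part X z r2 = near_part X z r `&` shell z r2.
  rewrite /near_part -setIA; congr (_ `&` _); apply/esym/setIidr => w hw i.
  have /andP[h1 h2] := hw i; apply/andP; split.
    apply: lt_trans h1; rewrite ltr_pXn2r ?nnegrE ?expR_ge0// ltr_expR ltrN2//.
  by apply: lt_trans h2 _; rewrite ltr_pXn2r ?nnegrE ?expR_ge0// ltr_expR.
split; first by rewrite E; apply/(measurable_restrictT _ mpd); exact: near_meas.
rewrite E -[in RHS]integral_mkcond near2 integral_mkcondr -near_int//.
- by move=> w; apply: erestrict_ge0.
- move=> th w; rewrite /f' !patchE fT; congr (if _ then _ else _).
  have S : shell z r2 (torus_act th w) <-> shell z r2 w.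
    have eC j : cabs2 (torus_act th w 0 j / z 0 j) = cabs2 (w 0 j / z 0 j).
      by rewrite mxE -mulrA [LHS]cabs2M cabs2_cexp expR0 expr1n mul1r.
    by split=> H i; have := H i; rewrite eC.
  by apply/idP/idP; rewrite !inE => /S.
Qed.

Lemma a_bounded : exists2 A : R, 0 < A & forall v : 'rV[R]_(m.*2.+1), window r2 v -> a v <= A.
Proof.
pose B : set 'rV[R]_(m.*2.+1) := [set v | forall q : 'I_(m.*2.+1), `[- (if (q < m)%N then r2 else pi / 2), (if (q < m)%N then r2 else pi / 2)]%classic (v 0 q)].
have cB : compact B.
  exact: (@rV_compact R _ (fun q : 'I_(m.*2.+1) => `[- (if (q < m)%N then r2 else pi / 2), (if (q < m)%N then r2 else pi / 2)]%classic) (fun=> @segment_compact R _ _)).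
have BP (v : 'rV[R]_(m.*2.+1)) : B v -> pdom r v.
  move=> Bv; split => [i|j].
    have := Bv (yix i); rewrite /= in_itv/= ltn_ord mxE -ler_norml => u; exact: le_lt_trans u r2r.
  have := Bv (tix j); rewrite /= in_itv/= ltnNge leq_addr/= mxE -ler_norml => u.
  exact: le_lt_trans u (pihalf_lt2 R).
have wB (v : 'rV[R]_(m.*2.+1)) : window r2 v -> B v.
  move=> [h1 h2] q; have [[i ->]|[j ->]] := yt_split q; rewrite /= in_itv/= -ler_norml.
    by rewrite ltn_ord; have := h1 i; rewrite mxE => /ltW.
  rewrite ltnNge leq_addr/=; have := h2 j; rewrite mxE => /andP[u1 u2].
  by rewrite ler_norml u1 ltW.
have p2 : 0 < pi / 2 :> R by rewrite divr_gt0// pi_gt0.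
have B0 : B !=set0.
  by exists 0 => q; rewrite /= in_itv/= mxE -ler_norml normr0; case: ifP => _; exact: ltW.
have ca : {within B, continuous a}.
  by apply: continuous_in_subspaceT => v /[!inE] /BP; exact: a_cont.
have [v1 v1B hmax] := compact_EVT_max B0 cB ca.
exists (a v1); first by apply/a_gt0/BP; rewrite inE in v1B.
by move=> v /wB Bv; apply: hmax; rewrite inE.
Qed.

Definition cs l (q : 'I_(m.*2.+1)) : R := if (q < m)%N then (sc l)^-1 else 1.
Definition scale l v := aff (cs l) (fun=> 0) v.

Lemma cs_gt0 l q : 0 < cs l q.
Proof. by rewrite /cs; case: ifP => _; rewrite ?invr_gt0 ?sc_gt0. Qed.

Lemma cs_y l i : cs l (yix i) = (sc l)^-1.
Proof. by rewrite /cs /= ltn_ord. Qed.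

Lemma cs_t l j : cs l (tix j) = 1.
Proof. by rewrite /cs /= ltnNge leq_addr. Qed.

Lemma prod_cs l : \prod_q cs l q = (sc l ^+ m)^-1.
Proof.
rewrite prod_split [X in _ * X]big1 ?mulr1 => [|j _]; last exact: cs_t.
under eq_bigr do rewrite cs_y.
by rewrite prodr_const card_ord exprVn.
Qed.

Lemma ypart_scale l v : ypart (scale l v) = (sc l)^-1 *: ypart v.
Proof. by apply/rowP => i; rewrite 2!mxE cs_y addr0 !mxE. Qed.

Lemma tpart_scale l v : tpart (scale l v) = tpart v.
Proof. by apply/rowP => j; rewrite 2!mxE cs_t addr0 mul1r mxE. Qed.

Lemma cvg_scV : (fun l => (sc l)^-1) @ \oo --> (0 : R).
Proof.
apply/cvgrPdist_lt => e e0.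
have e20 : 0 < e ^+ 2 by rewrite exprn_gt0.
have := near_infty_natSinv_lt (PosNum e20); apply: filterS => n /= hn.
rewrite sub0r normrN ger0_norm ?invr_ge0 ?sqrtr_ge0//.
by rewrite -(ltr_pXn2r (n := 2))// ?nnegrE ?invr_ge0 ?sqrtr_ge0// 1?ltW// exprVn sc2.
Qed.

Definition twindow : set 'rV[R]_(m.*2.+1) :=
  [set v | forall j, - (pi / 2) <= tpart v 0 j < pi / 2].
(** In the limit the density is evaluated on the torus of z, where only the angles
   remain. *)
Definition frozen (v : 'rV[R]_(m.*2.+1)) := @joinv R m 0 (tpart v).

Lemma frozen_pdom v : twindow v -> pdom r (frozen v).
Proof.
move=> tv; apply: window_pdom; split.
  by move=> i; rewrite ypart_joinv mxE normr0; exact: lt_trans r2r.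
by move=> j; rewrite tpart_joinv; exact: tv.
Qed.

Lemma cvg_scale v : (fun l => scale l v) @ \oo --> frozen v.
Proof.
apply: cvg_rV => q; have [[i ->]|[j ->]] := yt_split q.
  rewrite (_ : (fun l => _) = (fun l => (sc l)^-1 * v 0 (yix i))); last first.
    by apply/funext => l; rewrite mxE cs_y addr0.
  have -> : frozen v 0 (yix i) = 0 * v 0 (yix i).
    rewrite mul0r; have := congr1 (fun y : 'rV[R]_m => y 0 i) (ypart_joinv 0 (tpart v)).
    by rewrite !mxE.
  by apply: cvgM; [exact: cvg_scV|exact: cvg_cst].
rewrite (_ : (fun l => _) = (fun l => v 0 (tix j))); last first.
  by apply/funext => l; rewrite mxE cs_t addr0 mul1r.
have <- : frozen v 0 (tix j) = v 0 (tix j); last exact: cvg_cst.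
have := congr1 (fun y : 'rV[R]_m.+1 => y 0 j) (tpart_joinv 0 (tpart v)).
by rewrite !mxE.
Qed.

Variables (b : nat -> mpoly.multinom m.+1) (xi : 'rV[R]_m) (l0 : nat).
Hypothesis b0 : forall l, fun_of_multinom (b l) ord0 = l.
Hypothesis bdev : forall l, (l0 <= l)%N -> forall i, `|dev h (b l) i - xi 0 i| <= (sc l)^-1.

Definition expo l (y : 'rV[R]_m) : R := l%:R * k ((sc l)^-1 *: y) +
  \sum_i (fun_of_multinom (b l) (lift ord0 i))%:R * ((sc l)^-1 *: y) 0 i.

Lemma expoE l y : expo l y = l%:R * (k ((sc l)^-1 *: y) + (sc l)^-1 * \sum_i h i * y 0 i) +
  \sum_i dev h (b l) i * y 0 i.
Proof.
rewrite /expo mulrDr -addrA; congr (_ + _).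
rewrite mulr_sumr mulr_sumr -big_split/=; apply: eq_bigr => i _.
by rewrite mxE /dev b0; ring.
Qed.

Lemma derive_h y : 'D_y k 0 = - \sum_i h i * y 0 i.
Proof.
have C1 : C1near k 0 by apply: (Cn1_C1near oD) => //; exact: sk.
have [_ ->] := derive_sumEi y C1; rewrite -sumrN; apply: eq_bigr => i _.
by rewrite /h mulNr opprK.
Qed.

Lemma ratio_cvg : (fun l => l%:R * (sc l)^-1 ^+ 2) @ \oo --> (1 : R).
Proof.
rewrite (_ : (fun l => _) = (fun l => 1 - (sc l)^-1 * (sc l)^-1)); last first.
  apply/funext => l; rewrite -expr2 exprVn sc2 -natr1; field.
  by rewrite natr1 pnatr_eq0.
have h1 : (fun l => (sc l)^-1 * (sc l)^-1) @ \oo --> (0 * 0 : R).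
  by apply: cvgM; exact: cvg_scV.
have h2 : (fun l => 1 - (sc l)^-1 * (sc l)^-1) @ \oo --> (1 - 0 * 0 : R).
  by apply: cvgB h1; exact: cvg_cst.
by move: h2; rewrite mulr0 subr0.
Qed.

Lemma expo_cvg y : (fun l => expo l y) @ \oo --> hess k 0 y / 2 + \sum_i xi 0 i * y 0 i.
Proof.
rewrite (_ : (fun l => expo l y) = (fun l => l%:R * (k ((sc l)^-1 *: y) + (sc l)^-1 * \sum_i h i * y 0 i) +
  \sum_i dev h (b l) i * y 0 i)); last by apply/funext => l; exact: expoE.
apply: cvgD; last first.
  apply: (@cvg_sum R R _ _ \oo _ _ (fun i l => dev h (b l) i * y 0 i)) => i.
  apply: cvgM; last exact: cvg_cst.
  apply/cvgrPdist_le => e e0; near=> l.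
  apply: (@le_trans _ _ (sc l)^-1).
    by rewrite distrC; apply: bdev; near: l; exact: nbhs_infty_ge.
  have : `|0 - (sc l)^-1| <= e by near: l; move/cvgrPdist_le : cvg_scV; apply.
  by rewrite sub0r normrN ger0_norm// invr_ge0 sqrtr_ge0.
rewrite -[hess k 0 y / 2]add0r -[hess k 0 y / 2]mul1r.
rewrite (_ : (fun l => _) = (fun l => l%:R * (k ((sc l)^-1 *: y) - (sc l)^-1 * 'D_y k 0 - (sc l)^-1 ^+ 2 * (hess k 0 y / 2))
    + l%:R * (sc l)^-1 ^+ 2 * (hess k 0 y / 2))); last first.
  by apply/funext => l; rewrite derive_h; ring.
apply: cvgD; last by apply: cvgM; [exact: ratio_cvg|exact: cvg_cst].
apply/cvgrPdist_le => e e0; near=> l.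
rewrite sub0r normrN normrM ger0_norm//.
apply: (@le_trans _ _ (l%:R * ((sc l)^-1 ^+ 2 * e))).
  apply: ler_wpM2l => //; near: l.
  exact: (cvg_scV (second_order y oD sk D0 k0 e0)).
rewrite mulrA ler_piMl ?(ltW e0)// exprVn sc2 ler_pdivrMr// mul1r ler_nat //.
Unshelve. all: by end_near. Qed.
Definition Kb i : R := (`|xi 0 i| + 2) ^+ 2 / (2 * c).

Lemma square_bound (t p : R) : - (c / 2) * t ^+ 2 + (p - 1) * t <= p ^+ 2 / (2 * c) - t.
Proof.
have -> : p ^+ 2 / (2 * c) - t = - (c / 2) * t ^+ 2 + (p - 1) * t + c / 2 * (t - p / c) ^+ 2.
  by field; rewrite gt_eqF.
by rewrite lerDl mulr_ge0 ?sqr_ge0// divr_ge0// ltW.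
Qed.

Lemma expo_bound l (y : 'rV[R]_m) : (l0 <= l)%N -> (0 < l)%N ->
  (forall i, `|((sc l)^-1 *: y) 0 i| <= r) -> expo l y <= \sum_i (Kb i - `|y 0 i|).
Proof.
move=> ll l1 hy.
have q1 : l%:R * (k ((sc l)^-1 *: y) + (sc l)^-1 * \sum_i h i * y 0 i) <= - (c / 2) * nsq y.
  have : k ((sc l)^-1 *: y) + (sc l)^-1 * \sum_i h i * y 0 i <= - c * ((sc l)^-1 ^+ 2 * nsq y).
    have := k_upper hy; rewrite nsqZ mulr_sumr mulNr.
    under eq_bigr do rewrite mxE mulrCA.
    by move=> hk; rewrite -lerBrDr addrC mulr_sumr.
  move=> /(ler_wpM2l (ler0n R l))/le_trans; apply.
  have -> : l%:R * (- c * ((sc l)^-1 ^+ 2 * nsq y)) = - (l%:R * (sc l)^-1 ^+ 2 * (c * nsq y)) by ring.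
  have -> : - (c / 2) * nsq y = - (2^-1 * (c * nsq y)) by ring.
  rewrite lerN2; apply: ler_wpM2r; first by rewrite mulr_ge0 ?nsq_ge0// ltW.
  rewrite exprVn sc2 ler_pdivlMr// mulrC ler_pdivrMr// -natrM ler_nat.
  by rewrite muln2 -addnn -addn1 leq_add2l.
rewrite expoE; apply: le_trans (lerD q1 (lexx _)) _.
rewrite /nsq mulr_sumr -big_split/=; apply: ler_sum => i _.
apply: le_trans (square_bound `|y 0 i| (`|xi 0 i| + 2)).
rewrite real_normK ?num_real// lerD2l.
apply: le_trans (ler_norm _) _; rewrite normrM; apply: ler_wpM2r => //.
have : `|dev h (b l) i - xi 0 i| <= 1.
  apply: le_trans (bdev ll i) _; rewrite invf_le1 ?sc_gt0// sc_ge1 //.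
have := ler_normD (dev h (b l) i - xi 0 i) (xi 0 i); rewrite subrK; lra.
Qed.

Definition G l v : R := expR (2 * expo l (ypart v)) * (\1_(window r2) (scale l v) * a (scale l v)).
Definition Ginf v : R := expR (2 * (hess k 0 (ypart v) / 2 + \sum_i xi 0 i * ypart v 0 i)) *
  (\1_twindow v * a (frozen v)).

Lemma window_scale l v : window r2 (scale l v) ->
  twindow v /\ forall i, `|((sc l)^-1 *: ypart v) 0 i| <= r.
Proof.
move=> [h1 h2]; split => [j|i]; first by have := h2 j; rewrite tpart_scale.
by rewrite -ypart_scale; apply: ltW; exact: lt_trans (h1 i) r2r.
Qed.

Lemma G_cvg v : (fun l => (G l v)%:E) @ \oo --> (Ginf v)%:E.
Proof.
apply: cvg_EFin; first by apply: nearW.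
apply: (cvgM (f := fun l => expR (2 * expo l (ypart v)))).
  apply: (@cvg_comp _ _ _ (fun l => 2 * expo l (ypart v)) expR); last exact: continuous_expR.
  by apply: cvgM; [exact: cvg_cst|exact: expo_cvg].
have [tv|tv] := pselect (twindow v); last first.
  rewrite (_ : (fun l => _) = (fun=> 0)).
    by rewrite indicE memNset// mul0r; exact: cvg_cst.
  apply/funext => l; rewrite indicE memNset ?mul0r// => /window_scale[] //.
apply: cvgM; last first.
  apply: (@cvg_comp _ _ _ (fun l => scale l v) a); first exact: cvg_scale.
  exact: a_cont (frozen_pdom tv).
have hc : (fun l => (sc l)^-1 * \sum_j `|ypart v 0 j|) @ \oo --> 0 * \sum_j `|ypart v 0 j|.
  by apply: cvgM; [exact: cvg_scV|exact: cvg_cst].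
rewrite indicE mem_set//; apply: cvg_near_cst; near=> l.
rewrite indicE mem_set//; split; last by move=> j; rewrite tpart_scale; exact: tv.
move=> i; rewrite ypart_scale mxE normrM (ger0_norm (x := (sc l)^-1)) ?invr_ge0 ?sqrtr_ge0//.
apply: (@le_lt_trans _ _ ((sc l)^-1 * \sum_j `|ypart v 0 j|)).
  apply: ler_wpM2l; first by rewrite invr_ge0 sqrtr_ge0.
  by rewrite (bigD1 i)//= lerDl sumr_ge0.
have : `|0 * \sum_j `|ypart v 0 j| - (sc l)^-1 * \sum_j `|ypart v 0 j| | < r2.
  by near: l; move/cvgrPdist_lt : hc; apply.
by rewrite mul0r sub0r normrN; exact: le_lt_trans (ler_norm _).
Unshelve. all: by end_near. Qed.

Lemma G_ge0 l v : 0 <= G l v.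
Proof.
rewrite mulr_ge0 ?expR_ge0// indicE; have [wv|wv] := pselect (window r2 (scale l v)).
  by rewrite mem_set// mul1r ltW// a_gt0//; apply: window_pdom; exact: window_le.
by rewrite memNset// mul0r.
Qed.

Definition mj (q : 'I_(m.*2.+1)) (x : measurableTypeR R) : \bar R :=
  match fintype.split (cast_ord (esym (dim_split (m:=m))) q) with
  | inl i => (expR (2 * Kb i) * expR (- (2 * `|x|)))%:E
  | inr j => (\1_(`[- (pi / 2), pi / 2]%classic) x)%:E
  end.

Lemma mj_y i x : mj (yix i) x = (expR (2 * Kb i) * expR (- (2 * `|x|)))%:E.
Proof. by rewrite /mj /yix cast_ordK -[lshift _ i]/(unsplit (inl i)) unsplitK. Qed.
Lemma mj_t j x : mj (tix j) x = (\1_(`[- (pi / 2), pi / 2]%classic) x)%:E.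
Proof. by rewrite /mj /tix cast_ordK -[rshift _ j]/(unsplit (inr j)) unsplitK. Qed.

Lemma mj_ge0 q x : (0 <= mj q x)%E.
Proof.
have [[i ->]|[j ->]] := yt_split q; rewrite ?mj_y ?mj_t lee_fin // ?mulr_ge0 ?expR_ge0.
Qed.

Lemma measurable_mj q : measurable_fun setT (mj q).
Proof.
have [[i ->]|[j ->]] := yt_split q.
  rewrite (_ : mj _ = fun x => (expR (2 * Kb i) * expR (- (2 * `|x|)))%:E); last by apply/funext => x; exact: mj_y.
  apply/measurable_EFinP; apply: continuous_measurable_fun => x.
  apply: cvgM; first exact: cvg_cst.
  apply: continuous_comp; last exact: continuous_expR.
  by apply: cvgN; apply: cvgM; [exact: cvg_cst|exact: norm_continuous].
rewrite (_ : mj _ = fun x => (\1_(`[- (pi / 2), pi / 2]%classic) x)%:E); last by apply/funext => x; exact: mj_t.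
by apply/measurable_EFinP; exact: measurable_indic.
Qed.

Lemma prod_lt_pinfty (I : Type) (s : seq I) (f : I -> \bar R) :
  (forall i, 0 <= f i < +oo)%E -> (\prod_(i <- s) f i < +oo)%E.
Proof.
move=> hf; rewrite (eq_bigr (fun i => (fine (f i))%:E)) ?prodEFin ?ltry// => i _.
by have /andP[p q] := hf i; rewrite fineK// ge0_fin_numE.
Qed.

Lemma int_mj q : (0 <= \int[lebesgue_measure]_x mj q x < +oo)%E.
Proof.
apply/andP; split; first by apply: integral_ge0 => x _; exact: mj_ge0.
have [[i ->]|[j ->]] := yt_split q.
  under eq_integral do rewrite mj_y EFinM.
  have me : measurable_fun setT (fun x : measurableTypeR R => (expR (- (2 * `|x|)))%:E).
    apply/measurable_EFinP; apply: continuous_measurable_fun => x.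
    apply: continuous_comp; last exact: continuous_expR.
    by apply: cvgN; apply: cvgM; [exact: cvg_cst|exact: norm_continuous].
  have e0 (x : measurableTypeR R) : (0 <= (expR (- (2 * `|x|)))%:E)%E by rewrite lee_fin expR_ge0.
  rewrite ge0_integralZl ?lee_fin ?expR_ge0//.
  have := integral_exp_abs (ltr0Sn R 1).
  have := @integral_ge0 _ (measurableTypeR R) R lebesgue_measure setT _ (fun x _ => e0 x).
  set I := integral _ _ _ => I0 Ioo.
  have fI : I \is a fin_num by rewrite ge0_fin_numE.
  by rewrite -(fineK fI) -EFinM ltry.
under eq_integral do rewrite mj_t.
rewrite integral_indic// setIT /= lebesgue_measure_itv/=.
by case: ifP => _; rewrite -?EFinB ltry.
Qed.

Lemma G_bound : exists2 A : R, 0 < A & forall l v, (l0 + 1 <= l)%N ->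
  ((G l v)%:E <= A%:E * \prod_q mj q (v 0%R q))%E.
Proof.
have [A A0 hA] := a_bounded; exists A => // l v ll.
have [wv|wv] := pselect (window r2 (scale l v)); last first.
  rewrite /G indicE memNset// mul0r mulr0 mule_ge0 ?lee_fin ?(ltW A0)//.
  by apply: prode_ge0 => q _; exact: mj_ge0.
have [tv yv] := window_scale wv.
have -> : (\prod_q mj q (v 0%R q) = (expR (2 * \sum_i (Kb i - `|ypart v 0 i|)))%:E)%E.
  rewrite (eq_bigr (fun q => (fine (mj q (v 0 q)))%:E)); last first.
    move=> q _; have [[i ->]|[j ->]] := yt_split q; by rewrite ?mj_y ?mj_t.
  rewrite prodEFin; congr EFin; rewrite prod_split [X in _ * X]big1 ?mulr1; last first.
    move=> j _; rewrite mj_t/= indicE mem_set//=; have := tv j; rewrite mxE in_itv/= => /andP[-> /ltW ->]//.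
  rewrite mulr_sumr expR_sum; apply: eq_bigr => i _.
  by rewrite mj_y/= -expRD mxE; congr expR; ring.
rewrite -EFinM lee_fin /G indicE mem_set// mul1r mulrC; apply: ler_pM => //.
- by rewrite ltW// a_gt0//; apply: window_pdom; exact: window_le.
- exact: hA.
rewrite ler_expR ler_pM2l//; apply: expo_bound => //.
  by apply: leq_trans ll; rewrite leq_addr.
by apply: leq_trans ll; rewrite addn1.
Qed.

Lemma wgt_scale l v : wgt z (b l) (phi k z (scale l v)) = expR (2 * expo l (ypart v)).
Proof. by rewrite wgt_phi// b0 ypart_scale. Qed.

(** After rescaling by the width of the peak, the second-order expansion of k
   makes the integrand converge to a Gaussian, and the quadratic upper bound on
   k provides an integrable majorant. *)
Lemma near_limit : (0 <= (2 ^+ m.+1)%:E * \int[lam (m.*2.+1)]_v (Ginf v)%:E < +oo)%E /\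
  (fun l => (sc l ^+ m)%:E * \int[mu]_(w in near_part X z r2) (wgt z (b l) w)%:E)%E @ \oo -->
  ((2 ^+ m.+1)%:E * \int[lam (m.*2.+1)]_v (Ginf v)%:E)%E.
Proof.
have H l := near_half (measurable_wgt z bX (b l)) (fun w => wgt_ge0 z (b l) w : (0 <= (wgt z (b l) w)%:E)%E)
   (fun th w => congr1 EFin (wgt_torus z (b l) th w)).
have GE l v : ((wgt z (b l) (phi k z (scale l v)))%:E * (\1_(window r2) (scale l v) * a (scale l v))%:E)%E = (G l v)%:E.
  by rewrite wgt_scale -EFinM.
have mG l : measurable_fun setT (fun v : borel 'rV[R]_(m.*2.+1) => (G l v)%:E).
  rewrite (_ : (fun v => _) = (fun v => ((wgt z (b l) (phi k z v))%:E * (\1_(window r2) v * a v)%:E)%E) \o (scale l)).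
    exact: (measurableT_comp (proj1 (H l)) (measurable_aff (cs l) (fun=> 0))).
  by apply/funext => v; rewrite /= GE.
have [A A0 hA] := G_bound.
have mp := integral_prod measurable_mj mj_ge0.
have mGi : measurable_fun setT (fun v : borel 'rV[R]_(m.*2.+1) => (Ginf v)%:E).
  apply: (@emeasurable_fun_cvg _ (borel 'rV[R]_(m.*2.+1)) R setT (fun l v => (G l v)%:E) (fun v => (Ginf v)%:E)) => // v _; exact: G_cvg.
have pj v : (0 <= \prod_q mj q (v 0%R q))%E by apply: prode_ge0 => q _; exact: mj_ge0.
have mM : measurable_fun setT (fun v : borel 'rV[R]_(m.*2.+1) => (A%:E * \prod_q mj q (v 0%R q))%E).
  by apply: measurable_funeM; exact: (proj1 mp).
have MI : (\int[lam (m.*2.+1)]_v (A%:E * \prod_q mj q (v 0%R q)) < +oo)%E.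
  rewrite ge0_integralZl//; [|exact: (proj1 mp)|by rewrite lee_fin ltW].
  rewrite (proj2 mp).
  have Ioo : (\prod_q \int[lebesgue_measure]_x mj q x < +oo)%E.
    by apply: prod_lt_pinfty => q; exact: int_mj.
  have I0 : (0 <= \prod_q \int[lebesgue_measure]_x mj q x)%E.
    by apply: prode_ge0 => q _; have /andP[] := int_mj q.
  have fI : (\prod_q \int[lebesgue_measure]_x mj q x)%E \is a fin_num by rewrite ge0_fin_numE.
  by rewrite -(fineK fI) -EFinM ltry.
have G0 l v : (0 <= (G l v)%:E)%E by rewrite lee_fin G_ge0.
have hae : {ae lam (m.*2.+1), forall v, (fun l => (G l v)%:E) @ \oo --> (Ginf v)%:E}.
  by apply: aeW => v; exact: G_cvg.
have Gi0 v : (0 <= (Ginf v)%:E)%E.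
  rewrite -(cvg_lim (@ereal_hausdorff R) (@G_cvg v)); apply: lime_ge; first exact: (cvgP _ (@G_cvg v)).
  exact: nearW.
have [intG cvgG] := @dominated_ge0 R _ _ (lam (m.*2.+1)) (fun l v => (G l v)%:E) (fun v => (Ginf v)%:E)
  (fun v => A%:E * \prod_q mj q (v 0%R q))%E (l0 + 1) mG G0 mM (fun l v ll => hA l v ll) MI
  hae mGi.
split.
  have fG := integrable_fin_num measurableT intG.
  rewrite -(fineK fG) -EFinM ltry andbT lee_fin; apply: mulr_ge0; first exact: exprn_ge0.
  by apply: fine_ge0; apply: integral_ge0 => v _; exact: Gi0.
rewrite (_ : (fun l => _) = (fun l => ((2 ^+ m.+1)%:E * \int[lam (m.*2.+1)]_v (G l v)%:E)%E)).
  by apply: cvgeZl.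
apply/funext => l; rewrite (proj2 (H l)) muleCA; congr (_ * _)%E.
have F0 (v : 'rV[R]_(m.*2.+1)) : (0 <= (wgt z (b l) (phi k z v))%:E * (\1_(window r2) v * a v)%:E)%E.
  rewrite mule_ge0 ?lee_fin ?wgt_ge0// indicE; have [wv|wv] := pselect (window r2 v).
    by rewrite mem_set// mul1r ltW// a_gt0//; apply: window_pdom; exact: window_le.
  by rewrite memNset// mul0r.
rewrite (@integral_aff R _ (cs l) (fun=> 0) _ (fun q => cs_gt0 l q) (proj1 (H l)) F0).
rewrite prod_cs muleA -EFinM mulfV ?mul1e; last by rewrite expf_neq0// gt_eqF// sc_gt0.
by apply: eq_integral => v _; exact: GE.
Qed.
End laplace_near.

(** * The Laplace method on the whole boundary *)

Section rates.
Context {R : realType}.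

Lemma sc_small (p q : R) : 0 < q -> \forall l \near \oo, sc l * p <= l%:R * q.
Proof.
move=> q0.
have hc : (fun l => l%:R * (sc l)^-1 ^+ 2 * q - (sc l)^-1 * p) @ \oo --> (1 * q - 0 * p : R).
  apply: cvgB; apply: cvgM; [exact: ratio_cvg|exact: cvg_cst|exact: cvg_scV|exact: cvg_cst].
have : \forall l \near \oo, 0 < l%:R * (sc l)^-1 ^+ 2 * q - (sc l)^-1 * p.
  by move/cvgr_gt : hc; apply; rewrite mul1r mul0r subr0.
apply: filterS => l hl; rewrite -subr_ge0.
have s0 := @sc_gt0 R l.
have -> : l%:R * q - sc l * p = sc l ^+ 2 * (l%:R * (sc l)^-1 ^+ 2 * q - (sc l)^-1 * p).
  by field; rewrite gt_eqF.
by rewrite mulr_ge0 ?sqr_ge0// ltW.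
Qed.

Lemma pow_exp_cvg m (c : R) : 0 < c -> (fun l => sc l ^+ m * expR (- (c * l%:R))) @ \oo --> (0 : R).
Proof.
move=> c0.
pose d := Num.min 1 (c / m.+1%:R).
have d0 : 0 < d by rewrite lt_min ltr01 divr_gt0.
have d1 : d <= 1 by rewrite ge_min lexx.
have dm : d * m.+1%:R <= c.
  by rewrite -ler_pdivlMr// ge_min lexx orbT.
pose K := d^-1 ^+ m.+1.
have K0 : 0 < K by rewrite exprn_gt0// invr_gt0.
have B l : sc l ^+ m * expR (- (c * l%:R)) <= K * l.+1%:R^-1.
  have h1 : l.+1%:R <= d^-1 * expR (d * l%:R) :> R.
    rewrite mulrC ler_pdivlMr//; apply: le_trans (expR_ge1Dx _).
    by rewrite -natr1 mulrDl mul1r [l%:R * d]mulrC addrC lerD2r.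
  have h2 : l.+1%:R ^+ m.+1 <= K * expR (c * l%:R) :> R.
    apply: (@le_trans _ _ ((d^-1 * expR (d * l%:R)) ^+ m.+1)).
      have e0 : 0 <= d^-1 * expR (d * l%:R) by apply: le_trans h1.
      by rewrite lerXn2r ?nnegrE.
    rewrite exprMn -expRM_natl ler_pM2l// ler_expR mulrA [m.+1%:R * d]mulrC.
    exact: ler_wpM2r.
  rewrite expRN ler_pdivrMr ?expR_gt0// -mulrA [_^-1 * _]mulrC mulrA ler_pdivlMr//.
  apply: le_trans h2; rewrite exprSr; apply: ler_wpM2r => //.
  by rewrite lerXn2r// ?nnegrE ?sqrtr_ge0// sc_le.
have hc : (fun l => K * l.+1%:R^-1) @ \oo --> (K * 0 : R).
  by apply: cvgM; [exact: cvg_cst|exact: (@cvg_harmonic R)].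
apply/cvgrPdist_le => e e0; near=> l.
rewrite sub0r normrN ger0_norm; last by rewrite mulr_ge0 ?expR_ge0// exprn_ge0// sqrtr_ge0.
apply: le_trans (B l) _.
have : `|K * 0 - K * l.+1%:R^-1| <= e by near: l; move/cvgrPdist_le : hc; apply.
by rewrite mulr0 sub0r normrN; exact: le_trans (ler_norm _).
Unshelve. all: by end_near. Qed.
End rates.

Section laplace.
Context {R : realType} {m : nat}.
Variables (X : set 'rV[Cplx R]_m.+1)
  (mu : {measure set (borel 'rV[Cplx R]_m.+1) -> \bar R})
  (z : 'rV[Cplx R]_m.+1) (r2 kap : R) (h : 'I_m -> R).
Hypothesis mX : measurable (X : set (borel 'rV[Cplx R]_m.+1)).
Hypothesis muX : (mu X < +oo)%E.
Hypothesis bX : exists M : R, forall w, X w -> forall j, `|ReC (w 0 j)| <= M /\ `|ImC (w 0 j)| <= M.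
Hypothesis z0 : forall j, z 0 j != 0.
Hypothesis r20 : 0 < r2.
Hypothesis kap0 : 0 < kap.
Hypothesis h0 : forall i, 0 < h i.
Hypothesis far : forall x th, X (polar z x th) ->
  (exists i, r2 <= `|x 0 (lift ord0 i)|) ->
  x 0 ord0 <= - (\sum_i h i * x 0 (lift ord0 i)) - kap * Num.sqrt (nsq (\row_i x 0 (lift ord0 i))).

Section sequence.
Variables (b : nat -> mpoly.multinom m.+1) (xi : 'rV[R]_m) (l0 : nat).
Hypothesis b0 : forall l, fun_of_multinom (b l) ord0 = l.
Hypothesis bdev : forall l, (l0 <= l)%N -> forall i, `|dev h (b l) i - xi 0 i| <= (sc l)^-1.

Lemma dev_le l i : (l0 <= l)%N -> `|dev h (b l) i| <= `|xi 0 i| + 1.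
Proof.
move=> ll; have := ler_normD (dev h (b l) i - xi 0 i) (xi 0 i); rewrite subrK => /le_trans; apply.
rewrite addrC lerD2l; apply: le_trans (bdev ll i) _.
by rewrite invf_le1 ?sc_gt0// sc_ge1.
Qed.

Lemma devE l i : (fun_of_multinom (b l) (lift ord0 i))%:R = l%:R * h i + sc l * dev h (b l) i.
Proof. by rewrite /dev b0 [sc l * _]mulrC divfK ?gt_eqF ?sc_gt0// addrC subrK. Qed.

Lemma b_pos : \forall l \near \oo, forall j, (0 < fun_of_multinom (b l) j)%N.
Proof.
have H i : \forall l \near \oo, sc l * (`|xi 0 i| + 2) <= l%:R * h i by exact: sc_small.
have H' := filter_forall _ H.
near=> l => j.
case: (unliftP ord0 j) => [i ->|->]; last by rewrite b0; near: l; exists 1%N.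
rewrite -(ltr_nat R) devE.
have h1 : sc l * (`|xi 0 i| + 2) <= l%:R * h i by move: i; near: l; exact: H'.
have h2 : `|dev h (b l) i| <= `|xi 0 i| + 1 by apply: dev_le; near: l; exact: nbhs_infty_ge.
have s1 := @sc_ge1 R l.
have h3 : - (sc l * (`|xi 0 i| + 1)) <= sc l * dev h (b l) i.
  rewrite -mulrN; apply: ler_wpM2l; first by rewrite ltW// sc_gt0.
  by move: h2; rewrite ler_norml => /andP[].
have e1 : sc l * (`|xi 0 i| + 2) = sc l * (`|xi 0 i| + 1) + sc l by ring.
move: h1 h3 s1; rewrite e1; lra.
Unshelve. all: by end_near. Qed.

Lemma not_shell x th : ~ shell z r2 (polar z x th) -> exists i, r2 <= `|x 0 (lift ord0 i)|.
Proof.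
move=> /existsNP[i hi]; exists i; rewrite leNgt; apply/negP => hx; apply: hi.
by rewrite mxE mulfK// cabs2_cexp expR_sqr_window.
Qed.

Lemma far_exponent l (x : 'rV[R]_m.+1) : (l0 <= l)%N ->
  sc l * (\sum_i (`|xi 0 i| + 1)) <= l%:R * (kap / 2) ->
  (exists i, r2 <= `|x 0 (lift ord0 i)|) ->
  x 0 ord0 <= - (\sum_i h i * x 0 (lift ord0 i)) - kap * Num.sqrt (nsq (\row_i x 0 (lift ord0 i))) ->
  2 * \sum_j (fun_of_multinom (b l) j)%:R * x 0 j <= - (kap * r2 * l%:R).
Proof.
move=> ll hs [i0 hi0] hx; set Y := Num.sqrt _ in hx.
have yY i : `|x 0 (lift ord0 i)| <= Y.
  rewrite -sqrtr_sqr; apply: ler_wsqrtr.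
  by have := le_nsq (\row_i x 0 (lift ord0 i)) i; rewrite mxE.
have Yr : r2 <= Y := le_trans hi0 (yY i0).
have Y0 : 0 <= Y by rewrite sqrtr_ge0.
rewrite big_ord_recl b0.
have -> : \sum_i (fun_of_multinom (b l) (lift ord0 i))%:R * x 0 (lift ord0 i) =
    l%:R * (\sum_i h i * x 0 (lift ord0 i)) + sc l * \sum_i dev h (b l) i * x 0 (lift ord0 i).
  by rewrite !mulr_sumr -big_split; apply: eq_bigr => i _; rewrite devE /=; ring.
have h1 : l%:R * x 0 ord0 <= l%:R * (- (\sum_i h i * x 0 (lift ord0 i)) - kap * Y) by exact: ler_wpM2l.
have h2 : sc l * \sum_i dev h (b l) i * x 0 (lift ord0 i) <= l%:R * (kap / 2) * Y.
  apply: (@le_trans _ _ (sc l * (\sum_i (`|xi 0 i| + 1)) * Y)); last exact: ler_wpM2r.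
  rewrite -mulrA; apply: ler_wpM2l; first by rewrite ltW// sc_gt0.
  rewrite mulr_suml; apply: ler_sum => i _; apply: le_trans (ler_norm _) _.
  by rewrite normrM; apply: ler_pM => //; exact: dev_le.
have h3 : l%:R * (kap / 2) * r2 <= l%:R * (kap / 2) * Y.
  by apply: ler_wpM2l => //; rewrite mulr_ge0// divr_ge0// ltW.
have e1 : l%:R * (- (\sum_i h i * x 0 (lift ord0 i)) - kap * Y) =
  - (l%:R * \sum_i h i * x 0 (lift ord0 i)) - 2 * (l%:R * (kap / 2) * Y) by field.
have e2 : kap * r2 * l%:R = 2 * (l%:R * (kap / 2) * r2) by field.
move: h1 h2 h3; rewrite e1 e2.
move: (l%:R * x 0 ord0) (l%:R * \sum_i _) (sc l * \sum_i _) (_ * Y) (_ * r2) => A B C E G; lra.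
Qed.

Lemma far_wgt : \forall l \near \oo, forall w, X w -> ~ shell z r2 w ->
  wgt z (b l) w <= expR (- (kap * r2 * l%:R)).
Proof.
have k2 : 0 < kap / 2 by rewrite divr_gt0.
near=> l => w Xw nw.
have hb : forall j, (0 < fun_of_multinom (b l) j)%N by near: l; exact: b_pos.
have hs : sc l * (\sum_i (`|xi 0 i| + 1)) <= l%:R * (kap / 2) by near: l; exact: sc_small.
have ll : (l0 <= l)%N by near: l; exact: nbhs_infty_ge.
have [wn|/existsNP[j wj]] := pselect (forall j, w 0 j != 0); last first.
  rewrite (@wgt_zero _ _ z _ _ j) ?expR_ge0//.
  by apply/eqP; apply: contrapT => /negP.
have /choice[p hp] : forall j, exists p : R * R, w 0 j / z 0 j = cexp (mkC p.1 p.2).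
  by move=> j; have [|x [t ?]] := @cexp_surj R (w 0 j / z 0 j); [by rewrite mulf_neq0// invr_eq0|exists (x, t)].
have wE : w = polar z (\row_j (p j).1) (\row_j (p j).2).
  by apply/rowP => j; rewrite !mxE -hp divfK.
rewrite wE wgt_polar// ler_expR; rewrite wE in Xw nw.
have ns := not_shell nw.
exact: far_exponent ll hs ns (far Xw ns).
Unshelve. all: by end_near. Qed.

Lemma far_limit : (fun l => (sc l ^+ m)%:E * \int[mu]_(w in X `&` ~` shell z r2) (wgt z (b l) w)%:E)%E @ \oo --> 0%E.
Proof.
have mS : measurable (X `&` ~` shell z r2 : set (borel _)).
  by apply: measurableI => //; apply: measurableC; exact: measurable_shell.
have muS : (mu (X `&` ~` shell z r2) <= mu X)%E by apply: le_measure; rewrite ?inE//.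
have fX : mu X \is a fin_num by rewrite ge0_fin_numE.
apply: (@squeeze_cvge _ _ _ _ (fun=> 0%E) _ (fun l => (sc l ^+ m * expR (- (kap * r2 * l%:R)))%:E * mu X)%E).
- near=> l; apply/andP; split.
    rewrite mule_ge0 ?lee_fin ?exprn_ge0 ?sqrtr_ge0//; apply: integral_ge0 => w _; rewrite lee_fin; exact: wgt_ge0.
  rewrite EFinM -muleA; apply: lee_wpmul2l; first by rewrite lee_fin exprn_ge0// sqrtr_ge0.
  apply: (@le_trans _ _ (\int[mu]_(w in X `&` ~` shell z r2) (expR (- (kap * r2 * l%:R)))%:E)%E).
    apply: ge0_le_integral => //.
    + by move=> w _; rewrite lee_fin; exact: wgt_ge0.
    + by apply: measurable_funTS; exact: measurable_wgt z bX (b l).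
    + move=> w [Xw nw]; rewrite lee_fin.
      have H : forall w, X w -> ~ shell z r2 w -> wgt z (b l) w <= expR (- (kap * r2 * l%:R)) by near: l; exact: far_wgt.
      exact: H.
  by rewrite integral_cst//; apply: lee_wpmul2l => //; rewrite lee_fin expR_ge0.
- exact: cvg_cst.
rewrite -[X in _ --> X](mul0e (mu X)); apply: cvgeZr => //.
apply: cvg_EFin; first exact: nearW.
by apply: pow_exp_cvg; rewrite mulr_gt0.
Unshelve. all: by end_near. Qed.

(** Far from the torus of z the linear gap makes the weights exponentially small,
   which beats the factor sc l ^ m. *)
Lemma laplace_limit P : P \is a fin_num ->
  (fun l => (sc l ^+ m)%:E * \int[mu]_(w in near_part X z r2) (wgt z (b l) w)%:E)%E @ \oo --> P ->
  (fun l => (sc l ^+ m)%:E * \int[mu]_(w in X) (wgt z (b l) w)%:E)%E @ \oo --> P.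
Proof.
move=> fP hP.
have mS := measurable_shell z r2.
have E l : ((sc l ^+ m)%:E * \int[mu]_(w in X) (wgt z (b l) w)%:E =
   (sc l ^+ m)%:E * \int[mu]_(w in near_part X z r2) (wgt z (b l) w)%:E +
   (sc l ^+ m)%:E * \int[mu]_(w in X `&` ~` shell z r2) (wgt z (b l) w)%:E)%E.
  rewrite -ge0_muleDr; last 2 first.
  - by apply: integral_ge0 => w _; rewrite lee_fin; exact: wgt_ge0.
  - by apply: integral_ge0 => w _; rewrite lee_fin; exact: wgt_ge0.
  congr (_ * _)%E; rewrite -ge0_integral_setU//.
  - by rewrite /near_part -setIUr setUCr setIT.
  - exact: measurableI.
  - by apply: measurableI => //; exact: measurableC.
  - by apply: measurable_funTS; exact: measurable_wgt z bX (b l).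
  - by move=> w _; rewrite lee_fin; exact: wgt_ge0.
  - by apply/disj_setPS => w [[_ s1] [_ s2]].
under eq_fun do rewrite E.
rewrite -[P]adde0; apply: cvgeD => //; [exact: fin_num_adde_defl|exact: far_limit].
Qed.
End sequence.

(** [tb b] is the squared norm of the monomial normalised at [z]. *)
Definition tb b : R := fine (\int[mu]_(w in X) (wgt z b w)%:E).

Lemma wgt_int_fin b : (\int[mu]_(w in X) (wgt z b w)%:E)%E \is a fin_num.
Proof.
have [_ _ [M hM]] := bcont_mono bX b.
suff I : mu.-integrable X (EFin \o wgt z b) by exact: (integrable_fin_num mX I).
apply: (integrable_bounded mX muX); first exact: wgt_continuous z bX b.
exists ((M ^+ 2 + M ^+ 2) / cabs2 (mono b z)) => w Xw.
rewrite ger0_norm ?wgt_ge0// /wgt ler_pM2r ?invr_gt0 ?cabs2_gt0 ?mono_neq0//.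
have [h1 h2] := hM w Xw.
by apply: lerD; rewrite -real_normK ?num_real// lerXn2r ?nnegrE// (le_trans _ h1).
Qed.

Lemma tb_J b : J X mu b = cabs2 (mono b z) * tb b.
Proof.
have C0 := cabs2_gt0 (mono_neq0 z0 b).
rewrite /J /Rintegral /tb -[cabs2 (mono b z)]/(fine (cabs2 (mono b z))%:E) -fineM ?wgt_int_fin//.
congr fine; rewrite -ge0_integralZl//.
- by apply: eq_integral => w _; rewrite -EFinM /wgt mulrC divfK ?gt_eqF.
- by apply: measurable_funTS; exact: measurable_wgt z bX b.
- by move=> w _; rewrite lee_fin; exact: wgt_ge0.
- by rewrite lee_fin ltW.
Qed.

Lemma tb_limit (b : nat -> mpoly.multinom m.+1) P : P \is a fin_num ->
  (fun l => (sc l ^+ m)%:E * \int[mu]_(w in X) (wgt z (b l) w)%:E)%E @ \oo --> P ->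
  (fun l => sc l ^+ m * tb (b l)) @ \oo --> fine P.
Proof.
move=> fP hP.
have hP' : (fun l => (sc l ^+ m)%:E * \int[mu]_(w in X) (wgt z (b l) w)%:E)%E @ \oo --> (fine P)%:E by rewrite fineK.
have -> : (fun l => sc l ^+ m * tb (b l)) =
    fine \o (fun l => (sc l ^+ m)%:E * \int[mu]_(w in X) (wgt z (b l) w)%:E)%E.
  by apply/funext => l; rewrite /= fineM ?wgt_int_fin.
exact: fine_cvg hP'.
Qed.

Lemma tb_lower (c : R) b : 
  ((c * (sc (fun_of_multinom b ord0) ^+ m)^-1 * expR (c * \sum_i `|dev h b i|))%:E <=
   \int[mu]_(w in X) (wgt z b w)%:E)%E ->
  c * (sc (fun_of_multinom b ord0) ^+ m)^-1 * expR (c * \sum_i `|dev h b i|) <= tb b.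
Proof. by move=> H; rewrite -lee_fin /tb fineK// wgt_int_fin. Qed.
End laplace.

(** * Sums over multi-indices as integrals *)

Section summation.
Context {R : realType} {m : nat}.
Variables (h : 'I_m -> R) (om : mpoly.multinom m.+1 -> R) (theta : 'rV[R]_m -> R) (K c : R).
Hypothesis h0 : forall i, 0 < h i.
Hypothesis K0 : 0 < K.
Hypothesis c0 : 0 < c.
Hypothesis om0 : forall b, 0 <= om b.
Hypothesis om_le : forall b, om b <= K * sc (fun_of_multinom b ord0) ^+ m * expR (- (c * \sum_i `|dev h b i|)).
Hypothesis om_lim : forall (b : nat -> mpoly.multinom m.+1) (xi : 'rV[R]_m) l0,
  (forall l, fun_of_multinom (b l) ord0 = l) ->
  (forall l, (l0 <= l)%N -> forall i, `|dev h (b l) i - xi 0 i| <= (sc l)^-1) ->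
  (fun l => om (b l) / sc l ^+ m) @ \oo --> theta xi.

Definition hs (j : 'I_m.+1) : R := if unlift ord0 j is Some i then h i else 1.
Definition HH : R := \sum_j hs j.

Lemma HHE : HH = 1 + \sum_i h i.
Proof.
rewrite /HH big_ord_recl /hs unlift_none; congr (_ + _).
by apply: eq_bigr => i _; rewrite liftK.
Qed.

Lemma HH_gt0 : 0 < HH.
Proof. by rewrite HHE ltr_pwDl// sumr_ge0// => i _; exact: ltW. Qed.

Definition mnom (f : 'I_m.+1 -> nat) : mpoly.multinom m.+1 := mpoly.Multinom [tuple f i | i < m.+1].
Lemma mnomE f j : fun_of_multinom (mnom f) j = f j.
Proof. exact: mpoly.mnmE. Qed.

Definition in_cell (b : mpoly.multinom m.+1) (v : 'rV[R]_m.+1) := forall j : 'I_m.+1,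
  v 0 j \in `[(fun_of_multinom b j)%:R, (fun_of_multinom b j).+1%:R[.
Definition cell (b : mpoly.multinom m.+1) (v : 'rV[R]_m.+1) : \bar R :=
  (\prod_(j < m.+1) (\1_(`[(fun_of_multinom b j)%:R, (fun_of_multinom b j).+1%:R[%classic) (v 0%R j))%:E)%E.

Lemma cell_in b v : in_cell b v -> cell b v = 1%E.
Proof. by move=> H; apply: big1 => j _; rewrite indicE mem_set//; exact: H. Qed.

Lemma cell_out b v : ~ in_cell b v -> cell b v = 0%E.
Proof.
move=> /existsNP[j hj]; rewrite /cell (bigD1 j)//= indicE memNset ?mul0e//.
Qed.

Lemma cell_ge0 b v : (0 <= cell b v)%E.
Proof. by apply: prode_ge0 => j _; rewrite lee_fin. Qed.

Lemma in_cell_uniq b b' v : in_cell b v -> in_cell b' v -> b = b'.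
Proof.
move=> H H'; apply/mpoly.mnmP => j.
have := H j; have := H' j; rewrite !in_itv/= => /andP[a1 a2] /andP[b1 b2].
have := le_lt_trans a1 b2; have := le_lt_trans b1 a2.
by rewrite !ltr_nat !ltnS => u1 u2; apply/eqP; rewrite eqn_leq u1 u2.
Qed.

Lemma cell_integral b :
  measurable_fun setT (cell b : borel 'rV[R]_m.+1 -> \bar R) /\
  (\int[lam m.+1]_v cell b v = 1)%E.
Proof.
have [||h1 h2] := @integral_prod R m.+1 (fun j (x : measurableTypeR R) => (\1_(`[(fun_of_multinom b j)%:R, (fun_of_multinom b j).+1%:R[%classic) x)%:E).
- by move=> j; apply/measurable_EFinP; exact: measurable_indic.
- by move=> j x; rewrite lee_fin.
split; first exact: h1.
rewrite /cell h2 big1// => j _; rewrite integral_indic// setIT /= lebesgue_measure_itv/= lte_fin ltr_nat ltnSn.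
by rewrite -EFinB -natrB ?leqnSn// subSnn.
Qed.

Definition Phi N (g : mpoly.multinom m.+1 -> R) (v : 'rV[R]_m.+1) : \bar R :=
  (\sum_(b : mpoly.bmultinom m.+1 N.+1) (om b * g b)%:E * cell b v)%E.

Lemma Phi_in N g b v : in_cell b v -> (mpoly.mdeg b < N.+1)%N -> Phi N g v = (om b * g b)%:E.
Proof.
move=> H bN; rewrite /Phi (bigD1 (mpoly.BMultinom bN))//= cell_in// mule1 big1 ?adde0// => b' bb'.
rewrite cell_out ?mule0// => H'; move/eqP : bb'; apply; apply/val_inj => /=.
exact: in_cell_uniq H' H.
Qed.

Lemma Phi_out N g v : (forall b : mpoly.bmultinom m.+1 N.+1, ~ in_cell b v) -> Phi N g v = 0%E.
Proof. by move=> H; apply: big1 => b _; rewrite cell_out ?mule0. Qed.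

Lemma Phi_big N g b v : in_cell b v -> (N < mpoly.mdeg b)%N -> Phi N g v = 0%E.
Proof.
move=> H bN; apply: Phi_out => b' H'.
have E := in_cell_uniq H H'; have := mpoly.bmdeg b'; rewrite -E ltnS leqNgt bN //.
Qed.

Section bounded_g.
Variables (N : nat) (g : mpoly.multinom m.+1 -> R) (K2 : R).
Hypothesis g0 : forall b, (mpoly.mdeg b < N.+1)%N -> 0 <= g b <= K2.

Lemma omg_ge0 (b : mpoly.bmultinom m.+1 N.+1) : (0 <= (om b * g b)%:E)%E.
Proof. by rewrite lee_fin mulr_ge0//; have /andP[] := g0 (mpoly.bmdeg b). Qed.

Lemma Phi_ge0 v : (0 <= Phi N g v)%E.
Proof. by apply: sume_ge0 => b _; rewrite mule_ge0 ?omg_ge0 ?cell_ge0. Qed.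

Lemma measurable_Phi : measurable_fun setT (Phi N g : borel 'rV[R]_m.+1 -> \bar R).
Proof. by apply: emeasurable_sum => b; apply: measurable_funeM; exact: (cell_integral b).1. Qed.

Lemma integral_Phi : (\int[lam m.+1]_v Phi N g v = (\sum_(b : mpoly.bmultinom m.+1 N.+1) om b * g b)%:E)%E.
Proof.
rewrite /Phi ge0_integral_sum//.
- rewrite -sumEFin; apply: eq_bigr => b _; rewrite ge0_integralZl//.
  + by rewrite (cell_integral b).2 mule1.
  + exact: (cell_integral b).1.
  + by move=> v _; exact: cell_ge0.
  + exact: omg_ge0.
- by move=> b; apply: measurable_funeM; exact: (cell_integral b).1.
- by move=> b v _; rewrite mule_ge0 ?omg_ge0 ?cell_ge0.
Qed.

Definition affl l (x : 'rV[R]_m) : 'rV[R]_m := aff (fun=> sc l) (fun i => l%:R * h i) x.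

Lemma cell_dev b t l x : in_cell b (consr t (affl l x)) -> fun_of_multinom b ord0 = l ->
  forall i, `|dev h b i - x 0 i| <= (sc l)^-1.
Proof.
move=> H b0 i; have := H (lift ord0 i); rewrite consrS mxE in_itv/= -natr1 => /andP[h1 h2].
have s0 := @sc_gt0 R l.
have -> : dev h b i - x 0 i = ((fun_of_multinom b (lift ord0 i))%:R - (sc l * x 0 i + l%:R * h i)) / sc l.
  by rewrite /dev b0; field; rewrite gt_eqF.
have si : (0 : R) <= (sc l)^-1 by rewrite invr_ge0 ltW.
rewrite normrM (ger0_norm si) -[leRHS]mul1r; apply: ler_wpM2r => //.
by rewrite ler_norml; apply/andP; split; lra.
Qed.

Definition V (t : R) (x : 'rV[R]_m) : \bar R :=
  ((sc (Num.truncn t) ^+ m / N%:R ^+ m)%:E * Phi N g (consr t (affl (Num.truncn t) x)))%E.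

Lemma V_ge0 t x : (0 <= V t x)%E.
Proof. by rewrite mule_ge0 ?Phi_ge0// lee_fin divr_ge0 ?exprn_ge0 ?sqrtr_ge0. Qed.

Definition MM : R := 2 ^+ m * K * K2 * expR (c * m%:R).

Lemma in_cell_truncn b t y : in_cell b (consr t y) -> fun_of_multinom b ord0 = Num.truncn t.
Proof.
move=> H; have := H ord0; rewrite consr0 in_itv/= => /andP[h1 h2].
have t0 : 0 <= t by apply: le_trans h1.
have /andP[h3 h4] := truncn_itv t0.
have := le_lt_trans h1 h4; have := le_lt_trans h3 h2; rewrite !ltr_nat !ltnS => u1 u2.
by apply/eqP; rewrite eqn_leq u1 u2.
Qed.

(** The exponential decay in the deviation gives one integrable majorant for
   all N. *)
Lemma V_le t x : (0 < N)%N -> (V t x <= MM%:E * \prod_(i < m) (expR (- (c * `|x 0%R i|)))%:E)%E.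
Proof.
move=> N0; set l := Num.truncn t.
have K20 : 0 <= K2.
  have b0 : (mpoly.mdeg (@mpoly.mnm0 m.+1) < N.+1)%N by rewrite mpoly.mdeg0.
  by have /andP[] := g0 b0; exact: le_trans.
have M0 : 0 <= MM by rewrite !mulr_ge0 ?expR_ge0 ?exprn_ge0// ltW.
have P0 : (0 <= \prod_(i < m) (expR (- (c * `|x 0%R i|)))%:E)%E.
  by apply: prode_ge0 => i _; rewrite lee_fin expR_ge0.
have [[b Hb]|/forallNP H] := pselect (exists b : mpoly.bmultinom m.+1 N.+1, in_cell b (consr t (affl l x))); last first.
  by rewrite /V Phi_out// mule0 mule_ge0// lee_fin.
have bl := in_cell_truncn Hb; have bd := cell_dev Hb bl.
rewrite /V (Phi_in g Hb (mpoly.bmdeg b)) -EFinM prodEFin -EFinM lee_fin -/l.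
have /andP[g1 g2] := g0 (mpoly.bmdeg b).
have lN : (l <= N)%N.
  have -> : l = fun_of_multinom b ord0 by rewrite bl.
  rewrite -ltnS; apply: leq_ltn_trans (mpoly.bmdeg b).
  by rewrite mpoly.mdegE (bigD1 ord0)//= leq_addr.
have s0 := @sc_gt0 R l.
have N0' : (0 : R) < N%:R by rewrite ltr0n.
have r1 : sc l ^+ m / N%:R ^+ m * sc l ^+ m <= (2 ^+ m : R).
  rewrite mulrAC -exprMn -expr2 sc2 -expr_div_n; apply: lerXn2r; rewrite ?nnegrE ?divr_ge0//.
  rewrite ler_pdivrMr// -natrM ler_nat mul2n -addnn; apply: leq_trans (_ : N.+1 <= _)%N; first by rewrite ltnS.
  by rewrite -addn1 leq_add2l.
have r2 : om b <= K * sc l ^+ m * (expR (c * m%:R) * \prod_(i < m) expR (- (c * `|x 0 i|))).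
  apply: le_trans (om_le b) _; rewrite bl -/l; apply: ler_wpM2l.
    by rewrite mulr_ge0 ?exprn_ge0 ?ltW.
  rewrite -expR_sum -expRD ler_expR sumrN -!mulr_sumr.
  have : \sum_i `|x 0 i| <= \sum_i (`|dev h b i| + 1).
    apply: ler_sum => i _; have := ler_normB (dev h b i) (dev h b i - x 0 i).
    rewrite opprB addrC subrK => /le_trans; apply; rewrite lerD2l; apply: le_trans (bd i) _.
    by rewrite invf_le1 ?sc_ge1.
  rewrite big_split/= sumr_const card_ord => hsum.
  have := ler_wpM2l (ltW c0) hsum; rewrite mulrDr; lra.
set P := \prod_(i < m) _ in r2 *.
have P0' : 0 <= P by apply: prodr_ge0 => i _; exact: expR_ge0.
apply: (@le_trans _ _ (sc l ^+ m / N%:R ^+ m * (K * sc l ^+ m * (expR (c * m%:R) * P) * K2))).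
  apply: ler_wpM2l; first by rewrite divr_ge0 ?exprn_ge0// ltW.
  by apply: ler_pM.
have -> : sc l ^+ m / N%:R ^+ m * (K * sc l ^+ m * (expR (c * m%:R) * P) * K2) =
  (sc l ^+ m / N%:R ^+ m * sc l ^+ m) * (K * K2 * expR (c * m%:R) * P) by ring.
have -> : MM * P = 2 ^+ m * (K * K2 * expR (c * m%:R) * P) by rewrite /MM; ring.
by apply: ler_wpM2r => //; rewrite !mulr_ge0 ?expR_ge0// ltW.
Qed.

Lemma V_zero t x : t < 0 \/ N.+1%:R <= t -> V t x = 0%E.
Proof.
move=> ht; rewrite /V Phi_out ?mule0// => b Hb.
have := Hb ord0; rewrite consr0 in_itv/= => /andP[h1 h2].
have bN : (fun_of_multinom b ord0 <= N)%N.
  rewrite -ltnS; apply: leq_ltn_trans (mpoly.bmdeg b).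
  by rewrite mpoly.mdegE (bigD1 ord0)//= leq_addr.
case: ht => ht.
  by have := le_lt_trans h1 ht; rewrite ltNge ler0n.
by have := le_lt_trans ht h2; rewrite ltr_nat ltnS ltnNge bN.
Qed.

Lemma measurable_V t : measurable_fun setT (V t : borel 'rV[R]_m -> \bar R).
Proof.
apply: measurable_funeM.
exact: (measurableT_comp (measurable_consr1 t measurable_Phi) (measurable_aff (fun=> sc (Num.truncn t)) (fun i => (Num.truncn t)%:R * h i))).
Qed.

Lemma integral_V t : (0 < N)%N ->
  (\int[lam m]_x V t x = ((N%:R ^+ m)^-1)%:E * \int[lam m]_x Phi N g (consr t x))%E.
Proof.
move=> N0; set l := Num.truncn t.
have Pc0 (x : 'rV[R]_m) : (0 <= Phi N g (consr t x))%E by exact: Phi_ge0.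
have mP := measurable_consr1 t measurable_Phi.
rewrite [in RHS](@integral_aff R m (fun=> sc l) (fun i => l%:R * h i) (fun x => Phi N g (consr t x)) (fun=> sc_gt0 l) mP Pc0).
rewrite prodr_const card_ord /V ge0_integralZl//.
- by rewrite muleA -EFinM [_^-1 * _]mulrC.
- exact: (measurableT_comp mP (measurable_aff (fun=> sc l) (fun i => l%:R * h i))).
- by rewrite lee_fin divr_ge0 ?exprn_ge0 ?sqrtr_ge0.
Qed.

(** Summands are spread over disjoint cells; the variable of the zeroth exponent
   is rescaled by N and the others are centred on the normal ray and rescaled by
   the width of the peak. *)
Lemma sum_integral : (0 < N)%N ->
  (((N%:R ^+ m.+1)^-1 * \sum_(b : mpoly.bmultinom m.+1 N.+1) om b * g b)%:E =
   (HH^-1)%:E * \int[lebesgue_measure]_y \int[lam m]_x V (N%:R / HH * y + 0)%R x)%E.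
Proof.
move=> N0; have N0' : (0 : R) < N%:R by rewrite ltr0n.
have H0 := HH_gt0.
rewrite EFinM -integral_Phi integral_lamS; [|exact: measurable_Phi|exact: Phi_ge0].
have mI := measurable_integral_consr measurable_Phi Phi_ge0.
have I0 t : (0 <= \int[lam m]_x Phi N g (consr t x))%E by apply: integral_ge0 => x _; exact: Phi_ge0.
rewrite (@integral_affine1 R (N%:R / HH) 0 _ _ mI I0); last by rewrite divr_gt0.
under [in RHS]eq_integral do rewrite integral_V//.
rewrite ge0_integralZl//.
- rewrite !muleA -!EFinM; congr (_%:E * _)%E.
  by rewrite exprSr invfM; field; rewrite !gt_eqF// exprn_gt0.
- have maf : measurable_fun setT (fun y : measurableTypeR R => (N%:R / HH * y + 0 : measurableTypeR R)).
    by apply: measurable_funD => //; apply: measurable_funM.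
  exact: (measurableT_comp mI maf).
Qed.
End bounded_g.
End summation.

(** * Geometry of the boundary around z *)

Section domain_geometry.
Context {R : realType} {m : nat}.
Variables (Omega : set 'rV[Cplx R]_m.+1) (z : 'rV[Cplx R]_m.+1)
  (rho : 'rV[Cplx R]_m.+1 -> R).
Hypothesis oO : open Omega.
Hypothesis bO : bounded_set Omega.
Hypothesis Reinhardt : complete_Reinhardt Omega.
Hypothesis z_bd : boundary Omega z.
Hypothesis z0 : forall j, z 0 j != 0.
Let X := boundary Omega.

Lemma interior_Omega : Omega° = Omega.
Proof. by apply/interior_id. Qed.

Lemma boundary_not w : X w -> ~ Omega w.
Proof. by move=> [_ h] Ow; apply: h; rewrite interior_Omega. Qed.

Lemma measurable_boundary : measurable (X : set (borel 'rV[Cplx R]_m.+1)).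
Proof.
have mc : measurable (closure Omega : set (borel 'rV[Cplx R]_m.+1)).
  rewrite -[closure Omega]setCK; apply: measurableC; apply: open_borel.
  by apply: closed_openC; exact: closed_closure.
apply: measurableD => //; apply: open_borel; exact: open_interior.
Qed.

Lemma Omega_rot th w : Omega w -> Omega (torus_act th w).
Proof.
move=> Ow; have := Reinhardt (lambda := fun j => cexp (mkC 0 (th j))) Ow; apply => j.
by rewrite cexp_norm expR0.
Qed.

(** Rotations preserve the domain and are homeomorphisms, hence preserve its
   boundary. *)
Lemma boundary_rot th : X `<=` @torus_act R m.+1 th @^-1` X.
Proof.
move=> w Xw; have [cw _] := Xw; split; last first.
  rewrite interior_Omega => /(Omega_rot (fun j => - th j)); rewrite torus_actK => Ow.
  exact: (boundary_not Xw).
move=> B nB; have nB' : nbhs w (torus_act th @^-1` B) by exact: (@torus_act_continuous R m.+1 th w).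
by have [p [Op Bp]] := cw _ nB'; exists (torus_act th p); split => //; exact: Omega_rot.
Qed.

Lemma abs_re (a : Cplx R) : `|ReC a| <= Num.sqrt (ReC a ^+ 2 + ImC a ^+ 2).
Proof. by rewrite -sqrtr_sqr; apply: ler_wsqrtr; rewrite lerDl sqr_ge0. Qed.

Lemma abs_im (a : Cplx R) : `|ImC a| <= Num.sqrt (ReC a ^+ 2 + ImC a ^+ 2).
Proof. by rewrite -sqrtr_sqr; apply: ler_wsqrtr; rewrite lerDr sqr_ge0. Qed.

Lemma Omega_coord_bound : exists M : R, forall w, Omega w -> forall j, `|ReC (w 0 j)| <= M /\ `|ImC (w 0 j)| <= M.
Proof.
have [M [Mr hM]] := bO.
have hM1 : M < `|M| + 1 by apply: le_lt_trans (real_ler_norm Mr) _; rewrite ltrDl.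
exists (Num.sqrt (ReC M ^+ 2 + ImC M ^+ 2) + 1 + 1) => w Ow j.
have hb : ball (0 : 'rV[Cplx R]_m.+1) (`|M| + 1 + 1) w.
  rewrite mx_norm_ball /ball_/= sub0r normrN; apply: le_lt_trans (hM _ hM1 w Ow) _.
  by rewrite ltrDl ltr01.
have [_ /(_ 0 j)] := hb; rewrite /ball/= mxE sub0r normrN => /ltW.
rewrite norm_mkC (norm_mkC M) => h.
have E : mkC (Num.sqrt (ReC M ^+ 2 + ImC M ^+ 2)) 0 + 1 + 1 = mkC (Num.sqrt (ReC M ^+ 2 + ImC M ^+ 2) + 1 + 1) 0 :> Cplx R.
  by apply: Cext; rewrite ?ReCD ?ImCD/= ?addr0.
move: h; rewrite E lec_real => h.
by split; [exact: le_trans (abs_re _) h|exact: le_trans (abs_im _) h].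
Qed.

Lemma boundary_coord_bound : exists M : R, forall w, X w -> forall j, `|ReC (w 0 j)| <= M /\ `|ImC (w 0 j)| <= M.
Proof.
have [M hM] := Omega_coord_bound; exists (M + 1) => w [cw _] j.
have o1 : (0 : Cplx R) < 1 by exact: ltr01.
have [p [Op [_ bp]]] := cw _ (nbhsx_ballx w 1 o1).
have [h1 h2] := hM p Op j; have := bp 0 j; rewrite /ball/= norm_mkC => hb.
have {}hb : Num.sqrt (ReC (w 0 j - p 0 j) ^+ 2 + ImC (w 0 j - p 0 j) ^+ 2) < 1.
  by rewrite -(ltc_mk _ 1).
have a1 := le_lt_trans (abs_re _) hb; have a2 := le_lt_trans (abs_im _) hb.
rewrite ReCD ReCN in a1; rewrite ImCD ImCN in a2.
have b1 := ler_normD (ReC (w 0 j) - ReC (p 0 j)) (ReC (p 0 j)).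
have b2 := ler_normD (ImC (w 0 j) - ImC (p 0 j)) (ImC (p 0 j)).
rewrite subrK in b1; rewrite subrK in b2.
by split; [apply: le_trans b1 _|apply: le_trans b2 _]; rewrite addrC; apply: lerD => //; exact: ltW.
Qed.

Lemma boundary_polar th : X (polar z 0 th).
Proof.
have := @boundary_rot (fun j => th 0 j) z z_bd; rewrite /preimage/=; congr (X _).
by apply/rowP => j; rewrite !mxE.
Qed.

Hypothesis srr : smooth setT (rho \o @of_real R m.+1).
Hypothesis OmegaE : Omega = [set z | rho z < 0].
Hypothesis bdE : boundary Omega = [set z | rho z = 0].
Hypothesis psc : forall w, boundary Omega w ->
  forall u, u != 0 -> dprime rho w u = 0 -> 0 < levi rho w u.

Let F : 'rV[R]_m.+1 -> R := Flog rho z.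
Let sF : smooth setT F. Proof. exact: smooth_Flog. Qed.
Let F_lower (x x' : 'rV[R]_m.+1) : (forall j, x' 0 j <= x 0 j) -> F x < 0 -> F x' < 0.
Proof. exact: (Flog_lower Reinhardt OmegaE). Qed.
Let F_partial (x : 'rV[R]_m.+1) j : F x = 0 -> 0 < 'D_(Ei j) F x.
Proof. exact: (Flog_partial_gt0 Reinhardt srr OmegaE bdE psc z0). Qed.
Let F_tangent (x v : 'rV[R]_m.+1) : F x = 0 -> v != 0 -> 'D_v F x = 0 -> 0 < 'D_v ('D_v F) x.
Proof. exact: (Flog_tangent Reinhardt srr OmegaE bdE psc z0). Qed.
Let F_bd (x : 'rV[R]_m.+1) (s : R) : F x = 0 -> 0 < s -> F (- s *: ones + x) < 0.
Proof. exact: (Flog_bd_lt Reinhardt srr OmegaE bdE z0). Qed.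
Let F_convex (a b : 'rV[R]_m.+1) (t : R) : F a < 0 -> F b < 0 -> 0 <= t <= 1 -> F (a + t *: (b - a)) < 0.
Proof. exact: (Flog_convex Reinhardt srr OmegaE bdE psc z0). Qed.

Lemma rho_z0 : rho z = 0.
Proof. by have := z_bd; rewrite bdE. Qed.

Lemma Flog0 : F 0 = 0.
Proof. by rewrite /F /Flog polar00 rho_z0. Qed.

Definition kz : 'rV[R]_m -> R := k F.
Definition Dz : set 'rV[R]_m := gdom F.

Lemma consr00 : consr 0 0 = 0 :> 'rV[R]_m.+1.
Proof. by apply/rowP => j; case: (unliftP ord0 j) => [i ->|->]; rewrite ?consrS ?consr0 !mxE. Qed.

Lemma Dz0 : Dz 0.
Proof. by exists 0; rewrite consr00 Flog0. Qed.

Lemma kz0 : kz 0 = 0.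
Proof. by apply: (k_eq sF F_lower F_partial); rewrite consr00 Flog0. Qed.

Lemma open_Dz : open Dz.
Proof. exact: (open_gdom sF F_lower F_partial). Qed.

Lemma smooth_kz : smooth Dz kz.
Proof. exact: (smooth_k sF F_lower F_partial). Qed.

Lemma kz_concave (y v : 'rV[R]_m) : Dz y -> v != 0 -> 'D_v ('D_v kz) y < 0.
Proof. exact: (k_concave sF F_lower F_partial F_tangent). Qed.

Lemma kz_slope i : 0 < - 'D_(Ei i) kz 0.
Proof.
have [_ ->] := is_derive_k sF F_lower F_partial (Ei i) Dz0.
have k00 : k F 0 = 0 := kz0.
rewrite k00 consr00 mulNr opprK; apply: divr_gt0; last by apply: F_partial; exact: Flog0.
have -> : consr 0 (Ei i) = Ei (lift ord0 i) :> 'rV[R]_m.+1.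
  by have := @consr_EiS R m (0 : R) (1 : R) (0 : 'rV[R]_m) i; rewrite add0r !scale1r consr00 add0r.
by apply: F_partial; exact: Flog0.
Qed.

Lemma boundary_graph y th : Dz y -> X (polar z (consr (kz y) y) th).
Proof.
by move=> Dy; apply/(bd_polar Reinhardt srr OmegaE bdE z0); exact: kP.
Qed.

Lemma boundary_log x th : X (polar z x th) -> x 0 ord0 = kz (\row_i x 0 (lift ord0 i)).
Proof.
move=> /(bd_polar Reinhardt srr OmegaE bdE z0) Fx; apply/esym; apply: (k_eq sF F_lower F_partial).
by rewrite -consr_eta.
Qed.

Lemma near_first_neq0 r w : (forall y : 'rV[R]_m, (forall i, `|y 0 i| <= r) -> Dz y) ->
  near_part X z r w -> w 0 ord0 != 0.
Proof.
move=> rD [Xw sw]; apply/eqP => w0.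
have wn i : w 0 (lift ord0 i) / z 0 (lift ord0 i) != 0.
  apply/eqP => e; have /andP[h _] := sw i; move: h.
  by rewrite e /cabs2/= expr0n addr0 ltNge sqr_ge0.
have /choice[p hp] : forall i : 'I_m, exists p : R * R, w 0 (lift ord0 i) / z 0 (lift ord0 i) = cexp (mkC p.1 p.2).
  by move=> i; have [x [t ?]] := cexp_surj (wn i); exists (x, t).
pose y : 'rV[R]_m := \row_i (p i).1.
pose th : 'rV[R]_m.+1 := consr 0 (\row_i (p i).2).
have Dy : Dz y.
  apply: rD => i; have := sw i; rewrite hp cabs2_cexp expR_sqr_window mxE; exact: ltW.
have Op : Omega (polar z (consr (kz y - 1) y) th).
  apply/(Omega_Flog Reinhardt OmegaE).
  have := F_lt0_k sF F_lower F_partial (kz y - 1) Dy; rewrite ltrBlDr ltrDl ltr01 => h; exact: h.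
apply: (boundary_not Xw).
have := Reinhardt (lambda := fun j => if j == ord0 then 0 else 1) Op.
have -> : \row_j ((if j == ord0 then 0 else 1) * polar z (consr (kz y - 1) y) th 0 j) = w.
  apply/rowP => j; rewrite mxE; case: (unliftP ord0 j) => [i ->|->].
    rewrite (_ : lift ord0 i == ord0 = false)// mul1r mxE /th !consrS !mxE -hp divfK//.
  by rewrite eqxx mul0r w0.
by apply => j; case: ifP; rewrite ?normr0 ?normr1.
Qed.

Lemma derive_kz (y : 'rV[R]_m) : 'D_y kz 0 = - \sum_i (- 'D_(Ei i) kz 0) * y 0 i.
Proof.
have C1 : C1near kz 0 by apply: (Cn1_C1near open_Dz Dz0); exact: smooth_kz.
have [_ ->] := derive_sumEi y C1; rewrite -sumrN; apply: eq_bigr => i _.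
by rewrite mulNr opprK.
Qed.

(** The remainder left by the linear gap is what the Laplace method needs outside
   a neighbourhood of the torus of z. *)
Lemma far_gap r c : 0 < r -> 0 < c ->
  (forall y : 'rV[R]_m, (forall i, `|y 0 i| <= r) -> Dz y) ->
  (forall y : 'rV[R]_m, (forall i, `|y 0 i| <= r) -> kz y - 'D_y kz 0 <= - c * nsq y) ->
  forall x th, X (polar z x th) -> (exists i, r / 2 <= `|x 0 (lift ord0 i)|) ->
  x 0 ord0 <= - (\sum_i (- 'D_(Ei i) kz 0) * x 0 (lift ord0 i)) -
     c * (r / 4) * Num.sqrt (nsq (\row_i x 0 (lift ord0 i))).
Proof.
move=> r0 c0 rD rk x th /(bd_polar Reinhardt srr OmegaE bdE z0) Fx [i hi].
set y := \row_i x 0 (lift ord0 i).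
have r4 : r / 4 <= r by move: r0; lra.
have ry : r / 4 < Num.sqrt (nsq y).
  apply: (@lt_le_trans _ _ (r / 2)); first by move: r0; lra.
  apply: le_trans hi _; rewrite -sqrtr_sqr; apply: ler_wsqrtr.
  by have := le_nsq y i; rewrite mxE.
have r40 : 0 < r / 4 by rewrite divr_gt0.
have := @linear_gap _ _ F sF F_lower F_partial F_bd F_convex Flog0 (r / 4) c (x 0 ord0) y r40 c0.
rewrite -/kz derive_kz.
have -> : \sum_i (- 'D_(Ei i) kz 0) * y 0 i = \sum_i (- 'D_(Ei i) kz 0) * x 0 (lift ord0 i).
  by apply: eq_bigr => l _; rewrite mxE.
apply => //.
- by move=> y' hy'; apply: rD => l; exact: le_trans (hy' l) r4.
- by move=> y' hy'; apply: rk => l; exact: le_trans (hy' l) r4.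
have -> : consr (x 0 ord0) y = x by rewrite [RHS]consr_eta.
by have Fx' : F x = 0 := Fx; rewrite Fx'.
Qed.

(** Any defining function has the same logarithmic gradient at [z] up to a
    factor, since it vanishes on the graph of [kz]. *)
Definition slope (j : 'I_m.+1) : R :=
  if unlift ord0 j is Some i then - 'D_(Ei i) kz 0 else 1.

Section other_defining_function.
Variable rho' : 'rV[Cplx R]_m.+1 -> R.
Hypothesis srr' : smooth setT (rho' \o @of_real R m.+1).
Hypothesis bdE' : boundary Omega = [set z | rho' z = 0].
Hypothesis nd' : exists v, 'D_v (rho' \o @of_real R m.+1) (to_real z) != 0.
Let F' (x : 'rV[R]_m.+1) := rho' (polar z x 0).

Lemma torus0' th : rho' (polar z 0 th) = 0.
Proof. by have := boundary_polar th; rewrite /X bdE'. Qed.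

Lemma derive_polar_grad (v : 'rV[R]_m.+1) : is_derive (0 : R) (1 : R) (fun t : R => rho' (polar z (t *: v) 0)) (\sum_j grad_log rho' z j * v 0 j).
Proof.
pose p := to_real z.
have C1 : C1near (rho' \o @of_real R m.+1) (to_real (polar z (0 *: v) 0)).
  by apply: (Cn1_C1near (@openT _)) => //; exact: srr'.
pose K : 'rV[R]_(m.+1 + m.+1) := row_mx v v.
have := @is_derive_curve R _ (rho' \o @of_real R m.+1) (fun t : R => to_real (polar z (t *: v) 0)) 0
  (fun i => K 0 i * (expR (0 * K 0 i) * p 0 i)) C1.
have dc i : is_derive (0 : R) (1 : R) (fun t : R => to_real (polar z (t *: v) 0) 0 i) (K 0 i * (expR (0 * K 0 i) * p 0 i)).
  rewrite (_ : (fun t : R => _) = (fun t : R => expR (t * K 0 i) * p 0 i)); first exact: is_derive_expK.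
  by apply/funext => t; exact: to_real_polarx.
move=> /(_ dc).
rewrite (_ : (fun t : R => _) = (fun t : R => rho' (polar z (t *: v) 0))); last first.
  by apply/funext => t; rewrite /= to_realK.
move=> H; apply: (is_derive_eq H).
rewrite scale0r polar00 sum_splitK; apply: eq_bigr => j _.
rewrite /K row_mxEl row_mxEr mul0r expR0 /grad_log /p /to_real row_mxEl row_mxEr !mxE; ring.
Qed.

Lemma smooth_F' : smooth setT F'.
Proof. exact: smooth_rho_polar. Qed.

Lemma derive_F' (v : 'rV[R]_m.+1) : 'D_v F' 0 = \sum_j grad_log rho' z j * v 0 j.
Proof.
have H := derive_polar_grad v.
have [|_ ->//] := (is_derive_line0 F' 0 v (\sum_j grad_log rho' z j * v 0 j)).1 _.
rewrite (_ : (fun t : R => _) = (fun t : R => rho' (polar z (t *: v) 0)))//.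
by apply/funext => t; rewrite addr0.
Qed.

(** Differentiating along the graph of kz, where the defining function vanishes,
   gives the ratio of two partial derivatives. *)
Lemma grad_log_slope j : grad_log rho' z j = grad_log rho' z ord0 * slope j.
Proof.
case: (unliftP ord0 j) => [i ->|->]; last by rewrite /slope unlift_none mulr1.
rewrite /slope liftK.
have dk : is_derive (0 : R) (1 : R) (fun t : R => kz (t *: Ei i)) ('D_(Ei i) kz 0).
  have H : is_derive (0 : 'rV[R]_m) (Ei i) kz ('D_(Ei i) kz 0).
    by apply: DeriveDef => //; exact: smooth_derivable smooth_kz Dz0.
  have := (is_derive_line0 kz 0 (Ei i) ('D_(Ei i) kz 0)).2 H.
  by under eq_fun do rewrite addr0.
pose cv (t : R) : 'rV[R]_m.+1 := consr (kz (t *: Ei i)) (t *: Ei i).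
have c0 : cv 0 = 0 by rewrite /cv scale0r kz0 consr00.
pose c' (j : 'I_m.+1) : R := if unlift ord0 j is Some l then (l == i)%:R else 'D_(Ei i) kz 0.
have C1 : C1near F' (cv 0) by apply: (Cn1_C1near (@openT _)) => //; exact: smooth_F'.
have dc j' : is_derive (0 : R) (1 : R) (fun t => cv t 0 j') (c' j').
  case: (unliftP ord0 j') => [l ->|->]; rewrite /c' ?liftK ?unlift_none.
    rewrite (_ : (fun t => _) = (fun t : R => t * (l == i)%:R)); last first.
      by apply/funext => t; rewrite /cv consrS !mxE eqxx.
    have h := is_derive_mulR (is_derive_id (0 : R) (1 : R)) (is_derive_cst ((l == i)%:R : R) (0 : R) 1).
    by apply: (is_derive_eq h); rewrite mulr0 mul1r addr0.
  rewrite (_ : (fun t => _) = (fun t : R => kz (t *: Ei i)))//.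
  by apply/funext => t; rewrite /cv consr0.
have := is_derive_curve C1 dc; rewrite c0 => H1.
have zero : \forall t \near (0 : R), F' (cv t) = 0.
  have cl : (fun t : R => t *: Ei i) @ (0 : R) --> (0 : 'rV[R]_m).
    by have := @cvg_line R _ (Ei i) 0; under eq_fun do rewrite addr0; exact.
  have nD : nbhs (0 : 'rV[R]_m) Dz by apply: open_nbhs_nbhs; split; [exact: open_Dz|exact: Dz0].
  have : \forall t \near (0 : R), Dz (t *: Ei i) := cl _ nD.
  apply: filterS => t Dt; have := boundary_graph 0 Dt; rewrite /X bdE' /F' /cv //.
have H2 : is_derive (0 : R) (1 : R) (fun t => F' (cv t)) 0.
  have h0 : is_derive (0 : R) (1 : R) (fun=> 0 : R) 0 by exact: is_derive_cst.
  by apply: near_eq_is_derive h0; apply: filterS zero => t ->.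
have g j' : 'D_(Ei j') F' 0 = grad_log rho' z j'.
  rewrite derive_F' (bigD1 j')//= big1 ?addr0 => [|l lj]; first by rewrite mxE !eqxx mulr1.
  by rewrite mxE (negbTE lj) andbF mulr0.
have E0 : \sum_j grad_log rho' z j * c' j = 0.
  transitivity (\sum_j 'D_(Ei j) F' 0 * c' j); last by case: H1 => _ <-; case: H2.
  by apply: eq_bigr => j' _; congr (_ * _); exact: esym (g j').
move: E0; rewrite big_ord_recl (bigD1 i)//= [X in _ + (_ + X)]big1 ?addr0; last first.
  by move=> l li; rewrite /c' liftK (negbTE li) mulr0.
rewrite /c' unlift_none liftK eqxx mulr1 => /eqP; rewrite addrC addr_eq0 => /eqP ->.
by rewrite mulrN.
Qed.

Lemma grad_log_neq0 : grad_log rho' z ord0 != 0.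
Proof.
apply/eqP => g0; have [v /eqP] := nd'; apply.
have C1 : C1near (rho' \o @of_real R m.+1) (to_real z).
  by apply: (Cn1_C1near (@openT _)) => //; exact: srr'.
have [_ ->] := derive_sumEi v C1; rewrite big1// => q _.
have dz j : d_z j (realC rho') z = 0.
  have := d_z_log srr' torus0' j; rewrite grad_log_slope g0 mul0r mul0r => /eqP.
  by rewrite (_ : mkC 0 0 = 0)// mulf_eq0 (negbTE (z0 j)) orbF => /eqP.
suff -> : 'D_(Ei q) (rho' \o @of_real R m.+1) (to_real z) = 0 by rewrite mul0r.
case: (split_ordP q) => j ->; have := dz j; rewrite d_zE => E.
  by have := congr1 (@ReC R) E; rewrite /= => /eqP; rewrite mulf_eq0 invr_eq0 pnatr_eq0 orbF => /eqP.
by have := congr1 (@ImC R) E; rewrite /= => /eqP; rewrite mulf_eq0 invr_eq0 pnatr_eq0 orbF oppr_eq0 => /eqP.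
Qed.

Lemma beta_slope u : beta rho' z u =
  (\sum_j mkC (slope j) 0 * (u 0 j / z 0 j)) / mkC (\sum_j slope j) 0.
Proof.
set g := grad_log rho' z ord0.
have D u' : dprime rho' z u' = mkC (g / 2) 0 * \sum_j mkC (slope j) 0 * (u' 0 j / z 0 j).
  rewrite (dprime_log srr' torus0' _ z0) mulr_sumr; apply: eq_bigr => j _.
  rewrite grad_log_slope [RHS]mulrA; congr (_ * _).
  by apply: Cext; rewrite ?ReCM ?ImCM/= /g; ring.
have gn : mkC (g / 2) 0 != 0 :> Cplx R.
  apply/eqP => /(congr1 (@ReC R)) /= /eqP; rewrite mulf_eq0 invr_eq0 pnatr_eq0 orbF.
  by rewrite (negbTE grad_log_neq0).
rewrite /beta !D -mulf_div divff// mul1r; congr (_ / _).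
under eq_bigr do rewrite divff ?z0// mulr1.
apply: Cext; rewrite ?ReC_sum ?ImC_sum/=; first by apply: eq_bigr.
by rewrite big1.
Qed.
End other_defining_function.
End domain_geometry.

(** * The limit of the weighted sums *)

Section summation_limit.
Context {R : realType} {m : nat}.
Variables (h : 'I_m -> R) (om : mpoly.multinom m.+1 -> R) (theta : 'rV[R]_m -> R) (K c : R).
Hypothesis h0 : forall i, 0 < h i.
Hypothesis K0 : 0 < K.
Hypothesis c0 : 0 < c.
Hypothesis om0 : forall b, 0 <= om b.
Hypothesis om_le : forall b, om b <= K * sc (fun_of_multinom b ord0) ^+ m * expR (- (c * \sum_i `|dev h b i|)).
Hypothesis om_lim : forall (b : nat -> mpoly.multinom m.+1) (xi : 'rV[R]_m) l0,
  (forall l, fun_of_multinom (b l) ord0 = l) ->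
  (forall l, (l0 <= l)%N -> forall i, `|dev h (b l) i - xi 0 i| <= (sc l)^-1) ->
  (fun l => om (b l) / sc l ^+ m) @ \oo --> theta xi.
Let H := HH h.
Let H0 : 0 < H. Proof. exact: HH_gt0. Qed.

(** In the affine form of the substitution lemma for integrals. *)
Definition tN (N : nat) (y : R) : R := N%:R / H * y + 0.
Definition lN N y := Num.truncn (tN N y).

Lemma tN_ge0 N y : 0 <= y -> 0 <= tN N y.
Proof. by move=> y0; rewrite /tN addr0 mulr_ge0// divr_ge0// ltW. Qed.

Lemma tN_div N y : (0 < N)%N -> tN N y / N%:R = y / H.
Proof. by move=> N0; rewrite /tN addr0; field; rewrite gt_eqF// pnatr_eq0 -lt0n N0. Qed.

Lemma lN_ratio y : 0 < y -> (fun N => (lN N y)%:R / N%:R) @ \oo --> y / H.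
Proof.
move=> y0; apply/cvgrPdist_le => e e0; near=> N.
have N0 : (0 < N)%N by near: N; exists 1%N.
have N0' : (0 : R) < N%:R by rewrite ltr0n.
have Ne : e^-1 <= N%:R by near: N; exact: nbhs_infty_ger.
have Ne' : N%:R^-1 <= e by rewrite -[e]invrK lef_pV2 ?posrE ?invr_gt0.
have /andP[h1 h2] := truncn_itv (tN_ge0 N (ltW y0)); rewrite -/(lN N y) in h1 h2.
apply: le_trans Ne'; rewrite -(tN_div y N0) -mulrBl normrM [`|N%:R^-1|]ger0_norm ?invr_ge0//.
rewrite ler_piMl ?invr_ge0// ger0_norm ?subr_ge0//.
by move: h2; rewrite -natr1 -ltrBlDl => /ltW.
Unshelve. all: by end_near. Qed.

Lemma lN_near y (P : nat -> Prop) : 0 < y -> (\forall l \near \oo, P l) -> \forall N \near \oo, P (lN N y).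
Proof.
move=> y0 [M _ hM]; near=> N; apply: hM => /=.
have h1 : M.+1%:R * (H / y) <= N%:R by near: N; exact: nbhs_infty_ger.
have h2 : M.+1%:R <= tN N y.
  by rewrite /tN addr0 mulrAC ler_pdivlMr// -ler_pdivrMr// -mulrA.
have h3 : M%:R < tN N y by apply: lt_le_trans h2; rewrite ltr_nat.
have t0 : 0 <= tN N y by exact: tN_ge0 (ltW y0).
have h4 : (M <= lN N y)%N by rewrite /lN truncn_ge_nat// ltW.
exact: h4.
Unshelve. all: by end_near. Qed.

Lemma lN_cvg y : 0 < y -> (fun N => lN N y) @ \oo --> \oo.
Proof. by move=> y0 A hA; exact: lN_near. Qed.

(** The multi-index whose cell contains the point of deviation x at height l. *)
Definition bx (x : 'rV[R]_m) (l : nat) : mpoly.multinom m.+1 := mnom (fun j =>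
  if unlift ord0 j is Some i then Num.truncn (sc l * x 0 i + l%:R * h i) else l).

Lemma bx0 x l : fun_of_multinom (bx x l) ord0 = l.
Proof. by rewrite mnomE unlift_none. Qed.

Lemma bx_pos (x : 'rV[R]_m) : \forall l \near \oo, forall i, 0 <= sc l * x 0 i + l%:R * h i.
Proof.
apply: filter_forall => i; have := sc_small (- x 0 i) (h0 i).
by apply: filterS => l; rewrite mulrN -subr_ge0 opprK addrC.
Qed.

Lemma bx_cell (x : 'rV[R]_m) l t : 0 <= t -> Num.truncn t = l -> (forall i, 0 <= sc l * x 0 i + l%:R * h i) ->
  in_cell (bx x l) (consr t (affl h l x)).
Proof.
move=> t0 tl hx j; rewrite in_itv/= mnomE; case: (unliftP ord0 j) => [i ->|->].
  by rewrite consrS mxE; exact: truncn_itv.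
by rewrite consr0 -tl; exact: truncn_itv.
Qed.

Lemma bx_dev x : exists l0, forall l, (l0 <= l)%N -> forall i, `|dev h (bx x l) i - x 0 i| <= (sc l)^-1.
Proof.
have [l0 _ hl] := bx_pos x; exists l0 => l ll i.
apply: (@cell_dev R m h (bx x l) l%:R l x); last exact: bx0.
by apply: bx_cell => //; [rewrite (truncn_def (n := l))// lexx ltr_nat ltnSn|exact: hl].
Qed.

Lemma bx_ratio x i : (fun l => (fun_of_multinom (bx x l) (lift ord0 i))%:R / l%:R) @ \oo --> h i.
Proof.
have [l0 hl] := bx_dev x.
apply/cvgrPdist_le => e e0; near=> l.
have ll : (l0 <= l)%N by near: l; exact: nbhs_infty_ge.
have lp : (0 < l)%N by near: l; exists 1%N.
have lp' : (0 : R) < l%:R by rewrite ltr0n.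
have hs : sc l * (`|x 0 i| + 1) <= l%:R * e by near: l; exact: sc_small.
have dl : `|dev h (bx x l) i| <= `|x 0 i| + 1 by apply: (dev_le hl).
have s0 := @sc_gt0 R l.
have -> : h i - (fun_of_multinom (bx x l) (lift ord0 i))%:R / l%:R = - (sc l * dev h (bx x l) i) / l%:R.
  by rewrite /dev bx0; field; rewrite !gt_eqF.
rewrite normrM normrN normrM [`|l%:R^-1|]ger0_norm ?invr_ge0// ler_pdivrMr// [e * _]mulrC.
apply: le_trans hs; rewrite ger0_norm ?(ltW s0)//; apply: ler_wpM2l => //; exact: ltW.
Unshelve. all: by end_near. Qed.

Lemma bx_lN_ratio x y j : 0 < y ->
  (fun N => (fun_of_multinom (bx x (lN N y)) j)%:R / N%:R) @ \oo --> y / H * hs h j.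
Proof.
move=> y0; rewrite /hs; case: (unliftP ord0 j) => [i ->|->]; last first.
  rewrite mulr1; under eq_fun do rewrite bx0.
  exact: lN_ratio.
rewrite mulrC.
have c1 : (fun N => (fun_of_multinom (bx x (lN N y)) (lift ord0 i))%:R / (lN N y)%:R) @ \oo --> h i.
  by apply: (@cvg_comp _ _ _ (fun N => lN N y) (fun l => (fun_of_multinom (bx x l) (lift ord0 i))%:R / l%:R : R) \oo \oo); [exact: lN_cvg|exact: bx_ratio].
have c2 : (fun N => (fun_of_multinom (bx x (lN N y)) (lift ord0 i))%:R / (lN N y)%:R * ((lN N y)%:R / N%:R)) @ \oo --> h i * (y / H).
  by apply: cvgM; [exact: c1|exact: lN_ratio].
apply: cvg_trans c2; apply: near_eq_cvg; near=> N.
have lp : (0 < lN N y)%N by near: N; apply: (@lN_near y (fun l => (0 < l)%N) y0); exists 1%N.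
by rewrite /= mulrA divfK// pnatr_eq0 -lt0n.
Unshelve. all: by end_near. Qed.

Lemma mdeg_ratio x y : 0 < y ->
  (fun N => (mpoly.mdeg (bx x (lN N y)))%:R / N%:R) @ \oo --> y.
Proof.
move=> y0.
have -> : (fun N => (mpoly.mdeg (bx x (lN N y)))%:R / N%:R : R) =
   (fun N => \sum_(j <- index_enum 'I_m.+1) (fun_of_multinom (bx x (lN N y)) j)%:R / N%:R).
  by apply/funext => N; rewrite mpoly.mdegE natr_sum mulr_suml.
have Ey : y = \sum_(j <- index_enum 'I_m.+1) y / H * hs h j.
  by rewrite -mulr_sumr -/(HH h) divfK// gt_eqF.
rewrite [X in _ --> X]Ey; apply: (@cvg_sum R R _ _ \oo _ _ (fun j N => (fun_of_multinom (bx x (lN N y)) j)%:R / N%:R)) => j.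
exact: bx_lN_ratio.
Qed.

Variables (g : nat -> mpoly.multinom m.+1 -> R) (K2 : R) (gam : R -> R).
Hypothesis g0 : forall N b, (mpoly.mdeg b < N.+1)%N -> 0 <= g N b <= K2.
Hypothesis g_lim : forall y (a : nat -> mpoly.multinom m.+1), 0 < y < 1 ->
  (forall j, (fun N => (fun_of_multinom (a N) j)%:R / N%:R) @ \oo --> y / H * hs h j) ->
  (fun N => g N (a N)) @ \oo --> gam y.

Definition Vinf (y : R) (x : 'rV[R]_m) : R :=
  if 0 <= y <= 1 then (y / H) ^+ m * theta x * gam y else 0.

Lemma V_cvg y (x : 'rV[R]_m) : y != 0 -> y != 1 ->
  (fun N => V h om N (g N) (tN N y) x) @ \oo --> (Vinf y x)%:E.
Proof.
move=> yn0 yn1; rewrite /Vinf [0 <= y]le_eqVlt [y <= 1]le_eqVlt [0 == y]eq_sym (negbTE yn0) (negbTE yn1) /=.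
have [y0|y0] := ltP 0 y; last first.
  rewrite /=; apply: cvg_near_cst; near=> N.
  have N0 : (0 < N)%N by near: N; exists 1%N.
  apply: V_zero; left; rewrite /tN addr0 pmulr_rlt0; first by rewrite lt_neqAle yn0.
  by rewrite divr_gt0// ltr0n.
have [l0 hl] := bx_dev x.
have cell_near : \forall N \near \oo, in_cell (bx x (lN N y)) (consr (tN N y) (affl h (lN N y) x)).
  have := lN_near y0 (bx_pos x); apply: filterS => N hN.
  by apply: bx_cell => //; exact: tN_ge0 (ltW y0).
have [y1|y1] := ltP y 1; last first.
  rewrite /=; apply: cvg_near_cst; near=> N.
  have N0 : (0 < N)%N by near: N; exists 1%N.
  have hc : in_cell (bx x (lN N y)) (consr (tN N y) (affl h (lN N y) x)) by near: N; exact: cell_near.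
  have hm : 1 < (mpoly.mdeg (bx x (lN N y)))%:R / N%:R :> R.
    near: N; move/cvgr_gt : (mdeg_ratio x y0); apply; rewrite lt_neqAle eq_sym yn1 y1//.
  rewrite /V -/(lN N y) (Phi_big _ _ hc) ?mule0//.
  by move: hm; rewrite ltr_pdivlMr ?ltr0n// mul1r ltr_nat.
rewrite /=.
have cb := om_lim (bx0 x) hl.
have c1 : (fun N => om (bx x (lN N y)) / sc (lN N y) ^+ m) @ \oo --> theta x.
  exact: (@cvg_comp _ _ _ (fun N => lN N y) (fun l => om (bx x l) / sc l ^+ m) _ _ _ (lN_cvg y0) cb).
have c2 : (fun N => g N (bx x (lN N y))) @ \oo --> gam y.
  by apply: g_lim => [|j]; [rewrite y0|exact: bx_lN_ratio].
have c3 : (fun N => sc (lN N y) ^+ 2 / N%:R) @ \oo --> y / H.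
  have hN : (fun N : nat => (N%:R : R)^-1) @ \oo --> (0 : R).
    apply/cvgrPdist_le => e e0; near=> N.
    have Ne : e^-1 <= N%:R by near: N; exact: nbhs_infty_ger.
    by rewrite sub0r normrN ger0_norm ?invr_ge0// -[e]invrK lef_pV2 ?posrE ?invr_gt0//; apply: lt_le_trans Ne; rewrite invr_gt0.
  have c3' : (fun N => (lN N y)%:R / N%:R + N%:R^-1) @ \oo --> y / H + 0 by apply: cvgD; [exact: lN_ratio|exact: hN].
  rewrite addr0 in c3'; rewrite (_ : (fun N => _) = (fun N => (lN N y)%:R / N%:R + N%:R^-1))//.
  by apply/funext => N; rewrite sc2 -natr1 mulrDl mul1r.
have c4 : (fun N => (sc (lN N y) ^+ 2 / N%:R) ^+ m) @ \oo --> (y / H) ^+ m.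
  exact: (@cvg_comp _ _ _ (fun N => sc (lN N y) ^+ 2 / N%:R) (fun t : R => t ^+ m) _ _ _ c3 (@exprn_continuous _ m (y / H))).
have c5 : (fun N => (sc (lN N y) ^+ 2 / N%:R) ^+ m * (om (bx x (lN N y)) / sc (lN N y) ^+ m) * g N (bx x (lN N y))) @ \oo --> (y / H) ^+ m * theta x * gam y.
  by apply: cvgM; [apply: cvgM; [exact: c4|exact: c1]|exact: c2].
have c6 : (EFin \o (fun N => (sc (lN N y) ^+ 2 / N%:R) ^+ m * (om (bx x (lN N y)) / sc (lN N y) ^+ m) * g N (bx x (lN N y)))) @ \oo -->
   ((y / H) ^+ m * theta x * gam y)%:E.
  by apply: cvg_EFin; [exact: nearW|exact: c5].
apply: cvg_trans c6; apply: near_eq_cvg; near=> N.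
have N0 : (0 < N)%N by near: N; exists 1%N.
have hc : in_cell (bx x (lN N y)) (consr (tN N y) (affl h (lN N y) x)) by near: N; exact: cell_near.
have hm : (mpoly.mdeg (bx x (lN N y)))%:R / N%:R < 1 :> R.
  by near: N; move/cvgr_lt : (mdeg_ratio x y0); apply.
have md : (mpoly.mdeg (bx x (lN N y)) < N.+1)%N.
  by move: hm; rewrite ltr_pdivrMr ?ltr0n// mul1r ltr_nat => /ltnW.
rewrite /= /V -/(lN N y) (Phi_in om (g N) hc md) -EFinM; congr EFin.
have sn : sc (lN N y) ^+ m != 0 :> R by rewrite expf_neq0// gt_eqF// sc_gt0.
have Nn : (N%:R : R) ^+ m != 0 by rewrite expf_neq0// pnatr_eq0 -lt0n.
rewrite expr_div_n -exprM mulnC exprM.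
by field; rewrite sn Nn.
Unshelve. all: by end_near. Qed.

Let mj (x : 'rV[R]_m) : \bar R := (@MM R m K c K2)%:E * \prod_(i < m) (expR (- (c * `|x 0%R i|)))%:E.

Lemma int_mj_fin : measurable_fun setT (mj : borel 'rV[R]_m -> \bar R) /\
  exists2 M : R, 0 <= M & (\int[lam m]_x mj x = M%:E)%E.
Proof.
have me : measurable_fun setT (fun x : measurableTypeR R => (expR (- (c * `|x|)))%:E).
  apply/measurable_EFinP; apply: continuous_measurable_fun => x.
  apply: continuous_comp; last exact: continuous_expR.
  by apply: cvgN; apply: cvgM; [exact: cvg_cst|exact: norm_continuous].
have e0 (x : measurableTypeR R) : (0 <= (expR (- (c * `|x|)))%:E)%E by rewrite lee_fin expR_ge0.
have [mp ip] := @integral_prod R m (fun _ x => (expR (- (c * `|x|)))%:E) (fun=> me) (fun=> e0).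
have K20 : 0 <= K2.
  have b0 : (mpoly.mdeg (@mpoly.mnm0 m.+1) < 1)%N by rewrite mpoly.mdeg0.
  by have /andP[] := g0 b0; exact: le_trans.
have M0 : 0 <= @MM R m K c K2 by rewrite !mulr_ge0 ?expR_ge0 ?exprn_ge0// ltW.
split; first by apply: measurable_funeM.
rewrite /mj ge0_integralZl//; last first.
  by move=> x _; apply: prode_ge0 => i _; exact: e0.
rewrite ip; have := @integral_ge0 _ (measurableTypeR R) R lebesgue_measure setT _ (fun x _ => e0 x).
have := integral_exp_abs c0; set I := integral _ _ _ => Ioo I0.
have fI : I \is a fin_num by rewrite ge0_fin_numE.
exists (@MM R m K c K2 * \prod_(i < m) fine I).
  by rewrite mulr_ge0// prodr_ge0// => i _; exact: fine_ge0.
rewrite [RHS]EFinM -prodEFin; congr (_ * _)%E; apply: eq_bigr => i _; by rewrite fineK.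
Qed.

Lemma inner_cvg y : y != 0 -> y != 1 ->
  [/\ measurable_fun setT (fun x : borel 'rV[R]_m => (Vinf y x)%:E),
   (lam m).-integrable setT (fun x => (Vinf y x)%:E) &
   (fun N => \int[lam m]_x V h om N (g N) (tN N y) x)%E @ \oo --> (\int[lam m]_x (Vinf y x)%:E)%E].
Proof.
move=> y0 y1; have [mmj [M M0 iM]] := int_mj_fin.
have mV N := measurable_V h om N (g N) (tN N y).
have cV x := @V_cvg y x y0 y1.
have mVi : measurable_fun setT (fun x : borel 'rV[R]_m => (Vinf y x)%:E).
  by apply: (@emeasurable_fun_cvg _ (borel 'rV[R]_m) R setT (fun N x => V h om N (g N) (tN N y) x) (fun x => (Vinf y x)%:E)) => // x _; exact: cV.
have Vp N x : (0 <= V h om N (g N) (tN N y) x)%E := V_ge0 h om0 (@g0 N) (tN N y) x.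
have Vl N x : (1 <= N)%N -> (V h om N (g N) (tN N y) x <= mj x)%E by move=> N1; exact: (V_le K0 c0 om0 om_le (@g0 N)).
have Mi : (\int[lam m]_x mj x < +oo)%E by rewrite iM ltry.
have ae : {ae lam m, forall x, (fun N => V h om N (g N) (tN N y) x) @ \oo --> (Vinf y x)%:E}.
  by apply: aeW => x; exact: cV.
have [I1 I2] := @dominated_ge0 R _ _ (lam m) (fun N x => V h om N (g N) (tN N y) x) _ mj 1%N mV Vp mmj Vl Mi ae mVi.
by split.
Qed.

Hypothesis igam : lebesgue_measure.-integrable `[0, 1] (EFin \o (fun y => y ^+ m * gam y)).
Hypothesis itheta : (lam m).-integrable setT (EFin \o theta).
Let Z := fine (\int[lam m]_x (theta x)%:E)%E.

Lemma integral_Vinf y : (\int[lam m]_x (Vinf y x)%:E)%E =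
  ((fun y => ((Z / H ^+ m)%:E * (y ^+ m * gam y)%:E)%E) \_ `[0, 1]) y.
Proof.
have fZ : (\int[lam m]_x (theta x)%:E)%E = Z%:E by rewrite /Z fineK//; exact: integrable_fin_num itheta.
rewrite patchE /Vinf; have [yin|yout] := pselect (0 <= y <= 1).
  rewrite yin mem_set; last by rewrite /= in_itv/= yin.
  have -> : (fun x => ((y / H) ^+ m * theta x * gam y)%:E) = (fun x => (((y / H) ^+ m * gam y)%:E * (theta x)%:E)%E).
    by apply/funext => x; rewrite -EFinM; congr EFin; ring.
  rewrite (integralZl measurableT itheta) fZ -!EFinM; congr EFin.
  by rewrite expr_div_n; field; rewrite expf_neq0// gt_eqF.
rewrite memNset; last by rewrite /= in_itv/=.
by rewrite (negbTE (introN idP yout)) integral0.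
Qed.

Lemma outer_cvg :
  (fun N => ((N%:R ^+ m.+1)^-1 * \sum_(b : mpoly.bmultinom m.+1 N.+1) om b * g N b)%:E) @ \oo -->
  ((H^-1)%:E * \int[lebesgue_measure]_y \int[lam m]_x (Vinf y x)%:E)%E.
Proof.
have [mmj [M M0 iM]] := int_mj_fin.
pose W N (y : measurableTypeR R) : \bar R := (\int[lam m]_x V h om N (g N) (tN N y) x)%E.
have mW N : measurable_fun setT (W N.+1).
  have mI := measurable_integral_consr (measurable_Phi om N.+1 (g N.+1)) (Phi_ge0 om0 (@g0 N.+1)).
  have maf : measurable_fun setT (fun y : measurableTypeR R => (tN N.+1 y : measurableTypeR R)).
    by apply: measurable_funD => //; apply: measurable_funM.
  rewrite (_ : W N.+1 = (fun y => ((N.+1%:R ^+ m)^-1)%:E * \int[lam m]_x Phi om N.+1 (g N.+1) (consr (tN N.+1 y) x))%E).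
    by apply: measurable_funeM; exact: (measurableT_comp mI maf).
  by apply/funext => y; rewrite /W (integral_V h om0 (@g0 N.+1)).
have W0 N y : (0 <= W N y)%E by apply: integral_ge0 => x _; exact: (V_ge0 h om0 (@g0 N)).
pose B (y : measurableTypeR R) : \bar R := (M * \1_(`[0, 2 * H]%classic) y)%:E.
have WB N y : (W N.+1 y <= B y)%E.
  have [yin|yout] := pselect (y \in `[0, 2 * H]).
    rewrite /B indicE mem_set// mulr1 -iM; apply: ge0_le_integral => //.
    - by move=> x _; exact: (V_ge0 h om0 (@g0 N.+1)).
    - exact: measurable_V.
    - by move=> x _; exact: (V_le K0 c0 om0 om_le (@g0 N.+1)).
  rewrite /B indicE memNset// mulr0 /W integral0_eq// => x _; apply: V_zero.
  move/negP : yout; rewrite in_itv/= negb_and -!ltNge => /orP[yl|yr]; [left|right].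
    by rewrite /tN addr0 pmulr_rlt0// divr_gt0.
  rewrite /tN addr0; apply: (@le_trans _ _ (N.+1%:R / H * (2 * H))).
    by rewrite mulrCA divfK ?gt_eqF// -natrM ler_nat mul2n -addnn -addn1 leq_add2l.
  by apply: ler_wpM2l; [rewrite divr_ge0// ltW|exact: ltW].
have mB : measurable_fun setT B by apply/measurable_EFinP; apply: measurable_funM => //; exact: measurable_indic.
have iB : (\int[lebesgue_measure]_y B y < +oo)%E.
  rewrite /B; under eq_integral do rewrite EFinM.
  rewrite ge0_integralZl//; last by apply/measurable_EFinP; exact: measurable_indic.
  rewrite integral_indic// setIT /= lebesgue_measure_itv/=.
  by case: ifP => _; rewrite -?EFinB -EFinM ltry.
have cW y : y != 0 -> y != 1 -> (fun N => W N.+1 y) @ \oo --> (\int[lam m]_x (Vinf y x)%:E)%E.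
  move=> y0 y1; have [_ _ hc] := inner_cvg y0 y1.
  by rewrite (cvg_shiftS (fun N => W N y)).
have ae : {ae lebesgue_measure, forall y : measurableTypeR R, (fun N => W N.+1 y) @ \oo --> (\int[lam m]_x (Vinf y x)%:E)%E}.
  exists ([set 0] `|` [set 1]); split.
  - by apply: measurableU; exact: measurable_set1.
  - by rewrite measureU0//; exact: lebesgue_measure_set1.
  move=> y /= hy; have [->|y0] := eqVneq y 0; [by left|have [->|y1] := eqVneq y 1; [by right|]].
  by exfalso; apply: hy; exact: cW.
have mL : measurable_fun setT (fun y : measurableTypeR R => \int[lam m]_x (Vinf y x)%:E)%E.
  rewrite (_ : (fun y => _) = (fun y => ((Z / H ^+ m)%:E * (y ^+ m * gam y)%:E)%E) \_ `[0, 1]).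
    apply: (measurable_restrictT _ _).1 => //.
    have mg := measurable_int lebesgue_measure igam.
    by apply: emeasurable_funM; [exact: measurable_cst|exact: mg].
  by apply/funext => y; exact: integral_Vinf.
have [I1 I2] := @dominated_ge0 R _ _ lebesgue_measure (fun N y => W N.+1 y) (fun y => \int[lam m]_x (Vinf y x)%:E)%E B 0%N
  mW (fun N y => W0 N.+1 y) mB (fun N y _ => WB N y) iB ae mL.
rewrite -(cvg_shiftS (fun N => ((N%:R ^+ m.+1)^-1 * \sum_(b : mpoly.bmultinom m.+1 N.+1) om b * g N b)%:E)).
rewrite (_ : (fun N => _) = (fun N => ((H^-1)%:E * \int[lebesgue_measure]_y W N.+1 y)%E)).
  exact: (cvgeZl _ I2).
by apply/funext => N; rewrite (sum_integral h0 om0 (@g0 N.+1)).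
Qed.

Lemma summation_cvg :
  (fun N => (N%:R ^+ m.+1)^-1 * \sum_(b : mpoly.bmultinom m.+1 N.+1) om b * g N b) @ \oo -->
  H^-1 * (Z / H ^+ m) * (\int[lebesgue_measure]_(y in `[0%R, 1%R]) (y ^+ m * gam y))%R.
Proof.
have E : ((H^-1)%:E * \int[lebesgue_measure]_y \int[lam m]_x (Vinf y x)%:E =
   (H^-1 * (Z / H ^+ m) * (\int[lebesgue_measure]_(y in `[0%R, 1%R]) (y ^+ m * gam y))%R)%:E)%E.
  under eq_integral do rewrite integral_Vinf.
  rewrite -integral_mkcond (integralZl _ igam)// -mulrA !EFinM; congr (_ * (_ * _))%E.
  by rewrite /Rintegral fineK//; exact: integrable_fin_num igam.
have := outer_cvg; rewrite E => hc.
exact: fine_cvg hc.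
Qed.
End summation_limit.

Section summation_theorem.
Context {R : realType} {m : nat}.
Variables (h : 'I_m -> R) (om : mpoly.multinom m.+1 -> R) (theta : 'rV[R]_m -> R) (K c : R).
Hypothesis h0 : forall i, 0 < h i.
Hypothesis K0 : 0 < K.
Hypothesis c0 : 0 < c.
Hypothesis om0 : forall b, 0 <= om b.
Hypothesis om_le : forall b, om b <= K * sc (fun_of_multinom b ord0) ^+ m * expR (- (c * \sum_i `|dev h b i|)).
Hypothesis om_lim : forall (b : nat -> mpoly.multinom m.+1) (xi : 'rV[R]_m) l0,
  (forall l, fun_of_multinom (b l) ord0 = l) ->
  (forall l, (l0 <= l)%N -> forall i, `|dev h (b l) i - xi 0 i| <= (sc l)^-1) ->
  (fun l => om (b l) / sc l ^+ m) @ \oo --> theta xi.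

(** The case of the constant summand 1 at one position on the ray. *)
Lemma theta_integrable : (lam m).-integrable setT (EFin \o theta).
Proof.
have H0 := HH_gt0 h0.
have g0 (N : nat) (b : mpoly.multinom m.+1) : (mpoly.mdeg b < N.+1)%N -> 0 <= (1 : R) <= 1 by rewrite ler01 lexx.
have gl (y : R) (a : nat -> mpoly.multinom m.+1) : 0 < y < 1 ->
  (forall j, (fun N => (fun_of_multinom (a N) j)%:R / N%:R) @ \oo --> y / HH h * hs h j) ->
  (fun N : nat => (1 : R)) @ \oo --> (1 : R) by move=> _ _; exact: cvg_cst.
have y0 : (1 / 2 : R) != 0 by rewrite mulf_neq0// invr_eq0.
have y1 : (1 / 2 : R) != 1 by rewrite mul1r; apply/eqP => e; have := lexx (1 : R); rewrite -{2}e; lra.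
have [_ I _] := inner_cvg h0 K0 c0 om0 om_le om_lim (g := fun _ _ => 1) (K2 := 1) (gam := fun=> 1) g0 gl y0 y1.
pose q : R := (1 / 2 / HH h) ^+ m.
have q0 : q != 0 by rewrite expf_neq0// mulf_neq0// invr_eq0 gt_eqF.
have := integrableZl measurableT q^-1 I; apply: eq_integrable => // x _ /=.
have b01 : 0 <= (1 / 2 : R) <= 1 by apply/andP; split; lra.
by rewrite /Vinf b01 -EFinM -/q mulr1 mulKf.
Qed.

(** The dominated convergence is carried out in two steps, first in the deviation
   and then along the ray; the first limit factors through the integral of theta,
   which is where the constant comes from. *)
Lemma summation : exists L : R, forall (g : nat -> mpoly.multinom m.+1 -> R) (K2 : R) (gam : R -> R),
  (forall N b, (mpoly.mdeg b < N.+1)%N -> 0 <= g N b <= K2) ->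
  (forall y (a : nat -> mpoly.multinom m.+1), 0 < y < 1 ->
    (forall j, (fun N => (fun_of_multinom (a N) j)%:R / N%:R) @ \oo --> y / HH h * hs h j) ->
    (fun N => g N (a N)) @ \oo --> gam y) ->
  lebesgue_measure.-integrable `[0, 1] (EFin \o (fun y => y ^+ m * gam y)) ->
  (fun N => (N%:R ^+ m.+1)^-1 * \sum_(b : mpoly.bmultinom m.+1 N.+1) om b * g N b) @ \oo -->
  L * (\int[lebesgue_measure]_(y in `[0%R, 1%R]) (y ^+ m * gam y))%R.
Proof.
exists ((HH h)^-1 * (fine (\int[lam m]_x (theta x)%:E)%E / HH h ^+ m)) => g K2 gam g0 gl ig.
exact: (summation_cvg h0 K0 c0 om0 om_le om_lim g0 gl ig theta_integrable).
Qed.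
End summation_theorem.

(** * Powers of bases close to one *)

Section powers.
Context {R : realType}.
Implicit Types (a b w p q c : Cplx R).

Definition nrm w : R := Num.sqrt (cabs2 w).

Lemma nrm_ge0 w : 0 <= nrm w. Proof. exact: sqrtr_ge0. Qed.

Lemma nrmM a b : nrm (a * b) = nrm a * nrm b.
Proof. by rewrite /nrm cabs2M sqrtrM ?cabs2_ge0. Qed.

Lemma nrmD a b : nrm (a + b) <= nrm a + nrm b.
Proof.
have := ler_normD a b; rewrite (norm_mkC (a + b)) (norm_mkC a) (norm_mkC b).
rewrite -/(cabs2 (a + b)) -/(cabs2 a) -/(cabs2 b) -/(nrm (a + b)) -/(nrm a) -/(nrm b).
by rewrite lecE => /andP[_].
Qed.

Lemma nrm1 : nrm 1 = 1.
Proof. by rewrite /nrm /cabs2 /= expr1n expr0n addr0 sqrtr1. Qed.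

Lemma nrmX w n : nrm (w ^+ n) = nrm w ^+ n.
Proof. by elim: n => [|n IH]; rewrite ?expr0 ?nrm1// !exprS nrmM IH. Qed.

Lemma nrm_prod (I : Type) (s : seq I) (f : I -> Cplx R) :
  nrm (\prod_(i <- s) f i) = \prod_(i <- s) nrm (f i).
Proof.
elim: s => [|i s IH]; first by rewrite !big_nil nrm1.
by rewrite !big_cons nrmM IH.
Qed.

Lemma nrm_conj w : nrm w^* = nrm w.
Proof. by rewrite /nrm /cabs2 ReC_conj ImC_conj sqrrN. Qed.

Lemma abs_ReC w : `|ReC w| <= nrm w.
Proof. by rewrite -sqrtr_sqr; apply: ler_wsqrtr; rewrite lerDl sqr_ge0. Qed.

Lemma abs_ImC w : `|ImC w| <= nrm w.
Proof. by rewrite -sqrtr_sqr; apply: ler_wsqrtr; rewrite lerDr sqr_ge0. Qed.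

Lemma nrm_le w : nrm w <= `|ReC w| + `|ImC w|.
Proof.
have p0 : 0 <= `|ReC w| + `|ImC w| by rewrite addr_ge0.
rewrite -[leRHS]ger0_norm// -sqrtr_sqr; apply: ler_wsqrtr.
rewrite sqrrD !real_normK ?num_real// /cabs2 -addrA lerD2l lerDr.
by rewrite mulrn_wge0// mulr_ge0.
Qed.

Lemma nrm_cexp w : nrm (cexp w) = expR (ReC w).
Proof.
rewrite /nrm (_ : w = mkC (ReC w) (ImC w)); last by case: w.
by rewrite cabs2_cexp sqrtr_sqr ger0_norm ?expR_ge0.
Qed.

Lemma nrm_real (x : R) : nrm (mkC x 0) = `|x|.
Proof. by rewrite /nrm /cabs2/= expr0n addr0 sqrtr_sqr. Qed.

Lemma natCE (N : nat) : (N%:R : Cplx R) = mkC N%:R 0.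
Proof. by elim: N => [|N IH]; rewrite ?natCE// -natr1 IH; apply: Cext; rewrite ?ReCD ?ImCD/= ?addr0 ?natr1. Qed.

Lemma invCE (x : R) : (mkC x 0)^-1 = mkC x^-1 0.
Proof.
have [->|x0] := eqVneq x 0; first by rewrite !invr0.
have h : mkC x 0 != 0 :> Cplx R by apply: contra x0 => /eqP/(congr1 (@ReC R))/= ->.
apply: (mulfI h); rewrite divff//; apply: Cext; rewrite ?ReCM ?ImCM/= ?mulr0 ?mul0r ?subr0 ?addr0//.
by rewrite divff.
Qed.

(** Telescoping: powers of nearby numbers stay close, with a loss linear in the exponent. *)
Lemma nrm_pow_sub p q M n : nrm p <= M -> nrm q <= M -> 1 <= M ->
  nrm (p ^+ n - q ^+ n) <= n%:R * nrm (p - q) * M ^+ n.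
Proof.
move=> hp hq M1; have M0 : 0 <= M by apply: le_trans M1.
elim: n => [|n IH]; first by rewrite !expr0 subrr mul0r mul0r /nrm /cabs2/= expr0n addr0 sqrtr0.
rewrite (_ : p ^+ n.+1 - q ^+ n.+1 = p * (p ^+ n - q ^+ n) + (p - q) * q ^+ n); last by rewrite !exprS; ring.
apply: le_trans (nrmD _ _) _; rewrite !nrmM nrmX.
have h1 : nrm p * nrm (p ^+ n - q ^+ n) <= M * (n%:R * nrm (p - q) * M ^+ n) by apply: ler_pM => //; exact: nrm_ge0.
have h2 : nrm (p - q) * nrm q ^+ n <= nrm (p - q) * M ^+ n.+1.
  apply: ler_wpM2l; first exact: nrm_ge0.
  by apply: (@le_trans _ _ (M ^+ n)); [apply: lerXn2r; rewrite ?nnegrE ?nrm_ge0|rewrite exprS ler_peMl// exprn_ge0].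
apply: le_trans (lerD h1 h2) _; rewrite -natr1 !exprS; rewrite le_eqVlt; apply/orP; left; apply/eqP; ring.
Qed.

Lemma diff_quot (f : R -> R) d : is_derive (0 : R) (1 : R) f d ->
  (fun N : nat => N%:R * (f N%:R^-1 - f 0)) @ \oo --> d.
Proof.
move=> [h1 <-].
have h3 : h^-1 *: ((f \o shift 0) (h *: (1 : R)) - f 0) @[h --> (0 : R)^'] --> 'D_1 f 0 by exact: h1.
apply/cvgrPdist_le => e e0; move/cvgrPdist_le : h3 => /(_ e e0) [dl dl0 hd]; near=> N.
have N0 : (0 < N)%N by near: N; exists 1%N.
have Np : (0 : R) < N%:R^-1 by rewrite invr_gt0 ltr0n.
have Ne : dl^-1 + 1 <= N%:R by near: N; exact: nbhs_infty_ger.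
have Nd : N%:R^-1 < dl.
  rewrite -[dl]invrK ltf_pV2 ?posrE ?invr_gt0// ?ltr0n//.
  by apply: lt_le_trans Ne; rewrite ltrDl.
have := hd N%:R^-1; rewrite /ball_/= sub0r normrN gtr0_norm// => /(_ Nd); rewrite gt_eqF// => /(_ isT).
by rewrite invrK addr0 /GRing.scale/= mulr1.
Unshelve. all: by end_near. Qed.

Lemma is_derive_mul (x : R) : is_derive (0 : R) (1 : R) (fun t => x * t) x.
Proof.
by apply: (is_derive_eq (@is_deriveZ R R^o R^o id x 0 1 1 (is_derive_id _ _))); exact: mulr1.
Qed.

Lemma cexp_quot_re c :
  (fun N : nat => N%:R * (ReC (cexp (c * mkC N%:R^-1 0)) - 1)) @ \oo --> ReC c.
Proof.
have := is_derive_expcos 1 0 (is_derive_mul (ReC c)) (is_derive_mul (ImC c)).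
rewrite !mulr0 expR0 cos0 sin0 => /diff_quot.
rewrite !mulr0 expR0 cos0 !(mul1r, mulr1, mul0r, mulr0, addr0, add0r, oppr0, subr0) => h.
have E : (fun N : nat => N%:R * (ReC (cexp (c * mkC N%:R^-1 0)) - 1)) =
  (fun N : nat => N%:R * (expR (ReC c * N%:R^-1) * (cos (ImC c * N%:R^-1) * 1 + sin (ImC c * N%:R^-1) * 0) - 1)).
  by apply/funext => N; rewrite /cexp/= mulr1 mulr0 addr0 ReCM ImCM/= !mulr0 subr0 add0r.
rewrite E; under eq_fun do rewrite ?(mulr1, mulr0, addr0).
by move: h; under eq_fun do rewrite ?(mulr1, mulr0, addr0).
Qed.

Lemma cexp_quot_im c :
  (fun N : nat => N%:R * (ImC (cexp (c * mkC N%:R^-1 0)))) @ \oo --> ImC c.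
Proof.
have := is_derive_expcos 0 1 (is_derive_mul (ReC c)) (is_derive_mul (ImC c)).
rewrite !mulr0 expR0 cos0 sin0 => /diff_quot.
rewrite !mulr0 expR0 sin0 !(mul1r, mulr1, mul0r, mulr0, addr0, add0r, oppr0, subr0) => h.
have E : (fun N : nat => N%:R * ImC (cexp (c * mkC N%:R^-1 0))) =
  (fun N : nat => N%:R * (expR (ReC c * N%:R^-1) * (cos (ImC c * N%:R^-1) * 0 + sin (ImC c * N%:R^-1) * 1))).
  by apply/funext => N; rewrite /cexp/= mulr1 mulr0 add0r ReCM ImCM/= !mulr0 subr0 add0r.
rewrite E; under eq_fun do rewrite ?(mulr1, mulr0, add0r, subr0).
by move: h; under eq_fun do rewrite ?(mulr1, mulr0, add0r, subr0, addr0).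
Qed.

(** Both bases have the same first-order term in 1/N. *)
Lemma pow_dist c : (fun N : nat => N%:R * nrm (1 + N%:R^-1 * c - cexp (c * mkC N%:R^-1 0))) @ \oo --> (0 : R).
Proof.
apply/cvgrPdist_le => e e0.
have e20 : 0 < e / 2 by rewrite divr_gt0.
near=> N.
have N0 : (0 < N)%N by near: N; exists 1%N.
have h1 : `|ReC c - N%:R * (ReC (cexp (c * mkC N%:R^-1 0)) - 1)| <= e / 2.
  by near: N; move/cvgrPdist_le : (@cexp_quot_re c); apply.
have h2 : `|ImC c - N%:R * ImC (cexp (c * mkC N%:R^-1 0))| <= e / 2.
  by near: N; move/cvgrPdist_le : (@cexp_quot_im c); apply.
have Nn : (N%:R : R) != 0 by rewrite pnatr_eq0 -lt0n.
rewrite sub0r normrN ger0_norm ?mulr_ge0 ?nrm_ge0//.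
set q := cexp _ in h1 h2 *; clearbody q.
rewrite -[X in X * _](ger0_norm (ler0n R N)) -nrm_real -nrmM.
apply: le_trans (nrm_le _) _; rewrite [leRHS](splitr e); apply: lerD.
  apply: le_trans h1; rewrite natCE invCE ReCM !(ReCD, ReCN, ReCM)/= !mul0r !subr0.
  by rewrite [X in `|X|](_ : _ = ReC c - N%:R * (ReC q - 1))//; field.
apply: le_trans h2; rewrite natCE invCE ImCM !(ImCD, ImCN, ImCM)/= !mul0r !addr0 add0r.
by rewrite [X in `|X|](_ : _ = ImC c - N%:R * ImC q)//; field.
Unshelve. all: by end_near. Qed.

Lemma cexp_pow c (x : R) n : cexp (c * mkC x 0) ^+ n = cexp (c * mkC (n%:R * x) 0).
Proof.
elim: n => [|n IH]; first by rewrite expr0 mul0r (_ : mkC 0 0 = 0)// mulr0 cexp0.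
rewrite exprS IH -cexpD -mulrDr; congr (cexp (_ * _)).
by apply: Cext; rewrite ?ReCD ?ImCD/= ?addr0// -natr1 mulrDl mul1r addrC.
Qed.

Lemma nrm_1D c (N : nat) : nrm (1 + N%:R^-1 * c) <= expR (nrm c * N%:R^-1).
Proof.
apply: le_trans (nrmD _ _) _; rewrite nrm1 nrmM natCE invCE nrm_real ger0_norm ?invr_ge0//.
by rewrite mulrC; exact: expR_ge1Dx.
Qed.

Lemma cvg_ReC (f : nat -> Cplx R) l : f @ \oo --> l -> (fun N => ReC (f N)) @ \oo --> ReC l.
Proof. by move=> h; apply: (@cvg_comp _ _ _ f (@ReC R) \oo (nbhs l)) => //; exact: ReC_continuous. Qed.

Lemma cvg_ImC (f : nat -> Cplx R) l : f @ \oo --> l -> (fun N => ImC (f N)) @ \oo --> ImC l.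
Proof. by move=> h; apply: (@cvg_comp _ _ _ f (@ImC R) \oo (nbhs l)) => //; exact: ImC_continuous. Qed.

Lemma cvg_conjC (f : nat -> Cplx R) l : f @ \oo --> l -> (fun N => (f N)^*) @ \oo --> l^*.
Proof.
move=> h; apply: cvg_complex.
  by under eq_fun do rewrite ReC_conj; rewrite ReC_conj; exact: cvg_ReC.
by under eq_fun do rewrite ImC_conj; rewrite ImC_conj; apply: cvgN; exact: cvg_ImC.
Qed.

Lemma cvg_cexp c (x : nat -> R) (y : R) : x @ \oo --> y ->
  (fun N => cexp (c * mkC (x N) 0)) @ \oo --> cexp (c * mkC y 0).
Proof.
move=> h.
have hl (k : R) : (fun N => k * x N) @ \oo --> k * y by apply: cvgM; [exact: cvg_cst|exact: h].
have he : (fun N => expR (ReC c * x N)) @ \oo --> expR (ReC c * y).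
  by apply: (@cvg_comp _ _ _ (fun N => ReC c * x N) expR \oo (nbhs (ReC c * y))) ; [exact: hl|exact: continuous_expR].
have hc : (fun N => cos (ImC c * x N)) @ \oo --> cos (ImC c * y).
  by apply: (@cvg_comp _ _ _ (fun N => ImC c * x N) cos \oo (nbhs (ImC c * y))) ; [exact: hl|exact: continuous_cos].
have hs : (fun N => sin (ImC c * x N)) @ \oo --> sin (ImC c * y).
  by apply: (@cvg_comp _ _ _ (fun N => ImC c * x N) sin \oo (nbhs (ImC c * y))) ; [exact: hl|exact: continuous_sin].
have E (t : R) : cexp (c * mkC t 0) = mkC (expR (ReC c * t) * cos (ImC c * t)) (expR (ReC c * t) * sin (ImC c * t)).
  by rewrite /cexp ReCM ImCM/= !mulr0 subr0 add0r.
rewrite E; under eq_fun do rewrite E.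
by apply: cvg_complex; rewrite /=; apply: cvgM.
Qed.

(** (1 + c/N)^a behaves like exp (c a/N): both bases are within o(1/N), and a = O(N) keeps the powers bounded. *)
Lemma pow_cvg c (a : nat -> nat) (tau : R) :
  (fun N => (a N)%:R / N%:R) @ \oo --> tau ->
  (fun N => (1 + N%:R^-1 * c) ^+ a N) @ \oo --> cexp (c * mkC tau 0).
Proof.
move=> ha; set p := fun N : nat => 1 + N%:R^-1 * c; pose q (N : nat) := cexp (c * mkC N%:R^-1 0).
have cq : (fun N => q N ^+ a N) @ \oo --> cexp (c * mkC tau 0).
  by under eq_fun do rewrite /q cexp_pow; exact: cvg_cexp.
have cd : (fun N => nrm (p N ^+ a N - q N ^+ a N)) @ \oo --> (0 : R).
  pose B := (`|tau| + 1) * expR (nrm c * (`|tau| + 1)).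
  have B0 : 0 < B by rewrite mulr_gt0 ?expR_gt0 ?ltr_wpDl.
  apply/cvgrPdist_le => e e0; near=> N.
  have N0 : (0 < N)%N by near: N; exists 1%N.
  have Np : (0 : R) < N%:R by rewrite ltr0n.
  have h1 : `|tau - (a N)%:R / N%:R| <= 1 by near: N; move/cvgrPdist_le : ha; apply.
  have h2 : `|0 - N%:R * nrm (p N - q N)| <= e / B.
    by near: N; move/cvgrPdist_le : (@pow_dist c); apply; rewrite divr_gt0.
  have h3 : (a N)%:R / N%:R <= `|tau| + 1.
    by move: h1; rewrite ler_norml => /andP[+ _]; have := ler_norm tau; lra.
  rewrite sub0r normrN ger0_norm ?mulr_ge0 ?nrm_ge0// in h2.
  rewrite sub0r normrN ger0_norm ?nrm_ge0//.
  set M := expR (nrm c * N%:R^-1).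
  have M1 : 1 <= M by apply: le_trans (expR_ge1Dx _); rewrite lerDl mulr_ge0 ?nrm_ge0 ?invr_ge0.
  have hq : nrm (q N) <= M.
    rewrite nrm_cexp ler_expR ReCM/= mulr0 subr0; apply: ler_wpM2r; first by rewrite invr_ge0.
    by apply: le_trans (ler_norm _) (abs_ReC _).
  apply: le_trans (nrm_pow_sub (a N) (nrm_1D c N) hq M1) _.
  have -> : M ^+ a N = expR (nrm c * ((a N)%:R / N%:R)).
    by rewrite /M -expRM_natl; congr expR; ring.
  have h4 : expR (nrm c * ((a N)%:R / N%:R)) <= expR (nrm c * (`|tau| + 1)).
    by rewrite ler_expR; apply: ler_wpM2l => //; exact: nrm_ge0.
  have h5 : (a N)%:R * nrm (p N - q N) <= (`|tau| + 1) * (e / B).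
    rewrite (_ : (a N)%:R * nrm (p N - q N) = (a N)%:R / N%:R * (N%:R * nrm (p N - q N))); last by field; rewrite gt_eqF.
    by apply: ler_pM => //; rewrite ?divr_ge0 ?mulr_ge0 ?nrm_ge0.
  apply: le_trans (ler_pM _ (expR_ge0 _) h5 h4) _; first by rewrite mulr_ge0 ?nrm_ge0.
  rewrite (_ : _ * _ * _ = B * (e / B)); last by rewrite /B; ring.
  by rewrite mulrC divfK// gt_eqF.
have c0 : (fun N => p N ^+ a N - q N ^+ a N) @ \oo --> (0 : Cplx R).
  apply: cvg_complex; apply/cvgrPdist_le => e e0; move/cvgrPdist_le : cd => /(_ e e0); apply: filterS => N;
    rewrite !sub0r !normrN ger0_norm ?nrm_ge0//; apply: le_trans; [exact: abs_ReC|exact: abs_ImC].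
have := cvgD c0 cq; rewrite add0r => h.
rewrite (_ : (fun N => _) = (fun N => p N ^+ a N - q N ^+ a N + q N ^+ a N)); first exact: h.
by apply/funext => N; rewrite subrK.
Unshelve. all: by end_near. Qed.

Lemma cvg_prodC (I : Type) (s : seq I) (f : I -> nat -> Cplx R) (l : I -> Cplx R) :
  (forall i, f i @ \oo --> l i) -> (fun N => \prod_(i <- s) f i N) @ \oo --> \prod_(i <- s) l i.
Proof.
move=> h; elim: s => [|i s IH].
  by rewrite big_nil; under eq_fun do rewrite big_nil; exact: cvg_cst.
rewrite big_cons; under eq_fun do rewrite big_cons.
by apply: cvgM; [exact: h|exact: IH].
Qed.

Lemma cexp_sum (I : Type) (s : seq I) (f : I -> Cplx R) :
  \prod_(i <- s) cexp (f i) = cexp (\sum_(i <- s) f i).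
Proof.
elim: s => [|i s IH]; first by rewrite !big_nil cexp0.
by rewrite !big_cons IH cexpD.
Qed.

Lemma cexpC w : (cexp w)^* = cexp w^*.
Proof. by apply: Cext; rewrite /cexp ?ReC_conj ?ImC_conj/= ?ReC_conj ?ImC_conj ?cosN ?sinN ?mulrN. Qed.

Definition shift_prod n (cu : 'I_n -> Cplx R) (N : nat) (b : mpoly.multinom n) : Cplx R :=
  \prod_j (1 + N%:R^-1 * cu j) ^+ fun_of_multinom b j.

Lemma nrm_shift_prod n (cu : 'I_n -> Cplx R) N (b : mpoly.multinom n) :
  (mpoly.mdeg b < N.+1)%N -> nrm (shift_prod cu N b) <= expR (\sum_j nrm (cu j)).
Proof.
move=> hb; rewrite /shift_prod nrm_prod expR_sum; apply: ler_prod => j _; rewrite nrm_ge0/= nrmX.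
have bN : (fun_of_multinom b j <= N)%N.
  by rewrite -ltnS; apply: leq_ltn_trans hb; rewrite mpoly.mdegE (bigD1 j)//= leq_addr.
apply: (@le_trans _ _ (expR (nrm (cu j) * N%:R^-1) ^+ fun_of_multinom b j)).
  by apply: lerXn2r; rewrite ?nnegrE ?nrm_ge0 ?expR_ge0//; exact: nrm_1D.
rewrite -expRM_natl ler_expR mulrCA ler_piMr ?nrm_ge0//.
case: N {hb} bN => [|N] bN; first by rewrite invr0 mulr0 ler01.
by rewrite ler_pdivrMr ?ltr0n// mul1r ler_nat.
Qed.

Lemma shift_prod_cvg n (cu : 'I_n -> Cplx R) (a : nat -> mpoly.multinom n) (tau : 'I_n -> R) :
  (forall j, (fun N => (fun_of_multinom (a N) j)%:R / N%:R) @ \oo --> tau j) ->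
  (fun N => shift_prod cu N (a N)) @ \oo --> cexp (\sum_j cu j * mkC (tau j) 0).
Proof.
move=> h; rewrite -cexp_sum; apply: (@cvg_prodC _ _ (fun j N => (1 + N%:R^-1 * cu j) ^+ fun_of_multinom (a N) j)) => j.
exact: pow_cvg.
Qed.

Lemma mono_shift n (z u : 'rV[Cplx R]_n) N (b : mpoly.multinom n) : (forall j, z 0 j != 0) ->
  mono b (z + N%:R^-1 *: u) = mono b z * shift_prod (fun j => u 0 j / z 0 j) N b.
Proof.
move=> z0; rewrite /mono /shift_prod -big_split/=; apply: eq_bigr => j _.
rewrite -exprMn !mxE; congr (_ ^+ _); rewrite mulrDr mulr1; congr (_ + _).
by rewrite mulrCA; congr (_ * _); rewrite mulrCA divff ?mulr1 ?z0.
Qed.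
End powers.

(** * The scaling limit *)

Section complex_sums.
Context {R : realType}.

Lemma mkCX (x : R) n : (mkC x 0 : Cplx R) ^+ n = mkC (x ^+ n) 0.
Proof.
elim: n => [|n IH]; first by rewrite !expr0.
by rewrite !exprS IH; apply: Cext; rewrite ?ReCM ?ImCM/= ?mulr0 ?mul0r ?subr0 ?addr0.
Qed.

Lemma ReC_scale (x : R) (w : Cplx R) : ReC (mkC x 0 * w) = x * ReC w.
Proof. by rewrite ReCM/= mul0r subr0. Qed.

Lemma ImC_scale (x : R) (w : Cplx R) : ImC (mkC x 0 * w) = x * ImC w.
Proof. by rewrite ImCM/= mul0r addr0. Qed.

Lemma mkCM (x y : R) : mkC (x * y) 0 = mkC x 0 * mkC y 0 :> Cplx R.
Proof. by apply: Cext; rewrite ?ReC_scale ?ImC_scale/= ?mulr0. Qed.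

Lemma cexp_line (t : Cplx R) (y : R) :
  cexp (t * mkC y 0) = mkC (expR (ReC t * y) * cos (ImC t * y)) (expR (ReC t * y) * sin (ImC t * y)).
Proof. by rewrite /cexp ReCM ImCM/= !mulr0 subr0 add0r. Qed.

Lemma lin_continuous (k : R) : continuous (fun y : R => k * y).
Proof. by move=> x; apply: cvgM; [exact: cvg_cst|exact: cvg_id]. Qed.

Lemma cexp_line_continuous (t : Cplx R) :
  continuous (fun y : R => ReC (cexp (t * mkC y 0))) /\ continuous (fun y : R => ImC (cexp (t * mkC y 0))).
Proof.
have he : continuous (fun y : R => expR (ReC t * y)).
  by move=> x; apply: (@continuous_comp _ _ _ (fun y : R => ReC t * y) expR); [exact: lin_continuous|exact: continuous_expR].
split.
  rewrite (_ : (fun y => _) = (fun y : R => expR (ReC t * y) * cos (ImC t * y))); last by apply/funext => y; rewrite cexp_line.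
  move=> x; apply: cvgM; first exact: he.
  by apply: (@continuous_comp _ _ _ (fun y : R => ImC t * y) cos); [exact: lin_continuous|exact: continuous_cos].
rewrite (_ : (fun y => _) = (fun y : R => expR (ReC t * y) * sin (ImC t * y))); last by apply/funext => y; rewrite cexp_line.
move=> x; apply: cvgM; first exact: he.
by apply: (@continuous_comp _ _ _ (fun y : R => ImC t * y) sin); [exact: lin_continuous|exact: continuous_sin].
Qed.

Lemma integrable01 (f : R -> R) : continuous f -> lebesgue_measure.-integrable `[0, 1] (EFin \o f).
Proof.
move=> cf; apply: continuous_compact_integrable; first exact: segment_compact.
exact: continuous_subspaceT.
Qed.

Lemma ReC_F m (t : Cplx R) :
  ReC (F_ m t) = (\int[lebesgue_measure]_(y in `[0%R, 1%R]) (y ^+ m * ReC (cexp (t * mkC y 0))))%R.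
Proof.
rewrite /F_ /cintegral/=; apply: eq_Rintegral => y _.
by rewrite mkCX mulrC ReC_scale.
Qed.

Lemma ImC_F m (t : Cplx R) :
  ImC (F_ m t) = (\int[lebesgue_measure]_(y in `[0%R, 1%R]) (y ^+ m * ImC (cexp (t * mkC y 0))))%R.
Proof.
rewrite /F_ /cintegral/=; apply: eq_Rintegral => y _.
by rewrite mkCX mulrC ImC_scale.
Qed.
End complex_sums.

(** Adding a constant reduces bounded real summands to nonnegative ones. *)
Lemma summation_signed {R : realType} {m : nat} (h : 'I_m -> R) (om : mpoly.multinom m.+1 -> R) (L : R) :
  (forall (g : nat -> mpoly.multinom m.+1 -> R) (K2 : R) (gam : R -> R),
    (forall N b, (mpoly.mdeg b < N.+1)%N -> 0 <= g N b <= K2) ->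
    (forall y (a : nat -> mpoly.multinom m.+1), 0 < y < 1 ->
      (forall j, (fun N => (fun_of_multinom (a N) j)%:R / N%:R) @ \oo --> y / HH h * hs h j) ->
      (fun N => g N (a N)) @ \oo --> gam y) ->
    lebesgue_measure.-integrable `[0, 1] (EFin \o (fun y => y ^+ m * gam y)) ->
    (fun N => (N%:R ^+ m.+1)^-1 * \sum_(b : mpoly.bmultinom m.+1 N.+1) om b * g N b) @ \oo -->
    L * (\int[lebesgue_measure]_(y in `[0%R, 1%R]) (y ^+ m * gam y))%R) ->
  forall (f : nat -> mpoly.multinom m.+1 -> R) (K : R) (gam : R -> R), 0 <= K ->
    (forall N b, (mpoly.mdeg b < N.+1)%N -> `|f N b| <= K) ->
    (forall y (a : nat -> mpoly.multinom m.+1), 0 < y < 1 ->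
      (forall j, (fun N => (fun_of_multinom (a N) j)%:R / N%:R) @ \oo --> y / HH h * hs h j) ->
      (fun N => f N (a N)) @ \oo --> gam y) ->
    continuous gam ->
    (fun N => (N%:R ^+ m.+1)^-1 * \sum_(b : mpoly.bmultinom m.+1 N.+1) om b * f N b) @ \oo -->
    L * (\int[lebesgue_measure]_(y in `[0%R, 1%R]) (y ^+ m * gam y))%R.
Proof.
move=> HL f K gam K0 fK fl cg.
have cm : continuous (fun y : R => y ^+ m) by exact: exprn_continuous.
have i1 : lebesgue_measure.-integrable `[0, 1] (EFin \o (fun y : R => y ^+ m * K)).
  by apply: integrable01 => x; apply: cvgM; [exact: cm|exact: cvg_cst].
have i2 : lebesgue_measure.-integrable `[0, 1] (EFin \o (fun y : R => y ^+ m * gam y)).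
  by apply: integrable01 => x; apply: cvgM; [exact: cm|exact: cg].
have i3 : lebesgue_measure.-integrable `[0, 1] (EFin \o (fun y : R => y ^+ m * (K + gam y))).
  by apply: integrable01 => x; apply: cvgM; [exact: cm|apply: cvgD; [exact: cvg_cst|exact: cg]].
have c1 : (fun N => (N%:R ^+ m.+1)^-1 * \sum_(b : mpoly.bmultinom m.+1 N.+1) om b * (K + f N b)) @ \oo -->
    L * (\int[lebesgue_measure]_(y in `[0%R, 1%R]) (y ^+ m * (K + gam y)))%R.
  apply: (HL (fun N b => K + f N b) (K + K) (fun y => K + gam y)) => //.
    by move=> N b hb; have := fK N b hb; rewrite ler_norml => /andP[a1 a2]; apply/andP; split; lra.
  by move=> y a y01 ha; apply: cvgD; [exact: cvg_cst|exact: fl].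
have c2 : (fun N => (N%:R ^+ m.+1)^-1 * \sum_(b : mpoly.bmultinom m.+1 N.+1) om b * K) @ \oo -->
    L * (\int[lebesgue_measure]_(y in `[0%R, 1%R]) (y ^+ m * K))%R.
  apply: (HL (fun _ _ => K) K (fun=> K)) => //.
    by move=> N b _; rewrite K0 lexx.
  by move=> y a _ _; exact: cvg_cst.
have c3 : (fun N => (N%:R ^+ m.+1)^-1 * \sum_(b : mpoly.bmultinom m.+1 N.+1) om b * (K + f N b) -
   (N%:R ^+ m.+1)^-1 * \sum_(b : mpoly.bmultinom m.+1 N.+1) om b * K) @ \oo -->
   L * (\int[lebesgue_measure]_(y in `[0%R, 1%R]) (y ^+ m * (K + gam y)))%R -
   L * (\int[lebesgue_measure]_(y in `[0%R, 1%R]) (y ^+ m * K))%R.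
  by apply: cvgB; [exact: c1|exact: c2].
have EL : (\int[lebesgue_measure]_(y in `[0%R, 1%R]) (y ^+ m * (K + gam y)))%R =
  (\int[lebesgue_measure]_(y in `[0%R, 1%R]) (y ^+ m * K))%R + (\int[lebesgue_measure]_(y in `[0%R, 1%R]) (y ^+ m * gam y))%R.
  by rewrite -(RintegralD _ i1 i2)//; apply: eq_Rintegral => y _; rewrite mulrDr.
rewrite EL mulrDr addrAC subrr add0r in c3.
rewrite (_ : (fun N => _) = (fun N => (N%:R ^+ m.+1)^-1 * \sum_(b : mpoly.bmultinom m.+1 N.+1) om b * (K + f N b) -
   (N%:R ^+ m.+1)^-1 * \sum_(b : mpoly.bmultinom m.+1 N.+1) om b * K)); first exact: c3.
apply/funext => N; rewrite -mulrBr; congr (_ * _); rewrite -sumrB; apply: eq_bigr => b _; ring.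
Qed.

Section monomial_weights.
Context {R : realType} {m : nat}.
Variables (Omega : set 'rV[Cplx R]_m.+1)
    (mu : {measure set (borel 'rV[Cplx R]_m.+1) -> \bar R})
    (z : 'rV[Cplx R]_m.+1).
Hypotheses (Omega_domain : domain Omega)
    (Omega_bounded : bounded_set Omega)
    (Omega_spsc : strictly_pseudoconvex Omega)
    (Omega_Reinhardt : complete_Reinhardt Omega)
    (mu_smooth : smooth_positive_measure (boundary Omega) mu)
    (mu_inv : torus_invariant mu)
    (z_bd : boundary Omega z)
    (z_neq0 : forall j, z 0 j != 0)
    (muX : (mu (boundary Omega) < +oo)%E).
Let X := boundary Omega.
Let oO : open Omega. Proof. by case: Omega_domain. Qed.
Let mX : measurable (X : set (borel 'rV[Cplx R]_m.+1)). Proof. exact: measurable_boundary. Qed.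
Let bX : exists M : R, forall w, X w -> forall j, `|ReC (w 0 j)| <= M /\ `|ImC (w 0 j)| <= M.
Proof. exact: boundary_coord_bound. Qed.
Let rotX : forall th, X `<=` @torus_act R m.+1 th @^-1` X. Proof. exact: boundary_rot. Qed.

(** The weight om b is the inverse squared norm of the monomial normalised at z;
   the Laplace limit and the lower bound of these norms are the hypotheses of
   the summation theorem. *)
Lemma weights_exist : exists (h : 'I_m -> R) (om : mpoly.multinom m.+1 -> R) (theta : 'rV[R]_m -> R) (K c : R),
  [/\ (forall i, 0 < h i), 0 < K, 0 < c, (forall b, 0 <= om b) &
    (forall b, om b <= K * sc (fun_of_multinom b ord0) ^+ m * expR (- (c * \sum_i `|dev h b i|)))] /\
  [/\ (forall (b : nat -> mpoly.multinom m.+1) (xi : 'rV[R]_m) l0,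
      (forall l, fun_of_multinom (b l) ord0 = l) ->
      (forall l, (l0 <= l)%N -> forall i, `|dev h (b l) i - xi 0 i| <= (sc l)^-1) ->
      (fun l => om (b l) / sc l ^+ m) @ \oo --> theta xi),
    (forall b, J X mu b = cabs2 (mono b z) * (om b)^-1) &
    (forall rho, defining_function Omega rho -> forall u,
      beta rho z u = (\sum_j mkC (hs h j) 0 * (u 0 j / z 0 j)) / mkC (HH h) 0)].
Proof.
have [rho [srr0 OmegaE bdE nd] psc] := Omega_spsc.
have srr : smooth setT (rho \o @of_real R m.+1) by exact/smooth_onP.
have beta0 (rho' : 'rV[Cplx R]_m.+1 -> R) : smooth setT (rho' \o @of_real R m.+1) ->
  boundary Omega = [set z | rho' z = 0] -> (exists v, 'D_v (rho' \o @of_real R m.+1) (to_real z) != 0) ->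
  forall u, beta rho' z u = (\sum_j mkC (slope z rho j) 0 * (u 0 j / z 0 j)) / mkC (\sum_j slope z rho j) 0.
  by move=> s1 s2 s3 u; apply: beta_slope; eassumption.
have far0 (r c : R) : 0 < r -> 0 < c ->
  (forall y : 'rV[R]_m, (forall i, `|y 0 i| <= r) -> Dz z rho y) ->
  (forall y : 'rV[R]_m, (forall i, `|y 0 i| <= r) -> kz z rho y - 'D_y (kz z rho) 0 <= - c * nsq y) ->
  forall x th, X (polar z x th) -> (exists i, r / 2 <= `|x 0 (lift ord0 i)|) ->
  x 0 ord0 <= - (\sum_i (- 'D_(Ei i) (kz z rho) 0) * x 0 (lift ord0 i)) -
     c * (r / 4) * Num.sqrt (nsq (\row_i x 0 (lift ord0 i))).
  by move=> q1 q2 q3 q4; apply: far_gap; first [exact q4 | exact q3 | exact q1 | exact q2 | eassumption].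
pose k := kz z rho; pose D := Dz z rho.
have oD : open D by apply: open_Dz; eassumption.
have sk : smooth D k by apply: smooth_kz; eassumption.
have D0 : D 0 by apply: Dz0; eassumption.
have k0 : k 0 = 0 by apply: kz0; eassumption.
have conc (y v : 'rV[R]_m) : D y -> v != 0 -> 'D_v ('D_v k) y < 0 by move=> Dy v0; apply: kz_concave; eassumption.
have [r [c [C [r0 c0 C0 rD hk]]]] := quad_bounds oD sk D0 k0 conc.
have Xk y th : D y -> X (polar z (consr (k y) y) th) by move=> Dy; apply: boundary_graph; eassumption.
have Xlog x th : X (polar z x th) -> x 0 ord0 = k (\row_i x 0 (lift ord0 i)) by move=> Xx; apply: boundary_log; eassumption.
have X0 w : near_part X z r w -> w 0 ord0 != 0 by move=> hw; apply: near_first_neq0; eassumption.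
pose h (i : 'I_m) := - 'D_(Ei i) k 0.
have h0 i : 0 < h i by apply: kz_slope; eassumption.
have dk (y : 'rV[R]_m) : 'D_y k 0 = - \sum_i h i * y 0 i by apply: derive_kz; eassumption.
have klo (y : 'rV[R]_m) : (forall i, `|y 0 i| <= r) -> - \sum_i h i * y 0 i - C * nsq y <= k y.
  by move=> /hk/andP[+ _]; rewrite dk; set s := \sum_i _; set q := nsq y; lra.
have kup (y : 'rV[R]_m) : (forall i, `|y 0 i| <= r) -> k y <= - \sum_i h i * y 0 i - c * nsq y.
  by move=> /hk/andP[_]; rewrite dk; set s := \sum_i _; set q := nsq y; lra.
have [a [a_cont a_gt0 a_meas a_int]] := near_formula mX rotX mu_inv mu_smooth z_neq0 oD sk rD Xk (fun x th Xx _ => Xlog x th Xx) X0.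
have mnear : measurable (near_part X z r : set (borel _)) by apply: measurable_near_part => //.
have [c1 c10 lo] := wgt_lower mX bX z_neq0 r0 (h := h) (ltW C0) klo a_cont a_gt0 a_int a_meas mnear.
have r20 : 0 < r / 2 by rewrite divr_gt0.
have r2r : r / 2 < r by rewrite ltr_pdivrMr// mulr_natr mulr2n ltrDl.
have kup0 (y : 'rV[R]_m) : (forall i, `|y 0 i| <= r) -> k y - 'D_y k 0 <= - c * nsq y.
  by move=> /hk/andP[].
have far := far0 r c r0 c0 rD kup0.
have kap0 : 0 < c * (r / 4) by rewrite mulr_gt0// divr_gt0.
pose t := tb X mu z.
have tlo b : c1 * (sc (fun_of_multinom b ord0) ^+ m)^-1 * expR (c1 * \sum_i `|dev h b i|) <= t b.
  exact: (tb_lower mX muX bX z_neq0 (lo b)).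
have scp l : 0 < sc l ^+ m :> R by rewrite exprn_gt0// sqrtr_gt0 ltr0n.
have t0 b : 0 < t b by apply: lt_le_trans (tlo b); rewrite !mulr_gt0 ?invr_gt0 ?expR_gt0.
pose P xi := ((2 ^+ m.+1)%:E * \int[lam (m.*2.+1)]_v (Ginf k a xi v)%:E)%E.
exists h, (fun b => (t b)^-1), (fun xi => (fine (P xi))^-1), c1^-1, c1; split; split => //.
- by rewrite invr_gt0.
- by move=> b; rewrite invr_ge0 ltW.
- move=> b; have A0 : 0 < c1 * (sc (fun_of_multinom b ord0) ^+ m)^-1 * expR (c1 * \sum_i `|dev h b i|).
    by rewrite !mulr_gt0 ?invr_gt0 ?expR_gt0.
  have : (t b)^-1 <= (c1 * (sc (fun_of_multinom b ord0) ^+ m)^-1 * expR (c1 * \sum_i `|dev h b i|))^-1.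
    by rewrite lef_pV2 ?posrE ?t0 ?A0.
  by rewrite invfM invfM invrK -expRN.
- move=> b xi l0 hb hd.
  have [/andP[P0 Poo] lim1] := near_limit bX z_neq0 r20 r2r oD sk D0 k0 c0 kup a_cont a_gt0 a_int a_meas hb hd.
  have fP : P xi \is a fin_num by rewrite ge0_fin_numE.
  have lim2 := laplace_limit mX muX bX z_neq0 r20 kap0 h0 far hb hd fP lim1.
  have lim3 : (fun l => sc l ^+ m * t (b l)) @ \oo --> fine (P xi) := tb_limit mX muX bX z_neq0 fP lim2.
  have ge l : c1 <= sc l ^+ m * t (b l).
    have := tlo (b l); rewrite hb => tl.
    apply: le_trans (ler_wpM2l (ltW (scp l)) tl).
    rewrite mulrA mulrCA divff ?gt_eqF// mulr1.
    have s0 : 0 <= c1 * \sum_i `|dev h (b l) i| by rewrite mulr_ge0 ?(ltW c10)// sumr_ge0.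
    apply: ler_peMr; first exact: ltW.
    by apply: le_trans (expR_ge1Dx _); rewrite lerDl.
  have hP : c1 <= fine (P xi).
    rewrite leNgt; apply/negP => hlt; have e0 : 0 < c1 - fine (P xi) by rewrite subr_gt0.
    move/cvgrPdist_lt : lim3 => /(_ _ e0) [N _ hN]; have := hN N (leqnn N); have := ge N.
    rewrite /=; set s := _ * _; set q := fine _; rewrite ltr_norml => g1 /andP[g2 g3].
    by move: g1 g2; rewrite -/q; lra.
  have Pn : fine (P xi) != 0 by rewrite gt_eqF// (lt_le_trans c10).
  rewrite (_ : (fun l => _) = (fun l => (sc l ^+ m * t (b l))^-1)); first exact: cvgV.
  by apply/funext => l; rewrite invfM mulrC.
- by move=> b; rewrite invrK; exact: (tb_J mX muX bX z_neq0).
- move=> rho' [srr0' _ bdE' nd'] u.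
  have srr' : smooth setT (rho' \o @of_real R m.+1) by exact/smooth_onP.
  have nd2 := nd' z z_bd.
  exact: beta0 srr' bdE' nd2 u.
Qed.

(** The values of the monomials at z cancel against their norms, leaving the
   relative change under the shift. *)
Lemma szego_shift (om : mpoly.multinom m.+1 -> R) N d (p : 'I_d -> mpoly.mpoly m.+1 (Cplx R)) (u v : 'rV[Cplx R]_m.+1) :
  (forall b, J X mu b = cabs2 (mono b z) * (om b)^-1) -> orthonormal_basis X mu N p ->
  szego p (z + N%:R^-1 *: u) (z + N%:R^-1 *: v) =
  \sum_(b : mpoly.bmultinom m.+1 N.+1) mkC (om b) 0 *
    (shift_prod (fun j => u 0 j / z 0 j) N b * (shift_prod (fun j => v 0 j / z 0 j) N b)^*).
Proof.
move=> JE op; have [J0 ->] := szego_monomials mX muX bX rotX mu_inv op.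
apply: eq_bigr => b _; have := J0 b; rewrite JE => Jb.
have [x0 om0] : cabs2 (mono b z) != 0 /\ om b != 0.
  by move: Jb; rewrite mulf_eq0 negb_or invr_eq0 => /andP.
rewrite !mono_shift// rmorphM mkCM -invCE.
have nz (x : R) : x != 0 -> mkC x 0 != 0 :> Cplx R.
  by move=> xn; apply: contra xn => /eqP/(congr1 (@ReC R))/= ->.
have gen (M M' A B X' Y : Cplx R) : M * M' = X' -> X' != 0 -> Y != 0 -> M * A * (M' * B) / (X' / Y) = Y * (A * B).
  by move=> <-; rewrite mulf_eq0 negb_or => /andP[h1 h2] h3; field; rewrite h1 h2 h3.
by apply: gen; [exact: mul_conjE|exact: nz|exact: nz].
Qed.

End monomial_weights.

Theorem theorem1p1 (R : realType) (m : nat) (Omega : set 'rV[Cplx R]_m.+1)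
    (mu : {measure set (borel 'rV[Cplx R]_m.+1) -> \bar R})
    (z : 'rV[Cplx R]_m.+1)
    (Omega_domain : domain Omega)
    (Omega_bounded : bounded_set Omega)
    (Omega_spsc : strictly_pseudoconvex Omega)
    (Omega_Reinhardt : complete_Reinhardt Omega)
    (mu_smooth : smooth_positive_measure (boundary Omega) mu)
    (mu_inv : torus_invariant mu)
    (z_bd : boundary Omega z)
    (z_neq0 : forall j, z 0 j != 0) :
  exists C : Cplx R,
    forall rho : 'rV[Cplx R]_m.+1 -> R, defining_function Omega rho ->
    forall (d : nat -> nat)
           (p : forall N : nat, 'I_(d N) -> mpoly.mpoly m.+1 (Cplx R)),
      (forall N, orthonormal_basis (boundary Omega) mu N (p N)) ->
    forall u v : 'rV[Cplx R]_m.+1,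
      (fun N : nat => (N%:R ^+ m.+1)^-1 *
         szego (p N) (z + N%:R^-1 *: u) (z + N%:R^-1 *: v)) @ \oo -->
      C * F_ m (beta rho z u + (beta rho z v)^*).
Proof.
have oO : open Omega by case: Omega_domain.
have [muX|muX] := pselect (mu (boundary Omega) < +oo)%E; last first.
  (* An orthonormal basis of the constants forces the total mass to be finite. *)
  exists 0 => rho _ d p op u v; exfalso; apply: muX.
  by apply: (finite_mass _ (op 0%N)); exact: measurable_boundary.
have [h [om [theta [K [c [[h0 K0 c0 om0 om_le] [om_lim JE bE]]]]]]] :=
  weights_exist Omega_domain Omega_bounded Omega_spsc Omega_Reinhardt mu_smooth mu_inv z_bd z_neq0 muX.
have [L HL] := summation h0 K0 c0 om0 om_le om_lim.
exists (mkC L 0) => rho drho d p op u v.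
pose cu j := u 0 j / z 0 j; pose cv j := v 0 j / z 0 j.
pose E N b := shift_prod cu N b * (shift_prod cv N b)^*.
pose K2 := expR (\sum_j nrm (cu j)) * expR (\sum_j nrm (cv j)).
have K20 : 0 <= K2 by rewrite mulr_ge0 ?expR_ge0.
have EK N b : (mpoly.mdeg b < N.+1)%N -> nrm (E N b) <= K2.
  move=> hb; rewrite nrmM nrm_conj; apply: ler_pM; rewrite ?nrm_ge0//; exact: nrm_shift_prod.
set t := beta rho z u + (beta rho z v)^*.
have H0 := HH_gt0 h0.
have lin (w : 'rV[Cplx R]_m.+1) (y : R) : \sum_j w 0 j / z 0 j * mkC (y / HH h * hs h j) 0 = beta rho z w * mkC y 0.
  rewrite (bE _ drho) mulrAC mulr_suml mulr_suml; apply: eq_bigr => j _.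
  by rewrite !mkCM -invCE; ring.
have El y (a : nat -> mpoly.multinom m.+1) : 0 < y < 1 ->
    (forall j, (fun N => (fun_of_multinom (a N) j)%:R / N%:R) @ \oo --> y / HH h * hs h j) ->
    (fun N => E N (a N)) @ \oo --> cexp (t * mkC y 0).
  move=> _ ha; have -> : cexp (t * mkC y 0) = cexp (beta rho z u * mkC y 0) * (cexp (beta rho z v * mkC y 0))^*.
    rewrite cexpC -cexpD /t mulrDl; congr (cexp (_ + _)); rewrite [RHS]rmorphM; congr (_ * _).
    by apply: Cext; rewrite ?ReC_conj ?ImC_conj/= ?oppr0.
  rewrite -!lin; apply: cvgM; first exact: shift_prod_cvg.
  by apply: cvg_conjC; exact: shift_prod_cvg.
have [cr ci] := cexp_line_continuous t.
have natX N : ((N%:R : Cplx R) ^+ m.+1)^-1 = mkC ((N%:R ^+ m.+1)^-1) 0 by rewrite natCE mkCX invCE.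
have SE N := szego_shift (om := om) Omega_domain Omega_bounded Omega_Reinhardt mu_inv z_neq0 muX u v JE (op N).
apply: cvg_complex.
  rewrite ReC_scale ReC_F.
  rewrite (_ : (fun N => _) = (fun N => (N%:R ^+ m.+1)^-1 * \sum_(b : mpoly.bmultinom m.+1 N.+1) om b * ReC (E N b))).
    apply: (@summation_signed R m h om L HL (fun N b => ReC (E N b)) K2 (fun y => ReC (cexp (t * mkC y 0))) K20) => //.
      by move=> N b hb; exact: le_trans (abs_ReC _) (EK N b hb).
    by move=> y a y01 ha; apply: cvg_ReC; exact: El.
  apply/funext => N; rewrite SE natX ReC_scale ReC_sum; congr (_ * _).
  by apply: eq_bigr => b _; rewrite ReC_scale.
rewrite ImC_scale ImC_F.
rewrite (_ : (fun N => _) = (fun N => (N%:R ^+ m.+1)^-1 * \sum_(b : mpoly.bmultinom m.+1 N.+1) om b * ImC (E N b))).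
  apply: (@summation_signed R m h om L HL (fun N b => ImC (E N b)) K2 (fun y => ImC (cexp (t * mkC y 0))) K20) => //.
    by move=> N b hb; exact: le_trans (abs_ImC _) (EK N b hb).
  by move=> y a y01 ha; apply: cvg_ImC; exact: El.
apply/funext => N; rewrite SE natX ImC_scale ImC_sum; congr (_ * _).
by apply: eq_bigr => b _; rewrite ImC_scale.
Qed.
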